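(* Let $R>0$ and let $\boldsymbol{\nu}_0$ and $\boldsymbol{\theta}_0$ be in $X_R$. If $t\in\mathbb{R}_+\mapsto\boldsymbol{\nu}(t)$ and $t\in\mathbb{R}_+\mapsto\boldsymbol{\theta}(t)$ are gradient flows of $J$ starting respectively from $\boldsymbol{\nu}_0$ and $\boldsymbol{\theta}_0$, then $$d(\boldsymbol{\nu}(t),\boldsymbol{\theta}(t))\le d(\boldsymbol{\nu}_0,\boldsymbol{\theta}_0)\qquad\text{for all }t\in\mathbb{R}_+.$$ In particular there is a unique gradient flow (curve) of $J$ starting from $\boldsymbol{\nu}_0$.
   Context: Setting. $R_x,R_v>0$. $f_0$ is a Borel probability measure on $\mathbb{R}^2$ supported in $[-R_x,R_x]\times[-R_v,R_v]$ with atomless first (spatial) marginal $\rho_0$; $G_0(x):=\rho_0((-\infty,x])$. $\eta_0$ is the push-forward of $f_0$ by $(x,v)\mapsto(x,v+G_0(x))$. $\mu$ is a fixed $\sigma$-finite Borel measure on $\mathbb{R}$ such that the second marginal of $\eta_0$ is absolutely continuous with respect to $\mu$, with density $h$; thus $h\ge0$, $\int h\,d\mu=1$ and $h=0$ outside $A:=[-R_v,R_v+1]$. Spaces. $X$ is the set of $\mu$-measurable families $\boldsymbol{\nu}=(\nu^a)_{a\in A}$ of nonnegative Borel measures on $\mathbb{R}$ with $\nu^a(\mathbb{R})=h(a)$ for $\mu$-a.e. $a$ and $\int_A\int x^2\,d\nu^a\,d\mu(a)<\infty$. For $R>0$, $X_R$ is the set of $\boldsymbol{\nu}\in X$ with $\mathrm{Supp}(\nu^a)\subset[-R,R]$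 for $\mu$-a.e. $a$. $\boldsymbol{\nu}\otimes\mu$ denotes the measure $\int\phi\,d(\boldsymbol{\nu}\otimes\mu)=\int_A\int\phi(a,x)\,d\nu^a(x)\,d\mu(a)$. For measures of equal mass, $\Pi(\nu,\theta)$ is the set of nonnegative measures on the product with marginals $\nu,\theta$, and $W_2^2(\nu,\theta)=\inf_{\gamma\in\Pi(\nu,\theta)}\int|x-y|^2d\gamma$. $d^2(\boldsymbol{\nu},\boldsymbol{\theta}):=\int_AW_2^2(\nu^a,\theta^a)\,d\mu(a)$. $\boldsymbol{\gamma}\in\Pi(\boldsymbol{\nu},\boldsymbol{\theta})$ means $\boldsymbol{\gamma}=(\gamma^a)_{a\in A}$ is a $\mu$-measurable family with $\gamma^a\in\Pi(\nu^a,\theta^a)$. Energy. With $\overline{\boldsymbol{\nu}}:=\int_A\nu^a\,d\mu(a)$, $$J(\boldsymbol{\nu})=\frac14\int_{\mathbb{R}\times\mathbb{R}}|x-y|\,d\overline{\boldsymbol{\nu}}(x)\,d\overline{\boldsymbol{\nu}}(y)+\int_A\int_{\mathbb{R}}\left(\tfrac12-a\right)x\,d\nu^a(x)\,d\mu(a).$$ Subdifferential. For $\boldsymbol{\nu}\in X_R$, $\partial J(\boldsymbol{\nu})$ is the set of $\boldsymbol{w}=(w^a)_{a\in A}\in L^1(\boldsymbol{\nu}\otimes\mu)$ such that for all $R'>0$, $\boldsymbol{\theta}\in X_{R'}$ and $\boldsymbol{\gamma}\in\Pi(\boldsymbol{\nu},\boldsymbol{\theta})$: $J(\boldsymbol{\theta})-J(\boldsymbol{\nu})\ge\int_A\int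 w^a(y)(z-y)\,d\gamma^a(y,z)\,d\mu(a)$. Gradient flow. A gradient flow of $J$ on $[0,T]$ starting from $\boldsymbol{\nu}_0=(\nu_0^a)_{a\in A}$ is a curve $t\in[0,T]\mapsto\boldsymbol{\nu}(t)=(\nu(t)^a)_{a\in A}\in X_{R_1}$ (for some $R_1>0$, possibly depending on $T$), Lipschitz for $d$, with $\boldsymbol{\nu}(0)=\boldsymbol{\nu}_0$, together with a measurable map $t\mapsto\boldsymbol{v}(t)=(v(t)^a)_{a\in A}\in L^1(\boldsymbol{\nu}(t)\otimes\mu)$, such that $\boldsymbol{v}(t)\in-\partial J(\boldsymbol{\nu}(t))$ for a.e. $t$, and for $\mu$-a.e. $a$, $t\mapsto\nu(t)^a$ solves $\partial_t\nu^a+\partial_x(\nu^av^a)=0$, $\nu^a|_{t=0}=\nu_0^a$, in the sense of distributions. A gradient flow on $\mathbb{R}_+$ is one whose restriction to $[0,T]$ is a gradient flow on $[0,T]$ for every $T>0$. *)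

(* Defs.v *)
From HB Require Import structures.
From mathcomp Require Import all_boot all_order all_algebra.
From mathcomp Require Import all_classical all_reals all_analysis.
From mathcomp Require Import measurable_realfun.

Set Implicit Arguments.
Unset Strict Implicit.
Unset Printing Implicit Defensive.

Import Order.TTheory GRing.Theory Num.Theory.
Import numFieldNormedType.Exports.

Local Open Scope classical_set_scope.
Local Open Scope ring_scope.
Local Open Scope ereal_scope.

Notation borelR := measurableTypeR.
Notation borelR2 R := (measurableTypeR R * measurableTypeR R)%type.

Section initial_data.
Context {R : realType}.
Variable f0 : {measure set (borelR2 R) -> \bar R}.

Definition spatial_marginal : set (borelR R) -> \bar R := pushforward f0 fst.

Definition G0 (x : R) : R := fine (spatial_marginal `]-oo, x]%classic).

Definition eta0 : set (borelR2 R) -> \bar R :=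
  pushforward f0 (fun p : borelR2 R => (p.1, (p.2 + G0 p.1)%R) : borelR2 R).

Definition eta0_marginal2 : set (borelR R) -> \bar R := pushforward eta0 snd.

End initial_data.

Section transport.
Context {R : realType}.
Implicit Types m n : {measure set (borelR R) -> \bar R}.

Definition msupport m : set R :=
  [set x : R | forall U : set R, open U -> U x -> 0 < m U].

(* No equality of masses is required: if the masses differ there is no
   coupling, and [W2sq] is then +oo. *)
Definition coupling m n (g : {measure set (borelR2 R) -> \bar R}) : Prop :=
  (forall U : set (borelR R), measurable U -> g (U `*` setT) = m U) /\
  (forall U : set (borelR R), measurable U -> g (setT `*` U) = n U).

Definition W2sq m n : \bar R :=
  ereal_inf [set \int[g]_p ((`|p.1 - p.2| ^+ 2)%R)%:E
            | g in [set g : {measure set (borelR2 R) -> \bar R} |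
                     coupling m n g]].

End transport.

Definition levels {R : realType} (Rv : R) : set (borelR R) :=
  `[(- Rv)%R, (Rv + 1)%R]%classic.

(* A mu-measurable family (nu^a)_{a in A}, with A = levels Rv, is represented
   by a Borel kernel: every mu-measurable family of finite measures agrees
   mu-a.e. with one. Only the values on A, up to a mu-null set, are used. *)
Notation level_family R := (R.-ker (borelR R) ~> (borelR R)).
Notation level_plans R := (R.-ker (borelR R) ~> (borelR2 R)).

Section barycentre.
Context {R : realType}.
Variables (mu : {measure set (borelR R) -> \bar R}) (Rv : R).
Variable nu : level_family R.

Definition bary (U : set (borelR R)) : \bar R :=
  \int[mu]_(a in levels Rv) nu a U.

Let bary0 : bary set0 = 0.
Proof. by apply: integral0_eq => a _; rewrite measure0. Qed.

Let bary_ge0 U : 0 <= bary U.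
Proof. by apply: integral_ge0. Qed.

Let bary_sigma_additive : semi_sigma_additive bary.
Proof.
move=> U mU tU mUU; rewrite [X in _ --> X](_ : _ =
  \int[mu]_(a in levels Rv) (\sum_(n <oo) nu a (U n))); last first.
  apply: eq_integral => a _.
  by apply/esym/cvg_lim => //; exact/measure_semi_sigma_additive.
apply/cvg_closeP; split.
  by apply: is_cvg_nneseries => n _ _; exact: integral_ge0.
have mA : measurable (levels Rv) by exact: measurable_itv.
rewrite closeE// integral_nneseries// => n.
by apply: measurable_funS (measurable_kernel nu _ (mU n)).
Qed.

HB.instance Definition _ := isMeasure.Build _ _ R
  bary bary0 bary_ge0 bary_sigma_additive.

End barycentre.

Section families.
Context {R : realType}.
Variables (mu : {measure set (borelR R) -> \bar R}) (Rv : R) (h : R -> R).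
Let A := levels Rv.
Implicit Types nu theta : level_family R.

(* Measures are compared on measurable sets only: their values elsewhere are
   unconstrained. *)
Definition eq_family nu theta : Prop :=
  \forall a \ae mu, A a ->
    forall U : set (borelR R), measurable U -> nu a U = theta a U.

Definition in_X nu : Prop :=
  (\forall a \ae mu, A a -> nu a setT = (h a)%:E) /\
  \int[mu]_(a in A) \int[nu a]_x ((x ^+ 2)%R)%:E < +oo.

Definition in_XR (r : R) nu : Prop :=
  in_X nu /\
  \forall a \ae mu, A a -> msupport (nu a) `<=` `[(- r)%R, r]%classic.

Definition Xdist nu theta : \bar R :=
  (\int[mu]_(a in A) W2sq (nu a) (theta a)) `^ 2^-1.

(* Equality of masses only holds mu-a.e. in [in_X], so the coupling condition
   is required mu-a.e. as well. *)
Definition coupling_family nu theta (g : level_plans R) : Prop :=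
  \forall a \ae mu, A a -> coupling (nu a) (theta a) (g a).

(* Membership in L^1(nu (x) mu), where nu (x) mu is given by its defining
   iterated integral. *)
Definition in_L1 nu (w : R -> R -> R) : Prop :=
  measurable_fun (A `*` setT)
    (fun p : borelR2 R => w p.1 p.2 : borelR R) /\
  \int[mu]_(a in A) \int[nu a]_x (`|w a x|%R)%:E < +oo.

Definition energy nu : \bar R :=
  (4^-1)%:E * \int[bary mu Rv nu]_y \int[bary mu Rv nu]_x (`|x - y|%R)%:E
  + \int[mu]_(a in A) \int[nu a]_x (((2^-1 - a) * x)%R)%:E.

Definition subdiff nu (w : R -> R -> R) : Prop :=
  in_L1 nu w /\
  forall (r : R) (theta : level_family R) (g : level_plans R),
    (0 < r)%R -> in_XR r theta -> coupling_family nu theta g ->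
    \int[mu]_(a in A) \int[g a]_p ((w a p.1 * (p.2 - p.1))%R)%:E
      <= energy theta - energy nu.

End families.

Section test_functions.
Context {R : realType}.

Fixpoint is_Ck (k : nat) (phi : R * R -> R) : Prop :=
  match k with
  | 0%N => continuous phi
  | k'.+1 => [/\ continuous phi,
       (forall p, derivable phi p (1%R, 0%R)),
       (forall p, derivable phi p (0%R, 1%R)),
       is_Ck k' (fun p => 'D_(1%R, 0%R) phi p) &
       is_Ck k' (fun p => 'D_(0%R, 1%R) phi p)]
  end.

(* C^oo_c([0,T) x R), as restrictions of elements of C^oo_c((-oo,T) x R). *)
Definition test_function (T : R) (phi : R * R -> R) : Prop :=
  (forall k, is_Ck k phi) /\
  exists K : set (R * R),
    [/\ compact K, (forall p, K p -> (p.1 < T)%R) &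
        forall p, ~ K p -> phi p = 0%R].

End test_functions.

Section gradient_flows.
Context {R : realType}.
Variables (mu : {measure set (borelR R) -> \bar R}) (Rv : R) (h : R -> R).
Let A := levels Rv.
Local Notation leb := (@lebesgue_measure R).

(* d_t m + d_x (m u) = 0 on [0,T) x R with m|_{t=0} = m0, in the sense of
   distributions. The first two clauses make m and m u distributions. *)
Definition continuity_eq (T : R) (m0 : {measure set (borelR R) -> \bar R})
    (m : R -> {measure set (borelR R) -> \bar R}) (u : R -> R -> R) : Prop :=
  [/\ (forall U : set (borelR R), measurable U ->
         measurable_fun (`[0%R, T]%classic : set (borelR R))
           (fun t : borelR R => m t U)),
      \int[leb]_(t in `[0%R, T]) \int[m t]_x (`|u t x|%R)%:E < +oo &
      forall phi, test_function T phi ->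
        \int[leb]_(t in `[0%R, T]) \int[m t]_x
            (('D_(1%R, 0%R) phi (t, x) + u t x * 'D_(0%R, 1%R) phi (t, x))%R)%:E
        + \int[m0]_x (phi (0%R, x))%:E = 0].

(* Curves are required to be measurable jointly in (t,a): each [nu t] only
   matters up to a mu-null set of levels, and without joint measurability the
   null sets for different t could make "for mu-a.e. a" depend on the chosen
   representatives. *)
Definition gradient_flow_on (T : R) (nu0 : level_family R)
    (nu : R -> level_family R) (v : R -> R -> R -> R) : Prop :=
  (exists2 r : R, (0 < r)%R &
     forall t, t \in `[0%R, T] -> in_XR mu Rv h r (nu t)) /\
  (exists L : R, forall s t, s \in `[0%R, T] -> t \in `[0%R, T] ->
     Xdist mu Rv (nu s) (nu t) <= (L * `|s - t|)%R%:E) /\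
  (forall U : set (borelR R), measurable U ->
     measurable_fun ((`[0%R, T]%classic : set (borelR R)) `*` A)
       (fun p : borelR2 R => nu p.1 p.2 U)) /\
  eq_family mu Rv (nu 0%R) nu0 /\
  measurable_fun (((`[0%R, T]%classic : set (borelR R)) `*` A) `*` setT)
    (fun p : (borelR2 R * borelR R)%type => v p.1.1 p.1.2 p.2 : borelR R) /\
  (forall t, t \in `[0%R, T] -> in_L1 mu Rv (nu t) (v t)) /\
  (\forall t \ae leb, t \in `[0%R, T] ->
     subdiff mu Rv h (nu t) (fun a x => - v t a x)%R) /\
  (\forall a \ae mu, A a ->
     continuity_eq T (nu0 a) (fun t => nu t a) (fun t => v t a)).

Definition gradient_flow (nu0 : level_family R) (nu : R -> level_family R)
    (v : R -> R -> R -> R) : Prop :=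
  forall T : R, (0 < T)%R -> gradient_flow_on T nu0 nu v.

End gradient_flows.

(* Main.v *)
(** A family nu in X_R is encoded by the quantile functions X(a, .) of its
    members on (0, h(a)): nu is the law, level by level, of a field X on
    {(a, s) : a in A, 0 < s < h(a)} with the measure P = mu (x) Lebesgue. Then
    J(nu) is the convex functional E(X) = 1/4 iint |X - X'| + int (1/2 - a) X,
    and d(nu, theta) is the L^2(P) distance of the quantile fields.

    Contraction. Testing the continuity equation with functions of x - b t
    shows that each quantile trajectory is Lipschitz and that d/dt X = v(t, a, X)
    almost everywhere; since -v is a subgradient of the convex functional E, the
    derivative of the squared L^2(P) distance of two such fields is nonpositive.
    Uniqueness follows because d separates families.

    Existence. The explicit Euler scheme for d/dt x = - force(x) - drift, with
    steps 16^-n, is run for all starting points x at once. Convexity of E makes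
    it Cauchy in L^2(P), and convexity of the interaction potential upgrades
    this to uniform convergence. Two trajectories of the limit that meet stay
    together, so the speed of a trajectory is a function of its position. The
    discrete evolution variational inequality passes to the limit and gives the
    subgradient inequality against fields on the same space; competitors coupled
    by a plan are reduced to this case by replacing them with their conditional
    expectation, which does not increase E by Jensen's inequality. *)

Require Import Defs.
From HB Require Import structures.
From mathcomp Require Import all_boot all_order all_algebra.
From mathcomp Require Import all_classical all_reals all_analysis.
From mathcomp Require Import measurable_realfun ring lra.

Set Implicit Arguments.
Unset Strict Implicit.
Unset Printing Implicit Defensive.

Import Order.TTheory GRing.Theory Num.Theory.
Import numFieldNormedType.Exports.

Local Open Scope classical_set_scope.
Local Open Scope ring_scope.

(** * Integrals of bounded measurable functions *)

(** Every subgradient of the energy is bounded by its Lipschitz constant in L^1(P), [speed_bound].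
    Velocities may therefore be truncated at this value, and the argument stays within bounded
    measurable functions on finite measure spaces. The persistent obstacle is the order of
    quantifiers: the hypotheses hold for a.e. time or a.e. level, with exceptional sets that depend
    on the other variables. Jointly measurable representatives are therefore built first, rational
    parameters keep the exceptional sets countable in number, and Tonelli exchanges them. In the
    Lagrangian form, the speeds b = C and b = -C make the observables monotone in time, whence the
    Lipschitz bound; the derivative is then found with the convex observables (x - c)^+, whose
    forward and backward difference quotients enclose it. In the Euler scheme, the squared L^2 gap
    between step tau and a finer step is O(tau). It enters the pointwise squared gap through its
    square root, so that the pointwise gap is only O(tau^(1/4)); this loss is why the steps are
    powers of 16, which give the geometric rate 2^-n. *)

Section restriction.
Context d (T : measurableType d) (R : realType).
Variable mu : {measure set T -> \bar R}.
Local Open Scope ereal_scope.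
Import HBNNSimple.

(** The integral of a nonnegative function is a supremum over the simple functions below it,
    measurable or not, and simple functions transfer between the two sides. Such generality matters
    because integrands like [W2sq (nu a) (theta a)] are not known in advance to be measurable in
    [a]. *)
Lemma ge0_integral_mrestr (D : set T) (mD : measurable D) (f : T -> \bar R) :
  (forall x, 0 <= f x) -> \int[mrestr mu mD]_x f x = \int[mu]_(x in D) f x.
Proof.
move=> f0; rewrite ge0_integralTE// ge0_integralE//.
have key (h : {nnsfun T >-> R}) :
    sintegral (mrestr mu mD) h = sintegral mu (h \_ D)%R.
  rewrite mrestrict sintegralET sintegralET; apply: eq_fsbigr => x _.
  have [->|x0] := eqVneq x 0%R; first by rewrite !mul0e.
  congr (_ * mu _)%E; apply/seteqP; split => y /=.
    by move=> [hy Dy]; rewrite mindicE mem_set// mulr1.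
  rewrite mindicE; case: (boolP (y \in D)) => yD /=.
    by rewrite mulr1 => <-; split => //; exact: set_mem.
  by rewrite mulr0 => y0; move: x0; rewrite -y0 eqxx.
apply/eqP; rewrite eq_le; apply/andP; split; apply: ge_ereal_sup => _ [h /= hf <-].
  apply: ereal_sup_ubound; exists (proj_nnsfun h mD).
    move=> x; rewrite -mrestrict !patchE; case: ifPn => // _; exact: hf.
  by rewrite key mrestrict.
apply: ereal_sup_ubound; exists h => [x|].
  apply: (le_trans (hf x)); rewrite patchE; case: ifPn => // _; exact: f0.
rewrite key; congr sintegral; apply/funext => x; rewrite patchE.
case: ifPn => // xD; apply/eqP; rewrite eq_le.
have := hf x; rewrite patchE (negbTE xD) lee_fin => ->.
by rewrite fun_ge0.
Qed.

Lemma integral_mrestr (D : set T) (mD : measurable D) (f : T -> \bar R) :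
  \int[mrestr mu mD]_x f x = \int[mu]_(x in D) f x.
Proof. by rewrite [LHS]integralE [RHS]integralE !ge0_integral_mrestr. Qed.

Lemma ge0_le_integral_nonmeas (D : set T) (f g : T -> \bar R) :
  (forall x, D x -> 0 <= f x) -> (forall x, D x -> f x <= g x) ->
  \int[mu]_(x in D) f x <= \int[mu]_(x in D) g x.
Proof.
move=> f0 fg; have g0 x : D x -> 0 <= g x by move=> Dx; exact: le_trans (f0 _ Dx) (fg _ Dx).
rewrite !ge0_integralE//; apply: ge_ereal_sup => _ [h /= hf <-].
apply: ereal_sup_ubound; exists h => //= x; apply: (le_trans (hf x)).
by rewrite !patchE; case: ifPn => // /set_mem; exact: fg.
Qed.

Lemma ge0_ae_le_integral (D : set T) (f g : T -> \bar R) :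
  measurable D -> measurable_fun D g ->
  (forall x, D x -> 0 <= f x) -> (forall x, D x -> 0 <= g x) ->
  (\forall x \ae mu, D x -> f x <= g x) ->
  \int[mu]_(x in D) f x <= \int[mu]_(x in D) g x.
Proof.
move=> mD mg f0 g0 [N [mN N0 subN]].
(* Raising [g] to +oo on the null set makes the inequality hold everywhere. Only the measurable side
   is altered, so its integral does not change. *)
pose g' x := if x \in N then +oo else g x.
have mg' : measurable_fun D g'.
  apply: measurable_fun_if => //.
    by apply: (measurable_fun_bool true); rewrite preimage_mem_true; exact: measurableI.
  by apply: measurable_funS mg => // x [].
rewrite (@ge0_ae_eq_integral _ _ _ mu D g g')//; last 2 first.
- by move=> x Dx; rewrite /g'; case: ifPn => // _; exact: g0.
- exists N; split => // x /= h; apply: contrapT => Nx; apply: h => _.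
  by rewrite /g' memNset.
apply: ge0_le_integral_nonmeas => // x Dx; rewrite /g'; case: ifPn => [_|xN].
  exact: leey.
apply: contrapT => nfg; move/negP: xN; apply; apply: mem_set; apply: subN => /= h.
exact/nfg/h.
Qed.

Lemma ge0_ae_eq_integral_nonmeas (D : set T) (f g : T -> \bar R) :
  measurable D -> measurable_fun D g ->
  (forall x, D x -> 0 <= f x) -> (forall x, D x -> 0 <= g x) ->
  (\forall x \ae mu, D x -> f x = g x) ->
  \int[mu]_(x in D) f x = \int[mu]_(x in D) g x.
Proof.
move=> mD mg f0 g0 fg; apply/eqP; rewrite eq_le; apply/andP; split.
  by apply: ge0_ae_le_integral => //; apply: filterS fg => x h Dx; rewrite h.
case: fg => N [mN N0 subN].
(* Dually, [g] is lowered to 0 on the null set. *)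
pose g' x := if x \in N then 0 else g x.
have mg' : measurable_fun D g'.
  apply: measurable_fun_if => //.
    by apply: (measurable_fun_bool true); rewrite preimage_mem_true; exact: measurableI.
  by apply: measurable_funS mg => // x [].
rewrite (@ge0_ae_eq_integral _ _ _ mu D g g')//; last 2 first.
- by move=> x Dx; rewrite /g'; case: ifPn => // _; exact: g0.
- exists N; split => // x /= h; apply: contrapT => Nx; apply: h => _.
  by rewrite /g' memNset.
apply: ge0_le_integral_nonmeas => // x Dx; rewrite /g'; case: ifPn => [_|xN] //.
- exact: g0.
- exact: f0.
rewrite le_eqVlt; apply/orP; left; apply/eqP.
apply: contrapT => nfg; move/negP: xN; apply; apply: mem_set; apply: subN => /= h.
by apply: nfg; rewrite h.
Qed.

Lemma ae_eq_integral_nonmeas (D : set T) (f g : T -> \bar R) :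
  measurable D -> measurable_fun D g ->
  (\forall x \ae mu, D x -> f x = g x) ->
  \int[mu]_(x in D) f x = \int[mu]_(x in D) g x.
Proof.
move=> mD mg fg; rewrite [LHS]integralE [RHS]integralE; congr (_ - _).
  apply: ge0_ae_eq_integral_nonmeas => //; first exact: measurable_funepos.
  by apply: filterS fg => x h Dx; rewrite !funeposE h.
apply: ge0_ae_eq_integral_nonmeas => //; first exact: measurable_funeneg.
by apply: filterS fg => x h Dx; rewrite !funenegE h.
Qed.

End restriction.

Section bounded_measurable.
Context d (T : measurableType d) (R : realType).
Implicit Types f g : T -> R.

(** The bound holds at every point, not almost everywhere: one such function is integrable for every
    finite measure, and the class is stable under composition with any measurable map. The
    truncations by [clamp] further on serve to stay in this class. *)
Definition bmeas f := measurable_fun setT f /\ exists M : R, forall x, `|f x| <= M.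

Lemma bmeas_measurable f : bmeas f -> measurable_fun setT f.
Proof. by case. Qed.

Lemma bmeas_le f (M : R) : measurable_fun setT f -> (forall x, `|f x| <= M) -> bmeas f.
Proof. by move=> mf fM; split => //; exists M. Qed.

Lemma bmeas_cst c : bmeas (fun=> c).
Proof. by split => //; exists `|c|. Qed.

Lemma bmeasD f g : bmeas f -> bmeas g -> bmeas (fun x => f x + g x).
Proof.
move=> [mf [M fM]] [mg [N gN]]; split; first exact: measurable_funD.
by exists (M + N) => x; apply: le_trans (ler_normD _ _) _; exact: lerD.
Qed.

Lemma bmeasN f : bmeas f -> bmeas (fun x => - f x).
Proof.
move=> [mf [M fM]]; split; first exact: measurable_funN.
by exists M => x; rewrite normrN.
Qed.

Lemma bmeasB f g : bmeas f -> bmeas g -> bmeas (fun x => f x - g x).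
Proof. by move=> bf bg; apply: bmeasD => //; exact: bmeasN. Qed.

Lemma bmeasM f g : bmeas f -> bmeas g -> bmeas (fun x => f x * g x).
Proof.
move=> [mf [M fM]] [mg [N gN]]; split; first exact: measurable_funM.
by exists (M * N) => x; rewrite normrM; exact: ler_pM.
Qed.

Lemma bmeas_norm f : bmeas f -> bmeas (fun x => `|f x|).
Proof.
move=> [mf [M fM]]; split; first exact: measurableT_comp.
by exists M => x; rewrite normr_id.
Qed.

Lemma bmeasX f n : bmeas f -> bmeas (fun x => f x ^+ n).
Proof.
move=> [mf [M fM]]; split; first exact: measurable_funX.
exists (M ^+ n) => x; rewrite normrX lerXn2r ?nnegrE//.
exact: le_trans (normr_ge0 _) (fM x).
Qed.

Lemma bmeas_max f g : bmeas f -> bmeas g -> bmeas (fun x => Num.max (f x) (g x)).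
Proof.
move=> [mf [M fM]] [mg [N gN]]; split; first exact: measurable_maxr.
exists (M + N) => x; case: (leP (f x) (g x)) => _.
  by rewrite -[leLHS]add0r lerD// (le_trans (normr_ge0 _) (fM x)).
by rewrite -[leLHS]addr0 lerD// (le_trans (normr_ge0 _) (gN x)).
Qed.

Lemma bmeas_indic (A : set T) : measurable A -> bmeas (\1_A : T -> R).
Proof.
move=> mA; split; first exact: measurable_indic.
by exists 1 => x; rewrite indicE; case: (_ \in _); rewrite ?normr1 ?normr0.
Qed.

Lemma bmeas_if (p : T -> bool) f g : measurable_fun setT p ->
  bmeas f -> bmeas g -> bmeas (fun x => if p x then f x else g x).
Proof.
move=> mp [mf [M fM]] [mg [N gN]]; split; first exact: measurable_fun_ifT.
exists (M + N) => x; case: ifPn => _.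
  by rewrite -[leLHS]addr0 lerD// (le_trans (normr_ge0 _) (gN x)).
by rewrite -[leLHS]add0r lerD// (le_trans (normr_ge0 _) (fM x)).
Qed.

Lemma bmeas_lim (f_ : nat -> T -> R) f (M : R) : (forall n, measurable_fun setT (f_ n)) ->
  (forall n x, `|f_ n x| <= M) -> (forall x, f_ ^~ x @ \oo --> f x) -> bmeas f.
Proof.
move=> mf fM ff; split.
  by apply: (measurable_fun_cvg mf) => x _; exact: ff.
exists M => x; have /(@cvg_lim _ _) <- // : `|f_ n x| @[n --> \oo] --> `|f x|.
  exact: cvg_norm.
apply: limr_le; last by apply: nearW => n; exact: fM.
by apply/cvg_ex; exists `|f x|; exact: cvg_norm.
Qed.

End bounded_measurable.

Lemma bmeas_comp d d' (T : measurableType d) (T' : measurableType d')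
    (R : realType) (h : T' -> T) (f : T -> R) :
  measurable_fun setT h -> bmeas f -> bmeas (fun x => f (h x)).
Proof.
move=> mh [mf [M fM]]; split; first exact: measurableT_comp mf mh.
by exists M.
Qed.

Section bounded_integration.
Context d (T : measurableType d) (R : realType).
Variable m : {finite_measure set T -> \bar R}.
Implicit Types f g : T -> R.

Lemma bmeas_integrable f : bmeas f -> m.-integrable setT (EFin \o f).
Proof.
move=> [mf [M fM]]; apply: measurable_bounded_integrable => //.
  by rewrite ltey_eq fin_num_measure.
by exists M; split; [exact: num_real|move=> N MN x _; apply: le_trans (fM x) (ltW MN)].
Qed.

Lemma bmeas_integralE f : bmeas f ->
  (\int[m]_x (f x)%:E)%E = (\int[m]_x f x)%:E.
Proof.
by move=> bf; rewrite /Rintegral fineK// integrable_fin_num//; exact: bmeas_integrable.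
Qed.

Lemma bintD f g : bmeas f -> bmeas g ->
  \int[m]_x (f x + g x) = \int[m]_x f x + \int[m]_x g x.
Proof. by move=> bf bg; apply: RintegralD => //; exact: bmeas_integrable. Qed.

Lemma bintB f g : bmeas f -> bmeas g ->
  \int[m]_x (f x - g x) = \int[m]_x f x - \int[m]_x g x.
Proof. by move=> bf bg; apply: RintegralB => //; exact: bmeas_integrable. Qed.

Lemma bintZl k f : bmeas f -> \int[m]_x (k * f x) = k * \int[m]_x f x.
Proof. by move=> bf; apply: RintegralZl => //; exact: bmeas_integrable. Qed.

Lemma bintZr k f : bmeas f -> \int[m]_x (f x * k) = \int[m]_x f x * k.
Proof. by move=> bf; apply: RintegralZr => //; exact: bmeas_integrable. Qed.

Lemma bintN f : bmeas f -> \int[m]_x (- f x) = - \int[m]_x f x.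
Proof.
move=> bf; rewrite -mulN1r -bintZl//; apply: eq_Rintegral => x _.
by rewrite mulN1r.
Qed.

Lemma bint_cst c : \int[m]_x c = c * fine (m setT).
Proof. exact: Rintegral_cst. Qed.

Lemma bint0 : \int[m]_x (0 : R) = 0.
Proof. by rewrite bint_cst mul0r. Qed.

Lemma le_bint f g : bmeas f -> bmeas g -> (forall x, f x <= g x) ->
  \int[m]_x f x <= \int[m]_x g x.
Proof. by move=> bf bg fg; apply: le_Rintegral => //; exact: bmeas_integrable. Qed.

Lemma le_norm_bint f : bmeas f -> `|\int[m]_x f x| <= \int[m]_x `|f x|.
Proof. by move=> bf; apply: le_normr_Rintegral => //; exact: bmeas_integrable. Qed.

Lemma le_norm_bint_bound f (M : R) : bmeas f -> (forall x, `|f x| <= M) ->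
  `|\int[m]_x f x| <= M * fine (m setT).
Proof.
move=> bf fM; apply: le_trans (le_norm_bint bf) _; rewrite -bint_cst.
by apply: le_bint => //; [exact: bmeas_norm|exact: bmeas_cst].
Qed.

Lemma ae_eq_bint f g : bmeas g -> (\forall x \ae m, f x = g x) ->
  \int[m]_x f x = \int[m]_x g x.
Proof.
move=> [mg _] fg; rewrite /Rintegral; congr fine.
apply: ae_eq_integral_nonmeas => //; first exact/measurable_EFinP.
by apply: filterS fg => x ->.
Qed.

Lemma ae_le_bint f g : bmeas f -> bmeas g -> (\forall x \ae m, f x <= g x) ->
  \int[m]_x f x <= \int[m]_x g x.
Proof.
move=> bf bg fg; rewrite (@ae_eq_bint g (fun x => Num.max (f x) (g x))).
- apply: le_bint => //; first exact: bmeas_max.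
  by move=> x; rewrite le_max lexx.
- exact: bmeas_max.
- by apply: filterS fg => x /max_idPr ->.
Qed.

Lemma bint_ae_eq0 f : bmeas f -> (forall x, 0 <= f x) -> \int[m]_x f x = 0 ->
  \forall x \ae m, f x = 0.
Proof.
move=> bf f0 If; have := bmeas_integralE bf; rewrite If => If'.
have : ae_eq m setT (EFin \o f) (cst 0%E).
  apply/ae_eq_integral_abs => //; first exact/measurable_EFinP/(bmeas_measurable bf).
  by rewrite -[RHS]If'; apply: eq_integral => x _; rewrite /= ger0_norm.
by apply: filterS => x /(_ I) /= [].
Qed.

Lemma cvg_bint (f_ : nat -> T -> R) f (M : R) :
  (forall n, measurable_fun setT (f_ n)) -> measurable_fun setT f ->
  (forall n x, `|f_ n x| <= M) ->
  (\forall x \ae m, f_ n x @[n --> \oo] --> f x) ->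
  \int[m]_x f_ n x @[n --> \oo] --> \int[m]_x f x.
Proof.
move=> mf_ mf fM ff.
have [] := @dominated_convergence _ _ _ m setT measurableT
  (fun n => EFin \o f_ n) (EFin \o f) (fun=> M%:E).
- by move=> n; exact/measurable_EFinP.
- exact/measurable_EFinP.
- by apply: filterS ff => x h _; apply: cvg_EFin => //; exact: nearW.
- exact: (bmeas_integrable (bmeas_cst _ M)).
- by apply: aeW => x n _; rewrite lee_fin.
move=> intf _ h; rewrite /Rintegral; apply: fine_cvg.
by rewrite fineK ?integrable_fin_num.
Qed.

End bounded_integration.

Section almost_everywhere_combinators.
Context d (T : measurableType d) (R : realType) (mu : {measure set T -> \bar R}).
Implicit Types P Q S : T -> Prop.

Lemma ae_imply P Q : (forall x, P x -> Q x) ->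
  (\forall x \ae mu, P x) -> \forall x \ae mu, Q x.
Proof. by move=> PQ; apply: filterS. Qed.

Lemma ae_imply2 P Q S : (forall x, P x -> Q x -> S x) ->
  (\forall x \ae mu, P x) -> (\forall x \ae mu, Q x) -> \forall x \ae mu, S x.
Proof. by move=> PQ; apply: filterS2. Qed.

Lemma ae_imply3 P Q P' S : (forall x, P x -> Q x -> P' x -> S x) ->
  (\forall x \ae mu, P x) -> (\forall x \ae mu, Q x) -> (\forall x \ae mu, P' x) ->
  \forall x \ae mu, S x.
Proof. by move=> PQ; apply: filterS3. Qed.

Lemma ae_all_nat (P : nat -> T -> Prop) : (forall n, \forall x \ae mu, P n x) ->
  \forall x \ae mu, forall n, P n x.
Proof. exact: ae_foralln. Qed.

Lemma ae_all_rat (P : rat -> T -> Prop) : (forall q, \forall x \ae mu, P q x) ->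
  \forall x \ae mu, forall q, P q x.
Proof.
move=> h; have : \forall x \ae mu, forall n, P (odflt 0 (unpickle n)) x.
  by apply: ae_all_nat => n; exact: h.
by apply: ae_imply => x hx q; have := hx (pickle q); rewrite pickleK.
Qed.

End almost_everywhere_combinators.

Section ae_mrestr.
Context d (T : measurableType d) (R : realType).
Variables (mu : {measure set T -> \bar R}) (D : set T) (mD : measurable D).

Lemma ae_mrestr (Q : T -> Prop) :
  (\forall x \ae mrestr mu mD, Q x) <-> (\forall x \ae mu, D x -> Q x).
Proof.
split=> -[N [mN N0 subN]].
  exists (N `&` D); split => //; first exact: measurableI.
  move=> x /= h; have [Dx nQ] : D x /\ ~ Q x by apply/not_implyP.
  by split => //; apply: subN.
exists (N `|` ~` D); split => //; first by apply: measurableU => //; exact: measurableC.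
  rewrite /mrestr setIUl setICl setU0; apply: subset_measure0 N0 => //.
    exact: measurableI.
move=> x /= nQ; have [Dx|] := pselect (D x); last by right.
by left; apply: subN => /= h; apply/nQ/h.
Qed.

End ae_mrestr.

(** * Lebesgue measure on a compact interval *)

Section lebesgue_on_interval.
Context {R : realType}.
Implicit Types a b : R.

Lemma lebesgue_itv_lty a b : (@lebesgue_measure R `[a, b] < +oo)%E.
Proof.
by rewrite lebesgue_measure_itv/= lte_fin; case: ifPn => _; rewrite -?EFinB ltry.
Qed.

Lemma measurable_borelR_itv (i : interval R) : measurable ([set` i] : set (borelR R)).
Proof. exact: measurable_itv. Qed.

(** The restriction is a finite measure on the whole line, so that integrals over intervals with
    variable end points all have the same domain. *)
Definition lebI a b : {finite_measure set (borelR R) -> \bar R} :=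
  @mfrestr _ (borelR R) R `[a, b]%classic lebesgue_measure
    (measurable_borelR_itv `[a, b]) (lebesgue_itv_lty a b).

Lemma lebIT a b : a <= b -> fine (lebI a b setT) = b - a.
Proof.
move=> ab; rewrite /lebI /= /mfrestr /mrestr setTI lebesgue_measure_itv/= lte_fin.
by case: ltgtP ab => // -> _; rewrite subrr.
Qed.

Lemma lebI_integralE a b (f : R -> \bar R) :
  (\int[lebI a b]_x f x = \int[lebesgue_measure]_(x in `[a, b]) f x)%E.
Proof. exact: (integral_mrestr lebesgue_measure (measurable_borelR_itv `[a, b])). Qed.

Lemma lebI_bintE a b (f : R -> R) :
  \int[lebI a b]_x f x = \int[lebesgue_measure]_(x in `[a, b]) f x.
Proof. by rewrite /Rintegral lebI_integralE. Qed.

Lemma ae_lebI a b (Q : R -> Prop) :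
  (\forall x \ae lebI a b, Q x) <->
  (\forall x \ae lebesgue_measure, a <= x <= b -> Q x).
Proof.
split=> [/(ae_mrestr _ _ _).1|h]; first exact.
by apply/(ae_mrestr lebesgue_measure (measurable_borelR_itv `[a, b]) Q).2.
Qed.

Lemma ae_lebI_oo a b (Q : R -> Prop) :
  (\forall x \ae lebesgue_measure, a < x < b -> Q x) ->
  \forall x \ae lebI a b, Q x.
Proof.
move=> h; apply/ae_lebI.
have neq c : \forall x \ae @lebesgue_measure R, x <> c.
  exists [set c]; split => //; first exact: lebesgue_measure_set1.
  by move=> x /= /contrapT.
apply: (ae_imply3 _ h (neq a) (neq b)) => x hx /eqP xa /eqP xb /andP[ax bx].
by apply: hx; rewrite !lt_neqAle ax bx eq_sym xa xb.
Qed.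

Lemma ae_lebIW a b c e (Q : R -> Prop) : a <= c -> e <= b ->
  (\forall x \ae lebI a b, Q x) -> \forall x \ae lebI c e, Q x.
Proof.
move=> ac eb /ae_lebI h; apply/ae_lebI; apply: (ae_imply _ h) => x {}h /andP[cx xe].
by apply: h; rewrite (le_trans ac cx) (le_trans xe eb).
Qed.

Lemma ae_lebI_mem a b : \forall x \ae lebI a b, a <= x <= b.
Proof. by apply/ae_lebI; exact: aeW. Qed.

Lemma lebI_split a b c (f : borelR R -> R) : a <= b -> b <= c -> bmeas f ->
  \int[lebI a c]_x f x = \int[lebI a b]_x f x + \int[lebI b c]_x f x.
Proof.
move=> ab bc bf; rewrite !lebI_bintE.
have intf x y : lebesgue_measure.-integrable `[x, y] (EFin \o f).
  apply: (@measurable_bounded_integrable _ (borelR R) _ lebesgue_measure _ _ (measurable_borelR_itv _)).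
  - exact: lebesgue_itv_lty.
  - by apply: measurable_funTS; case: bf.
  - case: bf => _ [M fM]; exists M; split; first exact: num_real.
    by move=> N MN z _; apply: le_trans (fM z) (ltW MN).
apply/eqP; rewrite addrC -subr_eq; apply/eqP.
rewrite Rintegral_itvB//.
by rewrite Rintegral_itv_obnd_cbnd//; apply: integrableS (intf b c) => //; exact: subset_itv_oc_cc.
Qed.

End lebesgue_on_interval.

(** * Fubini for bounded functions and exchange of null sets *)

Section fubini_bounded.
Context d1 d2 (T1 : measurableType d1) (T2 : measurableType d2) (R : realType).
Variables (m2 : {finite_measure set T2 -> \bar R}).

Lemma bmeas_section1 (f : T1 * T2 -> R) x : bmeas f -> bmeas (fun y => f (x, y)).
Proof. by move=> bf; apply: bmeas_comp bf; exact: measurable_pair1. Qed.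

Lemma bmeas_section2 (f : T1 * T2 -> R) y : bmeas f -> bmeas (fun x => f (x, y)).
Proof. by move=> bf; apply: bmeas_comp bf; exact: measurable_pair2. Qed.

Lemma bmeas_bint1 (f : T1 * T2 -> R) : bmeas f -> bmeas (fun x => \int[m2]_y f (x, y)).
Proof.
move=> bf; have [mf [M fM]] := bf.
apply: (@bmeas_le _ _ _ _ (M * fine (m2 setT))); last first.
  by move=> x; apply: le_norm_bint_bound => [|y]; [exact: bmeas_section1|exact: fM].
(* Adding the bound makes the integrand nonnegative, as Tonelli requires; the added constant
   contributes a finite amount, subtracted at the end. The same shift recurs below for other signed
   integrands. *)
pose g (z : T1 * T2) : \bar R := (f z + M)%:E.
have mg : measurable_fun setT g by apply/measurable_EFinP/measurable_funD.
have g0 z : (0 <= g z)%E.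
  by rewrite lee_fin -lerBlDr sub0r; have := fM z; rewrite ler_norml => /andP[].
have := @measurable_fun_fubini_tonelli_F _ _ _ _ _ m2 _ mg g0.
have -> : fubini_F m2 g = fun x => (\int[m2]_y f (x, y) + M * fine (m2 setT))%:E.
  apply/funext => x; rewrite /fubini_F /g bmeas_integralE.
    by rewrite bintD ?bint_cst//; [exact: bmeas_section1|exact: bmeas_cst].
  by apply: bmeasD; [exact: bmeas_section1|exact: bmeas_cst].
move=> /measurable_EFinP h.
have := measurable_funB h (measurable_cst (M * fine (m2 setT))).
by apply: eq_measurable_fun => x _ /=; rewrite addrK.
Qed.

End fubini_bounded.

Section fubini_bounded_swap.
Context d1 d2 (T1 : measurableType d1) (T2 : measurableType d2) (R : realType).
Variables (m1 : {finite_measure set T1 -> \bar R})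
          (m2 : {finite_measure set T2 -> \bar R}).

Lemma bmeas_swap (f : T1 * T2 -> R) : bmeas f -> bmeas (fun z : T2 * T1 => f (z.2, z.1)).
Proof.
by apply: bmeas_comp; exact: measurable_fun_pair.
Qed.

Lemma bmeas_bint2 (f : T1 * T2 -> R) : bmeas f -> bmeas (fun y => \int[m1]_x f (x, y)).
Proof. by move=> /bmeas_swap bf; exact: (bmeas_bint1 m1 bf). Qed.

Lemma bint_swap (f : T1 * T2 -> R) : bmeas f ->
  \int[m1]_x \int[m2]_y f (x, y) = \int[m2]_y \int[m1]_x f (x, y).
Proof.
move=> bf; have [mf [M fM]] := bf.
pose g (z : T1 * T2) : \bar R := (f z + M)%:E.
have mg : measurable_fun setT g by apply/measurable_EFinP/measurable_funD.
have g0 z : (0 <= g z)%E.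
  by rewrite lee_fin -lerBlDr sub0r; have := fM z; rewrite ler_norml => /andP[].
have := @fubini_tonelli _ _ _ _ _ m1 m2 _ mg g0.
have -> : (fun x => \int[m2]_y g (x, y))%E = fun x => (\int[m2]_y f (x, y) + M * fine (m2 setT))%:E.
  apply/funext => x; rewrite /g bmeas_integralE.
    by rewrite bintD ?bint_cst//; [exact: bmeas_section1|exact: bmeas_cst].
  by apply: bmeasD; [exact: bmeas_section1|exact: bmeas_cst].
have -> : (fun y => \int[m1]_x g (x, y))%E = fun y => (\int[m1]_x f (x, y) + M * fine (m1 setT))%:E.
  apply/funext => x; rewrite /g bmeas_integralE.
    by rewrite bintD ?bint_cst//; [exact: bmeas_section2|exact: bmeas_cst].
  by apply: bmeasD; [exact: bmeas_section2|exact: bmeas_cst].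
rewrite !bmeas_integralE; last 2 first.
- by apply: bmeasD; [exact: bmeas_bint2|exact: bmeas_cst].
- by apply: bmeasD; [exact: bmeas_bint1|exact: bmeas_cst].
rewrite !bintD ?bint_cst; [|exact: bmeas_bint2|exact: bmeas_cst
  |exact: bmeas_bint1|exact: bmeas_cst].
by move=> [] ; rewrite -!mulrA [fine (m1 _) * _]mulrC => /addIr.
Qed.

End fubini_bounded_swap.

Section fubini_ae.
Context d1 d2 (T1 : measurableType d1) (T2 : measurableType d2) (R : realType).
Variables (m1 : {sigma_finite_measure set T1 -> \bar R})
          (m2 : {sigma_finite_measure set T2 -> \bar R}).

(** By Tonelli the indicator of the complement of [A] has zero integral in both orders, and a
    nonnegative function with zero integral vanishes almost everywhere. *)
Lemma ae_swap (A : set (T1 * T2)) : measurable A ->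
  (\forall x \ae m1, \forall y \ae m2, A (x, y)) ->
  \forall y \ae m2, \forall x \ae m1, A (x, y).
Proof.
move=> mA h; have mC : measurable (~` A) by exact: measurableC.
pose g (z : T1 * T2) : \bar R := (\1_(~` A) z)%:E.
have mg : measurable_fun setT g by apply/measurable_EFinP; exact: measurable_indic.
have g0 z : (0 <= g z)%E by rewrite lee_fin.
have I1 : (\int[m1]_x fubini_F m2 g x = 0)%E.
  rewrite (ge0_ae_eq_integral (g := cst 0%E))//.
  - by rewrite integral0.
  - exact: measurable_fun_fubini_tonelli_F.
  - by move=> x _; exact: integral_ge0.
  - apply: filterS h => x [N [mN N0 subN]] _ /=.
    rewrite /fubini_F (ge0_ae_eq_integral (g := cst 0%E))//.
    + by rewrite integral0.
    + by apply: measurableT_comp mg _; exact: measurable_pair1.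
    + exists N; split => // y /= hy; apply: subN => /= Axy; apply: hy => _.
      by rewrite /g indicE memNset//= => /(_ Axy).
rewrite (@fubini_tonelli _ _ _ _ _ m1 m2 _ mg g0) in I1.
have mG := @measurable_fun_fubini_tonelli_G _ _ _ _ _ m1 _ mg g0.
have : ae_eq m2 setT (fubini_G m1 g) (cst 0%E).
  apply/ae_eq_integral_abs => //; rewrite -[RHS]I1.
  by apply: eq_integral => y _; rewrite gee0_abs//; exact: integral_ge0.
apply: filterS => y /(_ I) /= Gy.
have : ae_eq m1 setT (fun x => g (x, y)) (cst 0%E).
  apply/ae_eq_integral_abs => //.
    by apply: measurableT_comp mg _; exact: measurable_pair2.
  by rewrite -[RHS]Gy; apply: eq_integral => x _; rewrite gee0_abs.
apply: filterS => x /(_ I); rewrite /g indicE.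
by case: (boolP ((x, y) \in ~` A)) => [_ [] /eqP|/negP xA _]; rewrite ?oner_eq0//;
  apply: contrapT => nA; apply: xA; exact: mem_set.
Qed.

End fubini_ae.

(** * Densities of Lipschitz functions *)

Section clamp.
Context {R : realType}.
Variables a b : R.
Hypothesis ab : a <= b.

Definition clamp (x : R) : R := Num.max a (Num.min x b).

Lemma clamp_ge x : a <= clamp x.
Proof. by rewrite le_max lexx. Qed.

Lemma clamp_le x : clamp x <= b.
Proof. by rewrite ge_max ab ge_min lexx orbT. Qed.

Lemma clamp_id x : a <= x <= b -> clamp x = x.
Proof. by move=> /andP[ax xb]; rewrite /clamp (min_idPl xb) (max_idPr ax). Qed.

Lemma le_clamp x y : x <= y -> clamp x <= clamp y.
Proof.
move=> xy; rewrite /clamp ge_max le_max lexx /= le_max; apply/orP; right.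
by rewrite le_min ge_min xy ge_min lexx orbT.
Qed.

Lemma clamp_lipschitz x y : `|clamp x - clamp y| <= `|x - y|.
Proof.
wlog xy : x y / x <= y.
  move=> h; have [/h//|/ltW/h] := leP x y.
  by rewrite distrC [`|y - x|]distrC.
rewrite !ler0_norm ?subr_le0// ?le_clamp// !opprB.
rewrite /clamp; move: xy; clear; rewrite /Num.max /Num.min.
by do ?case: ifPn; rewrite -?leNgt => *; lra.
Qed.

End clamp.

Definition lipschitz_with {R : realType} (C : R) (f : R -> R) :=
  forall x y, `|f x - f y| <= C * `|x - y|.

Lemma lipschitz_with_continuous {R : realType} (C : R) (f : R -> R) :
  lipschitz_with C f -> continuous f.
Proof.
move=> fC x; apply/cvgrPdist_le => /= e e0.
pose D := Num.max C 1; have D0 : 0 < D by rewrite lt_max ltr01 orbT.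
near=> y; apply: (le_trans (fC _ _)).
apply: (@le_trans _ _ (D * `|x - y|)).
  by rewrite ler_wpM2r// le_max lexx.
rewrite mulrC -ler_pdivlMr//.
near: y; apply/nbhs_ballP; exists (e / D) => /=; first exact: divr_gt0.
by move=> y /= xy; rewrite ltW.
Unshelve. all: by end_near. Qed.

Section monotone_lipschitz.
Context {R : realType}.
Variables (G : R -> R) (C a b : R).
Hypotheses (C0 : 0 < C) (ab : a <= b).
Hypotheses (Gnd : {homo G : x y / x <= y}) (GC : forall x y, x <= y -> G y - G x <= C * (y - x)).
Hypotheses (Ga : forall x, x <= a -> G x = G a) (Gb : forall x, b <= x -> G x = G b).

Let Glip : lipschitz_with C G.
Proof.
move=> x y; wlog xy : x y / x <= y.
  move=> h; have [/h//|/ltW/h] := leP x y.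
  by rewrite distrC [`|y - x|]distrC.
rewrite !ler0_norm ?subr_le0// ?Gnd// !opprB; exact: GC.
Qed.

(** The increments of [G] and [Hf] are nonnegative and add up to those of [C * x], so the Stieltjes
    measure of [G] is at most [C] times Lebesgue measure. *)
Let Hf (x : R) := C * x - G x.

Let Hnd : {homo Hf : x y / x <= y}.
Proof. by move=> x y xy; have := GC xy; rewrite /Hf; lra. Qed.

Let Grc : right_continuous G.
Proof. exact/right_continuousW/lipschitz_with_continuous/Glip. Qed.

Let Hrc : right_continuous Hf.
Proof.
apply: right_continuousW => x; apply: cvgB.
  by apply: cvgMr; exact: cvg_id.
exact: (lipschitz_with_continuous Glip).
Qed.

HB.instance Definition _ := isCumulative.Build R _ R G Gnd Grc.
HB.instance Definition _ := isCumulative.Build R _ R Hf Hnd Hrc.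

Let nuG : {measure set (borelR R) -> \bar R} := lebesgue_stieltjes_measure G.
Let nuH : {measure set (borelR R) -> \bar R} := lebesgue_stieltjes_measure Hf.

Let nuGE x y : x <= y -> nuG `]x, y]%classic = (G y - G x)%:E.
Proof.
move=> xy; rewrite /nuG/= /lebesgue_stieltjes_measure/= /measure_extension/= measurable_mu_extE/=; last first.
  exact: is_ocitv.
by rewrite wlength_itv_bnd// EFinB.
Qed.

Let nuHE x y : x <= y -> nuH `]x, y]%classic = (Hf y - Hf x)%:E.
Proof.
move=> xy; rewrite /nuH/= /lebesgue_stieltjes_measure/= /measure_extension/= measurable_mu_extE/=; last first.
  exact: is_ocitv.
by rewrite wlength_itv_bnd// EFinB.
Qed.

Let nuGH (A : set (borelR R)) : measurable A ->
  (lebesgue_measure A = C^-1%:E * (nuG A + nuH A))%E.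
Proof.
have C0' : 0 <= C^-1 by rewrite invr_ge0 ltW.
pose m := mscale (NngNum C0') (measure_add nuG nuH).
have mE X : m X = (C^-1%:E * (nuG X + nuH X))%E by rewrite -measure_addE.
move=> mA; rewrite (@lebesgue_measure_unique _ m _ A mA).
  exact: mE.
move=> X /ocitvP[->|[[x y] /= xy ->]]; first by rewrite !measure0.
rewrite -[RHS]/(m _) mE.
have xy' := ltW xy; have := nuGE xy'; have := nuHE xy'.
rewrite /= => -> ->; rewrite lebesgue_measure_itv/= lte_fin xy -!EFinB -EFinD -EFinM.
by congr EFin; rewrite /Hf; field; rewrite gt_eqF.
Qed.

Let nuGT : (nuG setT < +oo)%E.
Proof.
have sub n m' : (n <= m')%N -> `]a - n%:R, b + n%:R]%classic `<=` `]a - m'%:R, b + m'%:R]%classic.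
  move=> nm x /=; rewrite !in_itv /= => /andP[h1 h2]; apply/andP; split.
    by apply: le_lt_trans h1; rewrite lerD2l lerN2 ler_nat.
  by apply: (le_trans h2); rewrite lerD2l ler_nat.
pose F n : set (borelR R) := `]a - n%:R, b + n%:R]%classic.
have TF : \bigcup_n F n = setT.
  apply/seteqP; split => // x _.
  pose n := (Num.trunc (`|x| + `|a| + `|b|)).+1.
  have hn : `|x| + `|a| + `|b| < n%:R by rewrite /n truncnS_gt.
  exists n => //; rewrite /F /= in_itv/=.
  have := ler_norm x; have := ler_norm a; have := ler_norm b.
  have := ler_norm (- x); have := ler_norm (- a); have := ler_norm (- b).
  rewrite !normrN; move: hn; set u := `|x|; set v := `|a|; set w := `|b|.
  have v0 : 0 <= v by exact: normr_ge0. have w0 : 0 <= w by exact: normr_ge0.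
  by move=> *; apply/andP; split; lra.
have cF : (nuG \o F) n @[n --> \oo] --> nuG (\bigcup_n F n).
  apply: nondecreasing_cvg_mu.
  - by move=> n; exact: measurable_borelR_itv.
  - by rewrite TF.
  - by move=> n m' nm; apply/subsetPset; exact: sub.
have FE n : nuG (F n) = (G b - G a)%:E.
  have ? : a - n%:R <= b + n%:R.
    by rewrite (@le_trans _ _ a) ?gerBl// (le_trans ab)// lerDl.
  by rewrite /F nuGE// (Gb (x := b + _)) ?lerDl// (Ga (x := a - _)) ?gerBl.
rewrite -TF; have -> : nuG (\bigcup_n F n) = (G b - G a)%:E.
  apply: (cvg_unique _ cF) => //.
  by rewrite (_ : nuG \o F = cst (G b - G a)%:E); [exact: cvg_cst|apply/funext => n /=; exact: FE].
exact: ltry.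
Qed.

Let nuF : {finite_measure set (borelR R) -> \bar R} :=
  @mfrestr _ (borelR R) R setT nuG measurableT nuGT.

Let nuFE (A : set (borelR R)) : nuF A = nuG A.
Proof. by rewrite /nuF /= /mfrestr /mrestr setIT. Qed.

(** Radon-Nikodym gives a density of the Stieltjes measure of [G], and Lebesgue differentiation
    identifies it with the derivative. Constancy outside [[a, b]] makes that measure finite. *)
Lemma monotone_lipschitz_density : exists g : borelR R -> R,
  [/\ bmeas g,
      \forall x \ae lebesgue_measure, derivable G x 1 /\ derive1 G x = g x &
      forall x y, x <= y -> \int[lebI x y]_t g t = G y - G x].
Proof.
have dom : nuF `<< lebesgue_measure.
  apply/null_content_dominatesP => A mA A0.
  have := nuGH mA; rewrite A0 => /esym/eqP; rewrite mule_eq0 eqe invr_eq0 gt_eqF//=.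
  rewrite padde_eq0 ?measure_ge0// => /andP[/eqP h _].
  by rewrite nuFE.
have [f [f0 ffin fint fE]] := radon_nikodym_sigma_finite dom.
pose f1 x := fine (f x).
have fE1 : f = EFin \o f1 by apply/funext => x /=; rewrite /f1 fineK.
have mf1 : measurable_fun setT f1.
  by have := measurable_int _ fint; rewrite fE1 => /measurable_EFinP.
have fE2 x y : x <= y -> (\int[lebesgue_measure]_(t in `]x, y]) (f1 t)%:E = (G y - G x)%:E)%E.
  move=> xy; rewrite -nuGE// -nuFE (fE _ (measurable_borelR_itv _)).
  by rewrite fE1.
have intN y : lebesgue_measure.-integrable `]-oo, y] (EFin \o f1).
  by rewrite -fE1; apply: integrableS fint => //; exact: measurable_borelR_itv.
have := @FTC1Ny R f1 intN.
have loc : locally_integrable setT f1.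
  have := @integrable_locally R f1 setT measurableT.
  by rewrite patch_setT; apply; rewrite -fE1.
move=> /(_ loc) /= dF.
pose F x := (\int[lebesgue_measure]_(t in `]-oo, x]) f1 t)%R.
have FG x : F x = G x + (F a - G a).
  have key u v : u <= v -> F v - F u = G v - G u.
    move=> uv; rewrite /F (Rintegral_itvB (intN v)) ?bnd_simp//.
    by rewrite /Rintegral fE2.
  by have [/key|/ltW/key] := leP x a; lra.
have GF : G = (fun x => F x - (F a - G a)).
  by apply/funext => x; rewrite FG; lra.
have dG : \forall x \ae @lebesgue_measure R, derivable G x 1 /\ derive1 G x = f1 x.
  apply: (ae_imply _ dF) => x [dFx eFx].
  have -> : G = F - cst (F a - G a) by apply/funext => y; rewrite {1}GF.
  have dK : derivable (cst (F a - G a) : R -> R) x 1 by exact: derivable_cst.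
  split; first exact: (derivableB dFx dK).
  by rewrite derive1E (deriveB dFx dK) derive_cst subr0 -derive1E.
have Gbd x : derivable G x 1 -> `|derive1 G x| <= C.
  move=> /cvg_ex [l hl]; have -> : derive1 G x = l.
    rewrite derive1E; apply: cvg_lim => //; exact: hl.
  have : `|h^-1 *: ((G \o shift x) (h *: 1) - G x)| @[h --> 0^'] --> `|l|.
    exact: cvg_norm.
  move=> /cvg_lim <- //; apply: limr_le.
    by apply/cvg_ex; exists `|l|; exact: cvg_norm.
  near=> h; rewrite normrM normfV ler_pdivrMl ?normr_gt0; last by near: h; exact: nbhs_dnbhs_neq.
  rewrite /= mulrC; apply: (le_trans (Glip _ _)).
  by rewrite [h *: 1]mulr1 addrK.
(* The Radon-Nikodym density is bounded only almost everywhere. Difference quotients of [G] are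
   bounded by [C], so this truncation alters [f1] on a null set only. *)
pose g x := clamp (- C) C (f1 x).
have CC : - C <= C by rewrite (le_trans _ (ltW C0))// oppr_le0 ltW.
have gE : \forall x \ae @lebesgue_measure R, f1 x = g x.
  apply: (ae_imply _ dG) => x [/Gbd + E]; rewrite E => h.
  by rewrite /g clamp_id// -ler_norml.
exists g; split.
- apply: (@bmeas_le _ _ _ _ C).
    apply: measurable_maxr => //; exact: measurable_minr.
  by move=> x; rewrite ler_norml clamp_ge clamp_le.
- by apply: (ae_imply2 _ dG gE) => x [dx ->].
- move=> x y xy; rewrite lebI_bintE.
  rewrite -Rintegral_itv_obnd_cbnd; last first.
    rewrite (_ : EFin \o g = EFin \o g)//.
    apply: (@measurable_bounded_integrable _ (borelR R) _ lebesgue_measure _ _ (measurable_borelR_itv _)).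
    + apply: (le_lt_trans _ (lebesgue_itv_lty x y)); apply: le_measure; rewrite ?inE.
      * exact: measurable_borelR_itv.
      * exact: measurable_borelR_itv.
      * exact: subset_itv_oc_cc.
    + apply: measurable_funTS; apply: measurable_maxr => //; exact: measurable_minr.
    + exists C; split; first exact: num_real.
      by move=> N CN z _; apply: le_trans (ltW CN); rewrite ler_norml clamp_ge clamp_le.
  rewrite /Rintegral -(@ae_eq_integral_nonmeas _ _ _ lebesgue_measure _ (EFin \o f1)).
  + by rewrite fE2.
  + exact: measurable_borelR_itv.
  + apply/measurable_EFinP; apply: measurable_funTS; apply: measurable_maxr => //; exact: measurable_minr.
  + by apply: (ae_imply _ gE) => z /= ->.
Unshelve. all: by end_near. Qed.

End monotone_lipschitz.

Lemma derivable_cvg_forward {R : realType} (f : R -> R) x : derivable f x 1 ->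
  n.+1%:R * (f (x + n.+1%:R^-1) - f x) @[n --> \oo] --> derive1 f x.
Proof.
move=> /cvg_ex[l hl]; have -> : derive1 f x = l.
  by rewrite derive1E; apply: cvg_lim => //; exact: hl.
have h0 : (n.+1%:R^-1 : R) @[n --> \oo] --> 0^'.
  move=> A; rewrite /dnbhs /within /= => -[e /= e0 eA].
  have := near_infty_natSinv_lt (PosNum e0); apply: filterS => n /= hn.
  by apply: eA => /=; rewrite ?invr_neq0// sub0r normrN gtr0_norm ?invr_gt0.
have := cvg_comp _ _ h0 hl; apply: cvg_trans; apply: near_eq_cvg; apply: nearW => n /=.
by rewrite invrK /GRing.scale/= mulr1 (addrC _ x).
Qed.

Lemma derivable_cvg_backward {R : realType} (f : R -> R) x : derivable f x 1 ->
  n.+1%:R * (f x - f (x - n.+1%:R^-1)) @[n --> \oo] --> derive1 f x.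
Proof.
move=> /cvg_ex[l hl]; have -> : derive1 f x = l.
  by rewrite derive1E; apply: cvg_lim => //; exact: hl.
have h0 : (- n.+1%:R^-1 : R) @[n --> \oo] --> 0^'.
  move=> A; rewrite /dnbhs /within /= => -[e /= e0 eA].
  have := near_infty_natSinv_lt (PosNum e0); apply: filterS => n /= hn.
  by apply: eA => /=; rewrite ?oppr_eq0 ?invr_neq0// sub0r opprK gtr0_norm ?invr_gt0.
have := cvg_comp _ _ h0 hl; apply: cvg_trans; apply: near_eq_cvg; apply: nearW => n /=.
by rewrite invrN invrK /GRing.scale/= mulr1 (addrC _ x) mulNr -mulrN opprB.
Qed.

(** Quotients with steps 1/(n+1) stand for the derivative because they form a sequence of measurable
    functions. Both one-sided versions are recorded: later, convexity bounds a derivative from above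
    by forward quotients and from below by backward ones. *)
Lemma lipschitz_density {R : realType} (C a b : R) (f : R -> R) : a <= b ->
  lipschitz_with C f -> exists g : borelR R -> R,
  [/\ bmeas g,
      \forall x \ae lebI a b,
        n.+1%:R * (f (x + n.+1%:R^-1) - f x) @[n --> \oo] --> g x /\
        n.+1%:R * (f x - f (x - n.+1%:R^-1)) @[n --> \oo] --> g x &
      forall x y, a <= x -> x <= y -> y <= b -> \int[lebI x y]_t g t = f y - f x].
Proof.
move=> ab fC; pose D : R := `|C| + 1.
have D0 : 0 < D by rewrite ltr_pwDr.
have fD x y : `|f x - f y| <= D * `|x - y|.
  apply: (le_trans (fC x y)); rewrite ler_wpM2r//.
  by rewrite (le_trans (ler_norm _))// lerDl.
(* A steep linear term makes [f] nondecreasing, and the projection onto [[a, b]] makes the sum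
   constant outside, as the monotone case requires. The density [D] of the linear term is subtracted
   from the result. *)
pose c := clamp a b; pose G x := f (c x) + D * c x.
have Gnd x y : x <= y -> G x <= G y.
  move=> xy; have cxy : c x <= c y by exact: le_clamp.
  have := fD (c x) (c y); rewrite [`|c x - c y|]ler0_norm ?subr_le0// opprB.
  by move=> /(le_trans (ler_norm _)); rewrite /G; lra.
have GC x y : x <= y -> G y - G x <= (D + D) * (y - x).
  move=> xy; have cxy : c x <= c y by exact: le_clamp.
  have := clamp_lipschitz a b x y; rewrite -/(c x) -/(c y).
  rewrite !ler0_norm ?subr_le0// !opprB => cc.
  have := fD (c y) (c x); rewrite [`|c y - c x|]ger0_norm ?subr_ge0//.
  move=> /(le_trans (ler_norm _)) h.
  have : D * (c y - c x) <= D * (y - x) by rewrite ler_pM2l.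
  by rewrite /G; lra.
have Ga x : x <= a -> G x = G a.
  move=> xa; rewrite /G /c /clamp; congr (f _ + D * _).
    by rewrite (min_idPl (le_trans xa ab)) (min_idPl ab) (max_idPl xa) maxxx.
  by rewrite (min_idPl (le_trans xa ab)) (min_idPl ab) (max_idPl xa) maxxx.
have Gb x : b <= x -> G x = G b.
  by move=> bx; rewrite /G /c /clamp (min_idPr bx) minxx.
have DD : 0 < D + D by rewrite addr_gt0.
have [g [bg dg Ig]] := monotone_lipschitz_density DD ab Gnd GC Ga Gb.
exists (fun x => g x - D); split.
- by apply: bmeasB => //; exact: bmeas_cst.
- apply: ae_lebI_oo; apply: (ae_imply _ dg) => x [dGx eGx] axb.
  have key (e : nat -> R) : e n @[n --> \oo] --> 0 ->
      \forall n \near \oo, G (x + e n) = f (x + e n) + D * (x + e n).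
    move=> e0; move/andP: axb => [ax xb].
    have : \forall n \near \oo, a < x + e n < b.
      have xe : x + e n @[n --> \oo] --> x.
        by rewrite -[X in _ --> X]addr0; apply: cvgD => //; exact: cvg_cst.
      near=> n; apply/andP; split; near: n.
        by apply: (cvgr_gt x).
      by apply: (cvgr_lt x).
    apply: filterS => n /andP[h1 h2].
    by rewrite /G /c clamp_id// !ltW.
  have Gx : G x = f x + D * x.
    by rewrite /G /c clamp_id//; move/andP: axb => [? ?]; rewrite !ltW.
  have hn : (n.+1%:R^-1 : R) @[n --> \oo] --> 0 by exact: cvg_harmonic.
  split.
    have : n.+1%:R * (G (x + n.+1%:R^-1) - G x) - D @[n --> \oo] --> g x - D.
      by rewrite -eGx; apply: cvgB (cvg_cst _); exact: derivable_cvg_forward.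
    apply: cvg_trans; apply: near_eq_cvg; have := key _ hn.
    apply: filterS => n /= ->; rewrite Gx; field.
    by rewrite nat1r pnatr_eq0.
  have : n.+1%:R * (G x - G (x - n.+1%:R^-1)) - D @[n --> \oo] --> g x - D.
    by rewrite -eGx; apply: cvgB (cvg_cst _); exact: derivable_cvg_backward.
  apply: cvg_trans; apply: near_eq_cvg.
  have hn' : (- n.+1%:R^-1 : R) @[n --> \oo] --> 0.
    by rewrite -oppr0; exact: cvgN.
  have := key _ hn'; apply: filterS => n /= ->; rewrite Gx; field.
  by rewrite nat1r pnatr_eq0.
- move=> x y ax xy yb; rewrite bintB//; last exact: bmeas_cst.
  rewrite Ig// bint_cst lebIT// /G /c !clamp_id//.
  + by ring.
  + by rewrite ax (le_trans xy).
  + by rewrite yb (le_trans ax).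
Unshelve. all: by end_near. Qed.

(** * Smooth test functions *)

Section smooth_functions.
Context {R : realType}.
Implicit Types f g : R -> R.

(** The derivative is quantified existentially and characterised by [is_derive], so that each
    closure property is proved by exhibiting the derivative. *)
Fixpoint C1k (k : nat) f : Prop :=
  if k is k'.+1 then
    exists2 g, (forall x, is_derive x (1 : R) f (g x)) & C1k k' g
  else continuous f.

Definition smooth f := forall k, C1k k f.

Lemma is_derive1_continuous f (x d : R) : is_derive x 1 f d -> {for x, continuous f}.
Proof.
by case=> df _; apply: differentiable_continuous; exact/derivable1_diffP.
Qed.

Lemma C1kW k f : C1k k.+1 f -> C1k k f.
Proof.
elim: k f => [|k IH] f [g fg gk].
  by move=> x; exact: (is_derive1_continuous (fg x)).
by exists g => //; exact: IH.
Qed.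

Lemma C1k_continuous k f : C1k k f -> continuous f.
Proof. by elim: k => [//|k IH] /C1kW. Qed.

Lemma C1k_cst k c : C1k k (cst c : R -> R).
Proof.
elim: k c => [|k IH] c; first exact: cst_continuous.
by exists (cst 0) => // x; exact: is_derive_cst.
Qed.

Lemma C1kD k f g : C1k k f -> C1k k g -> C1k k (f \+ g).
Proof.
elim: k f g => [|k IH] f g; first by move=> cf cg x; apply: cvgD; [exact: cf|exact: cg].
move=> [f' ff' Cf'] [g' gg' Cg']; exists (f' \+ g'); last exact: IH.
by move=> x; exact: is_deriveD.
Qed.

Lemma C1kN k f : C1k k f -> C1k k (\- f).
Proof.
elim: k f => [|k IH] f; first by move=> cf x; apply: cvgN; exact: cf.
move=> [f' ff' Cf']; exists (\- f'); last exact: IH.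
by move=> x; exact: is_deriveN.
Qed.

Lemma C1kM k f g : C1k k f -> C1k k g -> C1k k (f \* g).
Proof.
elim: k f g => [|k IH] f g; first by move=> cf cg x; apply: cvgM; [exact: cf|exact: cg].
move=> /[dup] /C1kW Cf [f' ff' Cf'] /[dup] /C1kW Cg [g' gg' Cg'].
exists ((f \* g') \+ (g \* f')); last by apply: C1kD; exact: IH.
by move=> x; exact: is_deriveM.
Qed.

Lemma C1k_affine k f (a b : R) : C1k k f -> C1k k (fun x => f (a * x + b)).
Proof.
elim: k f => [|k IH] f.
  move=> cf x; apply: (@cvg_comp _ _ _ (fun x => a * x + b) f).
    by apply: cvgD; [apply: cvgMr; exact: cvg_id|exact: cvg_cst].
  exact: cf.
move=> [f' ff' Cf']; exists ((fun x => f' (a * x + b)) \* cst a).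
  move=> x; have h1 : is_derive x 1 (a *: (@id R)) (a *: 1) by exact: is_deriveZ.
  have h2 : is_derive x 1 (fun y => a * y + b) a.
    have := is_deriveD h1 (is_derive_cst b x 1).
    by congr (is_derive x 1 _ _); rewrite addr0 /GRing.scale/= mulr1.
  exact: (@is_derive1_comp _ f (fun y => a * y + b) x _ _ (ff' (a * x + b)) h2).
by apply: C1kM; [exact: IH|exact: C1k_cst].
Qed.

Lemma C1kV k f : (forall x, f x != 0) -> C1k k f -> C1k k (fun x => (f x)^-1).
Proof.
move=> f0; elim: k => [|k IH].
  by move=> cf x; apply: cvgV; [exact: f0|exact: cf].
move=> /[dup] /C1kW Cf [f' ff' Cf'].
exists ((\- f') \* ((fun x => (f x)^-1) \* (fun x => (f x)^-1))).
  move=> x; have := is_deriveV (f0 x) (ff' x).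
  congr (is_derive x 1 _ _).
  by rewrite /GRing.scale/= expr2 invfM; ring.
by apply: C1kM; [exact: C1kN|apply: C1kM; exact: IH].
Qed.

Lemma smooth_ext f g : f =1 g -> smooth f -> smooth g.
Proof. by move=> /funext ->. Qed.

Lemma smooth_cst c : smooth (cst c). Proof. by move=> k; exact: C1k_cst. Qed.

Lemma smoothD f g : smooth f -> smooth g -> smooth (f \+ g).
Proof. by move=> sf sg k; exact: C1kD. Qed.

Lemma smoothN f : smooth f -> smooth (\- f).
Proof. by move=> sf k; exact: C1kN. Qed.

Lemma smoothM f g : smooth f -> smooth g -> smooth (f \* g).
Proof. by move=> sf sg k; exact: C1kM. Qed.

Lemma smooth_affine f a b : smooth f -> smooth (fun x => f (a * x + b)).
Proof. by move=> sf k; exact: C1k_affine. Qed.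

Lemma smoothV f : (forall x, f x != 0) -> smooth f -> smooth (fun x => (f x)^-1).
Proof. by move=> f0 sf k; exact: C1kV. Qed.

Lemma smooth_prim f g : (forall x, is_derive x (1 : R) f (g x)) -> smooth g -> smooth f.
Proof. by move=> fg sg [|k]; [apply: (@C1kW 0); exists g|exists g]. Qed.

Lemma smooth_derive f : smooth f ->
  (forall x : R, is_derive x (1 : R) f (derive1 f x)) /\ smooth (derive1 f).
Proof.
move=> sf; have E k : exists2 g, (forall x, is_derive x (1 : R) f (g x)) & C1k k g.
  exact: (sf k.+1).
have D1 (x : R) : is_derive x (1 : R) f (derive1 f x).
  have [g fg _] := E 0; rewrite derive1E; apply: DeriveDef => //; by case: (fg x).
split => // k; have [g fg gk] := E k.
by rewrite (_ : derive1 f = g)//; apply/funext => x; rewrite derive1E; case: (fg x).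
Qed.

Lemma smooth_continuous f : smooth f -> continuous f.
Proof. by move=> /(_ 0%N). Qed.

(** The functions p(1/x) exp(-1/x), extended by 0 to x <= 0: a family that contains the classical
    flat function and is closed under differentiation. *)
Definition expinv (p : {poly R}) (x : R) : R :=
  if 0 < x then p.[x^-1] * expR (- x^-1) else 0.

Lemma expinv_le (p : {poly R}) : exists2 C, 0 <= C &
  forall x, `|x| <= 1 -> `|expinv p x| <= C * `|x|.
Proof.
elim/poly_ind: p => [|p c [C C0 IH]].
  exists 0 => // x _; rewrite /expinv horner0 mul0r; case: ifP => _; by rewrite normr0 mul0r.
have key n : exists2 K : R, 0 <= K & forall x, 0 < x -> x <= 1 ->
    x^-1 ^+ n * expR (- x^-1) <= K * x.
  (* From the exponential series, y^(n+1) / (n+1)! <= exp y, taken at y = 1/x. *)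
  exists (n.+1)`!%:R => // x x0 x1.
  have y0 : 0 < x^-1 by rewrite invr_gt0.
  have h : x^-1 ^+ n.+1 / n.+1`!%:R <= expR x^-1.
    by apply: le_trans (expR_ge1Dxn n (ltW y0)); rewrite lerDr.
  have f0 : 0 < n.+1`!%:R :> R by rewrite ltr0n fact_gt0.
  rewrite expRN ler_pdivrMr ?expR_gt0//.
  move: h; rewrite ler_pdivrMr// => h.
  rewrite mulrAC -ler_pdivrMr// -exprSr.
  by rewrite mulrC.
have main n : forall q : {poly R}, (size q <= n)%N ->
    exists2 K : R, 0 <= K & forall x, 0 < x -> x <= 1 -> `|q.[x^-1]| * expR (- x^-1) <= K * x.
  elim: n => [|n IHn] q sq.
    exists 0 => // x _ _; rewrite (_ : q = 0) ?horner0 ?normr0 ?mul0r//.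
    by apply/eqP; rewrite -size_poly_leq0.
  pose q' := take_poly n q.
  have [K K0 HK] := IHn q' (size_take_poly _ _).
  have [K1 K10 HK1] := key n.
  exists (K + `|q`_n| * K1); first by rewrite addr_ge0// mulr_ge0.
  move=> x x0 x1; have E : q = q' + q`_n *: 'X^n.
    rewrite -{1}(poly_take_drop n q); congr (_ + _).
    have -> : drop_poly n q = (q`_n)%:P.
      apply/polyP => i; rewrite coef_drop_poly coefC; case: eqP => [->//|/eqP i0].
      by rewrite nth_default// (leq_trans sq)// -addn1 addnC leq_add2r lt0n.
    by rewrite mul_polyC.
  rewrite {1}E hornerD hornerZ hornerXn.
  apply: (@le_trans _ _ ((`|q'.[x^-1]| + `|q`_n| * x^-1 ^+ n) * expR (- x^-1))).
    rewrite ler_wpM2r ?expR_ge0//; apply: (le_trans (ler_normD _ _)).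
    by rewrite normrM [`|x^-1 ^+ n|]ger0_norm// exprn_ge0// invr_ge0 ltW.
  rewrite mulrDl mulrDl lerD ?HK// -!mulrA ler_wpM2l// ?HK1//.
have [K K0 HK] := main _ _ (leqnn (size (p * 'X + c%:P))).
exists K => // x x1; rewrite /expinv; case: ifPn => x0.
  rewrite normrM [`|expR _|]ger0_norm ?expR_ge0// [`|x|]gtr0_norm//.
  by apply: HK => //; rewrite (le_trans (ler_norm _)).
by rewrite normr0 mulr_ge0.
Qed.

(** Away from 0 this is the product and chain rule, the factor X^2 coming from the derivative of
    1/x. At 0 the difference quotient is again of the form [expinv], for the polynomial [p * 'X],
    and [expinv_le] makes it tend to 0. *)
Lemma expinv_derive (p : {poly R}) (x : R) :
  is_derive x (1 : R) (expinv p) (expinv ((p - p^`()) * 'X^2) x).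
Proof.
have [x0|x0|x0] := ltgtP x 0.
- rewrite {2}/expinv ltNge (ltW x0)/=.
  have nE : \near x, (cst (0 : R) : R -> R) x = expinv p x.
    by near=> y; rewrite /expinv ltNge ltW//; near: y; exact: lt_nbhsl.
  exact: near_eq_is_derive nE (is_derive_cst _ _ _).
- rewrite {2}/expinv x0.
  have nE : \near x, p.[x^-1] * expR (- x^-1) = expinv p x.
    by near=> y; rewrite /expinv ifT//; near: y; exact: lt_nbhsr.
  apply: (near_eq_is_derive nE).
  have xn0 : x != 0 by rewrite gt_eqF.
  have dV : is_derive x 1 (fun y : R => y^-1) (- x ^- 2).
    have := is_deriveV xn0 (is_derive_id x 1).
    by congr (is_derive x 1 _ _); rewrite /GRing.scale/= mulr1.
  have dp : is_derive x 1 (fun y : R => p.[y^-1]) (p^`().[x^-1] * - x ^- 2).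
    exact: (@is_derive1_comp _ (fun y => p.[y]) (fun y => y^-1) x _ _ (is_derive_poly p x^-1) dV).
  have dVN : is_derive x 1 (fun y : R => - y^-1) (x ^- 2).
    by have := is_deriveN dV; rewrite opprK.
  have de : is_derive x 1 (fun y : R => expR (- y^-1)) (expR (- x^-1) * x ^- 2).
    exact: (@is_derive1_comp _ expR (fun y => - y^-1) x _ _ (is_derive_expR _) dVN).
  have := is_deriveM dp de; congr (is_derive x 1 _ _).
  rewrite /GRing.scale/= hornerM hornerD hornerN hornerXn exprVn.
  by ring.
- rewrite x0; clear x x0; rewrite {2}/expinv ltxx.
  have [C C0 HC] := expinv_le (p * 'X).
  have lim0 : h^-1 *: ((expinv p \o shift 0) (h *: 1) - expinv p 0) @[h --> 0^'] --> (0 : R).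
    apply/cvgrPdist_le => /= e e0.
    have [D D0 De] : exists2 D : R, 0 < D & C * D <= e.
      have C1 : 0 < C + 1 by rewrite ltr_wpDl.
      exists (e / (C + 1)); first exact: divr_gt0.
      by rewrite mulrC mulrAC ler_pdivrMr// mulrDr mulr1 lerDl ltW.
    near=> h; rewrite sub0r normrN /GRing.scale/= mulr1 addr0 {2}/expinv ltxx subr0.
    have -> : h^-1 * expinv p h = expinv (p * 'X) h.
      by rewrite /expinv; case: ifP => _; rewrite ?mulr0// hornerM hornerX; ring.
    apply: (le_trans (HC _ _)).
      by near: h; apply: dnbhs0_le.
    apply: le_trans De; rewrite ler_wpM2l//.
    by near: h; apply: dnbhs0_le.
  apply: DeriveDef.
    by apply/cvg_ex; exists 0.
  by apply: cvg_lim.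
Unshelve. all: by end_near. Qed.

Lemma smooth_expinv p : smooth (expinv p).
Proof.
move=> k; elim: k p => [|k IH] p.
  by move=> x; exact: (is_derive1_continuous (expinv_derive p x)).
by exists (expinv ((p - p^`()) * 'X^2)) => // x; exact: expinv_derive.
Qed.

(** The classical smooth transition from 0 to 1 over [0, 1]. The denominator never vanishes, since x
    and 1 - x are not both nonpositive. *)
Definition smstep (x : R) : R := expinv 1 x / (expinv 1 x + expinv 1 (1 - x)).

Let e1_ge0 x : 0 <= expinv 1 x.
Proof. by rewrite /expinv; case: ifP => // _; rewrite hornerC mul1r expR_ge0. Qed.

Let e1_gt0 x : 0 < x -> 0 < expinv 1 x.
Proof. by move=> x0; rewrite /expinv x0 hornerC mul1r expR_gt0. Qed.

Let e1_eq0 x : x <= 0 -> expinv 1 x = 0.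
Proof. by move=> x0; rewrite /expinv ltNge x0. Qed.

Let e1_nd x y : x <= y -> expinv 1 x <= expinv 1 y.
Proof.
move=> xy; have [x0|x0] := leP x 0; first by rewrite e1_eq0.
have y0 : 0 < y by exact: lt_le_trans xy.
by rewrite /expinv x0 y0 !hornerC !mul1r ler_expR lerN2 lef_pV2.
Qed.

Let den_gt0 x : 0 < expinv 1 x + expinv 1 (1 - x).
Proof.
have [x0|x0] := leP x 0; last by rewrite ltr_pwDl// e1_gt0.
by rewrite ltr_wpDl// e1_gt0// subr_gt0 (le_lt_trans x0).
Qed.

Lemma smooth_smstep : smooth smstep.
Proof.
have h : smooth (fun x => expinv 1 (1 - x)).
  apply: smooth_ext (smooth_affine (-1) 1 (smooth_expinv 1)) => x /=.
  by rewrite mulN1r addrC.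
apply: smoothM; first exact: smooth_expinv.
apply: smoothV; first by move=> x; rewrite gt_eqF.
by apply: smoothD => //; exact: smooth_expinv.
Qed.

Lemma smstep_le0 x : x <= 0 -> smstep x = 0.
Proof. by move=> x0; rewrite /smstep e1_eq0// mul0r. Qed.

Lemma smstep_ge1 x : 1 <= x -> smstep x = 1.
Proof.
move=> x1; rewrite /smstep (e1_eq0 (x := 1 - x)) ?subr_le0// addr0 divff//.
by rewrite gt_eqF// e1_gt0// (lt_le_trans ltr01).
Qed.

Lemma smstep_ge0 x : 0 <= smstep x.
Proof. by rewrite divr_ge0// ltW. Qed.

Lemma smstep_le1 x : smstep x <= 1.
Proof. by rewrite ler_pdivrMr// mul1r lerDl. Qed.

Lemma smstep_nd x y : x <= y -> smstep x <= smstep y.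
Proof.
move=> xy; rewrite ler_pdivrMr// mulrAC ler_pdivlMr//.
rewrite !mulrDr [expinv 1 y * expinv 1 x]mulrC lerD2l.
by apply: ler_pM => //; apply: e1_nd; rewrite // lerD2l lerN2.
Qed.

Lemma nondecreasing_derive_ge0 f (x d : R) : (forall x y, x <= y -> f x <= f y) ->
  is_derive x (1 : R) f d -> 0 <= d.
Proof.
move=> fnd [df fd]; have := derivable_cvg_forward df; rewrite derive1E fd => h.
rewrite -(cvg_lim _ h)//; apply: limr_ge; first by apply/cvg_ex; exists d; exact: h.
apply: nearW => n; rewrite mulr_ge0// subr_ge0; apply: fnd.
by rewrite lerDl invr_ge0.
Qed.

End smooth_functions.
Global Opaque smstep.

(** * Test functions of time and space *)

Section smooth_plane_functions.
Context {R : realType}.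
Implicit Types (phi psi : R * R -> R) (f : R -> R).

Lemma derive_along (phi : R * R -> R) (p v : R * R) (d : R) :
  is_derive (0 : R) (1 : R) (fun h : R => phi (h *: v + p)) d ->
  derivable phi p v /\ 'D_v phi p = d.
Proof.
move=> [dg gd]; split; first exact/derivable1P.
rewrite -gd /derive.
suff -> : (fun h : R => h^-1 *: ((phi \o shift p) (h *: v) - phi p)) =
  (fun h : R => h^-1 *: (((fun h : R => phi (h *: v + p)) \o shift 0) (h *: (1 : R))
    - phi (0 *: v + p))) by [].
apply/funext => h /=; by rewrite addr0 scale0r add0r [_ *: 1]mulr1.
Qed.

Lemma is_CkW k phi : is_Ck k.+1 phi -> is_Ck k phi.
Proof.
elim: k phi => [|k IH] phi; first by case.
by move=> [c d1 d2 D1 D2]; split; [exact: c|exact: d1|exact: d2|exact: (IH _ D1)|exact: (IH _ D2)].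
Qed.

Lemma is_CkD k phi psi : is_Ck k phi -> is_Ck k psi -> is_Ck k (phi \+ psi).
Proof.
elim: k phi psi => [|k IH] phi psi.
  by move=> cf cg x; apply: cvgD; [exact: cf|exact: cg].
move=> [c d1 d2 D1 D2] [c' d1' d2' D1' D2']; split.
- by move=> x; apply: cvgD; [exact: c|exact: c'].
- by move=> p; exact: derivableD.
- by move=> p; exact: derivableD.
- rewrite (_ : (fun p => _) = (fun p => 'D_(1, 0) phi p) \+ (fun p => 'D_(1, 0) psi p)).
    exact: IH.
  by apply/funext => p /=; rewrite deriveD.
- rewrite (_ : (fun p => _) = (fun p => 'D_(0, 1) phi p) \+ (fun p => 'D_(0, 1) psi p)).
    exact: IH.
  by apply/funext => p /=; rewrite deriveD.
Qed.

Lemma is_CkM k phi psi : is_Ck k phi -> is_Ck k psi -> is_Ck k (phi \* psi).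
Proof.
elim: k phi psi => [|k IH] phi psi.
  by move=> cf cg x; apply: cvgM; [exact: cf|exact: cg].
move=> /[dup] /is_CkW Cp [c d1 d2 D1 D2] /[dup] /is_CkW Cq [c' d1' d2' D1' D2']; split.
- by move=> x; apply: cvgM; [exact: c|exact: c'].
- by move=> p; exact: derivableM.
- by move=> p; exact: derivableM.
- rewrite (_ : (fun p => _) = (phi \* (fun p => 'D_(1, 0) psi p)) \+
                              (psi \* (fun p => 'D_(1, 0) phi p))).
    by apply: is_CkD; exact: IH.
  by apply/funext => p /=; rewrite deriveM.
- rewrite (_ : (fun p => _) = (phi \* (fun p => 'D_(0, 1) psi p)) \+
                              (psi \* (fun p => 'D_(0, 1) phi p))).
    by apply: is_CkD; exact: IH.
  by apply/funext => p /=; rewrite deriveM.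
Qed.

Lemma derive_plane_affine f (f' : R -> R) (a b c : R) (p v : R * R) :
  (forall x : R, is_derive x (1 : R) f (f' x)) ->
  let phi := fun q : R * R => f (a * q.1 + b * q.2 + c) in
  derivable phi p v /\ 'D_v phi p = (a * v.1 + b * v.2) * f' (a * p.1 + b * p.2 + c).
Proof.
move=> ff' phi; apply: derive_along; pose s : R := a * v.1 + b * v.2.
have h1 : is_derive (0 : R) (1 : R) (fun h : R => s * h + (a * p.1 + b * p.2 + c)) s.
  have h0 : is_derive (0 : R) (1 : R) (s *: (@id R)) (s *: 1) by exact: is_deriveZ.
  have := is_deriveD h0 (is_derive_cst (a * p.1 + b * p.2 + c) (0 : R) 1).
  by congr (is_derive _ (1 : R) _ _); rewrite addr0 /GRing.scale/= mulr1.
have := @is_derive1_comp _ f _ _ _ _ (ff' _) h1.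
rewrite mulr0 add0r [f' _ * s]mulrC; congr (is_derive _ _ _ _).
apply/funext => h /=; rewrite /phi /=; congr f.
by rewrite /s /GRing.scale/=; ring.
Qed.

Lemma is_Ck_affine k f (a b c : R) : C1k k f ->
  is_Ck k (fun q : R * R => f (a * q.1 + b * q.2 + c)).
Proof.
have contl : continuous (fun q : R * R => a * q.1 + b * q.2 + c).
  move=> q; apply: cvgD; last exact: cvg_cst.
  by apply: cvgD; apply: cvgMr; [exact: cvg_fst|exact: cvg_snd].
have contc g : continuous g -> continuous (fun q : R * R => g (a * q.1 + b * q.2 + c)).
  by move=> cg q; apply: (cvg_comp _ _ (contl q)); exact: cg.
elim: k f => [|k IH] f; first exact: contc.
move=> /[dup] /C1k_continuous Cf [f' ff' Cf'].
have D p v := derive_plane_affine a b c p v ff'.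
have gen v : is_Ck k (fun p => 'D_v (fun q : R * R => f (a * q.1 + b * q.2 + c)) p).
  rewrite (_ : (fun p => _) =
      (fun q : R * R => (cst (a * v.1 + b * v.2) \* f') (a * q.1 + b * q.2 + c))).
    by apply: IH; apply: C1kM => //; exact: C1k_cst.
  by apply/funext => p; have [_ ->] := D p v.
split => //; first exact: contc.
- by move=> p; have [] := D p (1, 0).
- by move=> p; have [] := D p (0, 1).
Qed.

(* [k] cuts off in space, [chi] in time; [f (x - b t)] is the observable *)
Definition moving_test (chi k f : R -> R) (b : R) (p : R * R) : R :=
  chi p.1 * (k p.2 * f (p.2 - b * p.1)).

Lemma is_Ck_moving_test n chi k f b : smooth chi -> smooth k -> smooth f ->
  is_Ck n (moving_test chi k f b).
Proof.
move=> schi sk sf.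
have -> : moving_test chi k f b =
    (fun q => chi (1 * q.1 + 0 * q.2 + 0)) \*
    ((fun q => k (0 * q.1 + 1 * q.2 + 0)) \* (fun q => f (- b * q.1 + 1 * q.2 + 0))).
  apply/funext => p; rewrite /moving_test /=; congr (chi _ * (k _ * f _)); ring.
by apply: is_CkM; [exact: is_Ck_affine|apply: is_CkM; exact: is_Ck_affine].
Qed.

Lemma derive_moving_test (chi k f chi' k' f' : R -> R) (b : R) (p : R * R) :
  (forall x : R, is_derive x (1 : R) chi (chi' x)) ->
  (forall x : R, is_derive x (1 : R) k (k' x)) ->
  (forall x : R, is_derive x (1 : R) f (f' x)) ->
  'D_(1, 0) (moving_test chi k f b) p =
     k p.2 * (chi' p.1 * f (p.2 - b * p.1) - b * chi p.1 * f' (p.2 - b * p.1)) /\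
  'D_(0, 1) (moving_test chi k f b) p =
     chi p.1 * (k' p.2 * f (p.2 - b * p.1) + k p.2 * f' (p.2 - b * p.1)).
Proof.
move=> dchi dk df; have -> : moving_test chi k f b =
    (fun q => chi (1 * q.1 + 0 * q.2 + 0)) \*
    ((fun q => k (0 * q.1 + 1 * q.2 + 0)) \* (fun q => f (- b * q.1 + 1 * q.2 + 0))).
  apply/funext => q; rewrite /moving_test /=; congr (chi _ * (k _ * f _)); ring.
have C v := derive_plane_affine 1 0 0 p v dchi.
have K v := derive_plane_affine 0 1 0 p v dk.
have F v := derive_plane_affine (- b) 1 0 p v df.
have gen v : 'D_v ((fun q => chi (1 * q.1 + 0 * q.2 + 0)) \*
    ((fun q => k (0 * q.1 + 1 * q.2 + 0)) \* (fun q => f (- b * q.1 + 1 * q.2 + 0)))) p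
    = chi p.1 * (k p.2 * ((v.2 - b * v.1) * f' (p.2 - b * p.1)) +
                 f (p.2 - b * p.1) * (v.2 * k' p.2))
      + k p.2 * f (p.2 - b * p.1) * (v.1 * chi' p.1).
  have [c1 c2] := C v; have [k1 k2] := K v; have [f1 f2] := F v.
  have dM := derivableM k1 f1.
  rewrite (deriveM c1 dM) (deriveM k1 f1) c2 k2 f2 /GRing.scale/= !fctE.
  have -> : 1 * p.1 + 0 * p.2 + 0 = p.1 by ring.
  have -> : 0 * p.1 + 1 * p.2 + 0 = p.2 by ring.
  have -> : - b * p.1 + 1 * p.2 + 0 = p.2 - b * p.1 by ring.
  by ring.
by rewrite !gen /=; split; ring.
Qed.

End smooth_plane_functions.

Section interval_lemmas.
Context {R : realType}.

Lemma continuous_bounded_ball (f : R -> R) (c : R) : continuous f ->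
  exists M, 0 <= M /\ forall x, `|x| <= c -> `|f x| <= M.
Proof.
move=> cf; have [c0|c0] := ltP c 0.
  by exists 0; split => // x /(le_trans (normr_ge0 _)); rewrite leNgt c0.
have Nc : - c <= c by rewrite (le_trans _ c0)// oppr_le0.
have cn : {within `[- c, c], continuous (fun x => `|f x|)}.
  apply: continuous_subspaceT => x; apply: (continuous_comp (cf x)); exact: norm_continuous.
have [z zc hz] := EVT_max Nc cn.
exists `|f z|; split => // x xc; apply: hz.
by rewrite in_itv/= -ler_norml.
Qed.

Lemma bmeas_comp_continuous d (T : measurableType d) (f : R -> R) (g : T -> R) :
  continuous f -> bmeas g -> bmeas (fun x => f (g x)).
Proof.
move=> cf [mg [M gM]]; split.
  by apply: measurableT_comp mg; exact: continuous_measurable_fun.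
by have [N [_ HN]] := continuous_bounded_ball M cf; exists N => x; exact: HN.
Qed.

Lemma bmeas_clamp d (T : measurableType d) (a b : R) (g : T -> R) : a <= b ->
  measurable_fun setT g -> bmeas (fun x => clamp a b (g x)).
Proof.
move=> ab mg; apply: (@bmeas_le _ _ _ _ (`|a| + `|b|)).
  by apply: measurable_maxr => //; exact: measurable_minr.
move=> x; rewrite ler_norml; apply/andP; split.
  apply: (@le_trans _ _ a); last exact: clamp_ge.
  by rewrite lerNl (le_trans (ler_norm _))// normrN lerDl.
by rewrite (le_trans (clamp_le ab _))// (le_trans (ler_norm _))// lerDr.
Qed.

Lemma lebI_indic (d T : R) (g : borelR R -> R) : 0 <= d -> d <= T -> bmeas g ->
  \int[lebI 0 T]_t (\1_(`]0, d[%classic) t * g t) = \int[lebI 0 d]_t g t.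
Proof.
move=> d0 dT bg; have bi : bmeas (fun t : borelR R => \1_(`]0, d[%classic) t * g t).
  by apply: bmeasM => //; apply: bmeas_indic; exact: measurable_borelR_itv.
rewrite (lebI_split d0 dT)//.
rewrite (@ae_eq_bint _ _ _ (lebI 0 d) _ g)//; last first.
  apply: ae_lebI_oo; apply: aeW => x xd; rewrite indicE mem_set ?mul1r//.
suff -> : \int[lebI d T]_x (\1_(`]0, d[%classic) x * g x) = 0 by rewrite addr0.
rewrite -[RHS](bint0 (lebI d T)); apply: ae_eq_bint; first exact: bmeas_cst.
apply: ae_lebI_oo; apply: aeW => x /andP[dx _]; rewrite indicE memNset ?mul0r//.
by rewrite /= ?in_itv/= => /andP[_]; rewrite ltNge (ltW dx).
Qed.

Lemma lebI_indic_le (d T : R) (g : borelR R -> R) : 0 <= d -> d <= T -> bmeas g ->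
  \int[lebI 0 T]_t (((t : R) <= d)%R%:R * g t) = \int[lebI 0 d]_t g t.
Proof.
move=> d0 dT bg; rewrite -(lebI_indic d0 dT bg); apply: ae_eq_bint.
  by apply: bmeasM => //; apply: bmeas_indic; exact: measurable_borelR_itv.
have neq c : \forall x \ae lebI 0 T, x <> c.
  apply/ae_lebI; exists [set c]; split => //; first exact: lebesgue_measure_set1.
  by move=> x /= /not_implyP[_ /contrapT].
apply: (ae_imply3 _ (neq 0) (neq d) (ae_lebI_mem 0 T)) => x /eqP x0 /eqP xd /andP[x1 x2].
rewrite indicE; congr ((nat_of_bool _)%:R * _); apply/idP/idP.
  by move=> h; rewrite inE/= in_itv/= !lt_neqAle eq_sym x0 x1 xd.
by rewrite inE/= in_itv/= => /andP[_ /ltW ->].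
Qed.

Lemma lebI_integrable (a b : R) (g : borelR R -> R) : bmeas g ->
  lebesgue_measure.-integrable `[a, b] (EFin \o g).
Proof.
move=> bg; apply: (@measurable_bounded_integrable _ (borelR R) _ lebesgue_measure _ _ (measurable_borelR_itv _)).
- exact: lebesgue_itv_lty.
- by apply: measurable_funTS; case: bg.
- case: bg => _ [M fM]; exists M; split; first exact: num_real.
  by move=> N MN z _; apply: le_trans (fM z) (ltW MN).
Qed.

(** The primitive of [g] cut off outside [[0, T]] vanishes on []0, T[], and by Lebesgue
    differentiation its derivative is [g] almost everywhere. *)
Lemma itv_integral_eq0_ae (T : R) (g : borelR R -> R) : bmeas g ->
  (forall d, 0 < d -> d < T -> \int[lebI 0 d]_t g t = 0) ->
  \forall t \ae lebI 0 T, g t = 0.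
Proof.
move=> bg h; pose D : set (borelR R) := `[0, T]%classic.
have mD : measurable D by exact: measurable_borelR_itv.
pose g' := (g \_ D : borelR R -> R).
have ig' : lebesgue_measure.-integrable setT (EFin \o g').
  have -> : EFin \o g' = (EFin \o g) \_ D.
    by apply/funext => x; rewrite /g' /= !patchE; case: ifP.
  exact: ((integrable_mkcond _ mD).1 (lebI_integrable 0 T bg)).
have intN y : lebesgue_measure.-integrable `]-oo, y] (EFin \o g').
  by apply: integrableS ig' => //; exact: measurable_borelR_itv.
have loc : locally_integrable setT g'.
  have := @integrable_locally R g' setT measurableT.
  by rewrite patch_setT; apply.
have := FTC1Ny intN loc => /= dF.
apply: ae_lebI_oo; apply: (ae_imply _ dF) => x [dx ex] /andP[x0 xT].
have <- : g' x = g x by rewrite /g' patchE mem_set// /D /= in_itv/= !ltW.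
rewrite -ex derive1E.
rewrite (@near_eq_derive R _ _ _ (cst 0)) ?derive_cst//.
near=> y.
have y0 : 0 < y by near: y; exact: lt_nbhsr.
have yT : y < T by near: y; exact: lt_nbhsl.
rewrite -[RHS](h y)// lebI_bintE /g' -Rintegral_mkcondl; congr Rintegral.
apply/seteqP; split => z; rewrite /D /= !in_itv/=.
  by move=> [/andP[-> _] ->].
by move=> /andP[-> zy]; rewrite zy (le_trans zy)// ltW.
Unshelve. all: by end_near. Qed.

Lemma antiderivative (g : R -> R) (c : R) : continuous g -> (forall x, x <= c -> g x = 0) ->
  exists G : R -> R, (forall x, is_derive x (1 : R) G (g x)) /\
    forall x y, x <= y -> \int[lebI x y]_t g t = G y - G x.
Proof.
move=> cg g0; have mg : measurable_fun setT (g : borelR R -> borelR R).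
  exact: continuous_measurable_fun.
have intc y : lebesgue_measure.-integrable `[c, y] (EFin \o g).
  apply: (@measurable_bounded_integrable _ (borelR R) _ lebesgue_measure _ _ (measurable_borelR_itv _)).
  - exact: lebesgue_itv_lty.
  - exact: measurable_funTS.
  - have [M [M0 HM]] := continuous_bounded_ball (`|c| + `|y|) cg.
    exists M; split; first exact: num_real.
    move=> N MN z /=; rewrite in_itv/= => /andP[cz zy]; apply: le_trans (ltW MN); apply: HM.
    rewrite ler_norml; apply/andP; split.
      rewrite lerNl (@le_trans _ _ (- c)) ?lerN2// (le_trans (ler_norm _))//.
      by rewrite normrN lerDl.
    by rewrite (le_trans zy)// (le_trans (ler_norm _))// lerDr.
have intN y : lebesgue_measure.-integrable `]-oo, y] (EFin \o g).
  have mN : measurable (`]-oo, y]%classic : set (borelR R)) by exact: measurable_borelR_itv.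
  have mC : measurable (`[c, y]%classic : set (borelR R)) by exact: measurable_borelR_itv.
  apply: (eq_integrable mN ((EFin \o g) \_ `[c, y])).
    move=> x; rewrite inE/= in_itv/= => xy; rewrite patchE; case: ifPn => //.
    rewrite notin_setE/= in_itv/= xy andbT => /negP; rewrite -ltNge => xc.
    by rewrite g0// ltW.
  have h : lebesgue_measure.-integrable setT ((EFin \o g) \_ `[c, y]).
    exact/(integrable_mkcond _ mC).1.
  exact: integrableS h.
pose G x := (\int[lebesgue_measure]_(t in `]-oo, x]) g t)%R.
exists G; split.
  move=> x; have := @continuous_FTC1 R g -oo%O x (x + 1).
  rewrite ltrDl ltr01 => /(_ isT (intN _) (ltNyr _) (cg x)) [d1 d2].
  by apply: DeriveDef; [exact: d1|rewrite -derive1E; exact: d2].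
move=> x y xy; rewrite lebI_bintE /G (Rintegral_itvB (intN y)) ?bnd_simp//.
rewrite Rintegral_itv_obnd_cbnd//.
apply: integrableS (intN y) => //; try exact: measurable_borelR_itv.
by move=> z /=; rewrite !in_itv/= => /andP[_].
Qed.

Lemma smooth_antiderivative (g : R -> R) (c : R) : smooth g -> (forall x, x <= c -> g x = 0) ->
  exists G : R -> R, [/\ smooth G, (forall x, is_derive x (1 : R) G (g x)) &
    forall x y, x <= y -> \int[lebI x y]_t g t = G y - G x].
Proof.
move=> sg g0; have [G [dG IG]] := antiderivative (smooth_continuous sg) g0.
by exists G; split => //; exact: smooth_prim sg.
Qed.

Lemma cutoff (r : R) : 0 <= r -> exists k k' : R -> R,
  [/\ smooth k, forall x, is_derive x (1 : R) k (k' x),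
      forall x, `|x| <= r -> k x = 1 /\ k' x = 0 &
      forall x, r + 2 <= `|x| -> k x = 0].
Proof.
move=> r0; pose k : R -> R := (fun x => smstep (1 * x + (r + 2))) \* (fun x => smstep (-1 * x + (r + 2))).
have sk : smooth k by apply: smoothM; apply: smooth_affine; exact: smooth_smstep.
have [dk sk'] := smooth_derive sk.
(* The plateau reaches beyond r, so that the derivative vanishes up to |x| = r included. *)
have k1 x : `|x| < r + 1 -> k x = 1.
  rewrite ltr_norml => /andP[h1 h2].
  by rewrite /k /= !smstep_ge1 ?mulr1//; lra.
exists k, (derive1 k); split => //.
  move=> x xr; have xr1 : `|x| < r + 1 by lra.
  split; first exact: k1.
  rewrite derive1E (@near_eq_derive R _ _ _ (cst 1 : R -> R)) ?derive_cst//.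
  near=> y; rewrite k1//=; near: y.
  have : (fun y => `|y|) @ x --> `|x| by exact: norm_continuous.
  move=> h; exact: (cvgr_lt _ h _ xr1).
move=> x; rewrite ler_normr => /orP[h|h]; rewrite /k /=.
  by rewrite (@smstep_le0 _ (-1 * x + _)) ?mulr0//; lra.
by rewrite (@smstep_le0 _ (1 * x + _)) ?mul0r//; lra.
Unshelve. all: by end_near. Qed.

End interval_lemmas.

HB.lock Definition ibint {R : realType} (a b : R) (f : R -> R) : R :=
  \int[lebI a b]_t f t.

Definition bm {R : realType} (f : R -> R) := bmeas (f : borelR R -> R).

Definition bm2 {R : realType} (f : R -> R -> R) :=
  bmeas (fun p : borelR2 R => f p.1 p.2).

Section bm_lemmas.
Context {R : realType}.
Implicit Types (f g : R -> R) (F G : R -> R -> R).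

Lemma bm_cst (c : R) : bm (fun=> c). Proof. exact: bmeas_cst. Qed.
Lemma bmD f g : bm f -> bm g -> bm (fun x => f x + g x). Proof. exact: bmeasD. Qed.
Lemma bmB f g : bm f -> bm g -> bm (fun x => f x - g x). Proof. exact: bmeasB. Qed.
Lemma bmN f : bm f -> bm (fun x => - f x). Proof. exact: bmeasN. Qed.
Lemma bmM f g : bm f -> bm g -> bm (fun x => f x * g x). Proof. exact: bmeasM. Qed.
Lemma bmX f n : bm f -> bm (fun x => f x ^+ n). Proof. exact: bmeasX. Qed.
Lemma bm_norm f : bm f -> bm (fun x => `|f x|). Proof. exact: bmeas_norm. Qed.
Lemma bm_max f g : bm f -> bm g -> bm (fun x => Num.max (f x) (g x)).
Proof. exact: bmeas_max. Qed.
Lemma bm_cont f g : continuous f -> bm g -> bm (fun x => f (g x)).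
Proof. exact: bmeas_comp_continuous. Qed.
Lemma bm_clamp (a b : R) : a <= b -> bm (clamp a b).
Proof.
move=> ab; exact: (bmeas_clamp ab (@measurable_id _ (borelR R) setT)).
Qed.
Lemma bm_indic (A : set (borelR R)) : measurable A -> bm (\1_A : R -> R).
Proof. exact: bmeas_indic. Qed.
Lemma bm_le (c : R) : bm (fun t => (t <= c)%R%:R).
Proof.
rewrite (_ : (fun t => _) = (fun t : borelR R => if (t : R) <= c then 1 else 0)).
  apply: bmeas_if; [|exact: bmeas_cst|exact: bmeas_cst].
  exact: (measurable_fun_ler (@measurable_id _ (borelR R) setT) (measurable_cst c)).
by apply/funext => z; case: ifP.
Qed.
Lemma bm_ge (c : R) : bm (fun t => (c <= t)%R%:R).
Proof.
rewrite (_ : (fun t => _) = (fun t : borelR R => if c <= (t : R) then 1 else 0)).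
  apply: bmeas_if; [|exact: bmeas_cst|exact: bmeas_cst].
  exact: (measurable_fun_ler (measurable_cst c) (@measurable_id _ (borelR R) setT)).
by apply/funext => z; case: ifP.
Qed.

Lemma bm2_cst (c : R) : bm2 (fun _ _ => c). Proof. exact: bmeas_cst. Qed.
Lemma bm2D F G : bm2 F -> bm2 G -> bm2 (fun x y => F x y + G x y). Proof. exact: bmeasD. Qed.
Lemma bm2B F G : bm2 F -> bm2 G -> bm2 (fun x y => F x y - G x y). Proof. exact: bmeasB. Qed.
Lemma bm2N F : bm2 F -> bm2 (fun x y => - F x y). Proof. exact: bmeasN. Qed.
Lemma bm2M F G : bm2 F -> bm2 G -> bm2 (fun x y => F x y * G x y). Proof. exact: bmeasM. Qed.
Lemma bm2X F n : bm2 F -> bm2 (fun x y => F x y ^+ n). Proof. exact: bmeasX. Qed.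
Lemma bm2_norm F : bm2 F -> bm2 (fun x y => `|F x y|). Proof. exact: bmeas_norm. Qed.
Lemma bm2_cont f F : continuous f -> bm2 F -> bm2 (fun x y => f (F x y)).
Proof. exact: bmeas_comp_continuous. Qed.
Lemma bm2_fst f : bm f -> bm2 (fun x _ => f x).
Proof. by apply: bmeas_comp; exact: measurable_fst. Qed.
Lemma bm2_snd f : bm f -> bm2 (fun _ y => f y).
Proof. by apply: bmeas_comp; exact: measurable_snd. Qed.
Lemma bm2_swap F : bm2 F -> bm2 (fun x y => F y x).
Proof. exact: bmeas_swap. Qed.
Lemma bm2_le : bm2 (fun x y : R => (x <= y)%R%:R).
Proof.
rewrite /bm2 (_ : (fun p => _) = (fun p : borelR2 R => if (p.1 : R) <= p.2 then 1 else 0)).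
  apply: bmeas_if; [|exact: bmeas_cst|exact: bmeas_cst].
  by apply: measurable_fun_ler; [exact: measurable_fst|exact: measurable_snd].
by apply/funext => z; case: ifP.
Qed.
Lemma bm2_row F x : bm2 F -> bm (F x).
Proof. exact: (bmeas_section1 (f := fun p : borelR2 R => F p.1 p.2)). Qed.
Lemma bm2_col F y : bm2 F -> bm (F^~ y).
Proof. exact: (bmeas_section2 (f := fun p : borelR2 R => F p.1 p.2)). Qed.

End bm_lemmas.

Section ibint_lemmas.
Context {R : realType}.
Variables a b : R.
Implicit Types (f g : R -> R) (F G : R -> R -> R).

Lemma ibintE f : ibint a b f = \int[lebI a b]_t f t.
Proof. by rewrite ibint.unlock. Qed.

Lemma eq_ibint f g : (forall t, a <= t <= b -> f t = g t) -> ibint a b f = ibint a b g.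
Proof.
move=> fg; rewrite !ibintE !lebI_bintE; apply: eq_Rintegral => t.
by rewrite inE/= in_itv/=; exact: fg.
Qed.

Lemma ae_eq_ibint f g : bm g -> (\forall t \ae lebI a b, f t = g t) ->
  ibint a b f = ibint a b g.
Proof. by rewrite !ibintE; exact: ae_eq_bint. Qed.

Lemma ibintD f g : bm f -> bm g ->
  ibint a b (fun t => f t + g t) = ibint a b f + ibint a b g.
Proof. by rewrite !ibintE; exact: bintD. Qed.

Lemma ibintB f g : bm f -> bm g ->
  ibint a b (fun t => f t - g t) = ibint a b f - ibint a b g.
Proof. by rewrite !ibintE; exact: bintB. Qed.

Lemma ibintN f : bm f -> ibint a b (fun t => - f t) = - ibint a b f.
Proof. by rewrite !ibintE; exact: bintN. Qed.

Lemma ibintZl k f : bm f -> ibint a b (fun t => k * f t) = k * ibint a b f.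
Proof. by rewrite !ibintE; exact: bintZl. Qed.

Lemma ibintZr k f : bm f -> ibint a b (fun t => f t * k) = ibint a b f * k.
Proof. by rewrite !ibintE; exact: bintZr. Qed.

Lemma ibint_cst c : a <= b -> ibint a b (fun=> c) = c * (b - a).
Proof. by move=> ab; rewrite ibintE bint_cst lebIT. Qed.

Lemma ibint0 : ibint a b (fun=> 0) = 0.
Proof. by rewrite ibintE bint0. Qed.

Lemma ibint_eq0 f : (\forall t \ae lebI a b, f t = 0) -> ibint a b f = 0.
Proof. by move=> f0; rewrite -ibint0; apply: ae_eq_ibint => //; exact: bm_cst. Qed.

Lemma le_ibint f g : bm f -> bm g -> (forall t, a <= t <= b -> f t <= g t) ->
  ibint a b f <= ibint a b g.
Proof.
move=> bf bg fg; rewrite !ibintE; apply: ae_le_bint => //.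
by apply: ae_imply (ae_lebI_mem a b) => t; exact: fg.
Qed.

Lemma ae_le_ibint f g : bm f -> bm g -> (\forall t \ae lebI a b, f t <= g t) ->
  ibint a b f <= ibint a b g.
Proof. by rewrite !ibintE; exact: ae_le_bint. Qed.

Lemma le_norm_ibint f : bm f -> `|ibint a b f| <= ibint a b (fun t => `|f t|).
Proof. by rewrite !ibintE; exact: le_norm_bint. Qed.

Lemma le_norm_ibint_bound f M : a <= b -> bm f -> (forall t, a <= t <= b -> `|f t| <= M) ->
  `|ibint a b f| <= M * (b - a).
Proof.
move=> ab bf fM; apply: (le_trans (le_norm_ibint bf)).
rewrite -(ibint_cst M ab); apply: le_ibint => //; [exact: bm_norm|exact: bm_cst].
Qed.

Lemma ibint_ge0 f : bm f -> (forall t, a <= t <= b -> 0 <= f t) -> 0 <= ibint a b f.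
Proof. by move=> bf f0; rewrite -ibint0; apply: le_ibint => //; exact: bm_cst. Qed.

Lemma ibint_ae_eq0 f : bm f -> (forall x, 0 <= f x) -> ibint a b f = 0 ->
  \forall x \ae lebI a b, f x = 0.
Proof. by rewrite ibintE; exact: bint_ae_eq0. Qed.

Lemma cvg_ibint (f_ : nat -> R -> R) f (M : R) :
  (forall n, bm (f_ n)) -> bm f -> (forall n x, `|f_ n x| <= M) ->
  (\forall x \ae lebI a b, f_ n x @[n --> \oo] --> f x) ->
  ibint a b (f_ n) @[n --> \oo] --> ibint a b f.
Proof.
move=> bf_ bf fM ff; rewrite ibintE.
have -> : (fun n => ibint a b (f_ n)) = (fun n => \int[lebI a b]_t f_ n t).
  by apply/funext => n; rewrite ibintE.
exact: (cvg_bint (m := lebI a b) (fun n => bmeas_measurable (bf_ n))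
  (bmeas_measurable bf) fM ff).
Qed.

Lemma ibint_split c f : a <= c -> c <= b -> bm f ->
  ibint a b f = ibint a c f + ibint c b f.
Proof. by rewrite !ibint.unlock; exact: lebI_split. Qed.

Lemma bm_ibint F : bm2 F -> bm (fun x => ibint a b (F x)).
Proof.
move=> bF; rewrite (_ : (fun x => _) = (fun x => \int[lebI a b]_y F x y)).
  exact: (bmeas_bint1 (lebI a b) (f := fun p : borelR2 R => F p.1 p.2)).
by apply/funext => x; rewrite ibintE.
Qed.

End ibint_lemmas.

Lemma ibint_swap {R : realType} (a b c d : R) (F : R -> R -> R) : bm2 F ->
  ibint a b (fun x => ibint c d (F x)) = ibint c d (fun y => ibint a b (F^~ y)).
Proof.
move=> bF; rewrite ibintE [RHS]ibintE.
under eq_Rintegral do rewrite ibintE.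
under [RHS]eq_Rintegral do rewrite ibintE.
exact: (bint_swap (lebI a b) (lebI c d) (f := fun p : borelR2 R => F p.1 p.2)).
Qed.

Lemma ibint_indic {R : realType} (d T : R) (g : R -> R) : 0 <= d -> d <= T -> bm g ->
  ibint 0 T (fun t => \1_(`]0, d[%classic) t * g t) = ibint 0 d g.
Proof. by rewrite !ibintE; exact: lebI_indic. Qed.

Lemma ibint_indic_le {R : realType} (d T : R) (g : R -> R) : 0 <= d -> d <= T -> bm g ->
  ibint 0 T (fun t => (t <= d)%R%:R * g t) = ibint 0 d g.
Proof. by rewrite !ibintE; exact: lebI_indic_le. Qed.

Lemma ibint_itv_eq0_ae {R : realType} (T : R) (g : R -> R) : bm g ->
  (forall d, 0 < d -> d < T -> ibint 0 d g = 0) ->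
  \forall t \ae lebI 0 T, g t = 0.
Proof.
move=> bg h; apply: itv_integral_eq0_ae => // d d0 dT.
by rewrite -ibintE; exact: h.
Qed.

Lemma ae_lebI_neq {R : realType} (a b c : R) : \forall x \ae lebI a b, x <> c.
Proof.
apply/ae_lebI; exists [set c]; split => //; first exact: lebesgue_measure_set1.
by move=> x /= /not_implyP[_ /contrapT].
Qed.

Lemma cvg_smstep {R : realType} (x : R) :
  smstep (n.+1%:R * x) @[n --> \oo] --> ((0 < x)%R%:R : R).
Proof.
have [x0|x0] := leP x 0.
  rewrite (_ : (fun n : nat => _) = cst 0); first exact: cvg_cst.
  by apply/funext => n; rewrite smstep_le0// mulr_ge0_le0.
apply: cvg_near_cst; near=> n; apply: smstep_ge1.
rewrite mulrC -ler_pdivrMr// mul1r.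
by apply: ltW; near: n; exact: (near_infty_natSinv_lt (PosNum x0)).
Unshelve. all: by end_near. Qed.

(** * Integrated weak form along moving observables *)

Section weak_solution.
Context {R : realType}.
Variables (T H r : R) (X u : R -> R -> R) (X0 : R -> R).
Hypotheses (T0 : 0 < T) (H0 : 0 <= H) (r0 : 0 <= r).
Hypothesis bX : bm2 X.
Hypothesis Xr : forall t s, `|X t s| <= r.
Hypothesis bV : bm2 (fun t s => u t (X t s)).
Hypothesis bX0 : bm X0.
Hypothesis X0r : forall s, `|X0 s| <= r.
Hypothesis weak : forall phi, test_function T phi ->
  ibint 0 T (fun t => ibint 0 H (fun s =>
     'D_(1, 0) phi (t, X t s) + u t (X t s) * 'D_(0, 1) phi (t, X t s)))
  + ibint 0 H (fun s => phi (0, X0 s)) = 0.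

Let ct (t : R) := clamp 0 T t.

Let bct : bm ct. Proof. exact: bm_clamp (ltW T0). Qed.

Let barg b : bm2 (fun t s => X t s - b * ct t).
Proof. by apply: bm2B => //; apply: bm2M; [exact: bm2_cst|exact: bm2_fst]. Qed.

(** On the quantile side, the integral of f(x - b t) against the measure at time t. Time is
    truncated to [[0, T]] so that the function is bounded for all t. [observable_flux] is its formal
    time derivative. *)
Definition observable (f : R -> R) (b t : R) : R :=
  ibint 0 H (fun s => f (X t s - b * ct t)).

Definition observable_flux (f' : R -> R) (b t : R) : R :=
  ibint 0 H (fun s => f' (X t s - b * ct t) * (u t (X t s) - b)).

Let bobs (f : R -> R) b : continuous f -> bm2 (fun t s => f (X t s - b * ct t)).
Proof. by move=> cf; exact: bm2_cont. Qed.

Let bflux (f : R -> R) b : continuous f -> bm2 (fun t s => f (X t s - b * ct t) * (u t (X t s) - b)).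
Proof.
by move=> cf; apply: bm2M; [exact: bobs|apply: bm2B => //; exact: bm2_cst].
Qed.

Lemma bm_observable (f : R -> R) b : continuous f -> bm (observable f b).
Proof. by move=> /(bobs b); exact: bm_ibint. Qed.

Lemma bm_observable_flux (f : R -> R) b : continuous f -> bm (observable_flux f b).
Proof. by move=> /(bflux b); exact: bm_ibint. Qed.

(** The test function is chi(t) k(x) f(x - b t), where [k] equals 1 on the range of [X], so that the
    spatial cutoff leaves no trace in the identity. *)
Let weak_product (chi chi' f f' : R -> R) (b T1 : R) : 0 < T1 -> T1 < T ->
  smooth chi -> (forall x : R, is_derive x (1 : R) chi (chi' x)) ->
  (forall t, T1 <= t -> chi t = 0) -> bm chi -> bm chi' ->
  smooth f -> (forall x : R, is_derive x (1 : R) f (f' x)) -> continuous f' ->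
  ibint 0 T (fun t => chi' t * observable f b t + chi t * observable_flux f' b t)
    + chi 0 * ibint 0 H (fun s => f (X0 s)) = 0.
Proof.
move=> T10 T1T schi dchi chi0 bchi bchi' sf df cf'.
have [k [k' [sk dk k1 kr]]] := cutoff r0.
(* [chi] need not vanish at negative times. The new factor is 0 for t <= -2 and 1 for t >= -1, which
   gives compact support without a change on [[0, T]]. *)
pose c : R -> R := (fun x => smstep (1 * x + 2)) \* chi.
have sc : smooth c by apply: smoothM => //; apply: smooth_affine; exact: smooth_smstep.
have [dc _] := smooth_derive sc.
have cE t : 0 <= t -> c t = chi t /\ derive1 c t = chi' t.
  move=> t0; have h y : -1 <= y -> c y = chi y.
    by move=> y1; rewrite /c /= smstep_ge1 ?mul1r//; lra.
  split; first by apply: h; lra.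
  rewrite derive1E (@near_eq_derive R _ _ _ chi); first by case: (dchi t).
  near=> y; apply: h; apply: ltW; near: y; apply: lt_nbhsr; lra.
have tf : test_function T (moving_test c k f b).
  split; first by move=> n; exact: is_Ck_moving_test.
  exists (`[-2, T1] `*` `[- (r + 2), r + 2]); split.
  - by apply: compact_setX; exact: segment_compact.
  - by move=> p [/= + _]; rewrite in_itv/= => /andP[_ /le_lt_trans ->].
  - move=> [t x] /= nK; rewrite /moving_test /=.
    have [tT|tT] := leP T1 t; first by rewrite /c /= chi0// mulr0 mul0r.
    have [t2|t2] := leP t (-2); first by rewrite /c /= smstep_le0 ?mul0r//; lra.
    rewrite kr ?mul0r ?mulr0// leNgt; apply/negP => xr; apply: nK; split => /=.
      by rewrite in_itv/= !ltW.
    by rewrite in_itv/= -ler_norml ltW.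
rewrite -[RHS](weak tf); congr (_ + _).
  apply: eq_ibint => t /andP[t0 tT].
  have ctt : ct t = t by rewrite /ct clamp_id// t0.
  have [c0 c0'] := cE _ t0.
  have b1 := bm2_row t (bobs b (smooth_continuous sf)).
  have b2 := bm2_row t (bflux b cf').
  rewrite /observable /observable_flux -(ibintZl _ _ _ b1) -(ibintZl _ _ _ b2).
  rewrite -(ibintD _ _ (bmM (bm_cst _) b1) (bmM (bm_cst _) b2)).
  apply: eq_ibint => s _.
  have [d1 d2] := derive_moving_test b (t, X t s) dc dk df.
  rewrite d1 d2 /=; have [-> ->] := k1 _ (Xr t s).
  by rewrite ctt c0 c0'; ring.
rewrite -(ibintZl _ _ _ (bm_cont (smooth_continuous sf) bX0)).
apply: eq_ibint => s _; rewrite /moving_test /=.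
have [-> _] := k1 _ (X0r s); have [-> _] := cE _ (lexx 0).
by rewrite mulr0 subr0 mul1r.
Unshelve. all: by end_near. Qed.

(** For a smooth bump [rho] supported in [[0, d]], the function chi(t), integral of [rho] from t to
    d, is an admissible time factor with derivative - rho. Fubini turns the flux term into the
    integral of [rho] against the primitive of the flux. Then [rho] tends to the indicator of []0,
    d[], and d varies. *)
Lemma weak_smooth (f f' : R -> R) (b : R) : smooth f ->
  (forall x : R, is_derive x (1 : R) f (f' x)) -> continuous f' ->
  \forall t \ae lebI 0 T, observable f b t =
    ibint 0 H (fun s => f (X0 s)) + ibint 0 t (observable_flux f' b).
Proof.
move=> sf df cf'; set F0 := ibint 0 H (fun s => f (X0 s)).
have bF := bm_observable b (smooth_continuous sf).
have bN := bm_observable_flux b cf'.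
set F := observable f b in bF *; set Fl := observable_flux f' b in bN *.
(* The primitive of the flux, with the variable end point moved into the integrand: its
   measurability in t is that of a parameter integral over a fixed interval. *)
pose N (t : R) := ibint 0 T (fun z => (z <= t)%R%:R * Fl z).
have bK : bm2 (fun t z => (z <= t)%R%:R * Fl z).
  by apply: bm2M; [exact: (bm2_swap bm2_le)|exact: bm2_snd].
have bNN : bm N by exact: bm_ibint.
have key d n : 0 < d -> d < T ->
    ibint 0 T (fun t => smstep (n.+1%:R * t) * smstep (n.+1%:R * (d - t)) *
      (F t - F0 - N t)) = 0.
  move=> d0 dT; pose rho (t : R) := smstep (n.+1%:R * t) * smstep (n.+1%:R * (d - t)).
  have srho : smooth rho.
    have -> : rho = (fun t => smstep (n.+1%:R * t + 0)) \*
                    (fun t => smstep (- n.+1%:R * t + n.+1%:R * d)).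
      by apply/funext => t; rewrite /rho /=; congr (smstep _ * smstep _); ring.
    by apply: smoothM; apply: smooth_affine; exact: smooth_smstep.
  have rho0 t : t <= 0 -> rho t = 0.
    by move=> t0; rewrite /rho smstep_le0 ?mul0r// mulr_ge0_le0.
  have rhod t : d <= t -> rho t = 0.
    by move=> dt; rewrite /rho (@smstep_le0 _ (_ * (d - t))) ?mulr0// mulr_ge0_le0// subr_le0.
  have rho1 t : `|rho t| <= 1.
    by rewrite /rho normrM mulr_ile1// ger0_norm ?smstep_ge0 ?smstep_le1.
  have brho : bm rho.
    apply: (bmeas_le _ rho1); exact: continuous_measurable_fun (smooth_continuous srho).
  have [G [sG dG IG']] := smooth_antiderivative srho rho0.
  have IG x y : x <= y -> ibint x y rho = G y - G x by rewrite ibintE; exact: IG'.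
  have G0 t : t <= 0 -> G t = G 0.
    move=> t0; apply/eqP; rewrite eq_sym -subr_eq0 -(IG _ _ t0); apply/eqP.
    by rewrite -[RHS](ibint0 t 0); apply: eq_ibint => z /andP[_]; exact: rho0.
  have Gd t : d <= t -> G t = G d.
    move=> dt; apply/eqP; rewrite -subr_eq0 -(IG _ _ dt); apply/eqP.
    by rewrite -[RHS](ibint0 d t); apply: eq_ibint => z /andP[+ _]; exact: rhod.
  pose chi t := G d - G t.
  have dchi (x : R) : is_derive x (1 : R) chi (- rho x).
    have := is_deriveB (is_derive_cst (G d) x 1) (dG x).
    by congr (is_derive _ (1 : R) _ _); rewrite sub0r.
  have schi : smooth chi by apply: smooth_prim dchi _; exact: smoothN.
  have bchi : bm chi.
    have -> : chi = (fun t => chi (clamp 0 d t)).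
      apply/funext => t; rewrite /chi; congr (_ - _).
      have [t0|t0] := leP t 0.
        by rewrite G0// /clamp (min_idPl (le_trans t0 (ltW d0))) (max_idPl t0).
      have [td|td] := leP t d; first by rewrite clamp_id// (ltW t0).
      by rewrite Gd ?(ltW td)// /clamp (min_idPr (ltW td)) (max_idPr (ltW d0)).
    by apply: bm_cont; [exact: smooth_continuous|exact: bm_clamp (ltW d0)].
  have chi0 t : d <= t -> chi t = 0 by move=> dt; rewrite /chi Gd// subrr.
  have := weak_product b d0 dT schi dchi chi0 bchi (bmN brho) sf df cf'.
  rewrite -/F -/Fl -/F0.
  have b1 t : bm (fun z => (z <= t)%R%:R * rho z) by apply: bmM brho; exact: bm_le.
  have b2 t : bm (fun z => (t <= z)%R%:R * rho z) by apply: bmM brho; exact: bm_ge.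
  have chiE t : 0 <= t -> t <= T ->
      chi t = ibint 0 T (fun z => (t <= z)%R%:R * rho z).
    move=> t0 tT; have -> : chi t = ibint 0 T rho - ibint 0 T (fun z => (z <= t)%R%:R * rho z).
      by rewrite ibint_indic_le// (IG _ _ (ltW T0)) (IG _ _ t0) (Gd T (ltW dT)) /chi; ring.
    rewrite -(ibintB _ _ brho (b1 t)); apply: ae_eq_ibint; first exact: b2.
    apply: ae_imply (ae_lebI_neq 0 T t) => z /eqP zt.
    by have [h|h|h] := ltgtP z t; rewrite ?mul0r ?mul1r ?subr0 ?subrr//; move: zt; rewrite h eqxx.
  have chi0E : chi 0 = ibint 0 T rho.
    by rewrite /chi (IG _ _ (ltW T0)) (Gd T (ltW dT)).
  have bNr : bm (fun t => chi t * Fl t) by exact: bmM.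
  have bFr : bm (fun t => rho t * F t) by exact: bmM.
  have bNNr : bm (fun t => rho t * N t) by exact: bmM.
  have bNF : bm (fun t => - rho t * F t) by apply: bmM bF; exact: bmN.
  have bFrho : bm (fun t => F0 * rho t) by apply: bmM brho; exact: bm_cst.
  have swap : ibint 0 T (fun t => chi t * Fl t) = ibint 0 T (fun t => rho t * N t).
    have bq : bm2 (fun t z => rho z * ((t <= z)%R%:R * Fl t)).
      by apply: bm2M; [exact: bm2_snd|exact: (bm2_swap bK)].
    transitivity (ibint 0 T (fun t => ibint 0 T (fun z => rho z * ((t <= z)%R%:R * Fl t)))).
      apply: eq_ibint => t /andP[t0 tT].
      by rewrite chiE// -(ibintZr _ _ _ (b2 t)); apply: eq_ibint => z _; ring.
    rewrite (ibint_swap _ _ _ _ bq); apply: eq_ibint => z _.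
    by rewrite /N -(ibintZl _ _ _ (bm2_row z bK)).
  rewrite (ibintD _ _ bNF bNr) swap chi0E => E.
  transitivity (ibint 0 T (fun t => rho t * F t - F0 * rho t - rho t * N t)).
    by apply: eq_ibint => t _; rewrite -/(rho t); ring.
  rewrite (ibintB _ _ (bmB bFr bFrho) bNNr) (ibintB _ _ bFr bFrho).
  rewrite (ibintZl _ _ _ brho).
  have E' : ibint 0 T (fun x => - rho x * F x) = - ibint 0 T (fun x => rho x * F x).
    by rewrite -(ibintN _ _ bFr); apply: eq_ibint => z _; rewrite mulNr.
  by move: E; rewrite E'; lra.
have : \forall t \ae lebI 0 T, F t - F0 - N t = 0.
  have bg : bm (fun t => F t - F0 - N t).
    by apply: bmB => //; apply: bmB => //; exact: bm_cst.
  apply: ibint_itv_eq0_ae => // d d0 dT.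
  set g := (fun t : R => F t - F0 - N t) in bg *.
  rewrite -(ibint_indic (ltW d0) (ltW dT) bg).
  have [mg [M gM]] := bg.
  have ms (c e : R) : bm (fun t => smstep (c * t + e)).
    apply: (@bmeas_le _ _ _ _ 1) => [|x]; last by rewrite ger0_norm ?smstep_ge0 ?smstep_le1.
    apply: continuous_measurable_fun; apply: smooth_continuous.
    by apply: smooth_affine; exact: smooth_smstep.
  have brho n : bm (fun t : R => smstep (n.+1%:R * t) * smstep (n.+1%:R * (d - t)) * g t).
    rewrite (_ : (fun _ => _) = (fun t => smstep (n.+1%:R * t + 0) *
        smstep (- n.+1%:R * t + n.+1%:R * d) * g t)).
      by apply: bmM bg; apply: bmM; exact: ms.
    by apply/funext => t /=; congr (smstep _ * smstep _ * _); ring.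
  have : ibint 0 T (fun t => smstep (n.+1%:R * t) * smstep (n.+1%:R * (d - t)) * g t)
      @[n --> \oo] --> ibint 0 T (fun t => \1_(`]0, d[%classic) t * g t).
    apply: (@cvg_ibint _ _ _ _ _ M) => //.
    - by apply: bmM bg; apply: bm_indic; exact: measurable_borelR_itv.
    - move=> n x; rewrite normrM -[leRHS]mul1r; apply: ler_pM => //.
      by rewrite normrM mulr_ile1// ger0_norm ?smstep_ge0 ?smstep_le1.
    - apply: aeW => t; apply: cvgM; last exact: cvg_cst.
      rewrite indicE; have -> : (t \in `]0, d[%classic)%:R =
          ((0 : R) < t)%R%:R * (0 < d - t)%R%:R :> R.
        rewrite -natrM mulnb; congr ((nat_of_bool _)%:R).
        by rewrite subr_gt0; apply/idP/idP; rewrite inE/= in_itv/=.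
      by apply: cvgM; exact: cvg_smstep.
  rewrite (_ : (fun n : nat => _) = cst 0); last by apply/funext => n; exact: key.
  by move=> /cvg_lim <- //; rewrite lim_cst.
apply: ae_imply2 (ae_lebI_mem 0 T) => t /andP[t0 tT].
by rewrite /N ibint_indic_le// => /eqP; rewrite subr_eq0 => /eqP <-; ring.
Qed.

End weak_solution.

(** * Lipschitz extension *)

Section mcshane.
Context {R : realType}.
Variables (G : set R) (C : R).
Hypotheses (C0 : 0 <= C) (G0 : G !=set0).
Implicit Types f g : R -> R.

(** McShane's extension of a Lipschitz function from [G] to the line. It is monotone in [f]
    ([mcshane_mono]), so that extending a quantile field in time keeps it nondecreasing in s. *)
Definition mcshane f (t : R) : R := inf [set f z + C * `|t - z| | z in G].

Definition bounded_below f := exists B, forall z, G z -> B <= f z.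

Lemma mcshane_has_inf f t : bounded_below f ->
  has_inf [set f z + C * `|t - z| | z in G].
Proof.
move=> [B fB]; have [z Gz] := G0; split; first by exists (f z + C * `|t - z|), z.
exists B => _ [y Gy <-]; rewrite (le_trans (fB _ Gy))// lerDl mulr_ge0//.
Qed.

Lemma mcshane_le f t z : bounded_below f -> G z -> mcshane f t <= f z + C * `|t - z|.
Proof.
move=> bf Gz; apply: ge_inf; last by exists z.
by have [] := mcshane_has_inf t bf.
Qed.

Lemma le_mcshane f t B : bounded_below f -> (forall z, G z -> B <= f z + C * `|t - z|) ->
  B <= mcshane f t.
Proof.
move=> bf h; apply: lb_le_inf; first by have [] := mcshane_has_inf t bf.
by move=> _ [z Gz <-]; exact: h.
Qed.

Lemma mcshane_lip f : bounded_below f -> lipschitz_with C (mcshane f).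
Proof.
move=> bf x y; have key a b : mcshane f a - mcshane f b <= C * `|a - b|.
  rewrite lerBlDl -lerBlDr; apply: le_mcshane => // z Gz.
  rewrite lerBlDr (le_trans (mcshane_le a bf Gz))// -addrA lerD2l -mulrDr ler_wpM2l//.
  by rewrite (_ : a - z = (b - z) + (a - b)) ?ler_normD//; ring.
rewrite ler_norml key andbT lerNl opprB distrC; exact: key.
Qed.

Lemma mcshane_id f t : bounded_below f ->
  (forall x y, G x -> G y -> `|f x - f y| <= C * `|x - y|) -> G t -> mcshane f t = f t.
Proof.
move=> bf fC Gt; apply/eqP; rewrite eq_le; apply/andP; split.
  by have := mcshane_le t bf Gt; rewrite subrr normr0 mulr0 addr0.
apply: le_mcshane => // z Gz; rewrite -lerBlDl.
exact: le_trans (ler_norm _) (fC _ _ Gt Gz).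
Qed.

Lemma mcshane_mono f g t : bounded_below f -> (forall z, f z <= g z) ->
  mcshane f t <= mcshane g t.
Proof.
move=> bf fg; have bg : bounded_below g.
  by have [B fB] := bf; exists B => z /fB /le_trans; apply.
apply: le_mcshane => // z Gz; apply: (le_trans (mcshane_le t bf Gz)).
by rewrite lerD2r.
Qed.

End mcshane.

Section density_lemmas.
Context {R : realType}.

(** The points of [[0, T]] within e / 2 of t form an interval of positive length, which no null set
    contains. *)
Lemma ae_lebI_dense (T t e : R) (P : R -> Prop) : 0 < T -> 0 <= t <= T -> 0 < e ->
  (\forall z \ae lebI 0 T, P z) -> exists z, [/\ 0 <= z <= T, `|t - z| < e & P z].
Proof.
move=> T0 /andP[t0 tT] e0 aeP; apply: contrapT => h.
pose a := Num.max 0 (t - e / 2); pose b := Num.min T (t + e / 2).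
have e2 : 0 < e / 2 by rewrite divr_gt0.
have ab : a < b by rewrite /a /b gt_max !lt_min; apply/andP; split; apply/andP; split; lra.
have sub z : a <= z <= b -> [/\ 0 <= z, z <= T & `|t - z| < e].
  rewrite /a /b ge_max le_min => /andP[/andP[h1 h2] /andP[h3 h4]].
  by split => //; rewrite ltr_norml; apply/andP; split; lra.
have : \forall z \ae lebI a b, False.
  move/ae_lebI : aeP => aeP; apply/ae_lebI; apply: (ae_imply _ aeP) => z Pz /sub[z0 zT tz].
  by apply: h; exists z; split => //; [rewrite z0|apply: Pz; rewrite z0].
move=> hF; have := lebIT (ltW ab).
have -> : lebI a b setT = 0%E.
  apply: (subset_measure0 (B := setT)) => //.
  by case: hF => N [mN N0 NT]; rewrite -N0; congr (lebI a b _); apply/seteqP; split => // x _; exact: NT.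
by rewrite /= => /esym/eqP; rewrite subr_eq0 gt_eqF.
Qed.

Lemma ae_eq_lip_eq (T C D : R) (f g : R -> R) : 0 < T ->
  (forall x y, 0 <= x <= T -> 0 <= y <= T -> `|f x - f y| <= C * `|x - y|) ->
  (forall x y, 0 <= x <= T -> 0 <= y <= T -> `|g x - g y| <= D * `|x - y|) ->
  (\forall t \ae lebI 0 T, f t = g t) -> forall t, 0 <= t <= T -> f t = g t.
Proof.
move=> T0 fC gD aefg t tT; apply/eqP; rewrite -subr_eq0 -normr_le0.
apply/ler_addgt0Pr => e e0; rewrite add0r.
pose K := `|C| + `|D| + 1; have K0 : 0 < K by rewrite ltr_pwDr// addr_ge0.
have eK : 0 < e / K by rewrite divr_gt0.
have [z [zT tz fz]] := ae_lebI_dense T0 tT eK aefg.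
have -> : f t - g t = (f t - f z) - (g t - g z) by rewrite fz; ring.
rewrite (le_trans (ler_normB _ _))// (le_trans (lerD (fC _ _ tT zT) (gD _ _ tT zT)))//.
rewrite -mulrDl (@le_trans _ _ (K * `|t - z|))//.
  rewrite ler_wpM2r// /K; have := ler_norm C; have := ler_norm D; lra.
by rewrite mulrC -ler_pdivlMr// ltW.
Qed.

Lemma ibint_tail (H m : R) (g : R -> R) : 0 <= m -> m <= H -> bm g ->
  ibint 0 H (fun s => (m < s)%R%:R * g s) = ibint m H g.
Proof.
move=> m0 mH bg.
have b1 : bm (fun s => (s <= m)%R%:R * g s) by apply: bmM => //; exact: bm_le.
rewrite (_ : (fun s => _) = (fun s => g s - (s <= m)%R%:R * g s)).
  rewrite (ibintB _ _ bg b1) ibint_indic_le// (ibint_split m0 mH bg); ring.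
by apply/funext => s; case: leP => _; rewrite ?mul0r ?mul1r ?subrr ?subr0.
Qed.

Lemma ibintxx (a : R) (f : R -> R) : bm f -> ibint a a f = 0.
Proof.
move=> bf; apply: ibint_eq0.
apply: ae_imply2 (ae_lebI_mem a a) (ae_lebI_neq a a a) => x ax xa; exfalso; apply: xa.
by apply/eqP; rewrite eq_le andbC.
Qed.

Lemma nondecreasing_bm (f : R -> R) (B : R) : (forall x y, x <= y -> f x <= f y) ->
  (forall x, `|f x| <= B) -> bm f.
Proof.
move=> fnd fB; apply: bmeas_le fB.
by apply: nondecreasing_measurable => // x y _ _; exact: fnd.
Qed.

End density_lemmas.

Lemma bmeas_sum {R : realType} d (T : measurableType d) (n : nat) (F : 'I_n -> T -> R) :
  (forall k, bmeas (F k)) -> bmeas (fun x => \sum_(k < n) F k x).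
Proof.
elim: n F => [|n IH] F bF.
  by under eq_fun do rewrite big_ord0; exact: bmeas_cst.
under eq_fun do rewrite big_ord_recr/=.
by apply: bmeasD => //; exact: (IH (fun k => F (widen_ord (leqnSn n) k))).
Qed.

Lemma bm2_shift {R : realType} (F : R -> R -> R) (c : R) :
  bm2 F -> bm2 (fun t s => F (t + c) s).
Proof.
move=> bF; rewrite /bm2.
apply: (@bmeas_comp _ _ _ _ R (fun p : borelR2 R => (p.1 + c, p.2) : borelR2 R) _ _ bF).
apply/measurable_fun_pairP; split => //=.
  by apply: measurable_funD => //; exact: measurable_cst.
exact: measurable_snd.
Qed.

Lemma cvg_harmonic_bound {R : realType} (c : R) (a : nat -> R) l :
  (forall n, `|l - a n| <= c * n.+1%:R^-1) -> a n @[n --> \oo] --> l.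
Proof.
move=> h; apply/cvgrPdist_le => /= e e0; near=> n; apply: (le_trans (h n)).
apply: (@le_trans _ _ ((`|c| + 1) * n.+1%:R^-1)).
  by rewrite ler_wpM2r ?invr_ge0// (le_trans (ler_norm _))// lerDl.
have c0 : 0 < `|c| + 1 by rewrite ltr_wpDl.
rewrite -ler_pdivlMl//; apply: ltW; near: n.
have e1 : 0 < (`|c| + 1)^-1 * e by rewrite mulr_gt0// invr_gt0.
exact: (near_infty_natSinv_lt (PosNum e1)).
Unshelve. all: by end_near. Qed.

(** The piecewise constant interpolation in time is a finite sum of products of measurable functions
    of one variable, and the Lipschitz bound makes it converge uniformly. *)
Lemma caratheodory_bmeas {R : realType} disp (S : measurableType disp) (T C B : R) (F : R -> S -> R) :
  0 < T -> 0 <= C -> (forall t, bmeas (F t)) ->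
  (forall t t' s, 0 <= t <= T -> 0 <= t' <= T -> `|F t s - F t' s| <= C * `|t - t'|) ->
  (forall t s, 0 <= t <= T -> `|F t s| <= B) ->
  bmeas (fun p : borelR R * S => F (clamp 0 T p.1) p.2).
Proof.
move=> T0 C0 bF lF FB.
pose d n : R := T * n.+1%:R^-1.
have d0 n : 0 < d n by rewrite mulr_gt0// invr_gt0.
have dn n : n.+1%:R * d n = T.
  by rewrite /d mulrC -mulrA mulVf ?mulr1// lt0r_neq0.
pose i n k t : R := ((k%:R * d n <= clamp 0 T t)%R%:R - (k.+1%:R * d n <= clamp 0 T t)%R%:R).
(* [i n k] is the indicator of the cell of index k, of length T/(n+1). The cells k <= n cover [[0,
   T[]; the index k = n + 1 takes care of the end point T. *)
pose G n t s := \sum_(k < n.+2) i n k t * F (k%:R * d n) s.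
have ct t : 0 <= clamp 0 T t <= T by rewrite clamp_ge// clamp_le// ltW.
have key n t s : exists2 k : nat, G n t s = F (k%:R * d n) s &
    k%:R * d n <= clamp 0 T t < k.+1%:R * d n.
  have /andP[c0 cT] := ct t; set c := clamp 0 T t in c0 cT *.
  pose k := Num.truncn (c / d n).
  have cd0 : 0 <= c / d n by rewrite divr_ge0// ltW.
  have /andP[k1 k2] : k%:R <= c / d n < k.+1%:R by exact: truncn_itv.
  rewrite ler_pdivlMr// in k1; rewrite ltr_pdivrMr// in k2.
  exists k; last by rewrite k1.
  have kn : (k < n.+2)%N.
    rewrite ltnS -(ler_nat R) -(ler_pM2r (d0 n)) dn.
    exact: le_trans k1 cT.
  rewrite /G (bigD1 (Ordinal kn))//= big1 ?addr0.
    by rewrite /i -/c k1 leNgt k2/= subr0 mul1r.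
  move=> j /eqP jk; rewrite /i -/c.
  have jk' : (j : nat) <> k by move=> e; apply: jk; exact: val_inj.
  have [jlk|klj|//] := ltngtP (j : nat) k.
    rewrite (le_trans _ k1) ?ler_pM2r ?ler_nat 1?ltnW//.
    by rewrite (le_trans _ k1) ?ler_pM2r ?ler_nat// subrr mul0r.
  rewrite leNgt (lt_le_trans k2) ?ler_pM2r ?ler_nat//=.
  by rewrite leNgt (lt_le_trans k2) ?ler_pM2r ?ler_nat//= 1?ltnW// subrr mul0r.
have bi n k : bm (i n k).
  have h (c : R) : bm (fun t : R => (c <= clamp 0 T t)%R%:R).
    apply: (@bmeas_comp _ _ (borelR R) (borelR R) R (clamp 0 T) _ _ (bm_ge c)).
    exact: bmeas_measurable (bm_clamp (ltW T0)).
  by apply: bmB.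
have nodeT n k : k%:R * d n <= T -> 0 <= k%:R * d n <= T.
  by move=> ->; rewrite andbT mulr_ge0// ltW.
apply: (@bmeas_lim _ _ _ (fun n (p : borelR R * S) => G n p.1 p.2) _ B).
- move=> n; apply: (@bmeas_measurable _ _ R (fun p : borelR R * S => G n p.1 p.2)).
  apply: (@bmeas_sum R _ _ n.+2 (fun k (p : borelR R * S) => i n k p.1 * F (k%:R * d n) p.2)) => k.
  apply: bmeasM.
    exact: (bmeas_comp (measurable_fst : measurable_fun setT (fst : borelR R * S -> borelR R)) (bi n k)).
  exact: (bmeas_comp (measurable_snd : measurable_fun setT (snd : borelR R * S -> S)) (bF _)).
- move=> n [t s]/=; have [k -> /andP[k1 k2]] := key n t s; have /andP[c0 cT] := ct t.
  by apply: FB; apply: nodeT; exact: le_trans k1 cT.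
- move=> [t s]/=; apply: (@cvg_harmonic_bound R (C * T)) => n.
  have [k -> /andP[k1 k2]] := key n t s; have /andP[c0 cT] := ct t.
  apply: (le_trans (lF _ _ _ (ct t) (nodeT _ _ (le_trans k1 cT)))).
  rewrite -mulrA ler_wpM2l// -/(d n).
  by rewrite ger0_norm ?subr_ge0//; apply: ltW; move: k2; rewrite -natr1 mulrDl mul1r; lra.
Qed.

Lemma caratheodory_bm2 {R : realType} (T C B : R) (F : R -> R -> R) : 0 < T -> 0 <= C ->
  (forall t, bm (F t)) -> (forall s, lipschitz_with C (F^~ s)) ->
  (forall t s, 0 <= t <= T -> `|F t s| <= B) -> bm2 (fun t s => F (clamp 0 T t) s).
Proof.
move=> T0 C0 bF lF FB.
exact: (@caratheodory_bmeas R _ (borelR R) T C B F T0 C0 bF (fun t t' s _ _ => lF s t t') FB).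
Qed.

Definition dqp {R : realType} (f : R -> R) (x : R) (n : nat) := n.+1%:R * (f (x + n.+1%:R^-1) - f x).
Definition dqm {R : realType} (f : R -> R) (x : R) (n : nat) := n.+1%:R * (f x - f (x - n.+1%:R^-1)).

Lemma cauchy_real_cvg {R : realType} (u : nat -> R) :
  (forall k, exists N, forall n m, (N <= n)%N -> (N <= m)%N -> `|u n - u m| <= k.+1%:R^-1) ->
  exists l : R, u n @[n --> \oo] --> l.
Proof.
move=> h; suff cv : cvgn u by exists (limn u).
apply: cauchy_cvg; apply: cauchy_exP => e e0.
have [k _ hk] := near_infty_natSinv_lt (PosNum e0).
have [N hN] := h k; exists (u N); exists N => // n /= Nn.
by rewrite -ball_normE /=; apply: (le_lt_trans (hN _ _ (leqnn N) Nn)); exact: (hk k (leqnn k)).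
Qed.

Lemma rational_above {R : realType} (x : R) : exists c : nat -> rat,
  forall n, x < ratr (c n) < x + n.+1%:R^-1.
Proof.
have h n : {c : rat | x < ratr c < x + n.+1%:R^-1}.
  apply: cid; have h' : x < x + n.+1%:R^-1 by rewrite ltrDl invr_gt0.
  by have [c] := rat_in_itvoo h'; rewrite in_itv/=; exists c.
by exists (fun n => sval (h n)) => n; exact: (svalP (h n)).
Qed.

Lemma rational_below {R : realType} (x : R) : exists c : nat -> rat,
  forall n, x - n.+1%:R^-1 < ratr (c n) < x.
Proof.
have h n : {c : rat | x - n.+1%:R^-1 < ratr c < x}.
  apply: cid; have h' : x - n.+1%:R^-1 < x by rewrite ltrBlDr ltrDl invr_gt0.
  by have [c] := rat_in_itvoo h'; rewrite in_itv/=; exists c.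
by exists (fun n => sval (h n)) => n; exact: (svalP (h n)).
Qed.

(** * Lagrangian form of the continuity equation *)

Section lagrangian.
Context {R : realType}.
Variables (T H r C : R) (X u F : R -> R -> R).
Hypotheses (T0 : 0 < T) (H0 : 0 <= H) (r0 : 0 <= r) (C0 : 0 <= C).
Hypothesis bX : bm2 X.
Hypothesis Xr : forall t s, `|X t s| <= r.
Hypothesis bV : bm2 (fun t s => u t (X t s)).
Hypothesis uC : forall t x, `|u t x| <= C.
Hypothesis Xnd : forall t s s', s <= s' -> X t s <= X t s'.
Hypothesis gal : forall t s c, 0 < s <= H -> (X t s <= c) = (s <= F t c).
Hypothesis FH : forall t c, 0 <= F t c <= H.
Hypothesis weak : forall phi, test_function T phi ->
  ibint 0 T (fun t => ibint 0 H (fun s =>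
     'D_(1, 0) phi (t, X t s) + u t (X t s) * 'D_(0, 1) phi (t, X t s)))
  + ibint 0 H (fun s => phi (0, X 0 s)) = 0.

Let V t s := u t (X t s).

Let Vr t s : `|V t s| <= C. Proof. exact: uC. Qed.

(** A smooth nondecreasing approximation of the indicator of []c, +oo[]: its observable approximates
    the mass to the right of c. *)
Let step n (c x : R) : R := smstep (n.+1%:R * x + - (n.+1%:R * c)).

Let smooth_step n c : smooth (step n c).
Proof. by apply: smooth_affine; exact: smooth_smstep. Qed.

Let stepE n c x : step n c x = smstep (n.+1%:R * (x - c)).
Proof. by rewrite /step mulrBr. Qed.

Let step01 n c x : 0 <= step n c x <= 1.
Proof. by rewrite /step smstep_ge0 smstep_le1. Qed.

Let step_norm n c x : `|step n c x| <= 1.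
Proof. by have /andP[a b] := step01 n c x; rewrite ger0_norm. Qed.

Let step_nd n c x y : x <= y -> step n c x <= step n c y.
Proof. by move=> xy; apply: smstep_nd; rewrite lerD2r ler_pM2l. Qed.

Let cvg_step c x : step n c x @[n --> \oo] --> ((c < x)%R%:R : R).
Proof.
have -> : (fun n => step n c x) = (fun n => smstep (n.+1%:R * (x - c))).
  by apply/funext => n; rewrite stepE.
by have := @cvg_smstep R (x - c); rewrite subr_gt0.
Qed.

Let obs f b t := observable T H X f b t.

Let good_obs n (c b t : R) : Prop := obs (step n c) b t =
  ibint 0 H (fun s => step n c (X 0 s)) + ibint 0 t (observable_flux T H X u (derive1 (step n c)) b).

Let ae_good_obs : \forall t \ae lebI 0 T, forall n (c : rat),
  good_obs n (ratr c) C t /\ good_obs n (ratr c) (- C) t.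
Proof.
have h n c b : \forall t \ae lebI 0 T, good_obs n c b t.
  have [d1 d2] := smooth_derive (smooth_step n c).
  apply: (weak_smooth T0 r0 bX Xr bV) => //.
  - exact: bm2_row bX.
  - exact: smooth_continuous.
apply: ae_all_nat => n; apply: ae_all_rat => c.
by apply: ae_imply2 (h n (ratr c) C) (h n (ratr c) (- C)).
Qed.

(** Countably many observables suffice for all later comparisons, so that a single null set of times
    serves every s. *)
Let good (t : R) : Prop := 0 <= t <= T /\ forall n (c : rat),
  good_obs n (ratr c) C t /\ good_obs n (ratr c) (- C) t.

Let ae_good : \forall t \ae lebI 0 T, good t.
Proof. by apply: ae_imply2 (ae_lebI_mem 0 T) ae_good_obs. Qed.

Let ct0T t : 0 <= t <= T -> clamp 0 T t = t.
Proof. exact: clamp_id. Qed.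

Let bflux n c b : bm (observable_flux T H X u (derive1 (step n c)) b).
Proof.
have [_ /smooth_continuous d2] := smooth_derive (smooth_step n c).
exact: bm_observable_flux.
Qed.

Let good0 : good 0.
Proof.
have T00 : 0 <= (0 : R) <= T by rewrite lexx ltW.
split=> // n c; have h b : good_obs n (ratr c) b 0.
  rewrite /good_obs ibintxx; last exact: bflux.
  by rewrite addr0 /obs /observable; apply: eq_ibint => s _; rewrite ct0T// mulr0 subr0.
by split.
Qed.

(** Since |u| <= C, no mass moves to the right in a frame of speed C, and none moves to the left in
    a frame of speed -C. *)
Let flux_sign n c b z : 0 <= z <= T ->
  (b = C -> observable_flux T H X u (derive1 (step n c)) b z <= 0) /\
  (b = - C -> 0 <= observable_flux T H X u (derive1 (step n c)) b z).
Proof.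
move=> zT; have [d1 d2] := smooth_derive (smooth_step n c).
have d0 x : 0 <= derive1 (step n c) x.
  by apply: nondecreasing_derive_ge0 (d1 x) => *; exact: step_nd.
have bz (b' : R) : bm (fun s => derive1 (step n c) (X z s - b' * clamp 0 T z) * (V z s - b')).
  apply: (bm2_row (F := fun z s => derive1 (step n c) (X z s - b' * clamp 0 T z) * (V z s - b'))).
  apply: bm2M; last by apply: bm2B => //; exact: bm2_cst.
  apply: bm2_cont; first exact: smooth_continuous.
  apply: bm2B => //; apply: bm2M; first exact: bm2_cst.
  by apply: bm2_fst; exact: bm_clamp (ltW T0).
split=> ->; rewrite /observable_flux.
  rewrite -[leRHS](ibint0 0 H); apply: (le_ibint (bz _) (bm_cst _)).
  move=> s _; rewrite mulr_ge0_le0// subr_le0.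
  exact: le_trans (ler_norm _) (uC _ _).
apply: (ibint_ge0 (bz _)).
move=> s _; rewrite mulr_ge0// opprK -lerBlDr sub0r.
by have := uC z (X z s); rewrite ler_norml => /andP[].
Qed.

Let good_mono t t' : good t -> good t' -> t <= t' -> forall n (c : rat),
  obs (step n (ratr c)) C t' <= obs (step n (ratr c)) C t /\
  obs (step n (ratr c)) (- C) t <= obs (step n (ratr c)) (- C) t'.
Proof.
move=> [/andP[t0 tT] gt] [/andP[t0' tT'] gt'] tt' n c.
have [-> ->] := gt n c; have [-> ->] := gt' n c.
rewrite !(ibint_split t0 tt' (bflux _ _ _)) !addrA.
split.
  rewrite gerDl -[leRHS](ibint0 t t'); apply: le_ibint => //; [exact: bm_cst|].
  move=> z /andP[z1 z2]; apply: (flux_sign _ _ _ _).1 => //.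
  by rewrite (le_trans t0)//= (le_trans z2).
rewrite lerDl; apply: ibint_ge0 => //.
move=> z /andP[z1 z2]; apply: (flux_sign _ _ _ _).2 => //.
by rewrite (le_trans t0)//= (le_trans z2).
Qed.

(** The limit is the mass to the right of the moving point c + b t, by the Galois relation [gal]
    between [X] and [F]; the value s = 0, where [gal] says nothing, is a null set. *)
Let cvg_obs t b c : 0 <= t <= T ->
  obs (step n c) b t @[n --> \oo] --> H - F t (c + b * t).
Proof.
move=> tT.
have bt : bm (fun s => X t s - b * t).
  by apply: bmB; [exact: bm2_row bX|exact: bm_cst].
have bi : bm (fun s => (F t (c + b * t) < s)%R%:R * 1).
  apply: bmM; last exact: bm_cst.
  rewrite (_ : (fun s => _) = (fun s : R => 1 - (s <= F t (c + b * t))%R%:R)).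
    by apply: bmB; [exact: bm_cst|exact: bm_le].
  by apply/funext => s; case: leP => _; rewrite ?subrr ?subr0.
have -> : H - F t (c + b * t) = ibint 0 H (fun s => (F t (c + b * t) < s)%R%:R * 1).
  have /andP[f0 fH] := FH t (c + b * t).
  by rewrite ibint_tail// ?ibint_cst ?mul1r//; exact: bm_cst.
apply: (@cvg_ibint _ _ _ _ _ 1) => //.
- move=> n; rewrite ct0T//; apply: bm_cont => //; exact: smooth_continuous.
- apply: ae_imply2 (ae_lebI_mem 0 H) (ae_lebI_neq 0 H 0) => s /andP[s0 sH] /eqP sn0.
  have s0' : 0 < s by rewrite lt_neqAle eq_sym sn0.
  rewrite ct0T// mulr1 ltNge -gal ?s0'// -ltNge -ltrBrDr; exact: cvg_step.
Qed.

Let good_dom t t' c : good t -> good t' -> t <= t' ->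
  F t (ratr c + C * t) <= F t' (ratr c + C * t') /\
  F t' (ratr c - C * t') <= F t (ratr c - C * t).
Proof.
move=> gt gt' tt'; have tT := gt.1; have tT' := gt'.1.
have h := good_mono gt gt' tt'; split.
  rewrite -(lerD2l (- H)) -lerN2 !opprD !opprK.
  have h1 := @cvg_obs _ C (ratr c) tT'; have h2 := @cvg_obs _ C (ratr c) tT.
  apply: (ler_cvg_to h1 h2).
  by apply: nearW => n; have [] := h n c.
rewrite -(lerD2l (- H)) -lerN2 !opprD !opprK -!mulNr.
have h1 := @cvg_obs _ (- C) (ratr c) tT; have h2 := @cvg_obs _ (- C) (ratr c) tT'.
apply: (ler_cvg_to h1 h2).
by apply: nearW => n; have [] := h n c.
Qed.

(** If [X] moved faster than [C] between two good times, a rational c would fit strictly between its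
    two positions in the moving frame, against [good_dom]. *)
Let good_lip s t t' : 0 < s <= H -> good t -> good t' ->
  `|X t s - X t' s| <= C * `|t - t'|.
Proof.
move=> sH; wlog tt' : t t' / t <= t'.
  move=> h gt gt'; have [/h|/ltW/h] := leP t t'; first exact.
  by rewrite distrC [`|t - t'|]distrC; exact.
move=> gt gt'; rewrite [`|t - t'|]ler0_norm ?subr_le0// opprB.
rewrite ler_norml; apply/andP; split; rewrite leNgt; apply/negP => h.
  have [c /andP[c1 c2]] : exists c : rat, X t s - C * t < ratr c < X t' s - C * t'.
    have h' : X t s - C * t < X t' s - C * t' by move: h; lra.
    by have [c] := rat_in_itvoo h'; rewrite in_itv/=; exists c.
  have [d _] := good_dom c gt gt' tt'.
  have : X t s <= ratr c + C * t by move: c1; lra.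
  rewrite gal// => /le_trans /(_ d); rewrite -gal//; move: c2; lra.
have [c /andP[c1 c2]] : exists c : rat, X t' s + C * t' < ratr c < X t s + C * t.
  have h' : X t' s + C * t' < X t s + C * t by move: h; lra.
  by have [c] := rat_in_itvoo h'; rewrite in_itv/=; exists c.
have [_ d] := good_dom c gt gt' tt'.
have : X t' s <= ratr c - C * t' by move: c1; lra.
rewrite gal// => /le_trans /(_ d); rewrite -gal//; move: c2; lra.
Qed.

Let Gset : set R := [set t | good t].
Let G0 : Gset !=set0. Proof. by exists 0. Qed.

(** [X] is known to be Lipschitz only along good times. [Y] is Lipschitz at all times, hence
    differentiable almost everywhere, and agrees with [X] at good times. *)
Let Y t s := mcshane Gset C (X^~ s) (clamp 0 T t).

Let Xbb s : bounded_below Gset (X^~ s).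
Proof.
by exists (- r) => z _; have := Xr z s; rewrite ler_norml => /andP[].
Qed.

Let Ylip s : lipschitz_with C (Y^~ s).
Proof.
move=> x y; apply: (le_trans (mcshane_lip C0 G0 (Xbb s) _ _)).
by rewrite ler_wpM2l// clamp_lipschitz.
Qed.

Let Ynd t s s' : s <= s' -> Y t s <= Y t s'.
Proof. by move=> ss'; apply: mcshane_mono => // z; exact: Xnd. Qed.

Let YX t s : good t -> 0 < s <= H -> Y t s = X t s.
Proof.
move=> gt sH; rewrite /Y (ct0T gt.1).
by apply: mcshane_id => // x y gx gy; exact: good_lip.
Qed.

Let Ybd t s : `|Y t s| <= r + C * T.
Proof.
have c0 : 0 <= clamp 0 T t by rewrite clamp_ge// ltW.
have cT : clamp 0 T t <= T by rewrite clamp_le// ltW.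
rewrite ler_norml; apply/andP; split.
  apply: (@le_trans _ _ (- r)); first by rewrite lerN2 lerDl mulr_ge0// ltW.
  apply: le_mcshane => // z gz; apply: (@le_trans _ _ (X z s)).
    by have := Xr z s; rewrite ler_norml => /andP[].
  by rewrite lerDl mulr_ge0.
have := mcshane_le C0 G0 (clamp 0 T t) (Xbb s) good0; rewrite subr0.
move=> /le_trans; apply; apply: lerD; first exact: le_trans (ler_norm _) (Xr _ _).
by rewrite ger0_norm// ler_wpM2l.
Qed.

Let bY t : bm (Y t).
Proof. by apply: nondecreasing_bm (Ybd t) => *; exact: Ynd. Qed.

Let bVt t : bm (V t). Proof. exact: bm2_row bV. Qed.

(** The hinge (x - c)^+ is convex, with the indicator of {x > c} as a subgradient. Hence the
    integral over {X > c} of the quotients of [Y] is bounded by the quotients of [K]: from above by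
    the forward ones, from below by the backward ones. *)
Let K t c := ibint 0 H (fun s => Num.max (Y t s - c) 0).

Let bK t c : bm (fun s => Num.max (Y t s - c) 0).
Proof. by apply: bm_max; [apply: bmB => //|]; exact: bm_cst. Qed.

Let Ndiff (f : R -> R -> R) q q' t t' : q <= q' ->
  (forall t, bm (f t)) -> (forall s, `|f t s - f t' s| <= C * `|t - t'|) ->
  `|ibint q q' (f t) - ibint q q' (f t')| <= C * `|t - t'| * (q' - q).
Proof.
move=> qq' bf fC; rewrite -(ibintB _ _ (bf t) (bf t')).
by apply: le_norm_ibint_bound => //; exact: bmB.
Qed.

Let Klip c : lipschitz_with (C * H) (K^~ c).
Proof.
move=> t t'; apply: (le_trans (Ndiff (f := fun t s => Num.max (Y t s - c) 0) H0 _ _)) => //.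
- move=> s; have := Ylip s t t'; set a := Y t s; set b := Y t' s.
  apply: le_trans; rewrite /Num.max; do 2 case: ifPn; rewrite -?leNgt => h1 h2.
  + by rewrite subrr normr0.
  + rewrite sub0r normrN ger0_norm//.
    by rewrite -[`|a - b|]normrN opprB; apply: le_trans (ler_norm _); lra.
  + by rewrite subr0 ger0_norm//; apply: le_trans (ler_norm _); lra.
  + by rewrite (_ : a - c - (b - c) = a - b)//; ring.
- by rewrite subr0 -[C * H * _]mulrAC.
Qed.

Let kk z c := ibint 0 H (fun s => (c < X z s)%R%:R * V z s).

Let bltX c : bm2 (fun z s => (c < X z s)%R%:R).
Proof.
rewrite /bm2 (_ : (fun p => _) = (fun p : borelR2 R => if c < X p.1 p.2 then 1 else 0)).
  apply: bmeas_if; [|exact: bmeas_cst|exact: bmeas_cst].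
  by apply: measurable_fun_ltr => //; case: bX.
by apply/funext => z; case: ifP.
Qed.

Let bkk c : bm (kk^~ c).
Proof. by apply: bm_ibint; apply: bm2M; [exact: bltX|exact: bV]. Qed.

Let kkC z c : `|kk z c| <= C * H.
Proof.
rewrite -[X in C * X]subr0; apply: le_norm_ibint_bound => //.
  by apply: bmM; [exact: (bm2_row z (bltX c))|exact: bVt].
move=> s _; rewrite normrM -[leRHS]mul1r; apply: ler_pM => //.
by case: (_ < _); rewrite ?normr1 ?normr0.
Qed.

(** [kn] is the primitive of [step n c]. Its distance from the hinge is the area between [step n c]
    and the indicator of []c, +oo[], which differ only on an interval of length 1/(n+1). *)
Let hinge n c : exists kn : R -> R, [/\ smooth kn,
  (forall x : R, is_derive x (1 : R) kn (step n c x)) &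
  forall x, `|Num.max (x - c) 0 - kn x| <= n.+1%:R^-1].
Proof.
have s0 x : x <= c -> step n c x = 0.
  by move=> xc; rewrite stepE smstep_le0// mulr_ge0_le0// subr_le0.
have [G [sG dG IG']] := smooth_antiderivative (smooth_step n c) s0.
have IG x y : x <= y -> ibint x y (step n c) = G y - G x by rewrite ibintE; exact: IG'.
have bs : bm (step n c).
  by apply: (bmeas_le _ (step_norm n c)); exact: continuous_measurable_fun (smooth_continuous (smooth_step n c)).
exists (fun x => G x - G c); split.
- by apply: smoothD => //; exact: smooth_cst.
- move=> x; have := is_deriveB (dG x) (is_derive_cst (G c) x 1).
  by congr (is_derive _ (1 : R) _ _); rewrite subr0.
- move=> x; have [xc|cx] := leP x c.
    rewrite (max_idPr _) ?subr_le0// sub0r normrN -opprB normrN -(IG _ _ xc).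
    rewrite (_ : ibint x c _ = 0) ?normr0 ?invr_ge0//.
    by rewrite -[RHS](ibint0 x c); apply: eq_ibint => z /andP[_]; exact: s0.
  have cx' := ltW cx; rewrite (max_idPl _) ?subr_ge0// -(IG _ _ cx').
  have <- : ibint c x (fun=> 1) = x - c by rewrite ibint_cst ?mul1r.
  rewrite -(ibintB _ _ (bm_cst 1) bs).
  have b1 : bm (fun t => 1 - step n c t) by apply: bmB => //; exact: bm_cst.
  have n0 : 0 <= n.+1%:R^-1 :> R by rewrite invr_ge0.
  have p0 z : 0 <= 1 - step n c z by have /andP[_ ?] := step01 n c z; rewrite subr_ge0.
  have p1 z : 1 - step n c z <= 1 by have /andP[? _] := step01 n c z; rewrite gerBl.
  rewrite ger0_norm; last exact: ibint_ge0.
  have [h|h] := leP x (c + n.+1%:R^-1).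
    apply: (@le_trans _ _ (ibint c x (fun=> 1))).
      by apply: le_ibint => //; exact: bm_cst.
    by rewrite ibint_cst// mul1r lerBlDl.
  rewrite (@ibint_split _ c x (c + n.+1%:R^-1)) ?lerDl ?(ltW h)//.
  rewrite [X in _ + X](_ : _ = 0) ?addr0.
    rewrite -[leRHS](_ : ibint c (c + n.+1%:R^-1) (fun=> 1) = _).
      by apply: le_ibint => //; exact: bm_cst.
    by rewrite ibint_cst ?lerDl// mul1r; ring.
  rewrite -[RHS](ibint0 (c + n.+1%:R^-1) x); apply: eq_ibint => z /andP[cz _].
  rewrite stepE smstep_ge1 ?subrr//.
  by rewrite -ler_pdivrMl// mulr1 lerBrDl.
Qed.

(** The integrated weak form with b = 0 for the smoothed hinges, followed by dominated convergence
    in n. At a good time [X] may be replaced by [Y]. *)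
Let K_ae c : \forall t \ae lebI 0 T, K t c = K 0 c + ibint 0 t (kk^~ c).
Proof.
have kn n : {kn : R -> R | [/\ smooth kn,
    (forall x : R, is_derive x (1 : R) kn (step n c x)) &
    forall x, `|Num.max (x - c) 0 - kn x| <= n.+1%:R^-1]} by exact/cid/hinge.
pose h n := sval (kn n).
have hS n : smooth (h n) by case: (svalP (kn n)).
have hB n x : `|Num.max (x - c) 0 - h n x| <= n.+1%:R^-1 by case: (svalP (kn n)).
have hcvg x : h n x @[n --> \oo] --> Num.max (x - c) 0.
  by apply: (@cvg_harmonic_bound R 1) => n; rewrite mul1r; exact: hB.
have hbd n x : `|x| <= r -> `|h n x| <= r + `|c| + 1.
  move=> xr; have n1 : n.+1%:R^-1 <= 1 :> R by rewrite invf_le1// ler1n.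
  have m1 : `|Num.max (x - c) 0| <= r + `|c|.
    apply: (@le_trans _ _ `|x - c|).
      by case: (leP (x - c) 0) => _; rewrite ?normr0.
    by apply: (le_trans (ler_normB _ _)); rewrite lerD2r.
  have -> : h n x = Num.max (x - c) 0 - (Num.max (x - c) 0 - h n x) by ring.
  apply: (le_trans (ler_normB _ _)); apply: lerD => //.
  exact: le_trans (hB n x) n1.
have ae1 : \forall t \ae lebI 0 T, forall n, obs (h n) 0 t =
    ibint 0 H (fun s => h n (X 0 s)) + ibint 0 t (observable_flux T H X u (step n c) 0).
  apply: ae_all_nat => n; have [h1 h2 _] := svalP (kn n).
  apply: (weak_smooth T0 r0 bX Xr bV) => //; first exact: bm2_row bX.
  exact: smooth_continuous.
have KX t : good t -> K t c = ibint 0 H (fun s => Num.max (X t s - c) 0).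
  move=> gt; apply: ae_eq_ibint.
    by apply: bm_max; [apply: bmB; [exact: bm2_row bX|]|]; exact: bm_cst.
  apply: ae_imply2 (ae_lebI_mem 0 H) (ae_lebI_neq 0 H 0) => s /andP[s0 sH] /eqP sn0.
  by rewrite YX// lt_neqAle eq_sym sn0 s0.
have c1 t : ibint 0 H (fun s => h n (X t s)) @[n --> \oo] -->
    ibint 0 H (fun s => Num.max (X t s - c) 0).
  apply: (@cvg_ibint _ _ _ _ _ (r + `|c| + 1)).
  - by move=> n; apply: bm_cont; [exact: smooth_continuous|exact: bm2_row bX].
  - by apply: bm_max; [apply: bmB; [exact: bm2_row bX|]|]; exact: bm_cst.
  - by move=> n s; apply: hbd.
  - by apply: aeW => s; exact: hcvg.
have fl n z : observable_flux T H X u (step n c) 0 z = ibint 0 H (fun s => step n c (X z s) * V z s).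
  by apply: eq_ibint => s _; rewrite mul0r !subr0.
have bfl n : bm2 (fun z s => step n c (X z s) * V z s).
  by apply: bm2M => //; apply: bm2_cont => //; exact: smooth_continuous.
have c2 t : ibint 0 t (observable_flux T H X u (step n c) 0) @[n --> \oo] --> ibint 0 t (kk^~ c).
  have -> : (fun n => ibint 0 t (observable_flux T H X u (step n c) 0)) =
      (fun n => ibint 0 t (fun z => ibint 0 H (fun s => step n c (X z s) * V z s))).
    by apply/funext => n; apply: eq_ibint => z _; exact: fl.
  have sb n z s : `|step n c (X z s) * V z s| <= C.
    rewrite normrM -[leRHS]mul1r; apply: ler_pM => //.
  apply: (@cvg_ibint _ _ _ _ _ (C * (H - 0))).
  - by move=> n; exact: (bm_ibint _ _ (bfl n)).
  - exact: bkk.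
  - move=> n z; apply: le_norm_ibint_bound => //; exact: (bm2_row z (bfl n)).
  - apply: aeW => z; apply: (@cvg_ibint _ _ _ _ _ C) => //.
    + by move=> n; exact: (bm2_row z (bfl n)).
    + by apply: bmM; [exact: (bm2_row z (bltX c))|exact: bVt].
    + by apply: aeW => s; apply: cvgM; [exact: cvg_step|exact: cvg_cst].
apply: ae_imply2 ae1 ae_good => t Et gt; rewrite (KX _ gt) (KX _ good0).
have L1 : obs (h n) 0 t @[n --> \oo] --> ibint 0 H (fun s => Num.max (X t s - c) 0).
  have -> : (fun n => obs (h n) 0 t) = (fun n => ibint 0 H (fun s => h n (X t s))).
    by apply/funext => n; apply: eq_ibint => s _; rewrite mul0r subr0.
  exact: c1.
have L2 : obs (h n) 0 t @[n --> \oo] -->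
    ibint 0 H (fun s => Num.max (X 0 s - c) 0) + ibint 0 t (kk^~ c).
  rewrite (_ : (fun n => obs (h n) 0 t) = (fun n => ibint 0 H (fun s => h n (X 0 s)) +
      ibint 0 t (observable_flux T H X u (step n c) 0))); last by apply/funext.
  by apply: cvgD; [exact: c1|exact: c2].
exact: (cvg_unique (@Rhausdorff R) L1 L2).
Qed.

Let K_eq c t : 0 <= t <= T -> K t c = K 0 c + ibint 0 t (kk^~ c).
Proof.
move: t; apply: (@ae_eq_lip_eq R T (C * H) (C * H) (K^~ c) (fun t => K 0 c + ibint 0 t (kk^~ c)) T0 _ _ (K_ae c)).
- by move=> x y _ _; exact: Klip.
- move=> x y; wlog xy : x y / x <= y.
    move=> w xT yT; have [/w|/ltW/w] := leP x y; first exact.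
    by rewrite distrC [`|y - x|]distrC; exact.
  move=> /andP[x0 xT] /andP[y0 yT].
  rewrite (ibint_split x0 xy (bkk c)) [X in `|X|](_ : _ = - ibint x y (kk^~ c)); last by ring.
  rewrite normrN [`|x - y|]ler0_norm ?subr_le0// opprB.
  exact: le_norm_ibint_bound.
Qed.

(** By [K_eq] the density of the Lipschitz function K(., c) is [kk]. Rational c leave a single null
    set of times. *)
Let K_dq : \forall z \ae lebI 0 T, forall c : rat,
  dqp (K^~ (ratr c)) z n @[n --> \oo] --> kk z (ratr c) /\
  dqm (K^~ (ratr c)) z n @[n --> \oo] --> kk z (ratr c).
Proof.
apply: ae_all_rat => q; set c := ratr q.
have [g [bg dg Ig]] := lipschitz_density (ltW T0) (Klip c).
have : \forall z \ae lebI 0 T, g z - kk z c = 0.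
  apply: ibint_itv_eq0_ae; first exact: bmB.
  move=> d d0 dT; rewrite (ibintB _ _ bg (bkk c)) ibintE.
  rewrite Ig ?(ltW d0) ?(ltW dT)// (K_eq c (t := d)) ?(ltW d0) ?(ltW dT)//; ring.
apply: ae_imply2 dg => z [h1 h2] /eqP; rewrite subr_eq0 => /eqP <-.
by split; [exact: h1|exact: h2].
Qed.

Let bm2Y : bm2 Y.
Proof.
have h : bm2 (fun t s => Y (clamp 0 T t) s).
  by apply: (@caratheodory_bm2 R T C (r + C * T)) => // t s _; exact: Ybd.
rewrite (_ : Y = fun t s => Y (clamp 0 T t) s)//; apply/funext => t; apply/funext => s.
by rewrite /Y (@clamp_id _ 0 T (clamp 0 T t))// clamp_ge ?clamp_le// ltW.
Qed.

Let Dp n t s := dqp (Y^~ s) t n.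
Let Dm n t s := dqm (Y^~ s) t n.

Let bDp n : bm2 (Dp n).
Proof.
apply: bm2M; first exact: bm2_cst.
by apply: bm2B => //; exact: (bm2_shift _ bm2Y).
Qed.

Let bDm n : bm2 (Dm n).
Proof.
apply: bm2M; first exact: bm2_cst.
by apply: bm2B => //; exact: (bm2_shift _ bm2Y).
Qed.

Let DpC n t s : `|Dp n t s| <= C.
Proof.
rewrite /Dp /dqp normrM ger0_norm// -ler_pdivlMl//.
apply: (le_trans (Ylip _ _ _)).
by rewrite addrAC subrr add0r ger0_norm ?invr_ge0// mulrC.
Qed.

Let DmC n t s : `|Dm n t s| <= C.
Proof.
rewrite /Dm /dqm normrM ger0_norm// -ler_pdivlMl//.
apply: (le_trans (Ylip _ _ _)).
by rewrite opprB addrCA subrr addr0 ger0_norm ?invr_ge0// mulrC.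
Qed.

(** Convergence of both quotients to a common limit, phrased through countable unions and
    intersections so that it defines a measurable set of pairs (t, s). *)
Let Cauchy : set (borelR2 R) := \bigcap_(k : nat) \bigcup_(N : nat) \bigcap_(n : nat) \bigcap_(m : nat)
  [set p | (N <= n)%N -> (N <= m)%N ->
     `|Dp n p.1 p.2 - Dp m p.1 p.2| + `|Dp n p.1 p.2 - Dm m p.1 p.2| <= k.+1%:R^-1].

Let mCauchy : measurable Cauchy.
Proof.
apply: bigcap_measurable => // k _; apply: bigcup_measurable => N _.
apply: bigcap_measurable => // n _; apply: bigcap_measurable => // m _.
have [Nn|] := boolP (N <= n)%N; last first.
  by move=> /negbTE h; rewrite (_ : [set p | _] = setT)//; apply/seteqP; split => p //=; rewrite h.
have [Nm|] := boolP (N <= m)%N; last first.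
  by move=> /negbTE h; rewrite (_ : [set p | _] = setT)//; apply/seteqP; split => p //=; rewrite h.
pose f := fun t s => `|Dp n t s - Dp m t s| + `|Dp n t s - Dm m t s|.
have bf : bm2 f by apply: bm2D; apply: bm2_norm; exact: bm2B.
rewrite (_ : [set p | _] = (fun p : borelR2 R => f p.1 p.2 : R) @^-1` `]-oo, k.+1%:R^-1]).
  by rewrite -[X in measurable X]setTI; apply: (bmeas_measurable bf).
apply/seteqP; split => p /=; rewrite in_itv/=; first by apply.
by move=> ? _ _.
Qed.

Let cvg_Cauchy (t s l : R) : Dp n t s @[n --> \oo] --> l -> Dm n t s @[n --> \oo] --> l -> Cauchy (t, s).
Proof.
move=> h1 h2 k _ /=.
have e0 : 0 < k.+1%:R^-1 / 4 :> R by rewrite divr_gt0.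
have h : \forall n \near \oo, `|l - Dp n t s| <= k.+1%:R^-1 / 4 /\ `|l - Dm n t s| <= k.+1%:R^-1 / 4.
  near=> n; split; near: n; [by move/cvgrPdist_le: h1; exact|by move/cvgrPdist_le: h2; exact].
have [N _ hN] := h.
exists N => // n _ m _ /= /hN[a1 _] /hN[a2 a3].
have -> : k.+1%:R^-1 = (k.+1%:R^-1 / 4 + k.+1%:R^-1 / 4) + (k.+1%:R^-1 / 4 + k.+1%:R^-1 / 4) :> R by field; rewrite addrC natr1.
apply: lerD.
  rewrite -[X in `|X|](subrKA l); apply: (le_trans (ler_normD _ _)); apply: lerD => //.
  by rewrite distrC.
rewrite -[X in `|X|](subrKA l); apply: (le_trans (ler_normD _ _)); apply: lerD => //.
by rewrite distrC.
Unshelve. all: by end_near. Qed.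

(** Multiplied by the indicator of [Cauchy], the quotients converge everywhere. The limit [y] is
    therefore jointly measurable, and it is the time derivative of [Y] on [Cauchy]. *)
Let w n t s := (\1_Cauchy (t, s) : R) * Dp n t s.
Let y t s : R := limn (fun n => w n t s).

Let Cauchy_cvg (t s : R) : Cauchy (t, s) ->
  Dp n t s @[n --> \oo] --> y t s /\ Dm n t s @[n --> \oo] --> y t s.
Proof.
move=> cs.
have [l hl] : exists l : R, Dp n t s @[n --> \oo] --> l.
  apply: cauchy_real_cvg => k; have [N _ hN] := cs k I; exists N => n m Nn Nm.
  by apply: le_trans (hN n I m I Nn Nm); rewrite lerDl.
have -> : y t s = l.
  rewrite /y (_ : (fun n => _) = fun n => Dp n t s); first exact: cvg_lim.
  by apply/funext => n; rewrite /w indicE mem_set// mul1r.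
split => //; apply/cvgrPdist_le => e e0.
have [k _ hk] := near_infty_natSinv_lt (PosNum (divr_gt0 e0 (ltr0n R 2))).
have [N _ hN] := cs k I.
have hl2 : \forall n \near \oo, `|l - Dp n t s| <= e / 2.
  by move/cvgrPdist_le: hl; apply; rewrite divr_gt0.
near=> m.
rewrite -[X in `|X|](subrKA (Dp m t s)); apply: (le_trans (ler_normD _ _)).
rewrite [leRHS](_ : _ = e / 2 + e / 2); last by field.
apply: lerD; first by near: m.
have Nm : (N <= m)%N by near: m; exact: nbhs_infty_ge.
apply: le_trans (ltW (hk k (leqnn k))).
by apply: le_trans (hN m I m I Nm Nm); rewrite lerDr.
Unshelve. all: by end_near. Qed.

Let w_cvg t s : w n t s @[n --> \oo] --> y t s.
Proof.
have [cs|cs] := pselect (Cauchy (t, s)).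
  rewrite (_ : (fun n => _) = fun n => Dp n t s); first by case: (Cauchy_cvg cs).
  by apply/funext => n; rewrite /w indicE mem_set// mul1r.
have -> : (fun n => w n t s) = fun=> 0.
  by apply/funext => n; rewrite /w indicE memNset// mul0r.
rewrite /y (_ : (fun n => w n t s) = fun=> 0); last first.
  by apply/funext => n; rewrite /w indicE memNset// mul0r.
by rewrite lim_cst//; exact: cvg_cst.
Qed.

Let by2 : bm2 y.
Proof.
have bC : bmeas (\1_Cauchy : borelR2 R -> R) by exact: bmeas_indic.
apply: (@bmeas_lim _ _ _ (fun n (p : borelR2 R) => w n p.1 p.2) _ C).
- move=> n; apply: (@bmeas_measurable _ _ R).
  rewrite (_ : (fun p : borelR2 R => w n p.1 p.2) = fun p : borelR2 R => \1_Cauchy p * Dp n p.1 p.2).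
    by apply: bmeasM => //; exact: bDp.
  by apply/funext => -[t s].
- move=> n [t s]; rewrite /w normrM -[leRHS]mul1r; apply: ler_pM => //.
  by rewrite indicE; case: (_ \in _); rewrite ?normr1 ?normr0.
- by move=> [t s]; exact: w_cvg.
Qed.

(** * Identification of the derivative at a fixed good time *)

Section fixed_time.
Variable z : R.
Hypothesis gz : good z.
Hypothesis Cz : \forall s \ae lebI 0 H, Cauchy (z, s).
Hypothesis Kz : forall c : rat,
  dqp (K^~ (ratr c)) z n @[n --> \oo] --> kk z (ratr c) /\
  dqm (K^~ (ratr c)) z n @[n --> \oo] --> kk z (ratr c).

Let E s := y z s - V z s.
Let bE : bm E. Proof. by apply: bmB => //; exact: (bm2_row z by2). Qed.

Let bgt c : bm (fun s => (c < X z s)%R%:R). Proof. exact: (bm2_row z (bltX c)). Qed.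

Let YXae : \forall s \ae lebI 0 H, Y z s = X z s.
Proof.
apply: ae_imply2 (ae_lebI_mem 0 H) (ae_lebI_neq 0 H 0) => s /andP[s0 sH] /eqP sn0.
by apply: YX => //; rewrite lt_neqAle eq_sym sn0 s0.
Qed.

Let maxsub (a b c : R) : (c < a)%R%:R * (b - a) <= Num.max (b - c) 0 - Num.max (a - c) 0.
Proof.
have [ca|ac] := ltP c a.
  rewrite mul1r [Num.max (a - c) 0]max_l ?subr_ge0 ?(ltW ca)//.
  have : b - c <= Num.max (b - c) 0 by rewrite le_max lexx.
  by lra.
by rewrite mul0r [Num.max (a - c) 0]max_r ?subr_le0// subr0 le_max lexx orbT.
Qed.

Let ubnd (D : nat -> R -> R -> R) c : (forall n, bm2 (D n)) -> (forall n t s, `|D n t s| <= C) ->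
  (forall s, Cauchy (z, s) -> D n z s @[n --> \oo] --> y z s) ->
  ibint 0 H (fun s => (c < X z s)%R%:R * D n z s) @[n --> \oo] -->
    ibint 0 H (fun s => (c < X z s)%R%:R * y z s).
Proof.
move=> bD DC Dy; apply: (@cvg_ibint _ _ _ _ _ C).
- by move=> n; apply: bmM => //; exact: (bm2_row z (bD n)).
- by apply: bmM => //; exact: (bm2_row z by2).
- move=> n s; rewrite normrM -[leRHS]mul1r; apply: ler_pM => //.
  by case: (_ < _); rewrite ?normr1 ?normr0.
- apply: ae_imply Cz => s /Dy h; apply: cvgM => //; exact: cvg_cst.
Qed.

(** By [maxsub], the forward quotients of [K] give one inequality in the limit and the backward
    quotients the reverse one. *)
Let E_rat (c : rat) : ibint 0 H (fun s => (ratr c < X z s)%R%:R * E s) = 0.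
Proof.
set c' : R := ratr c; have [k1 k2] := Kz c; rewrite -/c' in k1 k2.
rewrite (_ : (fun s => _) = fun s => (c' < X z s)%R%:R * y z s - (c' < X z s)%R%:R * V z s); last first.
  by apply/funext => s; rewrite /E mulrBr.
have byz := bm2_row z by2.
rewrite ibintB; [|by apply: bmM|by apply: bmM].
apply/eqP; rewrite subr_eq0 eq_le; apply/andP; split.
  apply: (ler_cvg_to (ubnd bDp DpC (fun s cs => (Cauchy_cvg cs).1)) k1).
  apply: nearW => n; rewrite /dqp /K -(ibintB _ _ (bK _ _) (bK _ _)).
  rewrite -ibintZl; last by apply: bmB.
  apply: ae_le_ibint.
  - by apply: bmM => //; exact: (bm2_row z (bDp n)).
  - by apply: bmM; [exact: bm_cst|apply: bmB].
  - apply: ae_imply YXae => s <-; rewrite /Dp /dqp mulrCA ler_wpM2l//; exact: maxsub.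
apply: (ler_cvg_to k2 (ubnd bDm DmC (fun s cs => (Cauchy_cvg cs).2))).
apply: nearW => n; rewrite /dqm /K -(ibintB _ _ (bK _ _) (bK _ _)).
rewrite -ibintZl; last by apply: bmB.
apply: ae_le_ibint.
- by apply: bmM; [exact: bm_cst|apply: bmB].
- by apply: bmM => //; exact: (bm2_row z (bDm n)).
- apply: ae_imply YXae => s <-; rewrite /Dm /dqm mulrCA ler_wpM2l//.
  rewrite -lerN2 opprB -mulrN opprB; exact: maxsub.
Qed.

Let b_of_lim (p : nat -> R -> bool) q : (forall n, bm (fun s => (p n s)%:R : R)) ->
  (forall s, (p n s)%:R @[n --> \oo] --> ((q s)%:R : R)) -> bm (fun s => (q s)%:R : R).
Proof.
move=> bp pq; apply: (@bmeas_lim _ _ _ (fun n s => (p n s)%:R) _ 1) => //.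
  by move=> n; exact: bmeas_measurable (bp n).
by move=> n s; case: (p n s); rewrite ?normr1 ?normr0.
Qed.

Let E_lim (p : nat -> R -> bool) q : (forall n, bm (fun s => (p n s)%:R : R)) ->
  (forall s, (p n s)%:R @[n --> \oo] --> ((q s)%:R : R)) ->
  (forall n, ibint 0 H (fun s => (p n s)%:R * E s) = 0) ->
  ibint 0 H (fun s => (q s)%:R * E s) = 0.
Proof.
move=> bp pq h; have bq := b_of_lim bp pq; have [_ [B HB]] := bE.
have L : ibint 0 H (fun s => (p n s)%:R * E s) @[n --> \oo] --> ibint 0 H (fun s => (q s)%:R * E s).
  apply: (@cvg_ibint _ _ _ _ _ B).
  - by move=> n; apply: bmM.
  - exact: bmM.
  - move=> n s; rewrite normrM -[leRHS]mul1r; apply: ler_pM => //.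
    by case: (p n s); rewrite ?normr1 ?normr0.
  - by apply: aeW => s; apply: cvgM; [exact: pq|exact: cvg_cst].
rewrite (_ : (fun n => _) = fun=> 0) in L; last by apply/funext.
by apply: (cvg_unique (@Rhausdorff R) L); exact: cvg_cst.
Qed.

Let eventually_cst (p : nat -> bool) (q : bool) : (\forall n \near \oo, p n = q) ->
  (p n)%:R @[n --> \oo] --> (q%:R : R).
Proof.
move=> h; apply: (cvg_trans _ (@cvg_cst _ (q%:R : R) _ \oo _)).
by apply: near_eq_cvg; apply: filterS h => n ->.
Qed.

Let lt_lim x : exists c : nat -> rat, forall s,
  ((ratr (c n) < X z s)%R)%:R @[n --> \oo] --> ((x < X z s)%R%:R : R).
Proof.
have [c hc] := rational_above x; exists c => s; apply: eventually_cst.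
have [xX|Xx] := ltP x (X z s); last first.
  near=> n; apply/negbTE; rewrite -leNgt (le_trans Xx)//; apply: ltW.
  by have /andP[] := hc n.
have d0 : 0 < X z s - x by rewrite subr_gt0.
near=> n; have /andP[_ h] := hc n; apply: (lt_trans h).
rewrite -ltrBrDl; near: n; exact: (near_infty_natSinv_lt (PosNum d0)).
Unshelve. all: by end_near. Qed.

Let le_lim x : exists c : nat -> rat, forall s,
  ((ratr (c n) < X z s)%R)%:R @[n --> \oo] --> ((x <= X z s)%R%:R : R).
Proof.
have [c hc] := rational_below x; exists c => s; apply: eventually_cst.
have [xX|Xx] := leP x (X z s).
  by near=> n; apply: lt_le_trans xX; have /andP[] := hc n.
have d0 : 0 < x - X z s by rewrite subr_gt0.
near=> n; apply/negbTE; rewrite -leNgt; apply: ltW; have /andP[h _] := hc n.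
apply: le_lt_trans h; rewrite lerBrDl -lerBrDr; apply: ltW.
near: n; exact: (near_infty_natSinv_lt (PosNum d0)).
Unshelve. all: by end_near. Qed.

Let E_lt x : ibint 0 H (fun s => (x < X z s)%R%:R * E s) = 0.
Proof.
have [c hc] := lt_lim x.
apply: (@E_lim (fun n s => ratr (c n) < X z s) (fun s => x < X z s)) => // n; exact: E_rat.
Qed.

Let E_le x : ibint 0 H (fun s => (x <= X z s)%R%:R * E s) = 0.
Proof.
have [c hc] := le_lim x.
apply: (@E_lim (fun n s => ratr (c n) < X z s) (fun s => x <= X z s)) => // n; exact: E_rat.
Qed.

Let bge x : bm (fun s => (x <= X z s)%R%:R).
Proof.
have [c hc] := le_lim x.
exact: (@b_of_lim (fun n s => ratr (c n) < X z s) (fun s => x <= X z s)).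
Qed.

(* On a flat of X(z, .), the forward quotients of Y are nondecreasing and the
   backward ones nonincreasing, so that the derivative is constant there. *)
Let E_flat s s' : 0 < s <= H -> 0 < s' <= H -> Cauchy (z, s) -> Cauchy (z, s') ->
  X z s = X z s' -> E s = E s'.
Proof.
wlog ss' : s s' / s <= s'.
  move=> h sH sH' cs cs' e; have [l|/ltW l] := leP s s'; first exact: h.
  by apply/esym; exact: h.
move=> sH sH' /Cauchy_cvg[p1 m1] /Cauchy_cvg[p2 m2] e.
have eY : Y z s = Y z s' by rewrite !YX.
rewrite /E /V e; congr (_ - _); apply/eqP; rewrite eq_le; apply/andP; split.
  apply: (ler_cvg_to p1 p2); apply: nearW => n.
  by rewrite /Dp /dqp ler_wpM2l// eY lerD2r Ynd.
apply: (ler_cvg_to m2 m1); apply: nearW => n.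
by rewrite /Dm /dqm ler_wpM2l// eY lerD2l lerN2 Ynd.
Qed.

Let E_eq x : \forall s \ae lebI 0 H, (X z s == x)%:R * E s = 0.
Proof.
have eqE s : (X z s == x)%:R = (x <= X z s)%R%:R - (x < X z s)%R%:R :> R.
  by have [//|//|] := ltgtP x (X z s); rewrite ?subrr ?subr0.
have bq : bm (fun s => (X z s == x)%:R).
  by under eq_fun do rewrite eqE; apply: bmB.
have I0 : ibint 0 H (fun s => (X z s == x)%:R * E s) = 0.
  under (_ : (fun s => _) = fun s => (x <= X z s)%R%:R * E s - (x < X z s)%R%:R * E s).
    by apply/funext => s; rewrite eqE mulrBl.
  by rewrite ibintB ?E_le ?E_lt ?subrr//; apply: bmM.
pose m := ibint 0 H (fun s => (X z s == x)%:R).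
have [m0|m0] := eqVneq m 0.
  apply: ae_imply (ibint_ae_eq0 bq _ m0) => s; first by move=> ->; rewrite mul0r.
  by case: (_ == _).
apply: ae_imply3 (ae_lebI_mem 0 H) (ae_lebI_neq 0 H 0) Cz => s /andP[s0 sH] /eqP sn0 cs.
have sH' : 0 < s <= H by rewrite lt_neqAle eq_sym sn0 s0.
have [xs|] := eqVneq (X z s) x; last by rewrite mul0r.
rewrite mul1r; apply: (mulfI m0); rewrite mulr0 -[RHS]I0 -ibintZr//.
apply: ae_eq_ibint; first exact: bmM.
apply: ae_imply3 (ae_lebI_mem 0 H) (ae_lebI_neq 0 H 0) Cz => s' /andP[s0' sH0'] /eqP sn0' cs'.
have [xs'|] := eqVneq (X z s') x; last by rewrite !mul0r.
rewrite !mul1r; apply: E_flat => //; last by rewrite xs xs'.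
by rewrite lt_neqAle eq_sym sn0' s0'.
Qed.

(** By monotonicity {s > q} coincides with {X(z, s) > X(z, q)} up to a part of the flat through q,
    on which [E] vanishes. So [E] integrates to zero over every [[q, H]], hence over every
    [[0, q]]. *)
Lemma velocity_eq : \forall s \ae lebI 0 H, y z s = V z s.
Proof.
have h : \forall s \ae lebI 0 H, E s = 0.
  apply: ibint_itv_eq0_ae => // q q0 qH.
  have tot : ibint 0 H E = 0.
    rewrite -[RHS](E_le (- r)); apply: eq_ibint => s _.
    have -> : - r <= X z s by have := Xr z s; rewrite ler_norml => /andP[].
    by rewrite mul1r.
  have tail : ibint q H E = 0.
    rewrite -(ibint_tail (ltW q0) (ltW qH) bE) -[RHS](E_lt (X z q)).
    apply: ae_eq_ibint; first exact: bmM.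
    apply: ae_imply (E_eq (X z q)) => s.
    have [qs|sq] := ltP q s; have [xs|xs|xs] := ltgtP (X z q) (X z s); rewrite ?mul0r ?mul1r//.
    + by move: (Xnd z (ltW qs)); rewrite leNgt xs.
    + by move: (Xnd z sq); rewrite leNgt xs.
  have := ibint_split (ltW q0) (ltW qH) bE.
  by rewrite tot tail addr0.
by apply: ae_imply h => s /eqP; rewrite subr_eq0 => /eqP.
Qed.

End fixed_time.

Let velocity_ae : \forall s \ae lebI 0 H, \forall t \ae lebI 0 T, y t s = V t s.
Proof.
pose N := [set p : borelR2 R | y p.1 p.2 - V p.1 p.2 = 0].
have mN : measurable N.
  have bN : bm2 (fun t s => y t s - V t s) by exact: bm2B.
  rewrite (_ : N = (fun p : borelR2 R => y p.1 p.2 - V p.1 p.2 : borelR R) @^-1` [set 0]).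
    by rewrite -[X in measurable X]setTI; apply: (bmeas_measurable bN).
  by [].
(* Differentiability is known for each s at a.e. time, but is needed at a.e. time for a.e. s; this
   is where measurability of [Cauchy] is used. *)
have aeC : \forall t \ae lebI 0 T, \forall s \ae lebI 0 H, Cauchy (t, s).
  apply: (@ae_swap _ _ (borelR R) (borelR R) R (lebI 0 H) (lebI 0 T)
    ((fun p : borelR2 R => (p.2, p.1) : borelR2 R) @^-1` Cauchy)).
    rewrite -[X in measurable X]setTI; apply: measurable_swap => //; exact: mCauchy.
  apply: aeW => s; have [g [_ dg _]] := lipschitz_density (ltW T0) (Ylip s).
  by apply: ae_imply dg => t [h1 h2]; exact: cvg_Cauchy h1 h2.
apply: (@ae_imply _ _ _ _ (fun s => \forall t \ae lebI 0 T, N (t, s))).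
  by move=> s; apply: ae_imply => t /eqP; rewrite subr_eq0 => /eqP.
apply: (@ae_swap _ _ (borelR R) (borelR R) R (lebI 0 T) (lebI 0 H) N mN).
apply: ae_imply3 ae_good aeC K_dq => t gt ct kt.
by apply: ae_imply (velocity_eq gt ct kt) => s; rewrite /N /= => ->; rewrite subrr.
Qed.

Theorem lagrangian_ae : exists Gd : R -> Prop,
  (\forall t \ae lebI 0 T, Gd t) /\ \forall s \ae lebI 0 H, forall t, Gd t ->
    X t s = X 0 s + ibint 0 t (fun z => u z (X z s)).
Proof.
exists good; split; first exact: ae_good.
apply: ae_imply3 (ae_lebI_mem 0 H) (ae_lebI_neq 0 H 0) velocity_ae => s /andP[s0 sH] /eqP sn0 vs t gt.
have sH' : 0 < s <= H by rewrite lt_neqAle eq_sym sn0 s0.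
rewrite -(YX gt sH') -(YX good0 sH'); have [g [bg dg Ig]] := lipschitz_density (ltW T0) (Ylip s).
have /andP[t0 tT] := gt.1.
rewrite -(_ : ibint 0 t g = ibint 0 t (V^~ s)); last first.
  apply: ae_eq_ibint; first exact: (bm2_col s bV).
  apply: (@ae_lebIW _ 0 T 0 t) => //.
  apply: ae_imply2 dg vs => z [h1 h2] <-.
  have [h3 _] := Cauchy_cvg (cvg_Cauchy h1 h2).
  exact: (cvg_unique (@Rhausdorff R) h1 h3).
by rewrite ibintE Ig//; ring.
Qed.

End lagrangian.

(** * Quantiles *)

Section quantile.
Context d (I : measurableType d) {R : realType}.
Variables (m : I -> {measure set (borelR R) -> \bar R}) (D : set I) (H : I -> R) (r : R).
Hypotheses (mD : measurable D)
  (mm : forall U : set (borelR R), measurable U -> measurable_fun D (fun i => m i U))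
  (mH : measurable_fun setT (H : I -> borelR R)) (H0 : forall i, 0 <= H i) (r0 : 0 <= r).

Definition quantile_ok (i : I) : bool := (i \in D) && (m i setT == (H i)%:E).

(* Forced to be the distribution function of a measure on [-r, r] of mass [H i],
   namely a Dirac mass at 0 when [m i] does not have this mass. *)
Definition qcdf (i : I) (c : R) : R :=
  if c < - r then 0 else if r <= c then H i else
  if quantile_ok i then fine (m i `]-oo, c]%classic) else (0 <= c)%R%:R * H i.

(** Generalised inverse of [qcdf]. Admitting c = r keeps the set nonempty for s beyond the mass, so
    that the values lie in [[- r, r]] for every s. *)
Definition quantile (i : I) (s : R) : R :=
  inf [set c | - r <= c <= r /\ (s <= qcdf i c \/ c = r)].

Let mray (c : R) : measurable (`]-oo, c]%classic : set (borelR R)).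
Proof. exact: measurable_borelR_itv. Qed.

Let ok_mass i : quantile_ok i -> m i setT = (H i)%:E.
Proof. by move=> /andP[_ /eqP]. Qed.

Let ok_fin i (U : set (borelR R)) : quantile_ok i -> measurable U -> m i U = (fine (m i U))%:E.
Proof.
move=> oki mU; rewrite fineK// ge0_fin_numE//.
by apply: (@le_lt_trans _ _ (m i setT)); [apply: le_measure; rewrite ?inE|rewrite ok_mass// ltry].
Qed.

Let ok_le i (U V : set (borelR R)) : quantile_ok i -> measurable U -> measurable V ->
  U `<=` V -> fine (m i U) <= fine (m i V).
Proof.
by move=> oki mU mV UV; rewrite -lee_fin -!ok_fin//; apply: le_measure => //; rewrite inE.
Qed.

Let ok_leH i (U : set (borelR R)) : quantile_ok i -> measurable U -> 0 <= fine (m i U) <= H i.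
Proof.
move=> oki mU; rewrite fine_ge0//=.
by have := ok_le oki mU measurableT (@subsetT _ U); rewrite (ok_mass oki).
Qed.

Lemma qcdf_bound i c : 0 <= qcdf i c <= H i.
Proof.
rewrite /qcdf; case: ifP => _; first by rewrite lexx H0.
case: ifP => _; first by rewrite lexx H0.
case: ifP => oki; first exact: ok_leH.
by case: (0 <= c); rewrite ?mul1r ?mul0r ?lexx ?H0.
Qed.

Lemma qcdf_nd i c c' : c <= c' -> qcdf i c <= qcdf i c'.
Proof.
move=> cc'; rewrite {1}/qcdf; case: (ltP c (- r)) => cr; first by case/andP: (qcdf_bound i c').
case: (leP r c) => rc; first by rewrite /qcdf [c' < - r]ltNge (le_trans cr cc')/= (le_trans rc cc').
rewrite /qcdf ltNge (le_trans cr cc')/=; case: (leP r c') => rc'.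
  by have := qcdf_bound i c; rewrite /qcdf [c < - r]ltNge cr/= [r <= c]leNgt rc => /andP[].
case: ifP => oki.
  by apply: ok_le => // x /=; rewrite !in_itv/= => /le_trans; exact.
rewrite ler_wpM2r//; have [c0|//] := leP 0 c.
by rewrite (le_trans c0 cc').
Qed.

(** Right continuity. For a genuine measure it is continuity along the decreasing rays that end at
    [e n], which are chosen below r so as to stay clear of the value forced there. *)
Lemma qcdf_rc i c s : (forall c', c < c' -> s <= qcdf i c') -> s <= qcdf i c.
Proof.
move=> h; rewrite /qcdf; case: (ltP c (- r)) => cr.
  have /h : c < (c + - r) / 2 by lra.
  by rewrite /qcdf ifT//; lra.
case: (leP r c) => rc.
  have /h : c < c + 1 by lra.
  by rewrite /qcdf ltNge (le_trans cr) ?lerDl//= (le_trans rc) ?lerDl.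
pose e n : R := c + (r - c) / 2 * n.+1%:R^-1.
have d0 : 0 < (r - c) / 2 by rewrite divr_gt0// subr_gt0.
have en n : c < e n < r.
  rewrite ltrDl mulr_gt0 ?invr_gt0//=; apply: (@le_lt_trans _ _ (c + (r - c) / 2)); last by lra.
  by rewrite lerD2l ler_piMr ?(ltW d0)// invf_le1// ler1n.
have hn n : s <= if quantile_ok i then fine (m i `]-oo, e n]%classic) else (0 <= e n)%R%:R * H i.
  have /andP[e1 e2] := en n; have := h _ e1; rewrite /qcdf.
  by rewrite [e n < - r]ltNge (le_trans cr (ltW e1))/= [r <= e n]leNgt e2.
case: ifP hn => oki hn; last first.
  have [c0|c0] := leP 0 c.
    by have := hn 0%N; rewrite (le_trans c0)// ltW//; case/andP: (en 0%N).
  have [n nh] : exists n, e n < 0.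
    have d1 : 0 < - c / ((r - c) / 2) by rewrite divr_gt0// oppr_gt0.
    have [n _ hn'] := near_infty_natSinv_lt (PosNum d1).
    exists n; have := hn' n (leqnn n) => /=; rewrite ltr_pdivlMr// mulrC /e => h'.
    by rewrite -ltrBrDl sub0r.
  by have := hn n; rewrite [0 <= e n]leNgt nh.
have eqI : `]-oo, c]%classic = \bigcap_n (`]-oo, e n]%classic : set (borelR R)).
  apply/seteqP; split => x /=; rewrite in_itv/=.
    by move=> xc n _ /=; rewrite in_itv/= (le_trans xc)// ltW//; case/andP: (en n).
  move=> hx; apply/ler_addgt0Pr => e' e0.
  have d1 : 0 < e' / ((r - c) / 2) by rewrite divr_gt0.
  have [n _ hn'] := near_infty_natSinv_lt (PosNum d1).
  have := hn' n (leqnn n) => /=; rewrite ltr_pdivlMr// mulrC => hn2.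
  have := hx n Logic.I; rewrite /= in_itv/= /e => hx2.
  by apply: (le_trans hx2); rewrite lerD2l ltW.
have L : m i `]-oo, e n]%classic @[n --> \oo] --> m i `]-oo, c]%classic.
  rewrite eqI; apply: nonincreasing_cvg_mu => //.
  - by rewrite ok_fin ?ltry.
  - by apply: bigcapT_measurable.
  - move=> n p np; apply/subsetPset => x /=; rewrite !in_itv/= => /le_trans; apply.
    by rewrite lerD2l ler_pM2l// lef_pV2 ?posrE// ler_nat.
rewrite -lee_fin -ok_fin//; rewrite -(cvg_lim _ L)//.
apply: lime_ge; first by apply/cvg_ex; eexists; exact: L.
by apply: nearW => n; rewrite ok_fin// lee_fin.
Qed.

Let qset i s := [set c : R | - r <= c <= r /\ (s <= qcdf i c \/ c = r)].

Let rr : - r <= r. Proof. by apply: le_trans r0; rewrite oppr_le0. Qed.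

Let qset_r i s : qset i s r.
Proof. by split; [rewrite lexx andbT|right]. Qed.

Let qset_has_inf i s : has_inf (qset i s).
Proof. by split; [exists r; exact: qset_r|exists (- r) => x [/andP[]]]. Qed.

Lemma quantile_bound i s : - r <= quantile i s <= r.
Proof.
apply/andP; split; last by apply: (ge_inf (qset_has_inf i s).2); exact: qset_r.
by apply: lb_le_inf; [exact: (qset_has_inf i s).1|move=> x [/andP[]]].
Qed.

Lemma quantile_norm i s : `|quantile i s| <= r.
Proof. by rewrite ler_norml quantile_bound. Qed.

(** The Galois connection between quantile and distribution function. Monotonicity, joint
    measurability and the law of the quantile all follow from it. *)
Lemma quantile_leE i s c : (quantile i s <= c) = (r <= c) || (- r <= c) && (s <= qcdf i c).
Proof.
have /andP[q1 q2] := quantile_bound i s.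
have [rc|cr] := leP r c; first by rewrite (le_trans q2 rc).
have [rc|rc] /= := leP (- r) c; last by apply/negbTE; rewrite -ltNge (lt_le_trans rc).
apply/idP/idP => [h|h].
  apply: qcdf_rc => c' cc'; have [r' |r'] := leP r c'.
    have sH : s <= H i.
      have h1 : quantile i s < r by exact: le_lt_trans h cr.
      have [x [/andP[x1 x2] [sx|->]] xr] := inf_lt (qset_has_inf i s).1 h1.
        by apply: le_trans sx _; case/andP: (qcdf_bound i x).
      by rewrite ltxx in xr.
    by rewrite /qcdf ltNge (le_trans rc (ltW cc'))/= r'.
  have [x [/andP[x1 x2] [sx|xr']] xr] := inf_lt (qset_has_inf i s).1 (le_lt_trans h cc').
    exact: le_trans sx (qcdf_nd i (ltW xr)).
  by move: xr; rewrite xr' ltNge ltW.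
by apply: (ge_inf (qset_has_inf i s).2); split; [rewrite rc ltW|left].
Qed.

Lemma quantile_gal i s c : 0 < s <= H i -> (quantile i s <= c) = (s <= qcdf i c).
Proof.
move=> /andP[s0 sH]; rewrite quantile_leE; have [rc|cr]/= := leP r c.
  by rewrite /qcdf [c < - r]ltNge (le_trans rr rc)/= rc sH.
have [//|cr'] := leP (- r) c.
by rewrite /= /qcdf cr' leNgt s0.
Qed.

Lemma quantile_nd i s s' : s <= s' -> quantile i s <= quantile i s'.
Proof.
move=> ss'; rewrite quantile_leE.
have := lexx (quantile i s'); rewrite {1}quantile_leE => /orP[->//|/andP[-> h]].
by rewrite (le_trans ss' h) orbT.
Qed.

Let measurable_ok : measurable_fun setT quantile_ok.
Proof.
rewrite (_ : quantile_ok = fun i => (i \in D) &&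
    ((fun i => m i setT) \_ D i == (H i)%:E)); last first.
  apply/funext => i; rewrite /quantile_ok patchE.
  by case: ifP => iD; rewrite ?andbF// iD.
apply: measurable_and.
  by apply: (measurable_fun_bool true); rewrite setTI (_ : _ @^-1` _ = D)//;
    apply/seteqP; split => x /=; [move/set_mem|move/mem_set].
apply: measurable_fun_eqe; last exact/measurable_EFinP.
exact: (measurable_restrictT _ mD).1 (mm measurableT).
Qed.

Let measurable_qcdf c : measurable_fun setT (fun i => qcdf i c : borelR R).
Proof.
rewrite /qcdf; case: (c < - r); first exact: measurable_cst.
case: (r <= c); first exact: mH.
rewrite (_ : (fun i => _) = fun i => if quantile_ok i then
   fine (((fun i => m i `]-oo, c]%classic) \_ D) i) else (0 <= c)%R%:R * H i); last first.
  apply/funext => i; case: ifP => // /andP[iD _].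
  by rewrite patchE iD.
apply: measurable_fun_ifT => //.
  apply: measurableT_comp; first exact: fine_measurable.
  by have h := mm (mray c); exact: (measurable_restrictT _ mD).1 h.
by apply: measurable_funM => //; exact: measurable_cst.
Qed.

Lemma bmeas_quantile : bmeas (fun p : I * borelR R => quantile p.1 p.2).
Proof.
apply: (@bmeas_le _ _ _ _ r); last by move=> p; exact: quantile_norm.
apply: (@measurability _ _ _ (borelR R) _ _ (@RGenOInfty.G R) (RGenOInfty.measurableE R)) => _ [_ [c ->] <-]; rewrite setTI.
rewrite (_ : _ @^-1` _ = ~` [set p : I * borelR R | quantile p.1 p.2 <= c]); last first.
  by apply/seteqP; split => p /=; rewrite in_itv/= andbT ltNge => /negP.
apply: measurableC.
have [rc|cr] := leP r c.
  by rewrite (_ : [set p | _] = setT)//; apply/seteqP; split => p //= _; rewrite quantile_leE rc.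
have [rc|rc] := leP (- r) c; last first.
  rewrite (_ : [set p | _] = set0)//; apply/seteqP; split => p //=.
  by rewrite quantile_leE leNgt cr/= leNgt rc.
rewrite (_ : [set p | _] = (fun p : I * borelR R => (p.2 : R) <= qcdf p.1 c) @^-1` [set true]).
  rewrite -[X in measurable X]setTI.
  suff h : measurable_fun setT (fun p : I * borelR R => (p.2 : R) <= qcdf p.1 c) by exact: h.
  apply: measurable_fun_ler; first exact: measurable_snd.
  exact: measurableT_comp (measurable_qcdf c) measurable_fst.
by apply/seteqP; split => p /=; rewrite quantile_leE [r <= c]leNgt cr/= rc.
Qed.

Lemma bm_quantile i : bm (quantile i).
Proof. exact: (bmeas_section1 (f := fun p : I * borelR R => quantile p.1 p.2)) bmeas_quantile. Qed.

(** Rays determine a finite measure. By the Galois connection the preimage of []-oo, c]] lies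
    between []0, F]] and [[0, F]] with F = [qcdf i c], two intervals of the same length; the point s
    = 0 escapes the connection. *)
Lemma quantile_law i : quantile_ok i -> m i (~` `[- r, r]%classic) = 0%E ->
  forall U : set (borelR R), measurable U -> m i U = pushforward (lebI 0 (H i)) (quantile i) U.
Proof.
move=> oki out.
have mQ : measurable_fun setT (quantile i : borelR R -> borelR R) := bmeas_measurable (bm_quantile i).
pose Qf : {mfun borelR R >-> borelR R} := HB.pack (quantile i : borelR R -> borelR R) (isMeasurableFun.Build _ _ _ _ _ mQ).
have Hi := H0 i.
have rayE (c : R) : m i `]-oo, c]%classic = pushforward (lebI 0 (H i)) Qf `]-oo, c]%classic.
  have -> : m i `]-oo, c]%classic = (qcdf i c)%:E.
    rewrite /qcdf; case: (ltP c (- r)) => cr.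
      apply/eqP; rewrite eq_le measure_ge0 andbT (_ : 0%:E = m i (~` `[- r, r]%classic))//.
      apply: le_measure; rewrite ?inE//.
        by apply: measurableC; exact: measurable_borelR_itv.
      move=> x /=; rewrite !in_itv/= => xc /andP[rx _].
      by have := lt_le_trans (le_lt_trans xc cr) rx; rewrite ltxx.
    case: (leP r c) => rc; last by rewrite oki; exact: ok_fin.
    rewrite -(ok_mass oki) -(setvU `]-oo, c]%classic) measureU//; last 2 first.
    - by apply: measurableC.
    - by rewrite setICl.
    rewrite [X in (X + _)%E](_ : _ = 0%E) ?add0e//.
    apply/eqP; rewrite eq_le measure_ge0 andbT (_ : 0%E = m i (~` `[- r, r]%classic))//.
    apply: le_measure; rewrite ?inE//.
    - by apply: measurableC.
    - by apply: measurableC; exact: measurable_borelR_itv.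
    - move=> x /=; rewrite !in_itv/= => h /andP[_ xr]; apply: h.
      exact: le_trans xr rc.
  have /andP[q0 qH] := qcdf_bound i c.
  rewrite /pushforward /lebI /= /mfrestr /mrestr.
  have mS : measurable ((Qf @^-1` `]-oo, c] `&` `[0, H i]) : set (borelR R)).
    apply: measurableI; last exact: measurable_borelR_itv.
    by rewrite -[X in measurable X]setTI; exact: (mQ measurableT _ (mray c)).
  have leb_le (A B : set (borelR R)) : measurable A -> measurable B -> A `<=` B ->
      (@lebesgue_measure R A <= @lebesgue_measure R B)%E.
    by move=> mA mB AB; apply: le_measure; rewrite ?inE.
  apply/eqP; rewrite eq_le; apply/andP; split.
    rewrite (_ : (qcdf i c)%:E = @lebesgue_measure R `]0, qcdf i c]%classic); last first.
      rewrite lebesgue_measure_itv/= lte_fin; case: ltP => [_|]; first by rewrite sube0.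
      by move=> h; congr (_%:E); apply/eqP; rewrite eq_le h q0.
    apply: (leb_le _ _ (measurable_borelR_itv `]0, qcdf i c]) mS).
    move=> s /=; rewrite !in_itv/= => /andP[s0 sq].
    by rewrite quantile_gal ?s0 ?(le_trans sq qH)// (ltW s0).
  rewrite (_ : (qcdf i c)%:E = @lebesgue_measure R `[0, qcdf i c]%classic); last first.
    rewrite lebesgue_measure_itv/= lte_fin; case: ltP => [_|]; first by rewrite sube0.
    by move=> h; congr (_%:E); apply/eqP; rewrite eq_le h q0.
  apply: (leb_le _ _ mS (measurable_borelR_itv `[0, qcdf i c])).
  move=> s /=; rewrite !in_itv/= => -[h /andP[s0 sH]]; rewrite s0/=.
  move: s0; rewrite le_eqVlt => /predU1P[<-//|s0].
  by rewrite -quantile_gal// s0.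
have ray_fin c : (pushforward (lebI 0 (H i)) Qf `]-oo, c]%classic < +oo)%E.
  by rewrite -rayE ok_fin ?ltry.
move=> U mU; apply: (@measure_unique _ R (borelR R) (@ocitv R) (fun k => `]- k%:R, k%:R]%classic)
  _ _ _ _ (m i) (pushforward (lebI 0 (H i)) Qf)) => //.
- exact: ocitvI.
- by move=> k; exists (- k%:R, k%:R).
- apply/seteqP; split => // x _; exists (Num.truncn `|x|).+1 => //=; rewrite in_itv/=.
  have := truncnS_gt `|x|; rewrite ltr_norml => /andP[-> h]; exact: ltW.
- move=> A [[x y] _ <-] /=.
  have [xy|yx] := leP x y; last by rewrite set_itv_ge ?measure0// -leNgt bnd_simp ltW.
  have -> : `]x, y]%classic = (`]-oo, y] `\` `]-oo, x])%classic :> set (borelR R).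
    apply/seteqP; split => z /=; rewrite !in_itv/=.
      by move=> /andP[xz ->]; split => //; apply/negP; rewrite -ltNge.
    by move=> [-> /negP]; rewrite -ltNge => ->.
  have sub : `]-oo, y]%classic `&` `]-oo, x]%classic = `]-oo, x]%classic :> set (borelR R).
    by apply: setIidr => z /=; rewrite !in_itv/= => /le_trans; exact.
  have diff (n : {measure set (borelR R) -> \bar R}) : (n `]-oo, y]%classic < +oo)%E ->
      n (`]-oo, y] `\` `]-oo, x])%classic = (n `]-oo, y]%classic - n `]-oo, x]%classic)%E.
    by move=> nfin; rewrite -[in RHS]sub; apply: measureD.
  rewrite (diff (m i)) ?rayE//.
  apply/esym; apply: (diff (pushforward (lebI 0 (H i)) Qf)); exact: ray_fin.
- by move=> k; rewrite ok_fin ?ltry//; exact: measurable_borelR_itv.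
Qed.

End quantile.

(** A point outside the support has an open null neighbourhood, hence lies in a null interval with
    rational end points, and there are countably many of these. *)
Lemma msupport_null {R : realType} (m : {measure set (borelR R) -> \bar R}) (r : R) :
  msupport m `<=` `[- r, r]%classic -> m (~` `[- r, r]%classic) = 0%E.
Proof.
move=> sub; apply: measure_negligible.
  by apply: measurableC; exact: measurable_borelR_itv.
have h : \forall x \ae m, forall p q : rat, m `]ratr p, ratr q[%classic = 0%E ->
    ~ (ratr p < x < ratr q).
  apply: ae_all_rat => p; apply: ae_all_rat => q.
  have [m0|m0] := pselect (m `]ratr p, ratr q[%classic = 0%E); last exact: aeW.
  exists (`]ratr p, ratr q[%classic : set (borelR R)); split; [exact: measurable_borelR_itv|exact: m0|].
  by move=> x /= /not_implyP[_ /contrapT]; rewrite in_itv.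
apply: negligibleS h => x /= xr hx; apply: xr; apply: sub => U oU Ux.
rewrite lt_neqAle measure_ge0 andbT; apply/negP => /eqP mU0.
have /nbhs_ballP [e e0 be] := open_nbhs_nbhs (conj oU Ux).
have h1 : x - e < x by rewrite ltrBlDr ltrDl.
have h2 : x < x + e by rewrite ltrDl.
have [p] := rat_in_itvoo h1; have [q] := rat_in_itvoo h2; rewrite !in_itv/= => /andP[xq qe] /andP[ep px].
apply: (hx p q); last by rewrite px xq.
apply/eqP; rewrite eq_le measure_ge0 andbT mU0; apply: le_measure; rewrite ?inE.
- exact: measurable_borelR_itv.
- exact: open_measurable.
- move=> z /=; rewrite in_itv/= => /andP[pz zq]; apply: be; rewrite -ball_normE/= ltr_norml.
  by apply/andP; split; lra.
Qed.

(** * Fields over the level space *)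

HB.lock Definition pint {R : realType} (P : {finite_measure set (borelR2 R) -> \bar R})
  (f : R -> R -> R) : R := \int[P]_p f p.1 p.2.

Definition bm3 {R : realType} (F : R -> R -> R -> R) :=
  bmeas (fun q : borelR R * borelR2 R => F q.1 q.2.1 q.2.2).

Section pint_lemmas.
Context {R : realType}.
Variable P : {finite_measure set (borelR2 R) -> \bar R}.
Implicit Types (f g : R -> R -> R).

Lemma pintE f : pint P f = \int[P]_p f p.1 p.2.
Proof. by rewrite pint.unlock. Qed.

Lemma ae_eq_pint f g : bm2 g -> (\forall p \ae P, f p.1 p.2 = g p.1 p.2) -> pint P f = pint P g.
Proof. by rewrite !pintE; exact: (@ae_eq_bint _ _ R P). Qed.

Lemma pintD f g : bm2 f -> bm2 g ->
  pint P (fun a s => f a s + g a s) = pint P f + pint P g.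
Proof. by rewrite !pintE; exact: (@bintD _ _ R P). Qed.

Lemma pintB f g : bm2 f -> bm2 g ->
  pint P (fun a s => f a s - g a s) = pint P f - pint P g.
Proof. by rewrite !pintE; exact: (@bintB _ _ R P). Qed.

Lemma pintZl k f : bm2 f -> pint P (fun a s => k * f a s) = k * pint P f.
Proof. by rewrite !pintE; exact: (@bintZl _ _ R P). Qed.

Lemma pint_cst c : pint P (fun _ _ => c) = c * fine (P setT).
Proof. by rewrite pintE; exact: (@bint_cst _ _ R P). Qed.

Lemma pint0 : pint P (fun _ _ => 0) = 0.
Proof. by rewrite pintE; exact: (@bint0 _ _ R P). Qed.

Lemma ae_le_pint f g : bm2 f -> bm2 g -> (\forall p \ae P, f p.1 p.2 <= g p.1 p.2) ->
  pint P f <= pint P g.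
Proof. by rewrite !pintE; exact: (@ae_le_bint _ _ R P). Qed.

Lemma le_pint f g : bm2 f -> bm2 g -> (forall a s, f a s <= g a s) -> pint P f <= pint P g.
Proof. by move=> bf bg fg; apply: ae_le_pint => //; apply: aeW => -[a s]. Qed.

Lemma pint_ge0 f : bm2 f -> (forall a s, 0 <= f a s) -> 0 <= pint P f.
Proof. by move=> bf f0; rewrite -pint0; apply: le_pint => //; exact: bm2_cst. Qed.

Lemma le_norm_pint f : bm2 f -> `|pint P f| <= pint P (fun a s => `|f a s|).
Proof. by rewrite !pintE; exact: (@le_norm_bint _ _ R P). Qed.

Lemma le_norm_pint_bound f (M : R) : bm2 f -> (forall a s, `|f a s| <= M) ->
  `|pint P f| <= M * fine (P setT).
Proof.
by move=> bf fM; rewrite pintE; apply: (@le_norm_bint_bound _ _ R P) => // -[a s]; exact: fM.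
Qed.

Lemma pint_ae_eq0 f : bm2 f -> (forall a s, 0 <= f a s) -> pint P f = 0 ->
  \forall p \ae P, f p.1 p.2 = 0.
Proof.
by rewrite pintE => bf f0; apply: (@bint_ae_eq0 _ _ R P) => // -[a s]; exact: f0.
Qed.

Lemma cvg_pint (f_ : nat -> R -> R -> R) f (M : R) :
  (forall n, bm2 (f_ n)) -> bm2 f -> (forall n a s, `|f_ n a s| <= M) ->
  (\forall p \ae P, f_ n p.1 p.2 @[n --> \oo] --> f p.1 p.2) ->
  pint P (f_ n) @[n --> \oo] --> pint P f.
Proof.
move=> bf_ bf fM ff; rewrite pintE.
have -> : (fun n => pint P (f_ n)) = (fun n => \int[P]_p f_ n p.1 p.2).
  by apply/funext => n; rewrite pintE.
apply: (cvg_bint (m := P) (f_ := fun n p => f_ n p.1 p.2) (f := fun p => f p.1 p.2) (M := M)).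
- by move=> n; exact: bmeas_measurable (bf_ n).
- exact: bmeas_measurable bf.
- by move=> n [a s]; exact: fM.
- exact: ff.
Qed.

Lemma pint_swap (F : R -> R -> R -> R -> R) :
  bmeas (fun q : borelR2 R * borelR2 R => F q.1.1 q.1.2 q.2.1 q.2.2) ->
  pint P (fun a s => pint P (F a s)) = pint P (fun a' s' => pint P (fun a s => F a s a' s')).
Proof.
move=> bF; rewrite pintE [RHS]pintE.
under eq_Rintegral do rewrite pintE.
under [RHS]eq_Rintegral do rewrite pintE.
exact: (bint_swap P P bF).
Qed.

Lemma bm2_pint (F : R -> R -> R -> R -> R) :
  bmeas (fun q : borelR2 R * borelR2 R => F q.1.1 q.1.2 q.2.1 q.2.2) ->
  bm2 (fun a s => pint P (F a s)).
Proof.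
move=> bF; have := bmeas_bint1 P bF.
by rewrite /bm2; congr bmeas; apply/funext => -[a s]; rewrite pintE.
Qed.

Lemma ibint_pint_swap (x y : R) (F : R -> R -> R -> R) : bm3 F ->
  ibint x y (fun t => pint P (F t)) = pint P (fun a s => ibint x y (fun t => F t a s)).
Proof.
move=> bF; rewrite ibintE [RHS]pintE.
under eq_Rintegral do rewrite pintE.
under [RHS]eq_Rintegral do rewrite ibintE.
exact: (bint_swap (lebI x y) P bF).
Qed.

Lemma bm_pint (F : R -> R -> R -> R) : bm3 F -> bm (fun t => pint P (F t)).
Proof.
move=> bF; have := bmeas_bint1 P bF.
by rewrite /bm; congr bmeas; apply/funext => t; rewrite pintE.
Qed.

End pint_lemmas.

Section bm3_lemmas.
Context {R : realType}.
Implicit Types (F G : R -> R -> R -> R).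

Lemma bm3D F G : bm3 F -> bm3 G -> bm3 (fun t a s => F t a s + G t a s).
Proof. exact: bmeasD. Qed.
Lemma bm3B F G : bm3 F -> bm3 G -> bm3 (fun t a s => F t a s - G t a s).
Proof. exact: bmeasB. Qed.
Lemma bm3M F G : bm3 F -> bm3 G -> bm3 (fun t a s => F t a s * G t a s).
Proof. exact: bmeasM. Qed.
Lemma bm3_norm F : bm3 F -> bm3 (fun t a s => `|F t a s|).
Proof. exact: bmeas_norm. Qed.
Lemma bm3_space (f : R -> R -> R) : bm2 f -> bm3 (fun _ => f).
Proof.
by apply: (bmeas_comp (h := fun q : borelR R * borelR2 R => q.2)); exact: measurable_snd.
Qed.

Lemma bm3_row F t : bm3 F -> bm2 (F t).
Proof. exact: (bmeas_section1 (f := fun q : borelR R * borelR2 R => F q.1 q.2.1 q.2.2)). Qed.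

Lemma bm3_path F a s : bm3 F -> bm (fun t => F t a s).
Proof. exact: (bmeas_section2 (f := fun q : borelR R * borelR2 R => F q.1 q.2.1 q.2.2) (a, s)). Qed.

Lemma bm3_level F a : bm3 F -> bm2 (fun t s => F t a s).
Proof.
apply: (bmeas_comp (h := fun q : borelR2 R => (q.1, (a, q.2)) : borelR R * borelR2 R)).
apply/measurable_fun_pairP; split; first exact: measurable_fst.
by apply/measurable_fun_pairP; split; [exact: measurable_cst|exact: measurable_snd].
Qed.

Lemma bm2_ibint F x y : bm3 F -> bm2 (fun a s => ibint x y (fun t => F t a s)).
Proof.
move=> bF; have := bmeas_bint2 (lebI x y) bF.
by rewrite /bm2; congr bmeas; apply/funext => -[a s]; rewrite ibintE.
Qed.

Lemma bm3_primitive F T : bm3 F ->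
  bm3 (fun t a s => ibint 0 T (fun z => (z <= t)%R%:R * F z a s)).
Proof.
move=> bF.
have bG : bmeas (fun p : borelR R * (borelR R * borelR2 R) =>
    ((p.1 : R) <= p.2.1)%R%:R * F p.1 p.2.2.1 p.2.2.2).
  apply: bmeasM.
    apply: (bmeas_comp (h := fun p : borelR R * (borelR R * borelR2 R) => (p.1, p.2.1) : borelR2 R)
      _ (f := fun q : borelR2 R => ((q.1 : R) <= q.2)%R%:R)) => //; last exact: bm2_le.
    apply/measurable_fun_pairP; split; first exact: measurable_fst.
    exact: measurableT_comp measurable_fst measurable_snd.
  apply: (bmeas_comp (h := fun p : borelR R * (borelR R * borelR2 R) => (p.1, p.2.2) : borelR R * borelR2 R)
    _ (f := fun q : borelR R * borelR2 R => F q.1 q.2.1 q.2.2)) => //.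
  apply/measurable_fun_pairP; split; first exact: measurable_fst.
  exact: measurableT_comp measurable_snd measurable_snd.
have := bmeas_bint2 (lebI 0 T) bG.
by rewrite /bm3; congr bmeas; apply/funext => -[t [a s]]; rewrite ibintE.
Qed.

End bm3_lemmas.

(** * The finite measure on the level space *)

Section level_space.
Context {R : realType}.
Variables (mu : {sigma_finite_measure set (borelR R) -> \bar R}) (Rv : R) (h : R -> R).
Hypotheses (mh : measurable_fun setT (h : borelR R -> borelR R)) (h0 : forall a, 0 <= h a).
Hypothesis hfin : (\int[mu]_(a in levels Rv) (h a)%:E < +oo)%E.
Let A : set (borelR R) := levels Rv.

Lemma measurable_levels : measurable (levels Rv : set (borelR R)).
Proof. exact: measurable_borelR_itv. Qed.

Definition hypograph : set (borelR2 R) := [set p | A p.1 /\ 0 <= (p.2 : R) <= h p.1].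

Lemma measurable_hypograph : measurable hypograph.
Proof.
have -> : hypograph = (A `*` setT) `&`
    ((fun p : borelR2 R => ((0 : R) <= p.2) && ((p.2 : R) <= h p.1)) @^-1` [set true]).
  by apply/seteqP; split => -[a s] /=; [move=> [? ->]|move=> [[? _]]].
apply: measurableI.
  by apply: measurableX => //; exact: measurable_levels.
rewrite -[X in measurable X]setTI.
suff H : measurable_fun setT (fun p : borelR2 R => ((0 : R) <= p.2) && ((p.2 : R) <= h p.1)) by exact: H.
apply: measurable_and; apply: measurable_fun_ler => //.
exact: measurableT_comp mh measurable_fst.
Qed.

Let leb : {sigma_finite_measure set (borelR R) -> \bar R} := @lebesgue_measure R.

Let slice (g : borelR2 R -> \bar R) a :
  (\int[leb]_s (g \_ hypograph) (a, s) = if a \in A then \int[lebI 0 (h a)]_s g (a, s) else 0)%E.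
Proof.
case: ifPn => aA.
  rewrite lebI_integralE [RHS]integral_mkcond; apply: eq_integral => s _.
  rewrite !patchE; congr (if _ then _ else _); apply/idP/idP => /set_mem /= H; apply/mem_set.
    by case: H => _; rewrite /= in_itv.
  by split; [exact: set_mem|move: H; rewrite /= in_itv].
apply: integral0_eq => s _; rewrite patchE memNset//= => -[aA' _].
by move: aA; rewrite mem_set.
Qed.

Let pm : {measure set (borelR2 R) -> \bar R} := (mu \x leb)%E.

Let hyp_patch (g : borelR2 R -> \bar R) : measurable_fun setT g -> measurable_fun setT (g \_ hypograph).
Proof.
by move=> mg; apply/(measurable_restrictT _ measurable_hypograph); exact: measurable_funTS.
Qed.

Let hyp_integral (g : borelR2 R -> \bar R) : measurable_fun setT g -> (forall p, 0 <= g p)%E ->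
  (\int[pm]_(p in hypograph) g p = \int[mu]_(a in A) \int[lebI 0 (h a)]_s g (a, s))%E.
Proof.
move=> mg g0; rewrite integral_mkcond /pm fubini_tonelli1; last 2 first.
- exact: hyp_patch.
- by move=> p; rewrite patchE; case: ifP.
by rewrite [RHS]integral_mkcond; apply: eq_integral => a _; rewrite /fubini_F slice patchE.
Qed.

Let hyp_measurable (g : borelR2 R -> \bar R) : measurable_fun setT g -> (forall p, 0 <= g p)%E ->
  measurable_fun A (fun a => \int[lebI 0 (h a)]_s g (a, s))%E.
Proof.
move=> mg g0.
have := @measurable_fun_fubini_tonelli_F _ _ _ _ _ leb _ (hyp_patch mg).
have H p : (0 <= (g \_ hypograph) p)%E by rewrite patchE; case: ifP.
move=> /(_ H) /(@measurable_funTS _ _ _ _ A); apply: eq_measurable_fun => a aA.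
by rewrite /fubini_F slice aA.
Qed.

Let hypograph_lty : (pm hypograph < +oo)%E.
Proof.
rewrite -[X in (X < _)%E]mul1e -integral_cst; last exact: measurable_hypograph.
rewrite (@hyp_integral (cst 1%E) (@measurable_cst _ _ _ _ _ _))//.
apply: le_lt_trans hfin; rewrite le_eqVlt; apply/orP; left; apply/eqP.
apply: eq_integral => a _.
rewrite integral_cst// mul1e -[LHS]fineK ?lebIT ?subr0//.
by apply: fin_num_measure.
Qed.

(** [mu] is only sigma-finite, but the product with Lebesgue measure gives the hypograph of [h] the
    integral of [h] as mass, which is finite. *)
Definition level_measure : {finite_measure set (borelR2 R) -> \bar R} :=
  mfrestr measurable_hypograph hypograph_lty.

Lemma ge0_level_integral (g : borelR2 R -> \bar R) : measurable_fun setT g -> (forall p, 0 <= g p)%E ->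
  (\int[level_measure]_p g p = \int[mu]_(a in levels Rv) \int[lebI 0 (h a)]_s g (a, s))%E.
Proof. move=> mg g0; rewrite -(hyp_integral mg g0).
exact: (integral_mrestr pm measurable_hypograph g). Qed.

Lemma ge0_level_measurable (g : borelR2 R -> \bar R) : measurable_fun setT g -> (forall p, 0 <= g p)%E ->
  measurable_fun (levels Rv) (fun a => \int[lebI 0 (h a)]_s g (a, s))%E.
Proof. exact: hyp_measurable. Qed.

Local Notation P := level_measure.

Let shift_int (f : R -> R -> R) (M : R) a : bm2 f ->
  (\int[lebI 0 (h a)]_s (f a s + M)%:E = (ibint 0 (h a) (f a) + M * h a)%:E)%E.
Proof.
move=> bf; rewrite (@bmeas_integralE _ (borelR R) R (lebI 0 (h a)) (fun s => f a s + M)); last first.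
  by apply: bmeasD; [exact: (bm2_row a bf)|exact: bmeas_cst].
by rewrite -ibintE (ibintD _ _ (bm2_row a bf) (bm_cst M)) ibint_cst// subr0.
Qed.

Let shift_ge0 (f : R -> R -> R) : bm2 f -> exists2 M, 0 <= M & forall a s, 0 <= f a s + M.
Proof.
move=> [_ [M fM]]; exists M => [|a s]; first exact: le_trans (normr_ge0 _) (fM (0, 0)).
by rewrite -lerBlDr sub0r; have := fM (a, s); rewrite ler_norml => /andP[].
Qed.

Let shift_meas (f : R -> R -> R) (M : R) : bm2 f ->
  measurable_fun setT (fun p : borelR2 R => (f p.1 p.2 + M)%:E).
Proof. by move=> bf; apply/measurable_EFinP; apply: measurable_funD => //; exact: bmeas_measurable bf. Qed.

Lemma level_measurable (f : R -> R -> R) : bm2 f ->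
  measurable_fun (levels Rv : set (borelR R)) (fun a => (ibint 0 (h a) (f a))%:E).
Proof.
move=> bf; have [M _ M0] := shift_ge0 bf.
have := ge0_level_measurable (shift_meas M bf) (fun p => M0 p.1 p.2).
under eq_fun do rewrite shift_int//.
move=> /measurable_EFinP m1; apply/measurable_EFinP.
have m2 : measurable_fun (levels Rv : set (borelR R)) (fun a => M * h a : borelR R).
  by apply: measurable_funM; [exact: measurable_cst|exact: measurable_funTS].
by have := measurable_funB m1 m2; apply: eq_measurable_fun => a _ /=; rewrite addrK.
Qed.

Lemma level_integrable (f : R -> R -> R) : bm2 f ->
  mu.-integrable (levels Rv) (fun a => (ibint 0 (h a) (f a))%:E).
Proof.
move=> bf; apply/integrableP; split; first exact: level_measurable.
have [_ [M fM]] := bf.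
apply: (@le_lt_trans _ _ (\int[mu]_(a in levels Rv) (`|M|%:E * (h a)%:E))%E).
  apply: ge0_le_integral => //.
  - exact: measurable_levels.
  - by apply: measurableT_comp => //; exact: level_measurable.
  - by apply: emeasurable_funM; [exact: measurable_cst|apply/measurable_EFinP; exact: measurable_funTS].
  - move=> a _; rewrite -EFinM lee_fin -[X in _ * X]subr0.
    apply: le_norm_ibint_bound => //; first exact: (bm2_row a bf).
    by move=> s _; apply: le_trans (ler_norm M); exact: (fM (a, s)).
have mhA : measurable_fun (levels Rv : set (borelR R)) (fun a => (h a)%:E).
  by apply/measurable_EFinP; exact: measurable_funTS.
rewrite (ge0_integralZl _ measurable_levels mhA)//; last by move=> a _; rewrite lee_fin.
by rewrite lte_mul_pinfty.
Qed.

Let ge0_level_int (f : R -> R -> R) : bm2 f -> (forall a s, 0 <= f a s) ->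
  (\int[mu]_(a in levels Rv) (ibint 0 (h a) (f a))%:E = (pint P f)%:E)%E.
Proof.
move=> bf f0; rewrite pintE -(bmeas_integralE P bf) ge0_level_integral; last 2 first.
- by apply/measurable_EFinP; exact: bmeas_measurable bf.
- by move=> p; rewrite lee_fin.
by apply: eq_integral => a _; rewrite ibintE -(bmeas_integralE (lebI 0 (h a)) (bm2_row a bf)).
Qed.

Lemma level_integral (f : R -> R -> R) : bm2 f ->
  (\int[mu]_(a in levels Rv) (ibint 0 (h a) (f a))%:E = (pint P f)%:E)%E.
Proof.
move=> bf; have [M M0 fM] := shift_ge0 bf.
have bM := bm2_cst M; have bfM := bm2D bf bM.
rewrite (_ : pint P f = pint P (fun a s => f a s + M) - pint P (fun _ _ => M)); last first.
  by rewrite (pintD _ bf bM) addrK.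
rewrite EFinB -ge0_level_int// -ge0_level_int// -integralB//; last 3 first.
- exact: measurable_levels.
- exact: level_integrable.
- exact: level_integrable.
apply: eq_integral => a _.
by rewrite -EFinB (ibintD _ _ (bm2_row a bf) (bm_cst M)) addrK.
Qed.

(** By Tonelli the sections of a null set are null for a.e. level. Measurability of [Q] is asked
    only in the converse, [level_ae]. *)
Lemma ae_level (Q : set (borelR2 R)) : (\forall p \ae P, Q p) ->
  \forall a \ae mu, levels Rv a -> \forall s \ae lebI 0 (h a), Q (a, s).
Proof.
move=> [N [mN N0 sub]].
pose g (p : borelR2 R) : \bar R := (\1_N p)%:E.
have mg : measurable_fun setT g by apply/measurable_EFinP; exact: measurable_indic.
have g0 p : (0 <= g p)%E by rewrite lee_fin.
have I0 : (\int[mu]_(a in levels Rv) \int[lebI 0 (h a)]_s g (a, s) = 0)%E.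
  rewrite -ge0_level_integral// /g integral_indic ?setIT//.
have := ge0_level_measurable mg g0 => mG.
have G0 a : levels Rv a -> (0 <= \int[lebI 0 (h a)]_s g (a, s))%E by move=> _; apply: integral_ge0.
have : ae_eq mu (levels Rv) (fun a => \int[lebI 0 (h a)]_s g (a, s))%E (cst 0%E).
  apply/(ae_eq_integral_abs _ measurable_levels mG); rewrite -[RHS]I0.
  by apply: eq_integral => a /set_mem aA; rewrite gee0_abs//; exact: G0.
apply: filterS => a Ga aA; have {}Ga := Ga aA.
have ms : measurable_fun setT (fun s => g (a, s)).
  by apply: measurableT_comp mg _; exact: measurable_pair1.
have : ae_eq (lebI 0 (h a)) setT (fun s => g (a, s)) (cst 0%E).
  apply/(ae_eq_integral_abs _ measurableT ms); rewrite -[RHS]Ga.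
  by apply: eq_integral => s _; rewrite gee0_abs.
apply: filterS => s /(_ Logic.I) gs; apply: contrapT => nQ.
by move: gs; rewrite /g indicE mem_set; [case=> /eqP; rewrite oner_eq0|exact: sub].
Qed.

Lemma level_ae (Q : set (borelR2 R)) : measurable Q ->
  (\forall a \ae mu, levels Rv a -> \forall s \ae lebI 0 (h a), Q (a, s)) ->
  \forall p \ae P, Q p.
Proof.
move=> mQ H; exists (~` Q); split => //; first exact: measurableC.
pose g (p : borelR2 R) : \bar R := (\1_(~` Q) p)%:E.
have mg : measurable_fun setT g by apply/measurable_EFinP; apply: measurable_indic; exact: measurableC.
have g0 p : (0 <= g p)%E by rewrite lee_fin.
transitivity (\int[P]_p g p)%E.
  by rewrite integral_indic ?setIT//; exact: measurableC.
rewrite ge0_level_integral// -[RHS](integral0 mu (levels Rv : set (borelR R))).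
apply: ge0_ae_eq_integral_nonmeas => //.
- exact: measurable_levels.
- by move=> a _; apply: integral_ge0.
apply: ae_imply H => a Ha aA; have {}Ha := Ha aA.
rewrite -[RHS](integral0 (lebI 0 (h a)) setT).
apply: ge0_ae_eq_integral_nonmeas => //.
by apply: ae_imply Ha => s Qs _; rewrite /g indicE memNset//= => /(_ Qs).
Qed.

End level_space.

Section pushforward_transfer.
Context d (T : measurableType d) d' (Y : measurableType d') {R : realType}.
Variables (l : {finite_measure set T -> \bar R}) (f : T -> Y) (m : {measure set Y -> \bar R}).
Hypothesis mf : measurable_fun setT f.
Hypothesis mE : forall U, measurable U -> m U = pushforward l f U.

Let F : {mfun T >-> Y} := HB.pack f (isMeasurableFun.Build _ _ _ _ _ mf).

Let mint (g : Y -> \bar R) : (\int[m]_y g y = \int[pushforward l F]_y g y)%E.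
Proof. by apply: eq_measure_integral => U mU _; rewrite mE. Qed.

Lemma ge0_transfer (g : Y -> \bar R) : measurable_fun setT g -> (forall y, 0 <= g y)%E ->
  (\int[m]_y g y = \int[l]_x g (f x))%E.
Proof.
move=> mg g0; by rewrite mint ge0_integral_pushforward// preimage_setT.
Qed.

Lemma bounded_transfer (g : Y -> R) : measurable_fun setT g -> bmeas (fun x => g (f x)) ->
  (\int[m]_y (g y)%:E = (\int[l]_x g (f x))%:E)%E.
Proof.
move=> mg bgf; rewrite mint (@integral_pushforward _ _ _ _ _ F mf l setT (EFin \o g))//.
- by rewrite preimage_setT -(bmeas_integralE l bgf).
- by apply/measurable_EFinP.
- by rewrite preimage_setT; exact: (bmeas_integrable l bgf).
Qed.

Lemma transfer_ae (Q : set Y) : measurable Q -> (\forall x \ae l, Q (f x)) -> \forall y \ae m, Q y.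
Proof.
move=> mQ H; exists (~` Q); split => //; first exact: measurableC.
rewrite mE; last exact: measurableC.
rewrite /pushforward; apply: measure_negligible.
  rewrite -[X in measurable X]setTI; apply: mf => //; exact: measurableC.
by apply: negligibleS H.
Qed.

End pushforward_transfer.

(** * Families as laws of fields *)

Section representation.
Context {R : realType}.
Variables (mu : {sigma_finite_measure set (borelR R) -> \bar R}) (Rv : R) (h : R -> R).
Hypotheses (mh : measurable_fun setT (h : borelR R -> borelR R)) (h0 : forall a, 0 <= h a).
Hypothesis hfin : (\int[mu]_(a in levels Rv) (h a)%:E < +oo)%E.
Let A : set (borelR R) := levels Rv.
Let P := level_measure mh h0 hfin.

Section kernel.
Context d (Y : measurableType d).
Variables (Z : borelR2 R -> Y).
Hypothesis mZ : measurable_fun setT Z.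

Let mslice a : measurable_fun setT (fun s : borelR R => Z (a, s)).
Proof. by apply: measurableT_comp mZ _; exact: measurable_pair1. Qed.

(** The target space is general: it is the line for families and the plane for plans between two
    families. *)
Definition level_kernel_fun (a : borelR R) : {measure set Y -> \bar R} :=
  measure_function_pushforward__canonical__measure_function_Measure (lebI 0 (h a)) (mslice a).
Local Notation lk := level_kernel_fun.

Let lk_kernel : forall U, measurable U -> measurable_fun setT (lk ^~ U).
Proof.
move=> U mU.
pose S : set (borelR2 R) := [set p | (0 <= (p.2 : R) <= h p.1) /\ Z p \in U].
have mS : measurable S.
  have -> : S = (Z @^-1` U) `&`
    ((fun p : borelR2 R => ((0 : R) <= p.2) && ((p.2 : R) <= h p.1)) @^-1` [set true]).
    apply/seteqP; split => -[a s] /= [H1 H2]; first by split => //; exact/set_mem.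
    by split => //; exact/mem_set.
  apply: measurableI; rewrite -[X in measurable X]setTI; first exact: mZ.
  suff H : measurable_fun setT (fun p : borelR2 R => ((0 : R) <= p.2) && ((p.2 : R) <= h p.1)) by exact: H.
  apply: measurable_and; apply: measurable_fun_ler => //.
  exact: measurableT_comp mh measurable_fst.
have := @measurable_fun_xsection _ _ (borelR R) (borelR R) R (@lebesgue_measure R) _ mS.
apply: eq_measurable_fun => a _; rewrite /lk /pushforward /lebI /= /mfrestr /mrestr.
congr (lebesgue_measure _); apply/seteqP; split => s /=.
  by move=> /xsectionP[] /= H1 /set_mem H2; split => //; rewrite in_itv.
by move=> [H1]; rewrite in_itv => H2; apply/xsectionP; split => //; exact/mem_set.
Qed.

HB.instance Definition _ := isKernel.Build _ _ (borelR R) Y R lk lk_kernel.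

Definition level_kernel : R.-ker (borelR R) ~> Y := lk.

Lemma level_kernelE a U : level_kernel a U = lebI 0 (h a) [set s | U (Z (a, s))].
Proof. by []. Qed.

End kernel.

Definition represents (nu : level_family R) (X : R -> R -> R) : Prop :=
  bm2 X /\ \forall a \ae mu, A a -> forall U : set (borelR R), measurable U ->
    nu a U = pushforward (lebI 0 (h a)) (X a) U.

Lemma repr_kernel (X : R -> R -> R) (bX : bm2 X) :
  represents (level_kernel (Z := fun p : borelR2 R => X p.1 p.2 : borelR R) (bmeas_measurable bX)) X.
Proof. by split => //; apply: aeW. Qed.

Lemma repr_ge0 nu X (g : R -> \bar R) : represents nu X ->
  measurable_fun setT (g : borelR R -> \bar R) -> (forall x, 0 <= g x)%E ->
  (\int[mu]_(a in A) \int[nu a]_x g x = \int[P]_p g (X p.1 p.2))%E.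
Proof.
move=> [bX HX] mg g0.
have mgX : measurable_fun setT (fun p : borelR2 R => g (X p.1 p.2)).
  exact: measurableT_comp mg (bmeas_measurable bX).
rewrite ge0_level_integral//; apply: ae_eq_integral_nonmeas.
- exact: measurable_levels.
- exact: (ge0_level_measurable mh mgX (fun p => g0 _)).
- apply: ae_imply HX => a Ha aA.
  exact: (@ge0_transfer _ (borelR R) _ (borelR R) R (lebI 0 (h a)) (X a) (nu a)
    (bmeas_measurable (bm2_row a bX)) (Ha aA) g mg g0).
Qed.

(** The integrand [G], such as (1/2 - a) x, may be unbounded; only its values [K] along the field
    have to be bounded and jointly measurable. *)
Lemma kernel_integral d (Y : measurableType d) (k : R.-ker (borelR R) ~> Y) (Z : borelR2 R -> Y)
    (G : R -> Y -> R) (K : R -> R -> R) : measurable_fun setT Z ->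
  (\forall a \ae mu, A a -> forall U, measurable U ->
    k a U = pushforward (lebI 0 (h a)) (fun s => Z (a, s)) U) ->
  (forall a, A a -> measurable_fun setT (G a)) -> bm2 K ->
  (forall a s, A a -> G a (Z (a, s)) = K a s) ->
  (\int[mu]_(a in A) \int[k a]_y (G a y)%:E = (pint P K)%:E)%E.
Proof.
move=> mZ kZ mG bK GK; rewrite -level_integral//; apply: ae_eq_integral_nonmeas.
- exact: measurable_levels.
- exact: level_measurable.
- apply: ae_imply kZ => a ka aA; rewrite ibintE.
  have mZa : measurable_fun setT (fun s : borelR R => Z (a, s)).
    by apply: measurableT_comp mZ _; exact: measurable_pair1.
  rewrite (bounded_transfer mZa (ka aA) (mG a aA)).
    by congr (_%:E); apply: eq_Rintegral => s _; exact: GK.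
  by under eq_fun do rewrite GK//; exact: (bm2_row a bK).
Qed.

Lemma repr_integral nu X (G K : R -> R -> R) : represents nu X -> bm2 K ->
  (forall a, A a -> measurable_fun setT (G a : borelR R -> borelR R)) ->
  (forall a s, A a -> G a (X a s) = K a s) ->
  (\int[mu]_(a in A) \int[nu a]_x (G a x)%:E = (pint P K)%:E)%E.
Proof.
move=> [bX HX] bK mG GK.
exact: (@kernel_integral _ (borelR R) nu (fun p => X p.1 p.2) G K (bmeas_measurable bX) HX mG bK GK).
Qed.

Lemma repr_in_XR nu X r : represents nu X -> (forall a s, `|X a s| <= r) -> in_XR mu Rv h r nu.
Proof.
move=> HX Xr; have [bX aeX] := HX; split; first split.
- apply: ae_imply aeX => a Ha aA; rewrite (Ha aA)// /pushforward preimage_setT.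
  by rewrite -[LHS]fineK ?lebIT ?subr0//; exact: fin_num_measure.
- have m2 : measurable_fun setT (fun x : borelR R => ((x : R) ^+ 2)%:E).
    by apply/measurable_EFinP; exact: measurable_funX.
  rewrite (repr_ge0 HX m2); last by move=> x; rewrite lee_fin sqr_ge0.
  have bX2 : bm2 (fun a s => X a s ^+ 2) by exact: bm2X.
  by rewrite (bmeas_integralE P bX2) ltry.
- apply: ae_imply aeX => a Ha aA x /= supp; apply: contrapT => xr.
  have oU : open (~` `[- r, r]%classic : set R) by apply: closed_openC; exact: itv_closed.
  have := supp _ oU xr; rewrite (Ha aA); last by apply: measurableC; exact: measurable_borelR_itv.
  rewrite /pushforward (_ : _ @^-1` _ = set0) ?measure0 ?ltxx//.
  apply/seteqP; split => // s /=; rewrite in_itv/= => /negP; apply/negP; rewrite negbK.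
  by rewrite -ler_norml.
Qed.

Lemma in_XR_repr nu r : 0 <= r -> in_XR mu Rv h r nu ->
  represents nu (quantile (fun a => nu a) setT h r).
Proof.
move=> r0 [[mass _] supp].
have mk (U : set (borelR R)) : measurable U -> measurable_fun setT (fun a => nu a U).
  exact: measurable_kernel.
split; first exact: (bmeas_quantile (@measurableT _ _) mk mh h0 r0).
apply: ae_imply2 mass supp => a ma sa aA.
apply: (quantile_law (@measurableT _ _) mk mh h0 r0).
  by rewrite /quantile_ok in_setT ma//= eqxx.
by apply: msupport_null; exact: sa.
Qed.

End representation.

(** * The energy of a field *)

Section energy_representation.
Context {R : realType}.
Variables (mu : {sigma_finite_measure set (borelR R) -> \bar R}) (Rv : R) (h : R -> R).
Hypotheses (mh : measurable_fun setT (h : borelR R -> borelR R)) (h0 : forall a, 0 <= h a).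
Hypothesis hfin : (\int[mu]_(a in levels Rv) (h a)%:E < +oo)%E.
Hypothesis Rv0 : 0 < Rv.
Let A : set (borelR R) := levels Rv.
Let P := level_measure mh h0 hfin.
Let Rv2 : - Rv <= Rv + 1.
Proof. by move: Rv0; lra. Qed.

(* Truncated outside the levels so as to be bounded. *)
Definition drift (a : R) : R := 2^-1 - clamp (- Rv) (Rv + 1) a.

Definition lagrangian_energy (X : R -> R -> R) : R :=
  4^-1 * pint P (fun a s => pint P (fun a' s' => `|X a s - X a' s'|)) +
  pint P (fun a s => drift a * X a s).
Local Notation E := lagrangian_energy.

Lemma driftE a : A a -> drift a = 2^-1 - a.
Proof. by rewrite /A /levels /= in_itv/= => aA; rewrite /drift clamp_id. Qed.

Lemma drift_bound a : `|drift a| <= Rv + 2^-1.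
Proof.
have : - Rv <= clamp (- Rv) (Rv + 1) a by rewrite clamp_ge.
have : clamp (- Rv) (Rv + 1) a <= Rv + 1 by rewrite clamp_le.
rewrite /drift ler_norml => u l.
by apply/andP; split; lra.
Qed.

Lemma bm_drift : bm drift.
Proof. by apply: bmB; [exact: bm_cst|exact: bm_clamp]. Qed.

Lemma bmeas_pair1 (X : R -> R -> R) : bm2 X ->
  bmeas (fun q : borelR2 R * borelR2 R => X q.1.1 q.1.2).
Proof.
move=> bX; apply: (bmeas_comp (h := fst) _ (f := fun p : borelR2 R => X p.1 p.2)) => //.
Qed.

Lemma bmeas_pair2 (X : R -> R -> R) : bm2 X ->
  bmeas (fun q : borelR2 R * borelR2 R => X q.2.1 q.2.2).
Proof.
move=> bX; apply: (bmeas_comp (h := snd) _ (f := fun p : borelR2 R => X p.1 p.2)) => //.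
Qed.

Let bdiff (X Y : R -> R -> R) : bm2 X -> bm2 Y ->
  bmeas (fun q : borelR2 R * borelR2 R => `|X q.1.1 q.1.2 - Y q.2.1 q.2.2|).
Proof. by move=> bX bY; apply: bmeas_norm; apply: bmeasB; [exact: bmeas_pair1|exact: bmeas_pair2]. Qed.

Lemma bm2_interaction (X Y : R -> R -> R) : bm2 X -> bm2 Y ->
  bm2 (fun a s => pint P (fun a' s' => `|X a s - Y a' s'|)).
Proof. by move=> bX bY; exact: (bm2_pint P (bdiff bX bY)). Qed.

Let bary_transfer nu X : represents mu Rv h nu X -> forall U : set (borelR R), measurable U ->
  bary mu Rv nu U = pushforward P (fun p : borelR2 R => X p.1 p.2) U.
Proof.
move=> HX U mU; have [bX _] := HX; rewrite /bary.
have mi : measurable_fun setT (fun x : borelR R => (\1_U x)%:E : \bar R).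
  by apply/measurable_EFinP; exact: measurable_indic.
transitivity (\int[mu]_(a in A) \int[nu a]_x (\1_U x)%:E)%E.
  by apply: eq_integral => a _; rewrite integral_indic ?setIT.
rewrite (repr_ge0 mh h0 hfin HX mi); last by move=> x; rewrite lee_fin.
have mX : measurable_fun setT (fun p : borelR2 R => X p.1 p.2 : borelR R) := bmeas_measurable bX.
have mV : measurable ((fun p : borelR2 R => X p.1 p.2 : borelR R) @^-1` U).
  by rewrite -[Y in measurable Y]setTI; exact: mX.
transitivity (\int[P]_p (\1_((fun p : borelR2 R => X p.1 p.2 : borelR R) @^-1` U) p)%:E)%E.
  by apply: eq_integral => p _; rewrite !indicE; congr (_%:R%:E); apply/idP/idP => /set_mem H; exact/mem_set.
by rewrite integral_indic ?setIT.
Qed.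

Let interaction_lip X : bm2 X -> lipschitz_with (fine (P setT)) (fun y => pint P (fun a s => `|X a s - y|)).
Proof.
move=> bX y y'.
have b1 x : bm2 (fun a' s' => `|X a' s' - x|).
  by apply: bm2_norm; apply: bm2B => //; exact: bm2_cst.
rewrite -(pintB _ (b1 _) (b1 _)) [X in _ <= X]mulrC; apply: le_norm_pint_bound => [|a s].
  exact: bm2B.
apply: (le_trans (ler_dist_dist _ _)).
by rewrite (_ : X a s - y - (X a s - y') = - (y - y')) ?normrN//; ring.
Qed.

Lemma energy_repr nu X : represents mu Rv h nu X -> energy mu Rv nu = (E X)%:E.
Proof.
move=> HX; have [bX _] := HX.
rewrite /energy /E EFinD EFinM; congr (_ * _ + _)%E.
  have mX : measurable_fun setT (fun p : borelR2 R => X p.1 p.2 : borelR R) := bmeas_measurable bX.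
  have inner (y : R) : (\int[bary mu Rv nu]_x (`|x - y|)%:E =
      (pint P (fun a s => `|X a s - y|))%:E)%E.
    have bXy : bm2 (fun a s => `|X a s - y|) by apply: bm2_norm; apply: bm2B => //; exact: bm2_cst.
    rewrite pintE; apply: (bounded_transfer mX (bary_transfer HX) (g := fun x => `|x - y|)).
      by apply: measurableT_comp => //; apply: measurable_funB => //; exact: measurable_cst.
    exact: bXy.
  under eq_integral do rewrite inner.
  have bI : bm2 (fun a s => pint P (fun a' s' => `|X a s - X a' s'|)) by exact: bm2_interaction.
  rewrite pintE.
  have -> : (\int[P]_p pint P (fun a' s' => `|X p.1 p.2 - X a' s'|) =
      \int[P]_p pint P (fun a' s' => `|X a' s' - X p.1 p.2|))%R.
    by apply: eq_Rintegral => p _; rewrite !pintE; apply: eq_Rintegral => q _; rewrite distrC.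
  apply: (bounded_transfer mX (bary_transfer HX) (g := fun y => pint P (fun a s => `|X a s - y|))).
    exact: continuous_measurable_fun (lipschitz_with_continuous (interaction_lip bX)).
  by under eq_fun do (under eq_fun do (under eq_fun do rewrite distrC)).
apply: (repr_integral mh h0 hfin HX (G := fun a x => (2^-1 - a) * x) (K := fun a s => drift a * X a s)).
- by apply: bm2M => //; apply: bm2_fst; exact: bm_drift.
- by move=> a _; apply: measurable_funM => //; exact: measurable_cst.
- by move=> a s aA /=; rewrite driftE.
Qed.

Let pmass := fine (P setT).

(** The Lipschitz constant of the energy in L^1(P). The interaction contributes 1/4 of twice the
    mass, since a displacement enters through both variables, and the drift contributes its bound Rv
    + 1/2. *)
Definition speed_bound : R := pmass / 2 + Rv + 2^-1.
Local Notation C := speed_bound.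

Let pmass0 : 0 <= pmass. Proof. exact: fine_ge0. Qed.

Lemma speed_bound_ge0 : 0 <= C.
Proof. rewrite /C; have := pmass0; have := ltW Rv0; lra. Qed.

Lemma energy_lip X Y : bm2 X -> bm2 Y -> E Y - E X <= C * pint P (fun a s => `|Y a s - X a s|).
Proof.
move=> bX bY; set D := pint P _.
have bD : bm2 (fun a s => `|Y a s - X a s|) by apply: bm2_norm; exact: bm2B.
have bIX := bm2_interaction bX bX; have bIY := bm2_interaction bY bY.
have bdX : bm2 (fun a s => drift a * X a s) by apply: bm2M => //; apply: bm2_fst; exact: bm_drift.
have bdY : bm2 (fun a s => drift a * Y a s) by apply: bm2M => //; apply: bm2_fst; exact: bm_drift.
have h1 : pint P (fun a s => pint P (fun a' s' => `|Y a s - Y a' s'|)) -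
    pint P (fun a s => pint P (fun a' s' => `|X a s - X a' s'|)) <= 2 * pmass * D.
  rewrite -(pintB _ bIY bIX).
  have bsum : bm2 (fun a s => pmass * `|Y a s - X a s| + D).
    by apply: bm2D; [apply: bm2M => //; exact: bm2_cst|exact: bm2_cst].
  apply: (@le_trans _ _ (pint P (fun a s => pmass * `|Y a s - X a s| + D))).
    apply: le_pint => //; first exact: bm2B.
    move=> a s.
    have b1 (Z : R -> R -> R) x : bm2 Z -> bm2 (fun a' s' => `|x - Z a' s'|).
      by move=> bZ; apply: bm2_norm; apply: bm2B => //; exact: bm2_cst.
    rewrite -(pintB _ (b1 _ _ bY) (b1 _ _ bX)) [pmass * _]mulrC -(pint_cst P) -pintD//; last exact: bm2_cst.
    apply: le_pint.
    - by apply: bm2B; exact: b1.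
    - by apply: bm2D => //; exact: bm2_cst.
    - move=> a' s'; rewrite lerBlDr.
      rewrite (_ : Y a s - Y a' s' = (Y a s - X a s) - (Y a' s' - X a' s') + (X a s - X a' s')); last by ring.
      by apply: (le_trans (ler_normD _ _)); rewrite lerD2r; exact: ler_normB.
  rewrite pintD; [|by apply: bm2M => //; exact: bm2_cst|exact: bm2_cst].
  by rewrite pintZl// pint_cst -/D -/pmass; lra.
have h2 : pint P (fun a s => drift a * Y a s) - pint P (fun a s => drift a * X a s) <= (Rv + 2^-1) * D.
  rewrite -(pintB _ bdY bdX) -pintZl//; apply: le_pint.
  - exact: bm2B.
  - by apply: bm2M => //; exact: bm2_cst.
  - move=> a s; rewrite -mulrBr; apply: (le_trans (ler_norm _)); rewrite normrM.
    by rewrite ler_wpM2r// drift_bound.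
rewrite /E /C; move: h1 h2; set x1 := pint _ _; set x2 := pint _ _; set x3 := pint _ _; set x4 := pint _ _.
lra.
Qed.

End energy_representation.

(** * Subgradients of the energy *)

Section subdifferential_representation.
Context {R : realType}.
Variables (mu : {sigma_finite_measure set (borelR R) -> \bar R}) (Rv : R) (h : R -> R).
Hypotheses (mh : measurable_fun setT (h : borelR R -> borelR R)) (h0 : forall a, 0 <= h a).
Hypothesis hfin : (\int[mu]_(a in levels Rv) (h a)%:E < +oo)%E.
Hypothesis Rv0 : 0 < Rv.
Let A : set (borelR R) := levels Rv.
Local Notation P := (level_measure mh h0 hfin).
Local Notation E := (lagrangian_energy mh h0 hfin).
Local Notation C := (speed_bound mh h0 hfin).
Local Notation represents := (represents mu Rv h).

Definition on_levels (w : R -> R -> R) (a x : R) : R := if a \in A then w a x else 0.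

Lemma measurable_on_levels (w : R -> R -> R) :
  measurable_fun (A `*` setT) (fun p : borelR2 R => w p.1 p.2 : borelR R) ->
  measurable_fun setT (fun p : borelR2 R => on_levels w p.1 p.2 : borelR R).
Proof.
have mA : measurable (A `*` setT : set (borelR2 R)).
  by apply: measurableX => //; exact: measurable_levels.
move=> /(measurable_restrictT _ mA); apply: eq_measurable_fun => p _.
rewrite patchE /on_levels; congr (if _ then _ else _); apply/idP/idP => /set_mem H; apply/mem_set => //.
by case: H.
Qed.

Lemma measurable_velocity (w X : R -> R -> R) : bm2 X ->
  measurable_fun (A `*` setT) (fun p : borelR2 R => w p.1 p.2 : borelR R) ->
  measurable_fun setT (fun p : borelR2 R => on_levels w p.1 (X p.1 p.2) : borelR R).
Proof.
move=> bX mw.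
have mp : measurable_fun setT (fun p : borelR2 R => (p.1, X p.1 p.2) : borelR2 R).
  by apply/measurable_fun_pairP; split; [exact: measurable_fst|exact: bmeas_measurable bX].
exact: measurableT_comp (measurable_on_levels mw) mp.
Qed.

Lemma energy_ae_eq X Y : bm2 X -> bm2 Y -> (\forall p \ae P, X p.1 p.2 = Y p.1 p.2) -> E X = E Y.
Proof.
move=> bX bY XY.
have z Z W : bm2 Z -> bm2 W -> (\forall p \ae P, Z p.1 p.2 = W p.1 p.2) -> E Z <= E W.
  move=> bZ bW ZW; rewrite -subr_le0; apply: le_trans (energy_lip mh h0 hfin Rv0 bW bZ) _.
  rewrite (ae_eq_pint (g := fun _ _ => 0)) ?pint0 ?mulr0//; first exact: bm2_cst.
  by apply: ae_imply ZW => p ->; rewrite subrr normr0.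
by apply/eqP; rewrite eq_le !z//; apply: ae_imply XY => p.
Qed.

(** Taking as plan the law of the pair (X, Y) on each level turns the inequality against plans into
    one against fields. A bounded field [Y] represents an admissible competitor. *)
Let plan_ineq nu X (w Y K : R -> R -> R) : represents nu X -> subdiff mu Rv h nu w ->
  bm2 Y -> bm2 K -> (forall a s, A a -> w a (X a s) * (Y a s - X a s) = K a s) ->
  pint P K <= E Y - E X.
Proof.
move=> HX [[mw _] sub] bY bK wK; have [bX aeX] := HX.
have [_ [M0 YM0]] := bY.
have [M M1 YM] : exists2 M, 0 < M & forall a s, `|Y a s| <= M.
  exists (`|M0| + 1); first by rewrite ltr_wpDl.
  by move=> a s; apply: (le_trans (YM0 (a, s))); apply: (le_trans (ler_norm _)); rewrite lerDl.
have mZ : measurable_fun setT (fun p : borelR2 R => (X p.1 p.2, Y p.1 p.2) : borelR2 R).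
  by apply/measurable_fun_pairP; split; [exact: bmeas_measurable bX|exact: bmeas_measurable bY].
pose theta : level_family R := level_kernel mh (Z := fun p : borelR2 R => Y p.1 p.2 : borelR R) (bmeas_measurable bY).
have HY : represents theta Y by exact: repr_kernel.
pose g := level_kernel mh mZ.
have cg : coupling_family mu Rv nu theta g.
  apply: ae_imply aeX => a Ha aA; split => U mU.
    by rewrite (Ha aA) // /pushforward /g level_kernelE; congr (lebI _ _ _); apply/seteqP; split => s /=; [case|split].
  by rewrite /g /theta !level_kernelE; congr (lebI _ _ _); apply/seteqP; split => s /=; [case|split].
have := sub M theta g M1 (repr_in_XR mh h0 hfin HY YM) cg.
rewrite (energy_repr mh h0 hfin Rv0 HX) (energy_repr mh h0 hfin Rv0 HY) -EFinB.
rewrite (kernel_integral mh h0 hfin (K := K) mZ)//.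
- by apply: aeW.
- move=> a aA.
  have mwa : measurable_fun setT (fun x : borelR R => w a x : borelR R).
    have := measurableT_comp (measurable_on_levels mw) (@measurable_pair1 _ _ (borelR R) (borelR R) a).
    by apply: eq_measurable_fun => x _ /=; rewrite /on_levels mem_set.
  apply: measurable_funM; first exact: measurableT_comp mwa measurable_fst.
  by apply: measurable_funB; [exact: measurable_snd|exact: measurable_fst].
Qed.

(** Moving [X] by the sign of the subgradient W on {C < |W|} makes the linear term the integral of
    |W| there, while the energy grows by at most [C] times the measure of that set. The set is
    therefore null, and W may be truncated at [C]. *)
Lemma subdiff_repr nu X w : represents nu X -> subdiff mu Rv h nu w ->
  (\forall p \ae P, `|on_levels w p.1 (X p.1 p.2)| <= C) /\
  forall Y, bm2 Y ->
    pint P (fun a s => clamp (- C) C (on_levels w a (X a s)) * (Y a s - X a s)) <= E Y - E X.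
Proof.
move=> HX sub; have [bX _] := HX; have [[mw _] _] := sub.
pose W a s := on_levels w a (X a s).
have mW : measurable_fun setT (fun p : borelR2 R => W p.1 p.2 : borelR R) by exact: measurable_velocity.
have C0 := speed_bound_ge0 mh h0 hfin Rv0.
have aeb : \forall p \ae P, `|W p.1 p.2| <= C.
  (* The upper bound M keeps the linear term bounded; the union over integers M recovers {C <
     |W|}. *)
  pose B M a s : bool := (C < `|W a s|) && (`|W a s| <= M).
  have mB M : measurable_fun setT (fun p : borelR2 R => B M p.1 p.2).
    apply: measurable_and.
      by apply: measurable_fun_ltr => //; exact: measurableT_comp.
    by apply: measurable_fun_ler => //; exact: measurableT_comp.
  have bBf M (f : R -> R -> R) N : measurable_fun setT (fun p : borelR2 R => f p.1 p.2 : borelR R) ->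
      (forall a s, B M a s -> `|f a s| <= N) -> 0 <= N -> bm2 (fun a s => if B M a s then f a s else 0).
    move=> mf fN N0; apply: (@bmeas_le _ _ _ _ N).
      by apply: measurable_fun_ifT => //; exact: measurable_cst.
    by move=> p; case: ifP => [/fN//|_]; rewrite normr0.
  have key (n : nat) : \forall p \ae P, ~~ B n%:R p.1 p.2.
    pose psi a s : R := if B n%:R a s then Num.sg (W a s) else 0.
    have bpsi : bm2 psi.
      apply: (bBf n%:R (fun a s => Num.sg (W a s)) 1) => //.
        rewrite (_ : (fun p => _) = fun p : borelR2 R => if W p.1 p.2 == 0 then 0 else if W p.1 p.2 < 0 then - 1 else 1); last first.
          by apply/funext => p; rewrite /Num.sg/=.
        apply: measurable_fun_ifT; first exact: measurable_fun_eqr.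
          exact: measurable_cst.
        apply: measurable_fun_ifT; first exact: measurable_fun_ltr.
          exact: measurable_cst.
        exact: measurable_cst.
      by move=> a s _; rewrite normr_sg lern1 leq_b1.
    pose K a s : R := if B n%:R a s then `|W a s| else 0.
    have bK : bm2 K.
      apply: (bBf n%:R (fun a s => `|W a s|) n%:R) => //; first exact: measurableT_comp.
      by move=> a s /andP[_]; rewrite normr_id.
    pose one a s : R := if B n%:R a s then 1 else 0.
    have bone : bm2 one by apply: (bBf n%:R (fun _ _ => 1) 1) => // a s _; rewrite normr1.
    have bY : bm2 (fun a s => X a s + psi a s) by exact: bm2D.
    have H1 : pint P K <= E (fun a s => X a s + psi a s) - E X.
      apply: (plan_ineq HX sub bY bK) => a s aA.
      rewrite addrAC subrr add0r /psi /K /W /on_levels mem_set//; case: ifP => _; last by rewrite mulr0.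
      by rewrite [w _ _ * _]mulrC -normrEsg.
    have H2 := energy_lip mh h0 hfin Rv0 bX bY.
    have H3 : pint P (fun a s => `|X a s + psi a s - X a s|) <= pint P one.
      apply: le_pint => //; first by apply: bm2_norm; exact: bm2B.
      move=> a s; rewrite addrAC subrr add0r /psi /one; case: ifP => _; last by rewrite normr0.
      by rewrite normr_sg lern1 leq_b1.
    have bd : bm2 (fun a s => K a s - C * one a s).
      by apply: bm2B => //; apply: bm2M => //; exact: bm2_cst.
    have d0 a s : 0 <= K a s - C * one a s.
      rewrite /K /one; case: ifP => [/andP[/ltW H _]|_]; last by rewrite mulr0 subr0.
      by rewrite mulr1 subr_ge0.
    have I0 : pint P (fun a s => K a s - C * one a s) = 0.
      apply/eqP; rewrite eq_le pint_ge0// andbT.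
      have bC1 : bm2 (fun a s => C * one a s) by apply: bm2M => //; exact: bm2_cst.
      rewrite (pintB _ bK bC1) pintZl// subr_le0.
      by apply: (le_trans H1); apply: (le_trans H2); rewrite ler_wpM2l.
    apply: ae_imply (pint_ae_eq0 bd d0 I0) => p; rewrite /K /one; case: ifP => // /andP[H _].
    by move=> /eqP; rewrite mulr1 subr_eq0 gt_eqF.
  apply: ae_imply (ae_all_nat key) => p H; rewrite leNgt; apply/negP => CW.
  have := H (Num.truncn `|W p.1 p.2|).+1; rewrite /B CW/= => /negP; apply.
  by apply: ltW; exact: truncnS_gt.
split => // Y bY.
(* On the null set where truncation is active the competitor is set equal to [X], so that W and its
   truncation agree wherever the increment is nonzero. *)
pose Y' a s := if `|W a s| <= C then Y a s else X a s.
have mC : measurable_fun setT (fun p : borelR2 R => `|W p.1 p.2| <= C).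
  by apply: measurable_fun_ler => //; exact: measurableT_comp.
have bY' : bm2 Y' by exact: (bmeas_if mC bY bX).
have CC : - C <= C by apply: (@le_trans _ _ 0) => //; rewrite oppr_le0.
have bcl : bm2 (fun a s => clamp (- C) C (W a s)).
  exact: (bmeas_clamp CC mW).
have -> : E Y = E Y'.
  by apply: energy_ae_eq => //; apply: ae_imply aeb => p H; rewrite /Y' H.
rewrite (ae_eq_pint (g := fun a s => clamp (- C) C (W a s) * (Y' a s - X a s))).
- apply: (plan_ineq HX sub bY'); first by apply: bm2M => //; exact: bm2B.
  move=> a s aA; rewrite /Y'; case: ifP => H; last by rewrite subrr !mulr0.
  by congr (_ * _); rewrite clamp_id -?ler_norml// /W /on_levels mem_set.
- by apply: bm2M => //; exact: bm2B.
- by apply: ae_imply aeb => p H; rewrite /Y' H.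
Qed.

End subdifferential_representation.

(** * Transport cost of quantile fields *)

Section layer_cake.
Context {R : realType}.

Lemma ibint_lt (r x : R) : - r <= x <= r -> ibint (- r) r (fun c => (c < x)%R%:R) = x + r.
Proof.
move=> /andP[rx xr].
have b : bm (fun c => (c < x)%R%:R).
  rewrite (_ : (fun c => _) = fun c => 1 - (x <= c)%R%:R).
    by apply: bmB; [exact: bm_cst|exact: bm_ge].
  by apply/funext => c; case: ltP => _; rewrite ?subrr ?subr0.
have e0 : ibint x r (fun c => (c < x)%R%:R) = 0.
  rewrite -[RHS](ibint0 x r); apply: eq_ibint => c /andP[xc _].
  by rewrite ltNge xc.
have e1 : ibint (- r) x (fun c => (c < x)%R%:R) = ibint (- r) x (fun=> 1).
  apply: ae_eq_ibint; first exact: bm_cst.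
  apply: ae_imply2 (ae_lebI_mem (- r) x) (ae_lebI_neq (- r) x x) => c /andP[_ cx] /eqP nc.
  by rewrite lt_neqAle nc cx.
by rewrite (ibint_split rx xr b) e0 e1 addr0 ibint_cst// mul1r opprK.
Qed.

Lemma measurable_lt_pair d (T : measurableType d) (p : T -> R) : measurable_fun setT p ->
  bmeas (fun z : borelR R * T => ((z.1 : R) < p z.2)%R%:R : R).
Proof.
move=> mp; rewrite (_ : (fun z => _) = fun z : borelR R * T => if (z.1 : R) < p z.2 then 1 else 0 : R).
  apply: bmeas_if; [|exact: bmeas_cst|exact: bmeas_cst].
  by apply: measurable_fun_ltr => //; exact: measurableT_comp.
by apply/funext => z; case: ifP.
Qed.

Lemma bmeas_lt d (T : measurableType d) (p : T -> R) (c : R) : measurable_fun setT p ->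
  bmeas (fun x => (c < p x)%R%:R : R).
Proof. by move=> mp; exact: (bmeas_section1 c (measurable_lt_pair mp)). Qed.

(** p + r is the integral over c in [-r, r] of the indicator of {c < p}, and likewise for q. The
    product moment is thus an integral of the masses of the corner sets {p > c, q > e}. *)
Lemma layer_cake d (T : measurableType d) (G : {finite_measure set T -> \bar R}) (r : R)
    (p q : T -> R) : 0 <= r -> measurable_fun setT p -> measurable_fun setT q ->
    (forall x, `|p x| <= r) -> (forall x, `|q x| <= r) ->
  \int[G]_x ((p x + r) * (q x + r)) =
  ibint (- r) r (fun c => ibint (- r) r (fun e => \int[G]_x ((c < p x)%R%:R * (e < q x)%R%:R))).
Proof.
move=> r0 mp mq pr qr.
have bp : bmeas p by exact: bmeas_le pr.
have bq : bmeas q by exact: bmeas_le qr.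
have bqr : bmeas (fun x => q x + r) by apply: bmeasD => //; exact: bmeas_cst.
have step (f : T -> R) (g : T -> R) : measurable_fun setT f -> (forall x, `|f x| <= r) -> bmeas g ->
    \int[G]_x ((f x + r) * g x) = ibint (- r) r (fun c => \int[G]_x ((c < f x)%R%:R * g x)).
  move=> mf fr bg; rewrite ibintE.
  have bF : bmeas (fun z : borelR R * T => ((z.1 : R) < f z.2)%R%:R * g z.2).
    by apply: bmeasM; [exact: measurable_lt_pair|exact: bmeas_comp measurable_snd bg].
  rewrite (bint_swap (lebI (- r) r) G bF); apply: eq_Rintegral => x _.
  rewrite -(ibint_lt (x := f x)) -?ler_norml// -ibintE -ibintZr//.
  exact: (bmeas_section2 x (measurable_lt_pair mf)).
rewrite (step p _ mp pr bqr); apply: eq_ibint => c _.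
have E : \int[G]_x ((c < p x)%R%:R * (q x + r)) = \int[G]_x ((q x + r) * (c < p x)%R%:R).
  by apply: eq_Rintegral => x _; rewrite mulrC.
rewrite E (step q _ mq qr (bmeas_lt c mp)); apply: eq_ibint => e _.
by apply: eq_Rintegral => x _; rewrite mulrC.
Qed.

End layer_cake.

(** * Optimality of the monotone coupling *)

Section hoeffding.
Context {R : realType}.
Variables (H r : R) (X Y : R -> R) (m n : {measure set (borelR R) -> \bar R}).
Hypotheses (r0 : 0 <= r) (bX : bm X) (bY : bm Y).
Hypotheses (Xr : forall s, `|X s| <= r) (Yr : forall s, `|Y s| <= r).
Hypotheses (mE : forall U : set (borelR R), measurable U -> m U = pushforward (lebI 0 H) X U).
Hypotheses (nE : forall U : set (borelR R), measurable U -> n U = pushforward (lebI 0 H) Y U).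

Let mXY : measurable_fun setT (fun s : borelR R => (X s, Y s) : borelR2 R).
Proof. by apply/measurable_fun_pairP; split; [exact: bmeas_measurable bX|exact: bmeas_measurable bY]. Qed.

Let monotone_plan : {measure set (borelR2 R) -> \bar R} :=
  measure_function_pushforward__canonical__measure_function_Measure (lebI 0 H) mXY.

Lemma W2sq_le : (W2sq m n <= (ibint 0 H (fun s => (X s - Y s) ^+ 2))%:E)%E.
Proof.
apply: ereal_inf_lbound; exists monotone_plan.
  split=> U mU.
    by rewrite mE// /pushforward/= /pushforward; congr (lebI _ _ _); apply/seteqP; split => s /=; [case|split].
  by rewrite nE// /pushforward/= /pushforward; congr (lebI _ _ _); apply/seteqP; split => s /=; [case|split].
have b2 : bm (fun s => `|X s - Y s| ^+ 2) by apply: bmX; apply: bm_norm; exact: bmB.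
rewrite (@bounded_transfer _ (borelR R) _ (borelR2 R) R (lebI 0 H) (fun s => (X s, Y s)) monotone_plan
   mXY _ (fun p => `|p.1 - p.2| ^+ 2))//.
- by rewrite ibintE; congr (_%:E); apply: eq_Rintegral => s _ /=; rewrite real_normK ?num_real.
- apply: measurable_funX; apply: measurableT_comp => //.
  by apply: measurable_funB; [exact: measurable_fst|exact: measurable_snd].
Qed.

Hypotheses (Xnd : forall s s', s <= s' -> X s <= X s') (Ynd : forall s s', s <= s' -> Y s <= Y s').

Let cl : R -> R := clamp (- r) r.
Let rr : - r <= r. Proof. by apply: le_trans r0; rewrite oppr_le0. Qed.
Let cl_id x : `|x| <= r -> cl x = x.
Proof. by rewrite ler_norml => h; apply: clamp_id. Qed.
Let clr x : `|cl x| <= r.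
Proof. by rewrite ler_norml; apply/andP; split; [apply: clamp_ge|apply: clamp_le]. Qed.
Let mcl : measurable_fun setT (cl : borelR R -> borelR R).
Proof. exact: bmeas_measurable (bm_clamp rr). Qed.

Section plan.
Variable g : {measure set (borelR2 R) -> \bar R}.
Hypothesis cg : coupling m n g.

Let gT : (g setT < +oo)%E.
Proof.
rewrite -setXTT (cg.1 _ measurableT) (mE measurableT).
by rewrite /pushforward preimage_setT -ge0_fin_numE//; exact: fin_num_measure.
Qed.

Let G : {finite_measure set (borelR2 R) -> \bar R} := mfrestr (@measurableT _ _) gT.

Let GE U : measurable U -> G U = g U.
Proof. by rewrite /G /= /mfrestr /mrestr setIT. Qed.

Let p1 : borelR2 R -> R := fun p => cl p.1.
Let p2 : borelR2 R -> R := fun p => cl p.2.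
Let mp1 : measurable_fun setT p1. Proof. exact: measurableT_comp mcl measurable_fst. Qed.
Let mp2 : measurable_fun setT p2. Proof. exact: measurableT_comp mcl measurable_snd. Qed.
Let bp1 : bmeas p1. Proof. by apply: bmeas_le mp1 _ => p; exact: clr. Qed.
Let bp2 : bmeas p2. Proof. by apply: bmeas_le mp2 _ => p; exact: clr. Qed.

Let marg1 (f : R -> R) : bm f -> \int[G]_p f (p1 p) = ibint 0 H (fun s => f (X s)).
Proof.
move=> bf; have bfc : bm (fun x => f (cl x)) by exact: bmeas_comp mcl bf.
apply: EFin_inj; transitivity (\int[m]_x (f (cl x))%:E)%E.
  apply/esym/(@bounded_transfer _ (borelR2 R) _ (borelR R) R G fst m _ _ (fun x => f (cl x))) => //.
  - by move=> U mU; rewrite -(cg.1 U mU) /pushforward GE; [congr (g _); apply/seteqP; split => p /=; [case|split]|rewrite -[Z in measurable Z]setTI; exact: measurable_fst].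
  - exact: bmeas_measurable bfc.
  - exact: bmeas_comp measurable_fst bfc.
rewrite (@bounded_transfer _ (borelR R) _ (borelR R) R (lebI 0 H) X m (bmeas_measurable bX) mE (fun x => f (cl x))).
- by rewrite ibintE; congr (_%:E); apply: eq_Rintegral => s _; rewrite cl_id.
- exact: bmeas_measurable bfc.
- exact: bmeas_comp (bmeas_measurable bX) bfc.
Qed.

Let marg2 (f : R -> R) : bm f -> \int[G]_p f (p2 p) = ibint 0 H (fun s => f (Y s)).
Proof.
move=> bf; have bfc : bm (fun x => f (cl x)) by exact: bmeas_comp mcl bf.
apply: EFin_inj; transitivity (\int[n]_x (f (cl x))%:E)%E.
  apply/esym/(@bounded_transfer _ (borelR2 R) _ (borelR R) R G snd n _ _ (fun x => f (cl x))) => //.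
  - by move=> U mU; rewrite -(cg.2 U mU) /pushforward GE; [congr (g _); apply/seteqP; split => p /=; [case|split]|rewrite -[Z in measurable Z]setTI; exact: measurable_snd].
  - exact: bmeas_measurable bfc.
  - exact: bmeas_comp measurable_snd bfc.
rewrite (@bounded_transfer _ (borelR R) _ (borelR R) R (lebI 0 H) Y n (bmeas_measurable bY) nE (fun x => f (cl x))).
- by rewrite ibintE; congr (_%:E); apply: eq_Rintegral => s _; rewrite cl_id.
- exact: bmeas_measurable bfc.
- exact: bmeas_comp (bmeas_measurable bY) bfc.
Qed.

(** For nondecreasing [X] and [Y] the sets {X > c} and {Y > e} are nested, so that their
    intersection has the smaller of the two marginal masses, an upper bound for every coupling. *)
Let corner c e : \int[G]_p ((c < p1 p)%R%:R * (e < p2 p)%R%:R) <=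
  ibint 0 H (fun s => (c < X s)%R%:R * (e < Y s)%R%:R).
Proof.
have bltR (x : R) : bm (fun y => (x < y)%R%:R) by exact: (bmeas_lt x (@measurable_id _ (borelR R) setT)).
have bb1 := bmeas_lt c mp1; have bb2 := bmeas_lt e mp2.
have le1 (b1 b2 : bool) : b1%:R * b2%:R <= b1%:R :> R by case: b1; case: b2; rewrite ?mulr1 ?mulr0 ?mul0r.
have le2 (b1 b2 : bool) : b1%:R * b2%:R <= b2%:R :> R by rewrite mulrC.
have [h|h] : (forall s, c < X s -> e < Y s) \/ (forall s, e < Y s -> c < X s).
- apply: contrapT => /not_orP[/existsNP[s1 /not_implyP[c1 /negP e1]] /existsNP[s2 /not_implyP[e2 /negP c2]]].
  rewrite -leNgt in e1; rewrite -leNgt in c2.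
  have [s12|/ltW s21] := leP s1 s2.
    by have := lt_le_trans c1 (le_trans (Xnd s12) c2); rewrite ltxx.
  by have := lt_le_trans e2 (le_trans (Ynd s21) e1); rewrite ltxx.
- apply: (@le_trans _ _ (\int[G]_p (c < p1 p)%R%:R)).
    by apply: le_bint => //; exact: bmeasM.
  rewrite (marg1 (bltR c)) le_eqVlt; apply/orP; left; apply/eqP.
  apply: eq_ibint => s _; case: (ltP c (X s)) => [/h ->|_]; by rewrite ?mulr1 ?mul0r.
- apply: (@le_trans _ _ (\int[G]_p (e < p2 p)%R%:R)).
    by apply: le_bint => //; exact: bmeasM.
  rewrite (marg2 (bltR e)) le_eqVlt; apply/orP; left; apply/eqP.
  apply: eq_ibint => s _; case: (ltP e (Y s)) => [/h ->|_]; by rewrite ?mulr1 ?mulr0.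
Qed.

Let cross : \int[G]_p ((p1 p + r) * (p2 p + r)) <= ibint 0 H (fun s => (X s + r) * (Y s + r)).
Proof.
have mX := bmeas_measurable bX; have mY := bmeas_measurable bY.
rewrite (layer_cake G r0 mp1 mp2 (fun p => clr _) (fun p => clr _)).
have -> := etrans (ibintE 0 H (fun s => (X s + r) * (Y s + r))) (layer_cake (lebI 0 H) r0 mX mY Xr Yr).
have bF d (T : measurableType d) (K : {finite_measure set T -> \bar R}) (p q : T -> R) :
    measurable_fun setT p -> measurable_fun setT q ->
    bm2 (fun c e => \int[K]_x ((c < p x)%R%:R * (e < q x)%R%:R)).
  move=> mp mq; rewrite /bm2.
  apply: (@bmeas_bint1 _ _ (borelR2 R) T R K (fun z : borelR2 R * T => ((z.1.1 : R) < p z.2)%R%:R * ((z.1.2 : R) < q z.2)%R%:R)).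
  apply: bmeasM.
    apply: (bmeas_comp (h := fun z : borelR2 R * T => (z.1.1, z.2) : borelR R * T) _ (measurable_lt_pair mp)).
    apply/measurable_fun_pairP; split; last exact: measurable_snd.
    exact: measurableT_comp measurable_fst measurable_fst.
  apply: (bmeas_comp (h := fun z : borelR2 R * T => (z.1.2, z.2) : borelR R * T) _ (measurable_lt_pair mq)).
  apply/measurable_fun_pairP; split; last exact: measurable_snd.
  exact: measurableT_comp measurable_snd measurable_fst.
have b1 := bF _ _ G p1 p2 mp1 mp2; have b2 := bF _ _ (lebI 0 H) X Y mX mY.
apply: le_ibint => [||c _]; [exact: bm_ibint|exact: bm_ibint|].
apply: le_ibint => [||e _]; [exact: (bm2_row c b1)|exact: (bm2_row c b2)|].
by have := corner c e; rewrite [X in _ <= X -> _]ibintE.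
Qed.

Let cost : (\int[g]_p (`|p.1 - p.2| ^+ 2)%:E = (\int[G]_p (p1 p - p2 p) ^+ 2)%:E)%E.
Proof.
have b2 : bmeas (fun p => (p1 p - p2 p) ^+ 2) by apply: bmeasX; exact: bmeasB.
rewrite -(bmeas_integralE G b2) /G (@integral_mrestr _ (borelR2 R) R g setT measurableT).
apply: ae_eq_integral_nonmeas => //; first by apply/measurable_EFinP; exact: bmeas_measurable b2.
have mO : measurable (~` `[- r, r]%classic : set (borelR R)).
  by apply: measurableC; exact: measurable_borelR_itv.
have outE (Z : R -> R) (l : {measure set (borelR R) -> \bar R}) : (forall s, `|Z s| <= r) ->
    (forall U : set (borelR R), measurable U -> l U = pushforward (lebI 0 H) Z U) ->
    l (~` `[- r, r]%classic) = 0%E.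
  move=> Zr lE; rewrite (lE _ mO) /pushforward (_ : _ @^-1` _ = set0) ?measure0//.
  by apply/seteqP; split => // s /=; rewrite in_itv/= -ler_norml Zr.
have ae1 : \forall p \ae g, `|p.1 : R| <= r.
  exists (~` `[- r, r]%classic `*` setT); split.
  - exact: measurableX.
  - by rewrite (cg.1 _ mO); exact: outE Xr mE.
  - by move=> p /= h; split => //; rewrite in_itv/= -ler_norml.
have ae2 : \forall p \ae g, `|p.2 : R| <= r.
  exists (setT `*` ~` `[- r, r]%classic); split.
  - exact: measurableX.
  - by rewrite (cg.2 _ mO); exact: outE Yr nE.
  - by move=> p /= h; split => //; rewrite in_itv/= -ler_norml.
apply: ae_imply2 ae1 ae2 => p h1 h2 _.
by rewrite /p1 /p2 !cl_id// real_normK ?num_real.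
Qed.

(** (x - y)^2 is expanded in x + r and y + r. The two squares depend on the marginals only, and by
    [layer_cake] and [corner] the cross term is largest for the monotone coupling. *)
Lemma hoeffding_plan : ((ibint 0 H (fun s => (X s - Y s) ^+ 2))%:E <= \int[g]_p (`|p.1 - p.2| ^+ 2)%:E)%E.
Proof.
rewrite cost lee_fin.
have bcr : bmeas (fun p => (p1 p + r) * (p2 p + r)) by apply: bmeasM; apply: bmeasD => //; exact: bmeas_cst.
have sq1 : bm (fun x => (cl x + r) ^+ 2).
  by apply: bmX; apply: bmD; [exact: bm_clamp|exact: bm_cst].
have bs1 : bmeas (fun p => (p1 p + r) ^+ 2) by apply: bmeasX; apply: bmeasD => //; exact: bmeas_cst.
have bs2 : bmeas (fun p => (p2 p + r) ^+ 2) by apply: bmeasX; apply: bmeasD => //; exact: bmeas_cst.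
have bt1 : bm (fun s => (X s + r) ^+ 2) by apply: bmX; apply: bmD => //; exact: bm_cst.
have bt2 : bm (fun s => (Y s + r) ^+ 2) by apply: bmX; apply: bmD => //; exact: bm_cst.
have btc : bm (fun s => (X s + r) * (Y s + r)) by apply: bmM; apply: bmD => //; exact: bm_cst.
have E1 : \int[G]_p (p1 p - p2 p) ^+ 2 = \int[G]_p (p1 p + r) ^+ 2 + \int[G]_p (p2 p + r) ^+ 2 -
    2 * \int[G]_p ((p1 p + r) * (p2 p + r)).
  rewrite -(bintD G bs1 bs2) -(bintZl G 2 bcr) -(bintB G (bmeasD bs1 bs2) (bmeasM (bmeas_cst _ 2) bcr)).
  by apply: eq_Rintegral => p _; ring.
have E2 : ibint 0 H (fun s => (X s - Y s) ^+ 2) = ibint 0 H (fun s => (X s + r) ^+ 2) +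
    ibint 0 H (fun s => (Y s + r) ^+ 2) - 2 * ibint 0 H (fun s => (X s + r) * (Y s + r)).
  rewrite -(ibintD 0 H bt1 bt2) -(ibintZl 0 H 2 btc) -(ibintB 0 H (bmD bt1 bt2) (bmM (bm_cst 2) btc)).
  by apply: eq_ibint => s _; ring.
have e1 : \int[G]_p (p1 p + r) ^+ 2 = ibint 0 H (fun s => (X s + r) ^+ 2).
  have := marg1 sq1; rewrite (_ : ibint 0 H _ = ibint 0 H (fun s => (X s + r) ^+ 2)).
    by move=> <-; apply: eq_Rintegral => p _; rewrite (cl_id (clr _)).
  by apply: eq_ibint => s _; rewrite cl_id.
have e2 : \int[G]_p (p2 p + r) ^+ 2 = ibint 0 H (fun s => (Y s + r) ^+ 2).
  have := marg2 sq1; rewrite (_ : ibint 0 H _ = ibint 0 H (fun s => (Y s + r) ^+ 2)).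
    by move=> <-; apply: eq_Rintegral => p _; rewrite (cl_id (clr _)).
  by apply: eq_ibint => s _; rewrite cl_id.
by rewrite E1 E2 e1 e2 lerD2l lerN2 ler_pM2l//; exact: cross.
Qed.

End plan.

Lemma W2sqE : W2sq m n = (ibint 0 H (fun s => (X s - Y s) ^+ 2))%:E.
Proof.
apply/eqP; rewrite eq_le W2sq_le/=; apply: le_ereal_inf_tmp => _ [g cg <-].
exact: hoeffding_plan.
Qed.

End hoeffding.

Section distance_representation.
Context {R : realType}.
Variables (mu : {sigma_finite_measure set (borelR R) -> \bar R}) (Rv : R) (h : R -> R).
Hypotheses (mh : measurable_fun setT (h : borelR R -> borelR R)) (h0 : forall a, 0 <= h a).
Hypothesis hfin : (\int[mu]_(a in levels Rv) (h a)%:E < +oo)%E.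
Let A : set (borelR R) := levels Rv.
Local Notation P := (level_measure mh h0 hfin).
Local Notation represents := (represents mu Rv h).

Let W2sq_ge0 (m n : {measure set (borelR R) -> \bar R}) : (0 <= W2sq m n)%E.
Proof.
apply: le_ereal_inf_tmp => _ [g _ <-]; apply: integral_ge0 => p _.
by rewrite lee_fin sqr_ge0.
Qed.

Lemma Xdist_le nu theta X Y r : 0 <= r -> represents nu X -> represents theta Y ->
  (forall a s, `|X a s| <= r) -> (forall a s, `|Y a s| <= r) ->
  (Xdist mu Rv nu theta <= (Num.sqrt (pint P (fun a s => (X a s - Y a s) ^+ 2)))%:E)%E.
Proof.
move=> r0 [bX aeX] [bY aeY] Xr Yr.
have bD : bm2 (fun a s => (X a s - Y a s) ^+ 2) by apply: bm2X; exact: bm2B.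
have D0 a s : 0 <= (X a s - Y a s) ^+ 2 by exact: sqr_ge0.
rewrite -powR12_sqrt ?pint_ge0// -poweR_EFin /Xdist.
have p0 : 0 <= 2^-1 :> R by rewrite invr_ge0.
apply: (@gt0_ler_poweR R 2^-1 p0).
- by rewrite in_itv/= leey andbT; apply: integral_ge0.
- by rewrite in_itv/= leey andbT lee_fin pint_ge0.
rewrite -level_integral//; apply: ge0_ae_le_integral.
- exact: measurable_levels.
- exact: level_measurable.
- by [].
- by move=> a _; rewrite lee_fin; apply: (ibint_ge0 (bm2_row a bD)) => s _; exact: D0.
- apply: ae_imply2 aeX aeY => a Xa Ya aA.
  exact: (W2sq_le (bm2_row a bX) (bm2_row a bY) (Xa aA) (Ya aA)).
Qed.

Lemma XdistE nu theta X Y r : 0 <= r -> represents nu X -> represents theta Y ->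
  (forall a s, `|X a s| <= r) -> (forall a s, `|Y a s| <= r) ->
  (forall a s s', s <= s' -> X a s <= X a s') -> (forall a s s', s <= s' -> Y a s <= Y a s') ->
  Xdist mu Rv nu theta = (Num.sqrt (pint P (fun a s => (X a s - Y a s) ^+ 2)))%:E.
Proof.
move=> r0 [bX aeX] [bY aeY] Xr Yr Xnd Ynd.
have bD : bm2 (fun a s => (X a s - Y a s) ^+ 2) by apply: bm2X; exact: bm2B.
have D0 a s : 0 <= (X a s - Y a s) ^+ 2 by exact: sqr_ge0.
rewrite -powR12_sqrt ?pint_ge0// -poweR_EFin /Xdist; congr (_ `^ _)%E.
rewrite -level_integral//; apply: ge0_ae_eq_integral_nonmeas.
- exact: measurable_levels.
- exact: level_measurable.
- by [].
- by move=> a _; rewrite lee_fin; apply: (ibint_ge0 (bm2_row a bD)) => s _; exact: D0.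
- apply: ae_imply2 aeX aeY => a Xa Ya aA.
  exact: (W2sqE r0 (bm2_row a bX) (bm2_row a bY) (Xr a) (Yr a) (Xa aA) (Ya aA) (Xnd a) (Ynd a)).
Qed.

End distance_representation.

(** * Continuous functions on the plane *)

Section plane_functions.
Context {R : realType}.

(** An open set is the union of the rational boxes that it contains: countably many products of
    intervals. *)
Lemma open_plane_measurable (U : set (R * R)) : open U -> measurable (U : set (borelR2 R)).
Proof.
move=> oU.
pose box (k : (rat * rat) * (rat * rat)) : set (R * R) :=
  `]ratr k.1.1, ratr k.1.2[%classic `*` `]ratr k.2.1, ratr k.2.2[%classic.
pose F k : set (borelR2 R) := if pselect (box k `<=` U) then box k else set0.
have -> : U = \bigcup_k F k.
  apply/seteqP; split => [p Up|p [k _]]; last by rewrite /F; case: pselect => // bU /bU.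
  have /nbhs_ballP[e e0 be] := open_nbhs_nbhs (conj oU Up).
  have h1 (x : R) : x - e < x by rewrite ltrBlDr ltrDl.
  have h2 (x : R) : x < x + e by rewrite ltrDl.
  have [q1] := rat_in_itvoo (h1 p.1); have [q2] := rat_in_itvoo (h2 p.1).
  have [q3] := rat_in_itvoo (h1 p.2); have [q4] := rat_in_itvoo (h2 p.2).
  rewrite !in_itv/= => /andP[a1 a2] /andP[a3 a4] /andP[a5 a6] /andP[a7 a8].
  exists ((q1, q2), (q3, q4)) => //; rewrite /F; case: pselect => [bU|[]].
    by rewrite /box /=; split; rewrite /= in_itv/=; apply/andP; split.
  move=> [x y] []; rewrite /= !in_itv/= => /andP[x1 x2] /andP[y1 y2].
  by apply: be; split; rewrite -ball_normE /= ltr_norml; apply/andP; split; lra.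
apply: countable_bigcupT_measurable; first exact: countableP.
move=> k; rewrite /F; case: pselect => [kU|nkU]; last exact: measurable0.
by apply: measurableX; exact: measurable_borelR_itv.
Qed.

Lemma continuous_plane_measurable (phi : R * R -> R) : continuous phi ->
  measurable_fun setT (phi : borelR2 R -> borelR R).
Proof.
move=> cphi.
apply: (@measurability _ _ _ (borelR R) _ _ (@RGenOInfty.G R) (RGenOInfty.measurableE R)) => _ [_ [c ->] <-]; rewrite setTI.
apply: open_plane_measurable; by apply: open_comp => //; exact: interval_open.
Qed.

Lemma bm2_plane (phi : R * R -> R) (F G : R -> R -> R) : continuous phi -> bm2 F -> bm2 G ->
  bm2 (fun x y => phi (F x y, G x y)).
Proof.
move=> cphi [mF [MF FM]] [mG [MG GM]]; split.
  have mp : measurable_fun setT (fun p : borelR2 R => (F p.1 p.2, G p.1 p.2) : borelR2 R).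
    by apply/measurable_fun_pairP; split.
  exact: measurableT_comp (continuous_plane_measurable cphi) mp.
have cK : compact (`[- MF, MF]%classic `*` `[- MG, MG]%classic : set (R * R)).
  by apply: compact_setX; exact: segment_compact.
have := continuous_compact (continuous_subspaceT cphi) cK.
move=> /compact_bounded [M [_ hM]]; exists (M + 1) => p.
have M1 : M < M + 1 by rewrite ltrDl.
apply: (hM _ M1); exists (F p.1 p.2, G p.1 p.2) => //; split; rewrite /= in_itv/= -ler_norml.
  exact: (FM p).
exact: (GM p).
Qed.

End plane_functions.

(** * Gradient flows in Lagrangian form *)

Lemma clampN {R : realType} (C z : R) : 0 <= C -> clamp (- C) C (- z) = - clamp (- C) C z.
Proof.
move=> C0; rewrite /clamp /Order.max /Order.min; do ?case: ifPn; rewrite -?leNgt; lra.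
Qed.

Section flow_representation.
Context {R : realType}.
Variables (mu : {sigma_finite_measure set (borelR R) -> \bar R}) (Rv : R) (h : R -> R).
Hypotheses (mh : measurable_fun setT (h : borelR R -> borelR R)) (h0 : forall a, 0 <= h a).
Hypothesis hfin : (\int[mu]_(a in levels Rv) (h a)%:E < +oo)%E.
Hypothesis Rv0 : 0 < Rv.
Let A : set (borelR R) := levels Rv.
Local Notation P := (level_measure mh h0 hfin).
Local Notation E := (lagrangian_energy mh h0 hfin).
Local Notation C := (speed_bound mh h0 hfin).
Local Notation represents := (represents mu Rv h).

Lemma in_XR_le (r r' : R) (nu : level_family R) : r <= r' ->
  in_XR mu Rv h r nu -> in_XR mu Rv h r' nu.
Proof.
move=> rr' [H1 H2]; split => //; apply: ae_imply H2 => a + aA => /(_ aA) H x /H /=.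
by rewrite !in_itv/= => /andP[x1 x2]; rewrite (le_trans x2 rr') (le_trans _ x1)// lerN2.
Qed.

Section flow.
Variables (T r : R) (nu0 : level_family R) (nu : R -> level_family R) (v : R -> R -> R -> R).
Hypotheses (T0 : 0 < T) (r0 : 0 <= r).
Hypothesis nu_XR : forall t, t \in `[0, T] -> in_XR mu Rv h r (nu t).
Hypothesis nu_meas : forall U : set (borelR R), measurable U ->
  measurable_fun ((`[0, T]%classic : set (borelR R)) `*` A) (fun p : borelR2 R => nu p.1 p.2 U).
Hypothesis nu_init : eq_family mu Rv (nu 0) nu0.
Hypothesis v_meas : measurable_fun (((`[0, T]%classic : set (borelR R)) `*` A) `*` setT)
  (fun p : (borelR2 R * borelR R)%type => v p.1.1 p.1.2 p.2 : borelR R).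
Hypothesis v_sub : \forall t \ae (@lebesgue_measure R), t \in `[0, T] ->
  subdiff mu Rv h (nu t) (fun a x => - v t a x).
Hypothesis v_cont : \forall a \ae mu, A a ->
  continuity_eq T (nu0 a) (fun t => nu t a) (fun t => v t a).

Let D : set (borelR2 R) := (`[0, T]%classic : set (borelR R)) `*` A.
Let mD : measurable D.
Proof. by apply: measurableX; [exact: measurable_borelR_itv|exact: measurable_levels]. Qed.
Let m (i : borelR2 R) : {measure set (borelR R) -> \bar R} := nu i.1 i.2.
Let Hh (i : borelR2 R) : R := h i.2.
Let mHh : measurable_fun setT (Hh : borelR2 R -> borelR R).
Proof. exact: measurableT_comp mh measurable_snd. Qed.
Let Hh0 i : 0 <= Hh i. Proof. exact: h0. Qed.

(** The quantile is taken with the pair (t, a) as parameter, on the domain [D] where joint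
    measurability of the curve is assumed. This makes the field jointly measurable in time, level
    and s. *)
Let X (t a s : R) : R := quantile m D Hh r (t, a) s.

Let bX : bm3 X.
Proof.
have := bmeas_quantile mD nu_meas mHh Hh0 r0.
apply: (bmeas_comp (h := fun q : borelR R * borelR2 R => ((q.1, q.2.1), q.2.2) : borelR2 R * borelR R)).
apply/measurable_fun_pairP; split; last exact: measurableT_comp measurable_snd measurable_snd.
apply/measurable_fun_pairP; split; first exact: measurable_fst.
exact: measurableT_comp measurable_fst measurable_snd.
Qed.

Let Xr t a s : `|X t a s| <= r. Proof. exact: quantile_norm. Qed.
Let Xnd t a s s' : s <= s' -> X t a s <= X t a s'. Proof. exact: quantile_nd. Qed.

Let t0T (t : R) : 0 <= t <= T -> t \in `[0, T]. Proof. by rewrite in_itv. Qed.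

Let inD t a : 0 <= t <= T -> A a -> D (t, a).
Proof. by move=> tT aA; split => //=; rewrite in_itv. Qed.

(** The pairs at which the quantile has the right law, together with those outside [D]. As this set
    is measurable, a.e. level at each time becomes a.e. time at a.e. level. *)
Let lawset : set (borelR2 R) := [set i | D i -> quantile_ok m D Hh i /\ m i (~` `[- r, r]%classic) = 0%E].

Let lawset_law t a : 0 <= t <= T -> A a -> lawset (t, a) -> forall U : set (borelR R), measurable U ->
  nu t a U = pushforward (lebI 0 (h a)) (X t a) U.
Proof.
move=> tT aA /(_ (inD tT aA)) [ok out].
exact: (quantile_law mD nu_meas mHh Hh0 r0 ok out).
Qed.

Let mlaw : measurable lawset.
Proof.
have mO : measurable (~` `[- r, r]%classic : set (borelR R)).
  by apply: measurableC; exact: measurable_borelR_itv.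
pose f1 := (fun i => m i setT) \_ D; pose f2 := (fun i => m i (~` `[- r, r]%classic)) \_ D.
have m1 : measurable_fun setT f1.
  have H := nu_meas (@measurableT _ (borelR R)); exact: (measurable_restrictT _ mD).1 H.
have m2 : measurable_fun setT f2.
  have H := nu_meas mO; exact: (measurable_restrictT _ mD).1 H.
rewrite (_ : lawset = ~` D `|` ((fun i => (f1 i == (Hh i)%:E) && (f2 i == 0%E)) @^-1` [set true])).
  apply: measurableU; first exact: measurableC.
  rewrite -[Y in measurable Y]setTI.
  suff H : measurable_fun setT (fun i => (f1 i == (Hh i)%:E) && (f2 i == 0%E)) by exact: H.
  apply: measurable_and; apply: measurable_fun_eqe => //; exact/measurable_EFinP.
apply/seteqP; split => i /=.
  move=> li; have [Di|nDi] := pselect (D i); last by left.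
  right; have [ok out] := li Di; rewrite /f1 /f2 !patchE mem_set// out eqxx andbT.
  by move: ok; rewrite /quantile_ok => /andP[].
move=> [nDi /(nDi)//|/andP[e1 e2] Di]; move: e1 e2; rewrite /f1 /f2 !patchE mem_set// => e1 /eqP e2.
by split => //; rewrite /quantile_ok mem_set.
Qed.

Let law_ae t : 0 <= t <= T -> \forall a \ae mu, lawset (t, a).
Proof.
move=> tT; have [[mass _] supp] := nu_XR (t0T tT).
apply: ae_imply2 mass supp => a ma sa [_ aA]; split.
  by rewrite /quantile_ok mem_set/= ?ma ?eqxx//; exact: inD.
by apply: msupport_null; exact: sa.
Qed.

Let nu_repr t : 0 <= t <= T -> represents (nu t) (X t).
Proof.
move=> tT; split; first exact: (bm3_row t bX).
by apply: ae_imply (law_ae tT) => a la aA; exact: lawset_law.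
Qed.

Let nu0_repr : represents nu0 (X 0).
Proof.
have T00 : 0 <= (0 : R) <= T by rewrite lexx ltW.
have [bX0 HX0] := nu_repr T00; split => //.
by apply: ae_imply2 HX0 nu_init => a Ha ia aA U mU; rewrite -(ia aA)// Ha.
Qed.

Let vD (t a x : R) : R := if (t, a) \in D then v t a x else 0.

Let mvD : measurable_fun setT (fun p : borelR2 R * borelR R => vD p.1.1 p.1.2 p.2 : borelR R).
Proof.
have mDT : measurable (D `*` setT : set (borelR2 R * borelR R)) by exact: measurableX.
have H := (measurable_restrictT _ mDT).1 v_meas; move: H.
apply: eq_measurable_fun => -[[t a] x] _; rewrite patchE /vD /=.
by congr (if _ then _ else _); apply/idP/idP => /set_mem K; apply/mem_set => //; case: K.
Qed.

Let mvX : measurable_fun setT (fun q : borelR R * borelR2 R => vD q.1 q.2.1 (X q.1 q.2.1 q.2.2) : borelR R).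
Proof.
have mp : measurable_fun setT (fun q : borelR R * borelR2 R =>
    ((q.1, q.2.1), X q.1 q.2.1 q.2.2) : borelR2 R * borelR R).
  apply/measurable_fun_pairP; split; last exact: bmeas_measurable bX.
  apply/measurable_fun_pairP; split; first exact: measurable_fst.
  exact: measurableT_comp measurable_fst measurable_snd.
exact: measurableT_comp mvD mp.
Qed.

Let C0 : 0 <= C. Proof. exact: speed_bound_ge0. Qed.
Let CC : - C <= C. Proof. by apply: (@le_trans _ _ 0) => //; rewrite oppr_le0. Qed.

Let u (t a x : R) : R := clamp (- C) C (vD t a x).
Let V (t a s : R) : R := u t a (X t a s).

Let uC t a x : `|u t a x| <= C.
Proof. by rewrite ler_norml; apply/andP; split; [apply: clamp_ge|apply: clamp_le]. Qed.

Let bV : bm3 V. Proof. exact: (bmeas_clamp CC mvX). Qed.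

(** Here the truncation in [u] is inactive. By [subdiff_repr] this is so for a.e. t at a.e. point of
    the level space, and measurability of the set allows the quantifiers to be exchanged. *)
Let slow : set (borelR R * borelR2 R) := [set q | `|vD q.1 q.2.1 (X q.1 q.2.1 q.2.2)| <= C].
Let mslow : measurable slow.
Proof.
rewrite (_ : slow = (fun q : borelR R * borelR2 R => `|vD q.1 q.2.1 (X q.1 q.2.1 q.2.2)| <= C) @^-1` [set true])//.
rewrite -[Y in measurable Y]setTI.
suff H : measurable_fun setT (fun q : borelR R * borelR2 R => `|vD q.1 q.2.1 (X q.1 q.2.1 q.2.2)| <= C) by exact: H.
by apply: measurable_fun_ler => //; exact: measurableT_comp.
Qed.

Let sub_ae : \forall t \ae lebI 0 T, (\forall p \ae P, slow (t, p)) /\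
  forall Y, bm2 Y -> pint P (fun a s => - V t a s * (Y a s - X t a s)) <= E Y - E (X t).
Proof.
apply/ae_lebI; apply: ae_imply v_sub => t + tT; rewrite in_itv/= => /(_ tT) sub.
have [ab ineq] := subdiff_repr mh h0 hfin Rv0 (nu_repr tT) sub.
have vE a x : on_levels Rv (fun a x => - v t a x) a x = - vD t a x.
  rewrite /on_levels /vD; have [aA|aA] := boolP (a \in levels Rv).
    by rewrite mem_set//; apply: inD => //; exact: set_mem.
  by rewrite memNset ?oppr0// => -[_] /= aA'; move: aA; rewrite mem_set.
split; first by apply: ae_imply ab => p; rewrite vE normrN.
move=> Y bY; have := ineq Y bY; congr (_ <= _); congr (pint P _).
apply/funext => a; apply/funext => s; rewrite vE; congr (_ * _).
by rewrite /V /u clampN.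
Qed.

Let level_facts : \forall a \ae mu, A a ->
  (\forall t \ae lebI 0 T, lawset (t, a)) /\
  (\forall t \ae lebI 0 T, \forall s \ae lebI 0 (h a), slow (t, (a, s))).
Proof.
have c2 : \forall a \ae mu, \forall t \ae lebI 0 T, lawset (t, a).
  apply: (@ae_swap _ _ (borelR R) (borelR R) R (lebI 0 T) mu lawset mlaw).
  by apply: ae_imply (ae_lebI_mem 0 T) => t; exact: law_ae.
have c3 : \forall p \ae P, \forall t \ae lebI 0 T, slow (t, p).
  apply: (@ae_swap _ _ (borelR R) (borelR2 R) R (lebI 0 T) P slow mslow).
  by apply: ae_imply sub_ae => t [].
apply: ae_imply2 c2 (ae_level c3) => a H2 H3 aA; split => //.
pose S : set (borelR2 R) := [set q | slow (q.2, (a, q.1))].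
have mS : measurable S.
  rewrite -[Y in measurable Y]setTI.
  have mp : measurable_fun setT (fun q : borelR2 R => (q.2, (a, q.1)) : borelR R * borelR2 R).
    apply/measurable_fun_pairP; split; first exact: measurable_snd.
    by apply/measurable_fun_pairP; split; [exact: measurable_cst|exact: measurable_fst].
  exact: (mp measurableT _ mslow).
exact: (@ae_swap _ _ (borelR R) (borelR R) R (lebI 0 (h a)) (lebI 0 T) S mS (H3 aA)).
Qed.

Let mv_level t a : D (t, a) -> measurable_fun setT (v t a : borelR R -> borelR R).
Proof.
move=> Dta.
have H : measurable_fun setT (fun x : borelR R => vD t a x : borelR R).
  exact: (measurableT_comp mvD (@measurable_pair1 _ _ (borelR2 R) (borelR R) (t, a))).
by move: H; apply: eq_measurable_fun => x _; rewrite /vD mem_set.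
Qed.

(** Integrals against [nu t a] become integrals along the quantile, with [u] in place of [v]. The
    law and the truncation are right for a.e. t only, which is enough under the time integral. *)
Let weak_transfer a (phi d1 d2 : R * R -> R) : A a ->
  continuous phi -> continuous d1 -> continuous d2 ->
  (forall U : set (borelR R), measurable U -> nu0 a U = pushforward (lebI 0 (h a)) (X 0 a) U) ->
  (\forall t \ae lebI 0 T, lawset (t, a)) ->
  (\forall t \ae lebI 0 T, \forall s \ae lebI 0 (h a), slow (t, (a, s))) ->
  (\int[lebesgue_measure]_(t in `[0%R, T]) \int[nu t a]_x (d1 (t, x) + v t a x * d2 (t, x))%:E
    + \int[nu0 a]_x (phi (0%R, x))%:E = 0)%E ->
  ibint 0 T (fun t => ibint 0 (h a) (fun s => d1 (t, X t a s) + u t a (X t a s) * d2 (t, X t a s)))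
  + ibint 0 (h a) (fun s => phi (0, X 0 a s)) = 0.
Proof.
move=> aA cphi c1 c2 init law slw.
have bXa : bm2 (fun t s => X t a s) by exact: bm3_level.
have bVa : bm2 (fun t s => V t a s) by exact: bm3_level.
have bct : bm2 (fun t _ => clamp 0 T t) by apply: bm2_fst; exact: bm_clamp (ltW T0).
pose K t s : R := d1 (clamp 0 T t, X t a s) + V t a s * d2 (clamp 0 T t, X t a s).
have bK : bm2 K.
  apply: bm2D; first exact: (bm2_plane c1 bct bXa).
  by apply: bm2M => //; exact: (bm2_plane c2 bct bXa).
have mline (f : R * R -> R) (t : R) : continuous f -> measurable_fun setT (fun x : borelR R => f (t, x) : borelR R).
  move=> cf; exact: measurableT_comp (continuous_plane_measurable cf) (@measurable_pair1 _ _ (borelR R) (borelR R) t).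
have bX0 : bm (X 0 a) by exact: (bm2_row 0 bXa).
have -> : (\int[nu0 a]_x (phi (0, x))%:E = (ibint 0 (h a) (fun s => phi (0, X 0 a s)))%:E)%E.
  rewrite ibintE; apply: (@bounded_transfer _ (borelR R) _ (borelR R) R (lebI 0 (h a)) (X 0 a) (nu0 a)
    (bmeas_measurable bX0) init (fun x => phi (0, x))); first exact: mline.
  by have := bm2_row 0 (bm2_plane cphi (bm2_cst 0) bXa).
have -> : (\int[lebesgue_measure]_(t in `[0%R, T]) \int[nu t a]_x
      (d1 (t, x) + v t a x * d2 (t, x))%:E =
    (ibint 0 T (fun t => ibint 0 (h a) (K t)))%:E)%E.
  rewrite -lebI_integralE ibintE -(bmeas_integralE (lebI 0 T) (bm_ibint 0 (h a) bK)).
  apply: ae_eq_integral_nonmeas => //.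
    by apply/measurable_EFinP; exact: bmeas_measurable (bm_ibint 0 (h a) bK).
  apply: ae_imply3 (ae_lebI_mem 0 T) law slw => t tT lt st _.
  have lawt := lawset_law tT aA lt.
  have bXt : bm (X t a) by exact: (bm2_row t bXa).
  have mvt := mv_level (inD tT aA).
  have ctt : clamp 0 T t = t by exact: clamp_id.
  have KE : K t = fun s => d1 (t, X t a s) + u t a (X t a s) * d2 (t, X t a s).
    by apply/funext => s; rewrite /K ctt.
  have mu_ : measurable_fun setT (fun x : borelR R => u t a x : borelR R).
    have H : measurable_fun setT (fun x : borelR R => vD t a x : borelR R).
      exact: (measurableT_comp mvD (@measurable_pair1 _ _ (borelR2 R) (borelR R) (t, a))).
    exact: bmeas_measurable (bmeas_clamp CC H).
  transitivity (\int[nu t a]_x (d1 (t, x) + u t a x * d2 (t, x))%:E)%E.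
    apply: ae_eq_integral_nonmeas => //.
      apply/measurable_EFinP; apply: measurable_funD; first exact: mline.
      by apply: measurable_funM => //; exact: mline.
    pose Q : set (borelR R) := [set x | `|vD t a x| <= C].
    have mQ : measurable Q.
      rewrite (_ : Q = (fun x : borelR R => `|vD t a x| <= C) @^-1` [set true])//.
      rewrite -[Y in measurable Y]setTI.
      suff H : measurable_fun setT (fun x : borelR R => `|vD t a x| <= C) by exact: H.
      apply: measurable_fun_ler => //; apply: measurableT_comp => //.
      exact: (measurableT_comp mvD (@measurable_pair1 _ _ (borelR2 R) (borelR R) (t, a))).
    have aeQ : \forall x \ae nu t a, Q x.
      exact: (@transfer_ae _ (borelR R) _ (borelR R) R (lebI 0 (h a)) (X t a) (nu t a)
        (bmeas_measurable bXt) lawt Q mQ st).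
    apply: ae_imply aeQ => x Qx _; congr (_ + _ * _)%:E.
    by rewrite /u clamp_id -?ler_norml// /vD mem_set//; exact: inD.
  rewrite ibintE (@bounded_transfer _ (borelR R) _ (borelR R) R (lebI 0 (h a)) (X t a) (nu t a)
    (bmeas_measurable bXt) lawt (fun x => d1 (t, x) + u t a x * d2 (t, x))).
  - by congr (_%:E); apply: eq_Rintegral => s _; rewrite KE.
  - apply: measurable_funD; first exact: mline.
    by apply: measurable_funM => //; exact: mline.
  - by rewrite -KE; exact: (bm2_row t bK).
move=> H; rewrite (_ : ibint 0 T _ = ibint 0 T (fun t => ibint 0 (h a) (K t))); first exact: EFin_inj H.
by apply: eq_ibint => t tT; apply: eq_ibint => s _; rewrite /K clamp_id.
Qed.

Let weak a : A a ->
  continuity_eq T (nu0 a) (fun t => nu t a) (fun t => v t a) ->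
  (forall U : set (borelR R), measurable U -> nu0 a U = pushforward (lebI 0 (h a)) (X 0 a) U) ->
  (\forall t \ae lebI 0 T, lawset (t, a)) ->
  (\forall t \ae lebI 0 T, \forall s \ae lebI 0 (h a), slow (t, (a, s))) ->
  forall phi, test_function T phi ->
  ibint 0 T (fun t => ibint 0 (h a) (fun s =>
     'D_(1, 0) phi (t, X t a s) + u t a (X t a s) * 'D_(0, 1) phi (t, X t a s)))
  + ibint 0 (h a) (fun s => phi (0, X 0 a s)) = 0.
Proof.
move=> aA [_ _ ceq] init law slw phi tf; have [Ck _] := tf.
have [_ _ _ c1 c2] := Ck 1%N.
exact: (weak_transfer aA (Ck 0%N) c1 c2 init law slw (ceq phi tf)).
Qed.

Let path_eq : \forall a \ae mu, A a -> \forall s \ae lebI 0 (h a), \forall t \ae lebI 0 T,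
  X t a s = X 0 a s + ibint 0 t (fun z => V z a s).
Proof.
have [_ init] := nu0_repr.
apply: ae_imply3 level_facts v_cont init => a H1 H2 H3 aA.
have [law slw] := H1 aA.
have W := weak aA (H2 aA) (H3 aA) law slw.
have FH t c : 0 <= qcdf m D Hh r (t, a) c <= h a.
  by apply: qcdf_bound => //; exact: Hh0.
have gal t s c : 0 < s <= h a -> (X t a s <= c) = (s <= qcdf m D Hh r (t, a) c).
  by move=> sH; apply: quantile_gal => //; exact: Hh0.
have [Gd [aeG HG]] := lagrangian_ae T0 (h0 a) r0 C0 (bm3_level a bX) (fun t s => Xr t a s)
  (bm3_level a bV) (fun t x => uC t a x) (fun t => @Xnd t a) gal FH W.
by apply: ae_imply HG => s Hs; apply: ae_imply aeG => t; exact: Hs.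
Qed.

Let prim (t a s : R) : R := ibint 0 T (fun z => (z <= t)%R%:R * V z a s).

(** [path_eq] holds for a.e. level, then a.e. s, then a.e. t. Integrating the jointly measurable
    defect [del] over everything allows the quantifiers to be read off in the other order. *)
Let flow_eq : \forall t \ae lebI 0 T, \forall p \ae P,
  X t p.1 p.2 = X 0 p.1 p.2 + prim t p.1 p.2.
Proof.
have bprim : bm3 prim by exact: bm3_primitive.
have bdel : bm3 (fun t a s => `|X t a s - (X 0 a s + prim t a s)|).
  apply: bm3_norm; apply: bm3B => //; apply: bm3D => //.
  by apply: bm3_space; exact: (bm3_row 0 bX).
pose del t a s := `|X t a s - (X 0 a s + prim t a s)|.
have bI : bm2 (fun a s => ibint 0 T (fun t => del t a s)) by exact: bm2_ibint.
pose Q : set (borelR2 R) := (fun p : borelR2 R => ibint 0 T (fun t => del t p.1 p.2) : borelR R) @^-1` [set 0].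
have mQ : measurable Q.
  by rewrite -[Y in measurable Y]setTI; apply: (bmeas_measurable bI).
have I0 : \forall p \ae P, Q p.
  apply: (@level_ae R mu Rv h mh h0 hfin Q mQ); apply: ae_imply path_eq => a Ha aA.
  apply: ae_imply (Ha aA) => s Hs; rewrite /Q /=; apply: ibint_eq0.
  apply: ae_imply2 (ae_lebI_mem 0 T) Hs => t /andP[t0 tT] e.
  by rewrite /del /prim (ibint_indic_le t0 tT (bm3_path a s bV)) -e subrr normr0.
have J0 : ibint 0 T (fun t => pint P (del t)) = 0.
  rewrite (ibint_pint_swap P 0 T bdel); apply: (@etrans _ _ _ _ _ (pint0 P)); apply: ae_eq_pint; first exact: bm2_cst.
  exact: I0.
have bdt t : bm2 (del t) by exact: (bm3_row t bdel).
have d0 t a s : 0 <= del t a s by exact: normr_ge0.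
have J1 := ibint_ae_eq0 (bm_pint P bdel) (fun t => pint_ge0 P (bdt t) (d0 t)) J0.
apply: ae_imply J1 => t Ht; apply: ae_imply (@pint_ae_eq0 _ P _ (bdt t) (d0 t) Ht) => p /eqP.
by rewrite normr_eq0 subr_eq0 => /eqP.
Qed.

Lemma flow_repr : exists X V : R -> R -> R -> R,
  [/\ [/\ bm3 X, bm3 V, forall t a s, `|X t a s| <= r & forall t a s s', s <= s' -> X t a s <= X t a s'],
      (forall t, 0 <= t <= T -> represents (nu t) (X t)), represents nu0 (X 0),
      \forall t \ae lebI 0 T, forall Y, bm2 Y ->
        pint P (fun a s => - V t a s * (Y a s - X t a s)) <= E Y - E (X t) &
      \forall t \ae lebI 0 T, \forall p \ae P, X t p.1 p.2 = X 0 p.1 p.2 +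
        ibint 0 T (fun z => (z <= t)%R%:R * V z p.1 p.2)].
Proof.
exists X, V; split => //.
by apply: ae_imply sub_ae => t [].
Qed.

End flow.
End flow_representation.

(** * Squares of primitives and the triangle inequality *)

Section square_of_primitive.
Context {R : realType}.

(** f(y) f(z) is symmetric, so the triangle {y <= z} carries half of its integral over the
    square. *)
Let sym (T : R) (f : R -> R) : 0 <= T -> bm f ->
  2 * ibint 0 T (fun z => ibint 0 T (fun y => (y <= z)%R%:R * f y) * f z) = (ibint 0 T f) ^+ 2.
Proof.
move=> T0 bf.
pose F z y := (y <= z)%R%:R * f y * f z.
have bF : bm2 F.
  apply: bm2M; last exact: bm2_fst.
  by apply: bm2M; [exact: (bm2_swap bm2_le)|exact: bm2_snd].
have bF' : bm2 (fun z y => F y z) by exact: bm2_swap.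
have -> : ibint 0 T (fun z => ibint 0 T (fun y => (y <= z)%R%:R * f y) * f z) =
    ibint 0 T (fun z => ibint 0 T (F z)).
  apply: eq_ibint => z _; rewrite -ibintZr//.
  by apply: bmM => //; exact: bm_le.
rewrite mulr2n mulrDl mul1r {2}(ibint_swap 0 T 0 T bF) -ibintD; [|exact: bm_ibint|exact: (bm_ibint 0 T bF')].
rewrite expr2 -ibintZl//; apply: eq_ibint => z _.
rewrite -ibintD; [|exact: (bm2_row z bF)|exact: (bm2_row z bF')].
rewrite -ibintZr//; apply: ae_eq_ibint; first by apply: bmM => //; exact: bm_cst.
apply: ae_imply (ae_lebI_neq 0 T z) => y yz; rewrite /F.
have [l|l|//] := ltgtP (y : R) z.
  by rewrite mul1r !mul0r addr0.
by rewrite !mul0r mul1r add0r mulrC.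
Qed.

(** The chain rule for the square of an absolutely continuous function, obtained from Fubini instead
    of differentiation. *)
Lemma sqr_primitive (T t c : R) (f : R -> R) : 0 <= t <= T -> bm f ->
  (c + ibint 0 T (fun y => (y <= t)%R%:R * f y)) ^+ 2 = c ^+ 2 +
  2 * ibint 0 t (fun z => (c + ibint 0 T (fun y => (y <= z)%R%:R * f y)) * f z).
Proof.
move=> /andP[t0 tT] bf.
have bG : bm (fun z => ibint 0 t (fun y => (y <= z)%R%:R * f y)).
  by apply: bm_ibint; apply: bm2M; [exact: (bm2_swap bm2_le)|exact: bm2_snd].
have -> : ibint 0 t (fun z => (c + ibint 0 T (fun y => (y <= z)%R%:R * f y)) * f z) =
    ibint 0 t (fun z => c * f z + ibint 0 t (fun y => (y <= z)%R%:R * f y) * f z).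
  apply: eq_ibint => z /andP[z0 zt]; rewrite mulrDl.
  by rewrite !ibint_indic_le// (le_trans zt tT).
rewrite ibintD; [|by apply: bmM => //; exact: bm_cst|exact: bmM].
rewrite ibintZl// ibint_indic_le// mulrDr sym//; ring.
Qed.

End square_of_primitive.

Section minkowski.
Context {R : realType}.
Variable P : {finite_measure set (borelR2 R) -> \bar R}.

(** Young's inequality with weights given by the two norms; e / 2 is added to each so that the
    weights are positive even when a norm vanishes. *)
Lemma minkowski_pint (f g : R -> R -> R) : bm2 f -> bm2 g ->
  Num.sqrt (pint P (fun a s => (f a s + g a s) ^+ 2)) <=
  Num.sqrt (pint P (fun a s => f a s ^+ 2)) + Num.sqrt (pint P (fun a s => g a s ^+ 2)).
Proof.
move=> bf bg.
have bf2 := bm2X 2 bf; have bg2 := bm2X 2 bg; have bfg2 := bm2X 2 (bm2D bf bg).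
set A := pint P (fun a s => f a s ^+ 2); set B := pint P (fun a s => g a s ^+ 2).
have A0 : 0 <= A by apply: pint_ge0 => // a s; exact: sqr_ge0.
have B0 : 0 <= B by apply: pint_ge0 => // a s; exact: sqr_ge0.
have AE : Num.sqrt A ^+ 2 = A by exact: sqr_sqrtr.
have BE : Num.sqrt B ^+ 2 = B by exact: sqr_sqrtr.
apply/ler_addgt0Pr => e e0.
set a := Num.sqrt A in AE *; set b := Num.sqrt B in BE *.
have a0 : 0 <= a by exact: sqrtr_ge0.
have b0 : 0 <= b by exact: sqrtr_ge0.
pose a' := a + e / 2; pose b' := b + e / 2.
have a'0 : 0 < a' by rewrite /a'; lra.
have b'0 : 0 < b' by rewrite /b'; lra.
rewrite (_ : a + b + e = a' + b'); last by rewrite /a' /b'; field.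
rewrite -(@ler_sqr R) ?nnegrE ?sqrtr_ge0//; last by rewrite addr_ge0// ltW.
rewrite sqr_sqrtr; last by apply: pint_ge0 => // x y; exact: sqr_ge0.
have c1 : bm2 (fun x y => (1 + b' / a') * f x y ^+ 2) by apply: bm2M => //; exact: bm2_cst.
have c2 : bm2 (fun x y => (1 + a' / b') * g x y ^+ 2) by apply: bm2M => //; exact: bm2_cst.
apply: (@le_trans _ _ ((1 + b' / a') * A + (1 + a' / b') * B)).
  rewrite -!pintZl// -pintD//; apply: le_pint => //; first exact: bm2D.
  move=> x y; rewrite -subr_ge0.
  rewrite (_ : _ - _ = (b' * f x y - a' * g x y) ^+ 2 / (a' * b')); last first.
    by field; rewrite !gt_eqF.
  by rewrite divr_ge0 ?sqr_ge0// mulr_ge0 ?ltW.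
have Aa : A <= a' ^+ 2 by rewrite -AE ler_sqr ?nnegrE ?(ltW a'0)// /a'; lra.
have Bb : B <= b' ^+ 2 by rewrite -BE ler_sqr ?nnegrE ?(ltW b'0)// /b'; lra.
apply: (@le_trans _ _ ((1 + b' / a') * a' ^+ 2 + (1 + a' / b') * b' ^+ 2)).
  by apply: lerD; rewrite ler_wpM2l// addr_ge0// divr_ge0// ltW.
by rewrite le_eqVlt; apply/orP; left; apply/eqP; field; rewrite !gt_eqF.
Qed.

End minkowski.

(** * Contraction and separation *)

Section contraction.
Context {R : realType}.
Variables (mu : {sigma_finite_measure set (borelR R) -> \bar R}) (Rv : R) (h : R -> R).
Hypotheses (mh : measurable_fun setT (h : borelR R -> borelR R)) (h0 : forall a, 0 <= h a).
Hypothesis hfin : (\int[mu]_(a in levels Rv) (h a)%:E < +oo)%E.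
Hypothesis Rv0 : 0 < Rv.
Local Notation P := (level_measure mh h0 hfin).
Local Notation E := (lagrangian_energy mh h0 hfin).
Local Notation represents := (represents mu Rv h).

(** Each flow is tested against the field of the other. The energies cancel in the sum, which says
    that the integral of (X - Y)(V - W) is nonpositive, and [sqr_primitive] integrates this in
    time. *)
Let dissipation (T : R) (X V Y W : R -> R -> R -> R) : 0 < T ->
  bm3 X -> bm3 V -> bm3 Y -> bm3 W ->
  (\forall t \ae lebI 0 T, forall Z, bm2 Z ->
        pint P (fun a s => - V t a s * (Z a s - X t a s)) <= E Z - E (X t)) ->
  (\forall t \ae lebI 0 T, forall Z, bm2 Z ->
        pint P (fun a s => - W t a s * (Z a s - Y t a s)) <= E Z - E (Y t)) ->
  (\forall t \ae lebI 0 T, \forall p \ae P, X t p.1 p.2 = X 0 p.1 p.2 +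
        ibint 0 T (fun z => (z <= t)%R%:R * V z p.1 p.2)) ->
  (\forall t \ae lebI 0 T, \forall p \ae P, Y t p.1 p.2 = Y 0 p.1 p.2 +
        ibint 0 T (fun z => (z <= t)%R%:R * W z p.1 p.2)) ->
  \forall t \ae lebI 0 T, pint P (fun a s => (X t a s - Y t a s) ^+ 2) <=
    pint P (fun a s => (X 0 a s - Y 0 a s) ^+ 2).
Proof.
move=> T0 bX bV bY bW sX sY eX eY.
pose f z a s := V z a s - W z a s; have bf : bm3 f by exact: bm3B.
pose D0 a s := X 0 a s - Y 0 a s.
have bD0 : bm2 D0 by apply: bm2B; [exact: bm3_row bX|exact: bm3_row bY].
pose D z a s := D0 a s + ibint 0 T (fun y => (y <= z)%R%:R * f y a s).
have bD : bm3 D by apply: bm3D; [exact: bm3_space|exact: bm3_primitive].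
have DE : \forall t \ae lebI 0 T, \forall p \ae P, X t p.1 p.2 - Y t p.1 p.2 = D t p.1 p.2.
  apply: ae_imply2 eX eY => t hX hY; apply: ae_imply2 hX hY => p -> ->; rewrite /D /D0 /f.
  have bv := bm3_path p.1 p.2 bV; have bw := bm3_path p.1 p.2 bW.
  have b1 : bm (fun z => (z <= t)%R%:R * V z p.1 p.2) by apply: bmM => //; exact: bm_le.
  have b2 : bm (fun z => (z <= t)%R%:R * W z p.1 p.2) by apply: bmM => //; exact: bm_le.
  rewrite (_ : ibint 0 T (fun y => (y <= t)%R%:R * (V y p.1 p.2 - W y p.1 p.2)) =
    ibint 0 T (fun z => (z <= t)%R%:R * V z p.1 p.2) - ibint 0 T (fun z => (z <= t)%R%:R * W z p.1 p.2)).
    by ring.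
  by rewrite -ibintB//; apply: eq_ibint => z _; ring.
have bDf : bm3 (fun z a s => D z a s * f z a s) by exact: bm3M.
have neg : \forall z \ae lebI 0 T, pint P (fun a s => D z a s * f z a s) <= 0.
  apply: ae_imply3 sX sY DE => z hX hY hD.
  have bXz := bm3_row z bX; have bYz := bm3_row z bY.
  have bVz := bm3_row z bV; have bWz := bm3_row z bW.
  have b1 : bm2 (fun a s => - V z a s * (Y z a s - X z a s)) by apply: bm2M; [exact: bm2N|exact: bm2B].
  have b2 : bm2 (fun a s => - W z a s * (X z a s - Y z a s)) by apply: bm2M; [exact: bm2N|exact: bm2B].
  have := lerD (hX _ bYz) (hY _ bXz); rewrite -pintD// addrA subrK subrr.
  apply: le_trans; rewrite le_eqVlt; apply/orP; left; apply/eqP.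
  apply: ae_eq_pint; first exact: bm2D.
  by apply: ae_imply hD => p <-; rewrite /f; ring.
apply: ae_imply2 (ae_lebI_mem 0 T) DE => t /andP[t0 tT] hD.
rewrite (ae_eq_pint (g := fun a s => D t a s ^+ 2)); last 2 first.
- by apply: bm2X; exact: bm3_row bD.
- by apply: ae_imply hD => p ->.
rewrite (_ : (fun a s => D t a s ^+ 2) = fun a s => D0 a s ^+ 2 + 2 * ibint 0 t (fun z => D z a s * f z a s)).
  have b3 : bm2 (fun a s => ibint 0 t (fun z => D z a s * f z a s)) by exact: bm2_ibint.
  rewrite pintD; [|exact: bm2X|by apply: bm2M => //; exact: bm2_cst].
  rewrite pintZl// gerDl -(ibint_pint_swap P 0 t bDf) pmulr_rle0//.
  apply: (@le_trans _ _ (ibint 0 t (fun=> 0))); last by rewrite ibint0.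
  apply: ae_le_ibint; [exact: bm_pint|exact: bm_cst|].
  exact: (ae_lebIW (lexx 0) tT neg).
apply/funext => a; apply/funext => s; rewrite /D (sqr_primitive _ _ (bm3_path a s bf))//.
by rewrite t0.
Qed.

(** [dissipation] holds for a.e. time only. Both curves are Lipschitz for [Xdist], so a good time
    close to t and the triangle inequality settle every t. *)
Lemma flow_contraction nu0 theta0 nu theta v w (t : R) :
  gradient_flow mu Rv h nu0 nu v -> gradient_flow mu Rv h theta0 theta w -> 0 <= t ->
  (Xdist mu Rv (nu t) (theta t) <= Xdist mu Rv nu0 theta0)%E.
Proof.
(* With t + 1 the horizon is positive also for t = 0. *)
move=> gnu gtheta t0; pose T := t + 1.
have T0 : 0 < T by rewrite ltr_wpDl.
have [[r1 r10 nuXR] [[L1 lip1] [m1 [i1 [mv1 [_ [s1 c1]]]]]]] := gnu T T0.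
have [[r2 r20 thXR] [[L2 lip2] [m2 [i2 [mv2 [_ [s2 c2]]]]]]] := gtheta T T0.
pose r := Num.max r1 r2.
have r1r : r1 <= r by rewrite le_max lexx.
have r2r : r2 <= r by rewrite le_max lexx orbT.
have r0 : 0 <= r by apply: le_trans r1r; exact: ltW.
have [X [V [[bX bV Xr Xnd] rX rX0 sX eX]]] := flow_repr mh h0 hfin Rv0 T0 r0
  (fun z zT => in_XR_le r1r (nuXR z zT)) m1 i1 mv1 s1 c1.
have [Y [W [[bY bW Yr Ynd] rY rY0 sY eY]]] := flow_repr mh h0 hfin Rv0 T0 r0
  (fun z zT => in_XR_le r2r (thXR z zT)) m2 i2 mv2 s2 c2.
have dis := dissipation T0 bX bV bY bW sX sY eX eY.
have tT : 0 <= t <= T by rewrite t0 /T lerDl ler01.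
rewrite (XdistE mh h0 hfin r0 (rX t tT) (rY t tT) (Xr t) (Yr t) (Xnd t) (Ynd t)).
rewrite (XdistE mh h0 hfin r0 rX0 rY0 (Xr 0) (Yr 0) (Xnd 0) (Ynd 0)) lee_fin.
set Dt := pint P _; set D0 := pint P _.
apply/ler_addgt0Pr => e e0.
pose L := `|L1| + `|L2| + 1; have L0 : 0 < L by rewrite ltr_wpDl// addr_ge0.
have eL : 0 < e / L by rewrite divr_gt0.
have [z [zT tz Dz]] := ae_lebI_dense T0 tT eL dis.
have inT x : 0 <= x <= T -> x \in `[0, T] by rewrite in_itv.
have h1 : Num.sqrt (pint P (fun a s => (X t a s - X z a s) ^+ 2)) <= L1 * `|t - z|.
  rewrite -lee_fin -(XdistE mh h0 hfin r0 (rX t tT) (rX z zT) (Xr t) (Xr z) (Xnd t) (Xnd z)).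
  by apply: lip1; exact: inT.
have h2 : Num.sqrt (pint P (fun a s => (Y z a s - Y t a s) ^+ 2)) <= L2 * `|t - z|.
  rewrite -lee_fin -(XdistE mh h0 hfin r0 (rY z zT) (rY t tT) (Yr z) (Yr t) (Ynd z) (Ynd t)).
  by rewrite distrC; apply: lip2; exact: inT.
have bXt := bm3_row t bX; have bYt := bm3_row t bY.
have bXz := bm3_row z bX; have bYz := bm3_row z bY.
have M1 := minkowski_pint P (bm2B bXt bXz) (bm2B bXz bYt).
have M2 := minkowski_pint P (bm2B bXz bYz) (bm2B bYz bYt).
have E1 : Num.sqrt Dt <= Num.sqrt (pint P (fun a s => (X t a s - X z a s) ^+ 2)) +
    Num.sqrt (pint P (fun a s => (X z a s - Y t a s) ^+ 2)).
  apply: le_trans M1; rewrite le_eqVlt; apply/orP; left; apply/eqP; congr (Num.sqrt (pint P _)).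
  by apply/funext => a; apply/funext => s; congr (_ ^+ 2); ring.
have E2 : Num.sqrt (pint P (fun a s => (X z a s - Y t a s) ^+ 2)) <=
    Num.sqrt (pint P (fun a s => (X z a s - Y z a s) ^+ 2)) +
    Num.sqrt (pint P (fun a s => (Y z a s - Y t a s) ^+ 2)).
  apply: le_trans M2; rewrite le_eqVlt; apply/orP; left; apply/eqP; congr (Num.sqrt (pint P _)).
  by apply/funext => a; apply/funext => s; congr (_ ^+ 2); ring.
have E3 : Num.sqrt (pint P (fun a s => (X z a s - Y z a s) ^+ 2)) <= Num.sqrt D0 by exact: ler_wsqrtr.
have Le : L * `|t - z| <= e by rewrite mulrC -ler_pdivlMr// ltW.
have l1 : L1 * `|t - z| <= `|L1| * `|t - z| by rewrite ler_wpM2r// ler_norm.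
have l2 : L2 * `|t - z| <= `|L2| * `|t - z| by rewrite ler_wpM2r// ler_norm.
have n0 := normr_ge0 (t - z).
move: Le; rewrite /L !mulrDl mul1r => Le; lra.
Qed.

Lemma Xdist_eq0 (r : R) nu theta : 0 <= r -> in_XR mu Rv h r nu -> in_XR mu Rv h r theta ->
  (Xdist mu Rv nu theta <= 0)%E -> eq_family mu Rv nu theta.
Proof.
move=> r0 nuR thR.
have rX := in_XR_repr mh h0 r0 nuR; have rY := in_XR_repr mh h0 r0 thR.
set X := quantile _ _ _ _ in rX; set Y := quantile _ _ _ _ in rY.
have Xr a s : `|X a s| <= r by exact: quantile_norm.
have Yr a s : `|Y a s| <= r by exact: quantile_norm.
rewrite (XdistE mh h0 hfin r0 rX rY Xr Yr); last 2 first.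
- by move=> a s s' ss'; exact: quantile_nd.
- by move=> a s s' ss'; exact: quantile_nd.
have [bX aeX] := rX; have [bY aeY] := rY.
have bD : bm2 (fun a s => (X a s - Y a s) ^+ 2) by apply: bm2X; exact: bm2B.
have D0 a s : 0 <= (X a s - Y a s) ^+ 2 by exact: sqr_ge0.
rewrite lee_fin -sqrtr0 ler_sqrt// => H.
have {}H : pint P (fun a s => (X a s - Y a s) ^+ 2) = 0.
  by apply/eqP; rewrite eq_le H pint_ge0.
have XY := ae_level (@pint_ae_eq0 _ P _ bD D0 H).
apply: ae_imply3 XY aeX aeY => a XYa Xa Ya aA U mU.
rewrite (Xa aA U mU) (Ya aA U mU).
have mXU (Z : R -> R) : bm Z -> measurable ((Z : borelR R -> borelR R) @^-1` U).
  by move=> bZ; rewrite -[S in measurable S]setTI; exact: (bmeas_measurable bZ).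
have mX := mXU _ (bm2_row a bX); have mY := mXU _ (bm2_row a bY).
transitivity (\int[lebI 0 (h a)]_s (\1_((X a : borelR R -> borelR R) @^-1` U) s)%:E)%E.
  by rewrite integral_indic ?setIT.
transitivity (\int[lebI 0 (h a)]_s (\1_((Y a : borelR R -> borelR R) @^-1` U) s)%:E)%E; last first.
  by rewrite integral_indic ?setIT.
apply: ge0_ae_eq_integral_nonmeas => //.
- by apply/measurable_EFinP; exact: measurable_indic.
- apply: ae_imply (XYa aA) => s /= /eqP; rewrite sqrf_eq0 subr_eq0 => /eqP e _.
  by change ((\1_U (X a s))%:E = (\1_U (Y a s))%:E :> \bar R); rewrite e.
Qed.

End contraction.

(** * Euler scheme *)

Section euler_scheme.
Context {R : realType}.
Variables (mu : {sigma_finite_measure set (borelR R) -> \bar R}) (Rv : R) (h : R -> R).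
Hypotheses (mh : measurable_fun setT (h : borelR R -> borelR R)) (h0 : forall a, 0 <= h a).
Hypothesis hfin : (\int[mu]_(a in levels Rv) (h a)%:E < +oo)%E.
Hypothesis Rv0 : 0 < Rv.
Local Notation P := (level_measure mh h0 hfin).
Local Notation E := (lagrangian_energy mh h0 hfin).
Local Notation C := (speed_bound mh h0 hfin).
Local Notation mass := (fine (P setT)).
Variables (r : R) (X0 : R -> R -> R).
Hypotheses (r0 : 0 <= r) (bX0 : bm2 X0).

Let mass0 : 0 <= mass. Proof. exact: fine_ge0. Qed.
Let C0 : 0 <= C. Proof. exact: speed_bound_ge0. Qed.

(** The mean sign is a subgradient of [potential]. The convention that the sign of 0 is 0 keeps it
    antisymmetric under exchange of the two points, which [energy_subgradient] exploits. *)
Definition force (Z : R -> R -> R) (y : R) : R :=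
  2^-1 * pint P (fun a s => Num.sg (y - Z a (X0 a s))).

(** A subgradient of the energy at the field Z a (X0 a s), evaluated at position y. Despite the name
    it enters [euler] as minus the velocity. *)
Definition accel (Z : R -> R -> R) (a y : R) : R := force Z y + drift Rv a.

(** Only the points [X0 a s] exert a force; all other starting points are passive tracers. The
    truncation at step 0 makes every step bounded in x. *)
Fixpoint euler (tau : R) (k : nat) (a x : R) : R :=
  if k is k'.+1 then euler tau k' a x - tau * accel (euler tau k') a (euler tau k' a x)
  else clamp (- r) r x.

Let rr : - r <= r. Proof. by apply: le_trans r0; rewrite oppr_le0. Qed.

Lemma bmeas_sg d (T : measurableType d) (f : T -> R) : bmeas f -> bmeas (fun x => Num.sg (f x)).
Proof.
move=> [mf _]; apply: (@bmeas_le _ _ _ _ 1); last by move=> x; rewrite normr_sg lern1 leq_b1.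
rewrite (_ : (fun x => _) = fun x => if f x == 0 then 0 else if f x < 0 then - 1 else 1); last first.
  by apply/funext.
apply: measurable_fun_ifT; first by apply: measurable_fun_eqr => //; exact: measurable_cst.
  exact: measurable_cst.
apply: measurable_fun_ifT; first by apply: measurable_fun_ltr => //; exact: measurable_cst.
  exact: measurable_cst.
exact: measurable_cst.
Qed.

Lemma bm2_along (Z : R -> R -> R) : bm2 Z -> bm2 (fun a s => Z a (X0 a s)).
Proof.
apply: (bmeas_comp (h := fun p : borelR2 R => (p.1, X0 p.1 p.2) : borelR2 R)).
by apply/measurable_fun_pairP; split; [exact: measurable_fst|exact: bmeas_measurable bX0].
Qed.

Let bsg (Z : R -> R -> R) y : bm2 Z -> bm2 (fun a s => Num.sg (y - Z a (X0 a s))).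
Proof.
move=> bZ; apply: (@bmeas_sg _ (borelR2 R) (fun p => y - Z p.1 (X0 p.1 p.2))).
exact: (bm2B (bm2_cst y) (bm2_along bZ)).
Qed.

Lemma bm2_accel (Z W : R -> R -> R) : bm2 Z -> bm2 W -> bm2 (fun a x => accel Z a (W a x)).
Proof.
move=> bZ bW; apply: bm2D; last by apply: bm2_fst; exact: bm_drift.
apply: bm2M; first exact: bm2_cst.
apply: (@bm2_pint R P (fun a x a' s' => Num.sg (W a x - Z a' (X0 a' s')))).
apply: bmeas_sg; apply: bmeasB; first exact: bmeas_pair1.
exact: (bmeas_pair2 (bm2_along bZ)).
Qed.

Lemma accel_bound Z a y : bm2 Z -> `|accel Z a y| <= C.
Proof.
move=> bZ; rewrite /accel; apply: (le_trans (ler_normD _ _)); rewrite /speed_bound -addrA.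
apply: lerD; last exact: drift_bound.
rewrite /force normrM ger0_norm// mulrC; apply: ler_pM => //.
rewrite -[leRHS]mul1r; apply: le_norm_pint_bound; first exact: bsg.
by move=> a' s'; rewrite normr_sg lern1 leq_b1.
Qed.

Lemma bm2_euler tau k : bm2 (euler tau k).
Proof.
elim: k => [|k IH] /=; first by apply: bm2_snd; exact: bm_clamp.
by apply: bm2B => //; apply: bm2M; [exact: bm2_cst|exact: bm2_accel].
Qed.

Lemma sg_subgradient (y y' c : R) : Num.sg (y - c) * (y' - y) <= `|y' - c| - `|y - c|.
Proof.
rewrite [`|y - c|]normrEsg lerBrDr -mulrDr addrA subrK.
apply: (le_trans (ler_norm _)); rewrite normrM normr_sg ler_piMl//.
by rewrite lern1 leq_b1.
Qed.

Lemma sg_nd (x y : R) : x <= y -> Num.sg x <= Num.sg y.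
Proof.
move=> xy; have [x0|x0|x0] := ltgtP x 0.
- rewrite (ltr0_sg x0); have := normr_sg y; have : `|Num.sg y| <= 1 by rewrite normr_sg lern1 leq_b1.
  by rewrite ler_norml => /andP[].
- by rewrite gtr0_sg// gtr0_sg// (lt_le_trans x0).
- by rewrite x0 sgr0 sgr_ge0 -x0.
Qed.

Lemma accel_nd Z a y y' : bm2 Z -> y <= y' -> accel Z a y <= accel Z a y'.
Proof.
move=> bZ yy'; rewrite lerD2r ler_wpM2l//; apply: le_pint; [exact: bsg|exact: bsg|].
by move=> a' s'; apply: sg_nd; rewrite lerD2r.
Qed.

Let bnorm (Z : R -> R -> R) y : bm2 Z -> bm2 (fun a s => `|y - Z a (X0 a s)|).
Proof. by move=> bZ; apply: bm2_norm; apply: bm2B; [exact: bm2_cst|exact: bm2_along]. Qed.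

Definition potential (Z : R -> R -> R) (y : R) : R :=
  2^-1 * pint P (fun a s => `|y - Z a (X0 a s)|).

Lemma force_subgradient Z y y' : bm2 Z -> force Z y * (y' - y) <= potential Z y' - potential Z y.
Proof.
move=> bZ; rewrite /force /potential -mulrBr -mulrA ler_wpM2l//.
rewrite -(pintB _ (bnorm _ bZ) (bnorm _ bZ)) mulrC -pintZl; last exact: bsg.
apply: le_pint.
- by apply: bm2M; [exact: bm2_cst|exact: bsg].
- by apply: bm2B; exact: bnorm.
- by move=> a s; rewrite mulrC; exact: sg_subgradient.
Qed.

Lemma potential_dist Z W y : bm2 Z -> bm2 W ->
  `|potential Z y - potential W y| <= 2^-1 * pint P (fun a s => `|Z a (X0 a s) - W a (X0 a s)|).
Proof.
move=> bZ bW; rewrite /potential -mulrBr normrM ger0_norm// ler_wpM2l//.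
rewrite -(pintB _ (bnorm _ bZ) (bnorm _ bW)).
have bB : bm2 (fun a s => `|y - Z a (X0 a s)| - `|y - W a (X0 a s)|) by apply: bm2B; exact: bnorm.
apply: (le_trans (le_norm_pint P bB)); apply: le_pint.
- exact: bm2_norm.
- by apply: bm2_norm; apply: bm2B; exact: bm2_along.
- move=> a s; apply: (le_trans (ler_dist_dist _ _)).
  by rewrite (_ : y - _ - _ = - (Z a (X0 a s) - W a (X0 a s))) ?normrN//; ring.
Qed.

(** The double integral is symmetrised by exchanging its two variables. By antisymmetry of the sign
    the sum becomes the subgradient inequality of the absolute value at U - U', tested against Y -
    Y'. *)
Lemma energy_subgradient Z Y : bm2 Z -> bm2 Y ->
  pint P (fun a s => accel Z a (Z a (X0 a s)) * (Y a s - Z a (X0 a s))) <=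
  E Y - E (fun a s => Z a (X0 a s)).
Proof.
move=> bZ bY; set U := fun a s => Z a (X0 a s).
have bU : bm2 U by exact: bm2_along.
have bIU := bm2_interaction mh h0 hfin bU bU; have bIY := bm2_interaction mh h0 hfin bY bY.
have bdr : bm2 (fun a s => drift Rv a) by apply: bm2_fst; exact: bm_drift.
pose F a s a' s' := Num.sg (U a s - U a' s') * (Y a s - U a s).
have bF : bmeas (fun q : borelR2 R * borelR2 R => F q.1.1 q.1.2 q.2.1 q.2.2).
  apply: bmeasM; last by apply: bmeasB; exact: bmeas_pair1.
  by apply: bmeas_sg; apply: bmeasB; [exact: bmeas_pair1|exact: bmeas_pair2].
have bFs : bmeas (fun q : borelR2 R * borelR2 R => F q.2.1 q.2.2 q.1.1 q.1.2).
  exact: (bmeas_swap bF).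
have bF1 a s : bm2 (F a s).
  exact: (bmeas_section1 (f := fun q : borelR2 R * borelR2 R => F q.1.1 q.1.2 q.2.1 q.2.2) (a, s)).
have bF2 a s : bm2 (fun a' s' => F a' s' a s).
  exact: (bmeas_section1 (f := fun q : borelR2 R * borelR2 R => F q.2.1 q.2.2 q.1.1 q.1.2) (a, s)).
have bpF : bm2 (fun a s => pint P (F a s)) by exact: (bm2_pint P bF).
have bpF' : bm2 (fun a s => pint P (fun a' s' => F a' s' a s)).
  exact: (@bm2_pint R P (fun a s a' s' => F a' s' a s) bFs).
have bd Z' : bm2 Z' -> forall x, bm2 (fun a' s' => `|x - Z' a' s'|).
  by move=> bZ' x; apply: bm2_norm; apply: bm2B => //; exact: bm2_cst.
have key : 2 * pint P (fun a s => pint P (F a s)) <=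
    pint P (fun a s => pint P (fun a' s' => `|Y a s - Y a' s'|)) -
    pint P (fun a s => pint P (fun a' s' => `|U a s - U a' s'|)).
  rewrite mulr2n mulrDl mul1r {2}(pint_swap P bF) -pintD// -pintB//.
  apply: le_pint; [exact: bm2D|exact: bm2B|] => a s.
  rewrite -pintD// -pintB//; [|exact: bd|exact: bd].
  apply: le_pint; [exact: bm2D| |].
    by apply: bm2B; exact: bd.
  move=> a' s'; rewrite /F.
  rewrite (_ : U a' s' - U a s = - (U a s - U a' s')); last by ring.
  rewrite sgrN mulNr -mulrBr.
  have := sg_subgradient (U a s - U a' s') (Y a s - Y a' s') 0.
  rewrite !subr0; congr (_ * _ <= _); ring.
have E1 : pint P (fun a s => accel Z a (U a s) * (Y a s - U a s)) =
    2^-1 * pint P (fun a s => pint P (F a s)) +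
    (pint P (fun a s => drift Rv a * Y a s) - pint P (fun a s => drift Rv a * U a s)).
  have bdY : bm2 (fun a s => drift Rv a * Y a s) by exact: bm2M.
  have bdU : bm2 (fun a s => drift Rv a * U a s) by exact: bm2M.
  rewrite -pintB// -pintZl// -pintD; last 2 first.
  - by apply: bm2M => //; exact: bm2_cst.
  - exact: bm2B.
  congr (pint P _); apply/funext => a; apply/funext => s.
  rewrite /accel /force mulrDl -mulrBr -mulrA; congr (_ * _ + _).
  rewrite mulrC -pintZl; last exact: bsg.
  by congr (pint P _); apply/funext => a'; apply/funext => s'; rewrite mulrC.
rewrite E1 /lagrangian_energy.
move: key; set x1 := pint _ _; set x2 := pint _ _; set x3 := pint _ _.
set x4 := pint _ _; set x5 := pint _ _; lra.
Qed.

Section step.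
Variable tau : R.
Hypothesis tau0 : 0 <= tau.
Local Notation Z := (euler tau).

Lemma euler_step k j a x : `|Z (k + j)%N a x - Z k a x| <= C * tau * j%:R.
Proof.
elim: j => [|j IH]; first by rewrite addn0 subrr normr0 mulr0.
rewrite addnS /= (_ : C * tau * j.+1%:R = C * tau * j%:R + tau * C); last by rewrite -natr1; ring.
rewrite addrAC; apply: (le_trans (ler_normB _ _)).
apply: lerD => //; rewrite normrM (ger0_norm tau0) ler_wpM2l//.
by apply: accel_bound; exact: bm2_euler.
Qed.

Lemma euler_norm k a x : `|Z k a x| <= r + C * tau * k%:R.
Proof.
have := euler_step 0 k a x; rewrite add0n => hk.
rewrite -(subrK (Z 0 a x) (Z k a x)) addrC.
apply: (le_trans (ler_normD _ _)); apply: lerD => //=.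
by rewrite ler_norml; apply/andP; split; [apply: clamp_ge|apply: clamp_le].
Qed.

Let gap k a x x' := Z k a x' - Z k a x.

(** [accel] is nondecreasing in the position, so that one step brings two points closer together or
    makes them cross, by at most 2 C tau. *)
Let gap_step k a x x' : (0 <= gap k a x x' -> gap k a x x' - 2 * C * tau <= gap k.+1 a x x' <= gap k a x x') /\
  (gap k a x x' <= 0 -> gap k a x x' <= gap k.+1 a x x' <= gap k a x x' + 2 * C * tau).
Proof.
have b := bm2_euler tau k; rewrite /gap /=.
set y := Z k a x; set y' := Z k a x'.
have := accel_bound a y b; have := accel_bound a y' b.
rewrite !ler_norml => /andP[l1 u1] /andP[l2 u2].
have -> : y' - tau * accel (Z k) a y' - (y - tau * accel (Z k) a y) =
  y' - y - tau * (accel (Z k) a y' - accel (Z k) a y) by ring.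
have d1 : tau * (accel (Z k) a y' - accel (Z k) a y) <= 2 * C * tau.
  by rewrite [2 * C * tau]mulrC ler_wpM2l//; lra.
have d2 : - (2 * C * tau) <= tau * (accel (Z k) a y' - accel (Z k) a y).
  by rewrite -mulNr [- _ * tau]mulrC ler_wpM2l//; lra.
split => yy'.
  have : 0 <= tau * (accel (Z k) a y' - accel (Z k) a y).
    by rewrite mulr_ge0// subr_ge0 accel_nd// -subr_ge0.
  by move=> d0; apply/andP; split; lra.
have : tau * (accel (Z k) a y' - accel (Z k) a y) <= 0.
  by rewrite mulr_ge0_le0// subr_le0 accel_nd// -subr_le0.
by move=> d0; apply/andP; split; lra.
Qed.

Lemma euler_gap_ge k a x x' : x <= x' -> - (2 * C * tau) <= Z k a x' - Z k a x.
Proof.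
have Ct : 0 <= C * tau by rewrite mulr_ge0.
move=> xx'; elim: k => [|k IH].
  by rewrite /= (@le_trans _ _ 0)//; [lra|rewrite subr_ge0 le_clamp].
have [h1 h2] := gap_step k a x x'; rewrite /gap in h1 h2.
have [g|/ltW g] := leP 0 (Z k a x' - Z k a x).
  by have /andP[+ _] := h1 g; lra.
by have /andP[+ _] := h2 g; lra.
Qed.

Lemma euler_gap_le k j a x x' : x <= x' ->
  Z (k + j)%N a x' - Z (k + j)%N a x <= Num.max (Z k a x' - Z k a x) (2 * C * tau).
Proof.
have Ct : 0 <= C * tau by rewrite mulr_ge0.
move=> xx'; elim: j => [|j IH]; first by rewrite addn0 le_max lexx.
rewrite addnS; have [h1 h2] := gap_step (k + j)%N a x x'; rewrite /gap in h1 h2.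
have [g|/ltW g] := leP 0 (Z (k + j)%N a x' - Z (k + j)%N a x).
  by have /andP[_ +] := h1 g; move/le_trans; apply.
have /andP[_ h3] := h2 g; rewrite le_max; apply/orP; right; lra.
Qed.

(** Expanding the square at each step brings in the energy at that step. It is compared with the
    energy at step k by [energy_lip], as points have moved by at most C tau i since; this produces
    the term in C^2 mass. *)
Lemma euler_evi k i Y : bm2 Y ->
  pint P (fun a s => (Z (k + i)%N a (X0 a s) - Y a s) ^+ 2) <=
  pint P (fun a s => (Z k a (X0 a s) - Y a s) ^+ 2) +
  2 * (tau * i%:R) * (E Y - E (fun a s => Z k a (X0 a s)) + C ^+ 2 * mass * (tau * i%:R)) +
  C ^+ 2 * mass * tau * (tau * i%:R).
Proof.
move=> bY; elim: i => [|i IH]; first by rewrite addn0 !(mulr0, mul0r, addr0).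
set n := (k + i)%N in IH.
have bZ j : bm2 (Z j) by exact: bm2_euler.
have bU j : bm2 (fun a s => Z j a (X0 a s)) by exact: bm2_along.
pose A a s := accel (Z n) a (Z n a (X0 a s)).
have bA : bm2 A by apply: (@bm2_accel (Z n) (fun a s => Z n a (X0 a s))).
have A2 a s : A a s ^+ 2 <= C ^+ 2.
  by rewrite -(real_normK (num_real (A a s))) ler_sqr ?nnegrE//; exact: accel_bound.
have sub := energy_subgradient (bZ n) bY.
have En : E (fun a s => Z k a (X0 a s)) - E (fun a s => Z n a (X0 a s)) <= C * (C * tau * i%:R * mass).
  apply: (le_trans (energy_lip mh h0 hfin Rv0 (bU n) (bU k))); rewrite ler_wpM2l//.
  have bN : bm2 (fun a s => `|Z k a (X0 a s) - Z n a (X0 a s)|) by apply: bm2_norm; exact: bm2B.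
  apply: le_trans (ler_norm _) _; apply: le_norm_pint_bound => // a s.
  by rewrite normr_id distrC; exact: euler_step.
have step : pint P (fun a s => (Z n.+1 a (X0 a s) - Y a s) ^+ 2) <=
    pint P (fun a s => (Z n a (X0 a s) - Y a s) ^+ 2) +
    2 * tau * pint P (fun a s => A a s * (Y a s - Z n a (X0 a s))) + tau ^+ 2 * C ^+ 2 * mass.
  have b1 : bm2 (fun a s => (Z n a (X0 a s) - Y a s) ^+ 2) by apply: bm2X; exact: bm2B.
  have b2 : bm2 (fun a s => A a s * (Y a s - Z n a (X0 a s))) by apply: bm2M => //; exact: bm2B.
  rewrite -pint_cst -pintZl// -pintD//; last by apply: bm2M => //; exact: bm2_cst.
  rewrite -pintD; last 2 first.
  - by apply: bm2D => //; apply: bm2M => //; exact: bm2_cst.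
  - exact: bm2_cst.
  apply: le_pint.
  - by apply: bm2X; exact: bm2B.
  - by apply: bm2D; [apply: bm2D => //; apply: bm2M => //|]; exact: bm2_cst.
  - move=> a s; rewrite -subr_ge0 [Z n.+1 _ _]/= -/(A a s).
    rewrite (_ : _ - _ = tau ^+ 2 * (C ^+ 2 - A a s ^+ 2)); last by ring.
    by rewrite mulr_ge0 ?sqr_ge0// subr_ge0.
rewrite addnS -/n; apply: (le_trans step).
have t2 : 2 * tau * pint P (fun a s => A a s * (Y a s - Z n a (X0 a s))) <=
    2 * tau * (E Y - E (fun a s => Z n a (X0 a s))).
  by rewrite ler_wpM2l// mulr_ge0.
have t3 : 2 * tau * (E (fun a s => Z k a (X0 a s)) - E (fun a s => Z n a (X0 a s))) <=
    2 * tau * (C * (C * tau * i%:R * mass)).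
  by rewrite ler_wpM2l// mulr_ge0.
have t4 : 0 <= tau ^+ 2 * C ^+ 2 * mass by rewrite !mulr_ge0// sqr_ge0.
have t5 : 0 <= tau ^+ 2 * C ^+ 2 * mass * i%:R by rewrite mulr_ge0.
rewrite -natr1; move: IH t2 t3 t4 t5.
set x1 := pint _ _; set x2 := pint _ _; set x3 := pint _ _.
set e1 := E Y; set e2 := E _; set e3 := E _; set j : R := i%:R => IH t2 t3 t4 t5.
rewrite -subr_ge0.
rewrite (_ : _ - _ = (x2 + 2 * (tau * j) * (e1 - e2 + C ^+ 2 * mass * (tau * j)) + C ^+ 2 * mass * tau * (tau * j) - x1)
  + (2 * tau * (e1 - e3) - 2 * tau * x3) + (2 * tau * (C * (C * tau * j * mass)) - 2 * tau * (e2 - e3))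
  + 2 * (tau ^+ 2 * C ^+ 2 * mass) + 2 * (tau ^+ 2 * C ^+ 2 * mass * j)); last by ring.
lra.
Qed.

End step.

(** * Comparison of two step sizes *)

Section refinement.
Variables (sigma : R) (N : nat).
Hypotheses (sigma0 : 0 < sigma) (N0 : (0 < N)%N).
Let tau := N%:R * sigma.
Local Notation Z := (euler tau).
Local Notation W := (euler sigma).

Let sig0 : 0 <= sigma. Proof. exact: ltW. Qed.
Let tau0 : 0 <= tau. Proof. by rewrite mulr_ge0. Qed.
Let sigtau : sigma <= tau. Proof. by rewrite /tau ler_peMl// ler1n. Qed.

(* The coarse scheme, interpolated at the fine times. *)
Let F j a x := Z (j %/ N)%N a x - (j %% N)%:R * sigma * accel (Z (j %/ N)%N) a (Z (j %/ N)%N a x).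

Let F_step j a x : F j.+1 a x = F j a x - sigma * accel (Z (j %/ N)%N) a (Z (j %/ N)%N a x).
Proof.
have jE := divn_eq j N; have mN := ltn_pmod j N0.
set q := (j %/ N)%N in jE *; set m := (j %% N)%N in jE mN *.
have [mS|mS] := ltnP m.+1 N.
  have [e1 e2] : (j.+1 %/ N = q /\ j.+1 %% N = m.+1)%N.
    by rewrite jE -addnS divnMDl// modnMDl divn_small// modn_small// addn0.
  by rewrite /F e1 e2 -/q -/m -natr1; ring.
have mE : m.+1 = N by apply/eqP; rewrite eqn_leq mN.
have [e1 e2] : (j.+1 %/ N = q.+1 /\ j.+1 %% N = 0)%N.
  by rewrite jE -addnS mE -mulSnr mulnK// modnMl.
by rewrite /F e1 e2 -/q -/m mul0r mul0r subr0 /= /tau -mE -natr1; ring.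
Qed.

Let F_dist j a x : `|F j a x - Z (j %/ N)%N a x| <= C * tau.
Proof.
rewrite addrAC subrr add0r normrN normrM mulrC; apply: ler_pM => //.
  by apply: accel_bound; exact: bm2_euler.
rewrite ger0_norm ?mulr_ge0// ler_wpM2r// ler_nat ltnW//; exact: ltn_pmod.
Qed.

Let bF j : bm2 (F j).
Proof.
have b := bm2_euler tau (j %/ N)%N.
by apply: bm2B => //; apply: bm2M; [exact: bm2_cst|exact: bm2_accel].
Qed.

Let B j a x := accel (Z (j %/ N)%N) a (Z (j %/ N)%N a x) - accel (W j) a (W j a x).

Let B_bound j a x : `|B j a x| <= 2 * C.
Proof.
apply: (le_trans (ler_normB _ _)); rewrite mulr2n mulrDl mul1r.
by apply: lerD; apply: accel_bound; exact: bm2_euler.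
Qed.

(** The cross term is taken at the coarse node, where [B] is evaluated, rather than at the
    interpolated point [F j a x], which is within C tau of it. The factor 8 is 4 from this
    replacement and 4 from the squared increment. *)
Let D_step j a x : (F j.+1 a x - W j.+1 a x) ^+ 2 <= (F j a x - W j a x) ^+ 2 +
  2 * sigma * - (B j a x * (Z (j %/ N)%N a x - W j a x)) + 8 * C ^+ 2 * (sigma * tau).
Proof.
rewrite F_step /=; set z := Z _ a x; set y := W j a x; set f := F j a x.
have -> : f - sigma * accel (Z (j %/ N)%N) a z - (y - sigma * accel (W j) a y) =
   f - y - sigma * B j a x by rewrite /B -/z -/y; ring.
have b := B_bound j a x; set c := B j a x in b *.
have c2 : c ^+ 2 <= 4 * C ^+ 2.
  rewrite -(real_normK (num_real c)) (_ : 4 * C ^+ 2 = (2 * C) ^+ 2); last by ring.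
  by rewrite ler_sqr ?nnegrE// mulr_ge0.
have fz : - (c * (f - z)) <= 2 * C * (C * tau).
  apply: (le_trans (ler_norm _)); rewrite normrN normrM; apply: ler_pM => //.
  exact: F_dist.
have h1 : sigma * - (c * (f - z)) <= sigma * (2 * C * (C * tau)) by rewrite ler_wpM2l.
have h2 : sigma * sigma * c ^+ 2 <= sigma * tau * (4 * C ^+ 2).
  by apply: ler_pM => //; [rewrite mulr_ge0|exact: sqr_ge0|rewrite ler_wpM2l].
rewrite -subr_ge0.
rewrite (_ : _ - _ = 2 * (sigma * (2 * C * (C * tau)) - sigma * - (c * (f - z))) +
  (sigma * tau * (4 * C ^+ 2) - sigma * sigma * c ^+ 2)); last by ring.
lra.
Qed.

(** Integrated over the field the cross terms are nonpositive, since both schemes move against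
    subgradients of one convex energy. Only the error terms of [D_step] accumulate. *)
Lemma refinement_L2 j : pint P (fun a s => (F j a (X0 a s) - W j a (X0 a s)) ^+ 2) <=
  8 * C ^+ 2 * mass * tau * (sigma * j%:R).
Proof.
have bZ k : bm2 (Z k) by exact: bm2_euler.
have bW k : bm2 (W k) by exact: bm2_euler.
elim: j => [|j IH].
  rewrite mulr0 mulr0 -(pint0 P) le_eqVlt; apply/orP; left; apply/eqP; congr (pint P _).
  apply/funext => a; apply/funext => s.
  by rewrite /F div0n mod0n mul0r mul0r subr0 /= subrr expr0n.
have bBz : bm2 (fun a s => - (B j a (X0 a s) * (Z (j %/ N)%N a (X0 a s) - W j a (X0 a s)))).
  apply: (bm2_along (Z := fun a x => - (B j a x * (Z (j %/ N)%N a x - W j a x)))).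
  by apply: bm2N; apply: bm2M; apply: bm2B => //; exact: bm2_accel.
have mono : pint P (fun a s => - (B j a (X0 a s) * (Z (j %/ N)%N a (X0 a s) - W j a (X0 a s)))) <= 0.
  have e1 := energy_subgradient (bZ (j %/ N)%N) (bm2_along (bW j)).
  have e2 := energy_subgradient (bW j) (bm2_along (bZ (j %/ N)%N)).
  have := lerD e1 e2; rewrite -pintD; last 2 first.
  - by apply: bm2M; [apply: (bm2_along (Z := fun a x => accel (Z (j %/ N)%N) a (Z (j %/ N)%N a x))); exact: bm2_accel|
      apply: bm2B; exact: bm2_along].
  - by apply: bm2M; [apply: (bm2_along (Z := fun a x => accel (W j) a (W j a x))); exact: bm2_accel|
      apply: bm2B; exact: bm2_along].
  rewrite addrA subrK subrr; apply: le_trans; rewrite le_eqVlt; apply/orP; left; apply/eqP.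
  congr (pint P _); apply/funext => a; apply/funext => s; rewrite /B; ring.
have bD k : bm2 (fun a s => (F k a (X0 a s) - W k a (X0 a s)) ^+ 2).
  apply: (bm2_along (Z := fun a x => (F k a x - W k a x) ^+ 2)).
  by apply: bm2X; exact: bm2B.
have st : pint P (fun a s => (F j.+1 a (X0 a s) - W j.+1 a (X0 a s)) ^+ 2) <=
   pint P (fun a s => (F j a (X0 a s) - W j a (X0 a s)) ^+ 2) +
   2 * sigma * pint P (fun a s => - (B j a (X0 a s) * (Z (j %/ N)%N a (X0 a s) - W j a (X0 a s)))) +
   8 * C ^+ 2 * (sigma * tau) * mass.
  rewrite -pint_cst -pintZl// -pintD//; last by apply: bm2M => //; exact: bm2_cst.
  rewrite -pintD; last 2 first.
  - by apply: bm2D => //; apply: bm2M => //; exact: bm2_cst.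
  - exact: bm2_cst.
  apply: le_pint => //.
  by apply: bm2D; [apply: bm2D => //; apply: bm2M => //|]; exact: bm2_cst.
have jS : sigma * j.+1%:R = sigma * j%:R + sigma by rewrite -natr1; ring.
apply: (le_trans st); rewrite jS [leRHS]mulrDr.
have : 2 * sigma * pint P (fun a s => - (B j a (X0 a s) * (Z (j %/ N)%N a (X0 a s) - W j a (X0 a s)))) <= 0.
  by rewrite mulr_ge0_le0// mulr_ge0.
have -> : 8 * C ^+ 2 * (sigma * tau) * mass = 8 * C ^+ 2 * mass * tau * sigma by ring.
move: IH; set x1 := pint _ _; set x2 := pint _ _; lra.
Qed.

(** At a single x the two forces come from different fields. Convexity of both potentials bounds the
    cross term by differences of the potentials, hence by the L^1(P) distance of the fields; the
    drift cancels. The parameter [e] is that of Young's inequality, which passes to the L^2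
    bound. *)
Lemma refinement_sup j (T e : R) a x : 0 < e -> sigma * j%:R <= T -> 0 <= T ->
  (F j a x - W j a x) ^+ 2 <=
  (sigma * j%:R) * (2 * (C * tau * mass + 2^-1 * (8 * C ^+ 2 * mass * tau * T / e + e * mass)) +
    8 * C ^+ 2 * tau).
Proof.
move=> e0 + T0; set K := 2 * _ + _ => jT.
have bZ k : bm2 (Z k) by exact: bm2_euler.
have bW k : bm2 (W k) by exact: bm2_euler.
elim: j jT => [|j IH] jT.
  by rewrite /F div0n mod0n mul0r mul0r subr0 /= subrr expr0n mulr0 mul0r.
have jT' : sigma * j%:R <= T.
  by apply: le_trans jT; rewrite ler_wpM2l// ler_nat.
pose k := (j %/ N)%N.
pose delta := pint P (fun a s => `|Z k a (X0 a s) - W j a (X0 a s)|).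
have bdel : bm2 (fun a s => `|Z k a (X0 a s) - W j a (X0 a s)|).
  by apply: bm2_norm; apply: bm2B; exact: bm2_along.
have b2 : bm2 (fun a s => (F j a (X0 a s) - W j a (X0 a s)) ^+ 2).
  apply: (bm2_along (Z := fun a x => (F j a x - W j a x) ^+ 2)).
  by apply: bm2X; exact: bm2B.
have dl : delta <= C * tau * mass + 2^-1 * (8 * C ^+ 2 * mass * tau * T / e + e * mass).
  have L2 := refinement_L2 j.
  have L2' : pint P (fun a s => (F j a (X0 a s) - W j a (X0 a s)) ^+ 2) <= 8 * C ^+ 2 * mass * tau * T.
    by apply: (le_trans L2); rewrite ler_wpM2l// !mulr_ge0// sqr_ge0.
  apply: (@le_trans _ _ (pint P (fun a s => C * tau + 2^-1 * (e^-1 * (F j a (X0 a s) - W j a (X0 a s)) ^+ 2 + e)))).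
    apply: le_pint => //.
      apply: bm2D; first exact: bm2_cst.
      by apply: bm2M; [exact: bm2_cst|apply: bm2D; [apply: bm2M => //|]]; exact: bm2_cst.
    move=> a' s'; set f := F j _ _; set y := W j _ _; set z := Z k _ _.
    have fz : `|f - z| <= C * tau by exact: F_dist.
    rewrite -[z - y](subrKA f); apply: (le_trans (ler_normD _ _)); apply: lerD.
      by rewrite distrC.
    rewrite -subr_ge0 (_ : _ - _ = 2^-1 * (e^-1 * (`|f - y| - e) ^+ 2)).
      by rewrite mulr_ge0// mulr_ge0 ?sqr_ge0// invr_ge0 ltW.
    rewrite -(real_normK (num_real (f - y))); field; exact: lt0r_neq0.
  rewrite pintD; [|exact: bm2_cst|by apply: bm2M; [exact: bm2_cst|apply: bm2D; [apply: bm2M => //|]]; exact: bm2_cst].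
  rewrite pint_cst pintZl; last by apply: bm2D; [apply: bm2M => //|]; exact: bm2_cst.
  rewrite pintD; [|by apply: bm2M => //; exact: bm2_cst|exact: bm2_cst].
  rewrite pintZl// pint_cst lerD2l ler_wpM2l// lerD2r [leRHS]mulrC ler_wpM2l// invr_ge0 ltW//.
have nB : - (B j a x * (Z k a x - W j a x)) <= delta.
  have f1 := force_subgradient (Z k a x) (W j a x) (bZ k).
  have f2 := force_subgradient (W j a x) (Z k a x) (bW j).
  have p1 := potential_dist (W j a x) (bZ k) (bW j).
  have p2 := potential_dist (Z k a x) (bZ k) (bW j).
  rewrite -/delta in p1 p2.
  have := ler_norm (potential (Z k) (W j a x) - potential (W j) (W j a x)).
  have := ler_norm (- (potential (Z k) (Z k a x) - potential (W j) (Z k a x))); rewrite normrN.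
  rewrite (_ : - (B j a x * _) = force (Z k) (Z k a x) * (W j a x - Z k a x) +
     force (W j) (W j a x) * (Z k a x - W j a x)); last by rewrite /B /accel -/k; ring.
  lra.
apply: (le_trans (D_step j a x)).
have h1 : 2 * sigma * - (B j a x * (Z k a x - W j a x)) <= 2 * sigma *
    (C * tau * mass + 2^-1 * (8 * C ^+ 2 * mass * tau * T / e + e * mass)).
  by rewrite ler_wpM2l ?mulr_ge0//; exact: le_trans nB dl.
have jS : sigma * j.+1%:R = sigma * j%:R + sigma by rewrite -natr1; ring.
have := IH jT'; rewrite jS [(_ + sigma) * K]mulrDl.
have -> : sigma * K = 2 * sigma * (C * tau * mass + 2^-1 * (8 * C ^+ 2 * mass * tau * T / e + e * mass)) +
   8 * C ^+ 2 * (sigma * tau) by rewrite /K; ring.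
move: h1; rewrite /k; set q1 := 2 * sigma * - _; set q2 := 2 * sigma * _; lra.
Qed.

Lemma refinement_dist j a x : `|Z (j %/ N)%N a x - W j a x| <= C * tau + `|F j a x - W j a x|.
Proof.
rewrite -[X in `|X|](subrKA (F j a x)); apply: (le_trans (ler_normD _ _)); rewrite lerD2r.
by rewrite distrC; exact: F_dist.
Qed.

(** With tau <= e^2 every term in [refinement_sup], in particular the one in tau / e, is at most of
    order e. *)
Lemma refinement_cauchy (e T : R) j a x : 0 < e -> e <= 1 -> tau <= e ^+ 2 ->
  0 <= T -> sigma * j%:R <= T ->
  (Z (j %/ N)%N a x - W j a x) ^+ 2 <=
   e * (2 * (C ^+ 2 + T * (2 * C * mass + 8 * C ^+ 2 * mass * T + mass + 8 * C ^+ 2))).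
Proof.
move=> e0 e1 te T0 jT; have e0' := ltW e0.
have te1 : tau <= e by apply: (le_trans te); rewrite expr2 ler_piMr.
have te2 : tau / e <= e by rewrite ler_pdivrMr// -expr2.
have sup := refinement_sup a x e0 jT T0.
have h1 : (Z (j %/ N)%N a x - W j a x) ^+ 2 <= 2 * (C * tau) ^+ 2 + 2 * (F j a x - W j a x) ^+ 2.
  have d := refinement_dist j a x; rewrite -(real_normK (num_real (Z _ a x - _))).
  rewrite -[(F j a x - _) ^+ 2](real_normK (num_real _)).
  have : `|Z (j %/ N)%N a x - W j a x| ^+ 2 <= (C * tau + `|F j a x - W j a x|) ^+ 2.
    by rewrite ler_sqr ?nnegrE// addr_ge0// mulr_ge0.
  move/le_trans; apply; rewrite -subr_ge0 (_ : _ - _ = (C * tau - `|F j a x - W j a x|) ^+ 2).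
    exact: sqr_ge0.
  ring.
apply: (le_trans h1).
have h2 : (C * tau) ^+ 2 <= e * C ^+ 2.
  rewrite exprMn mulrC ler_wpM2r ?sqr_ge0// expr2.
  by apply: (@le_trans _ _ (e * e)); [exact: ler_pM|rewrite ler_piMr].
have h3 : (F j a x - W j a x) ^+ 2 <= T * (e * (2 * C * mass + 8 * C ^+ 2 * mass * T + mass + 8 * C ^+ 2)).
  apply: (le_trans sup); apply: ler_pM => //; first by rewrite mulr_ge0.
    have x0 : 0 <= C * tau * mass by rewrite !mulr_ge0.
    have y0 : 0 <= 8 * C ^+ 2 * mass * tau * T / e by rewrite divr_ge0// !mulr_ge0// sqr_ge0.
    have z0 : 0 <= e * mass by rewrite mulr_ge0.
    have w0 : 0 <= 8 * C ^+ 2 * tau by rewrite !mulr_ge0// sqr_ge0.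
    by move: x0 y0 z0 w0; lra.
  have C2 := sqr_ge0 C.
  have i1 : C * mass * tau <= C * mass * e by rewrite ler_wpM2l// mulr_ge0.
  have i2 : 8 * C ^+ 2 * mass * T * (tau / e) <= 8 * C ^+ 2 * mass * T * e.
    by rewrite ler_wpM2l// !mulr_ge0.
  have i3 : 8 * C ^+ 2 * tau <= 8 * C ^+ 2 * e by rewrite ler_wpM2l// mulr_ge0.
  rewrite -subr_ge0.
  rewrite (_ : _ - _ = 2 * (C * mass * e - C * mass * tau) +
    (8 * C ^+ 2 * mass * T * e - 8 * C ^+ 2 * mass * T * (tau / e)) + (8 * C ^+ 2 * e - 8 * C ^+ 2 * tau)); last by field; exact: lt0r_neq0.
  lra.
rewrite -subr_ge0 (_ : _ - _ = 2 * (e * C ^+ 2 - (C * tau) ^+ 2) +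
  2 * (T * (e * (2 * C * mass + 8 * C ^+ 2 * mass * T + mass + 8 * C ^+ 2)) - (F j a x - W j a x) ^+ 2)); last by ring.
lra.
Qed.

End refinement.

End euler_scheme.

(** * The limit flow *)

Lemma geo_dominates {R : realType} (c e : R) : 0 <= c -> 0 < e -> exists n0, forall n, (n0 <= n)%N -> c * (2 ^+ n)^-1 <= e.
Proof.
move=> c0 e0; exists (Num.truncn (c / e)).+1 => n nn.
have p2 : 0 < 2 ^+ n :> R by rewrite exprn_gt0.
rewrite ler_pdivrMr// mulrC -ler_pdivrMr//.
apply: (@le_trans _ _ (n%:R)).
  apply: ltW; apply: (lt_le_trans (truncnS_gt _)); by rewrite ler_nat.
by rewrite -natrX ler_nat; apply: ltnW; exact: ltn_expl.
Qed.

Lemma cvg_geo_bound {R : realType} (c l : R) (a : nat -> R) : 0 <= c ->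
  (forall n, `|l - a n| <= c * (2 ^+ n)^-1) -> a n @[n --> \oo] --> l.
Proof.
move=> c0 h; apply/cvgrPdist_le => /= e e0; have [n0 hn] := geo_dominates c0 e0.
by exists n0 => // n /= nn; exact: le_trans (h n) (hn n nn).
Qed.

Lemma cauchy_geo {R : realType} (c : R) (a : nat -> R) : 0 <= c ->
  (forall n m, (n <= m)%N -> `|a n - a m| <= c * (2 ^+ n)^-1) ->
  exists2 l : R, a n @[n --> \oo] --> l & forall n, `|l - a n| <= c * (2 ^+ n)^-1.
Proof.
move=> c0 h; have [l hl] : exists l : R, a n @[n --> \oo] --> l.
  apply: cauchy_real_cvg => k.
  have k0 : 0 < k.+1%:R^-1 :> R by rewrite invr_gt0.
  have [n0 hn] := geo_dominates c0 k0; exists n0.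
  have key n m : (n0 <= n)%N -> (n <= m)%N -> `|a n - a m| <= k.+1%:R^-1.
    by move=> nn nm; apply: le_trans (h n m nm) (hn n nn).
  move=> n m nn nm; have [l|/ltnW l] := leqP n m; first exact: key.
  by rewrite distrC; exact: key.
exists l => // n; rewrite distrC.
have L : `|a n - a m| @[m --> \oo] --> `|a n - l|.
  by apply: cvg_norm; apply: cvgB => //; exact: cvg_cst.
apply: (ler_cvg_to L (@cvg_cst _ (c * (2 ^+ n)^-1) _ \oo _)).
by exists n => // m /= nm; exact: h.
Qed.

Section limit_flow.
Context {R : realType}.
Variables (mu : {sigma_finite_measure set (borelR R) -> \bar R}) (Rv : R) (h : R -> R).
Hypotheses (mh : measurable_fun setT (h : borelR R -> borelR R)) (h0 : forall a, 0 <= h a).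
Hypothesis hfin : (\int[mu]_(a in levels Rv) (h a)%:E < +oo)%E.
Hypothesis Rv0 : 0 < Rv.
Local Notation P := (level_measure mh h0 hfin).
Local Notation E := (lagrangian_energy mh h0 hfin).
Local Notation C := (speed_bound mh h0 hfin).
Local Notation mass := (fine (P setT)).
Variables (r : R) (X0 : R -> R -> R).
Hypotheses (r0 : 0 <= r) (bX0 : bm2 X0).
Local Notation euler := (euler mh h0 hfin r X0).

Let mass0 : 0 <= mass. Proof. exact: fine_ge0. Qed.
Let C0 : 0 <= C. Proof. exact: speed_bound_ge0. Qed.

Let tn (n : nat) : R := (16 ^+ n)^-1.
Let tn0 n : 0 < tn n. Proof. by rewrite invr_gt0 exprn_gt0. Qed.
Let tn_ge0 n : 0 <= tn n. Proof. exact: ltW. Qed.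
Let tn2 n : tn n <= (2 ^+ n)^-1.
Proof. by rewrite lef_pV2 ?posrE ?exprn_gt0// lerXn2r ?nnegrE// ler_nat. Qed.

Let step (n : nat) (t : R) : nat := Num.truncn (16 ^+ n * t).

Definition approx_flow (n : nat) (t a x : R) : R := euler (tn n) (step n t) a x.

Let step_spec n t : 0 <= t -> (step n t)%:R <= 16 ^+ n * t < (step n t).+1%:R.
Proof. by move=> t0; apply: truncn_itv; rewrite mulr_ge0// exprn_ge0. Qed.

Let step_le n t : 0 <= t -> tn n * (step n t)%:R <= t < tn n * (step n t)%:R + tn n.
Proof.
move=> t0; have p0 : 0 < 16 ^+ n :> R by rewrite exprn_gt0.
have /andP[k1 k2] := step_spec n t0.
apply/andP; split; first by rewrite /tn mulrC ler_pdivrMr// mulrC.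
have -> : tn n * (step n t)%:R + tn n = (step n t).+1%:R / 16 ^+ n.
  by rewrite /tn -natr1; ring.
by rewrite ltr_pdivlMr// mulrC.
Qed.

Let step_mono n t t' : 0 <= t -> t <= t' -> (step n t <= step n t')%N.
Proof.
move=> t0 tt'; have /andP[A _] := step_spec n t0.
have /andP[_ B] := step_spec n (le_trans t0 tt').
rewrite -ltnS -(ltr_nat R); apply: (le_lt_trans A); apply: le_lt_trans B.
by rewrite ler_wpM2l// exprn_ge0.
Qed.

(** Since 16^(m - n) is an integer, integer parts nest: the coarse step index is the quotient of the
    fine one, which is how [refinement_cauchy] pairs the schemes. *)
Let step_div n m t : (n <= m)%N -> 0 <= t -> (step m t %/ 16 ^ (m - n))%N = step n t.
Proof.
move=> nm t0; have N0 : (0 < 16 ^ (m - n))%N by rewrite expn_gt0.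
have NR : 0 < (16 ^ (m - n))%:R :> R by rewrite ltr0n.
have /andP[k1 k2] := step_spec n t0; have /andP[j1 j2] := step_spec m t0.
have E16 : 16 ^+ m * t = (16 ^ (m - n))%:R * (16 ^+ n * t).
  by rewrite natrX mulrA -exprD subnK.
have A1 : (step n t * 16 ^ (m - n) <= step m t)%N.
  rewrite -ltnS -(ltr_nat R) natrM; apply: le_lt_trans j2.
  by rewrite E16 mulrC ler_pM2l.
have A2 : (step m t < (step n t).+1 * 16 ^ (m - n))%N.
  rewrite -(ltr_nat R) natrM; apply: (le_lt_trans j1).
  by rewrite E16 mulrC ltr_pM2r.
apply/eqP; rewrite eqn_leq leq_divRL// A1 andbT -ltnS ltn_divLR//.
Qed.

(** The constant of [refinement_cauchy], plus 1 so that it dominates the square root of that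
    constant and no root has to be taken. *)
Definition rate (T : R) : R :=
  2 * (C ^+ 2 + T * (2 * C * mass + 8 * C ^+ 2 * mass * T + mass + 8 * C ^+ 2)) + 1.

Let rate_ge0 T : 0 <= T -> 0 <= rate T.
Proof.
move=> T0; rewrite /rate; have C2 := sqr_ge0 C.
have := mulr_ge0 C0 mass0; have := mulr_ge0 (mulr_ge0 C2 mass0) T0 => a1 a2.
have : 0 <= T * (2 * C * mass + 8 * C ^+ 2 * mass * T + mass + 8 * C ^+ 2).
  by apply: mulr_ge0 => //; move: mass0; lra.
lra.
Qed.

Let approx_cauchy T n m t a x : (n <= m)%N -> 0 <= t <= T ->
  `|approx_flow n t a x - approx_flow m t a x| <= rate T * (2 ^+ n)^-1.
Proof.
move=> nm /andP[t0 tT]; have T0 := le_trans t0 tT.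
have N0 : (0 < 16 ^ (m - n))%N by rewrite expn_gt0.
have tauE : (16 ^ (m - n))%:R * tn m = tn n.
  rewrite natrX /tn -{2}(subnK nm) exprD invfM mulrA mulfV ?mul1r//.
(* The parameter e is 4^-n, whose square is the coarse step 16^-n. *)
have e0 : 0 < (4 ^+ n)^-1 :> R by rewrite invr_gt0 exprn_gt0.
have e1 : (4 ^+ n)^-1 <= 1 :> R by rewrite invf_le1 ?exprn_gt0// exprn_ege1// ler1n.
have te : (16 ^ (m - n))%:R * tn m <= (4 ^+ n)^-1 ^+ 2.
  by rewrite tauE /tn exprVn -exprM mulnC exprM (_ : 4 ^+ 2 = 16 :> R)//; ring.
have sT : tn m * (step m t)%:R <= T by have /andP[/le_trans ->] := step_le m t0.
have := refinement_cauchy mh h0 hfin Rv0 r0 bX0 (tn0 m) N0 a x e0 e1 te T0 sT.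
rewrite tauE step_div// -/(approx_flow n t a x) -/(approx_flow m t a x) => H.
have p2 : 0 <= (2 ^+ n)^-1 :> R by rewrite invr_ge0 exprn_ge0.
have rT := rate_ge0 T0.
rewrite -(ler_pXn2r (ltn0Sn 1)) ?nnegrE ?mulr_ge0// real_normK ?num_real//.
apply: (le_trans H); rewrite exprMn exprVn -exprM mulnC exprM (_ : 2 ^+ 2 = 4 :> R); last by ring.
rewrite mulrC ler_pM2r//; move: rT; rewrite /rate.
set K := 2 * _ => K1; nra.
Qed.

Definition flow (t a x : R) : R := limn (fun n => approx_flow n t a x).

Let flow_rate T n t a x : 0 <= t <= T ->
  `|flow t a x - approx_flow n t a x| <= rate T * (2 ^+ n)^-1.
Proof.
move=> tT; have T0 : 0 <= T by case/andP: tT; exact: le_trans.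
have [l hl hr] := cauchy_geo (rate_ge0 T0) (fun n m nm => approx_cauchy a x nm tT).
by rewrite /flow (cvg_lim _ hl).
Qed.

Let cvg_flow t a x : 0 <= t -> approx_flow n t a x @[n --> \oo] --> flow t a x.
Proof.
move=> t0; apply: (cvg_geo_bound (rate_ge0 t0)) => n.
by apply: flow_rate; rewrite t0 lexx.
Qed.

Let cvg_tn : tn n @[n --> \oo] --> (0 : R).
Proof.
apply: (@cvg_geo_bound _ 1) => // n.
by rewrite sub0r normrN ger0_norm// mul1r; exact: tn2.
Qed.

Let cvg_steps t t' : 0 <= t -> t <= t' ->
  tn n * (step n t' - step n t)%:R @[n --> \oo] --> t' - t.
Proof.
move=> t0 tt'; apply: (@cvg_geo_bound _ 1) => // n.
have t0' := le_trans t0 tt'.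
rewrite natrB ?step_mono// mul1r; apply: (le_trans _ (tn2 n)).
have /andP[A1 A2] := step_le n t0; have /andP[B1 B2] := step_le n t0'.
rewrite mulrBr ler_norml; apply/andP; split; lra.
Qed.

Let approx_shift n t t' : 0 <= t -> t <= t' -> approx_flow n t' =
  euler (tn n) (step n t + (step n t' - step n t))%N.
Proof. by move=> t0 tt'; rewrite subnKC ?step_mono. Qed.

Lemma flow0 a x : flow 0 a x = clamp (- r) r x.
Proof.
rewrite /flow; apply: cvg_lim => //; rewrite /approx_flow /step.
under eq_fun do rewrite mulr0 truncn0.
exact: cvg_cst.
Qed.

Lemma flow_lipschitz t t' a x : 0 <= t -> 0 <= t' ->
  `|flow t a x - flow t' a x| <= C * `|t - t'|.
Proof.
wlog tt' : t t' / t <= t'.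
  move=> W t0 t0'; have [l|/ltW l] := leP t t'; first exact: W.
  by rewrite distrC [`|t - _|]distrC; exact: W.
move=> t0 t0'; rewrite distrC [`|t - _|]distrC (ger0_norm (_ : 0 <= t' - t)) ?subr_ge0//.
have L : `|approx_flow n t' a x - approx_flow n t a x| @[n --> \oo]
    --> `|flow t' a x - flow t a x|.
  by apply: cvg_norm; apply: cvgB; exact: cvg_flow.
have M : C * (tn n * (step n t' - step n t)%:R) @[n --> \oo] --> C * (t' - t).
  by apply: cvgMr; exact: cvg_steps.
apply: (ler_cvg_to L M); near=> n.
rewrite (approx_shift n t0 tt') mulrA.
exact: (euler_step mh h0 hfin Rv0 r0 bX0 (tn_ge0 n)).
Unshelve. all: by end_near. Qed.

Let approx_norm n t a x : 0 <= t -> `|approx_flow n t a x| <= r + C * t.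
Proof.
move=> t0; apply: (le_trans (euler_norm mh h0 hfin Rv0 r0 bX0 (tn_ge0 n) _ a x)).
by rewrite lerD2l -mulrA ler_wpM2l//; case/andP: (step_le n t0).
Qed.

Lemma flow_norm t a x : 0 <= t -> `|flow t a x| <= r + C * t.
Proof.
move=> t0; have := flow_lipschitz a x t0 (lexx 0).
rewrite subr0 flow0 (ger0_norm t0) => H.
have H0 : `|clamp (- r) r x| <= r.
  by rewrite ler_norml clamp_ge ?clamp_le//; move: r0; lra.
have := ler_normD (flow t a x - clamp (- r) r x) (clamp (- r) r x).
rewrite subrK; lra.
Qed.

Lemma flow_nd t a x x' : 0 <= t -> x <= x' -> flow t a x <= flow t a x'.
Proof.
move=> t0 xx'; rewrite -subr_ge0.
have L : approx_flow n t a x' - approx_flow n t a x @[n --> \oo]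
    --> flow t a x' - flow t a x.
  by apply: cvgB; exact: cvg_flow.
have M : - (2 * C * tn n) @[n --> \oo] --> - (2 * C * 0).
  by apply: cvgN; apply: cvgMr; exact: cvg_tn.
rewrite mulr0 oppr0 in M; apply: (ler_cvg_to M L); near=> n.
exact: (euler_gap_ge mh h0 hfin Rv0 r0 bX0 (tn_ge0 n)).
Unshelve. all: by end_near. Qed.

(** The limit of [euler_gap_le], in which the overshoot 2 C tau disappears. For x and x' that share
    their position at time t, it says that they remain together. *)
Lemma flow_sticky t t' a x x' : 0 <= t -> t <= t' -> x <= x' ->
  flow t' a x' - flow t' a x <= flow t a x' - flow t a x.
Proof.
move=> t0 tt' xx'; have t0' := le_trans t0 tt'.
have L u : 0 <= u -> approx_flow n u a x' - approx_flow n u a x @[n --> \oo]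
    --> flow u a x' - flow u a x.
  by move=> u0; apply: cvgB; exact: cvg_flow.
have M : approx_flow n t a x' - approx_flow n t a x + 4 * C * tn n @[n --> \oo]
    --> flow t a x' - flow t a x + 4 * C * 0.
  by apply: cvgD; [exact: L|apply: cvgMr; exact: cvg_tn].
rewrite mulr0 addr0 in M; apply: (ler_cvg_to (L _ t0') M); near=> n.
rewrite (approx_shift n t0 tt').
have := euler_gap_le mh h0 hfin Rv0 r0 bX0 (tn_ge0 n) (step n t) (step n t' - step n t) a xx'.
have := euler_gap_ge mh h0 hfin Rv0 r0 bX0 (tn_ge0 n) (step n t) a xx'.
have := mulr_ge0 C0 (tn_ge0 n).
rewrite -/(approx_flow n t a x) -/(approx_flow n t a x') le_max => c0 g1 /orP[]; lra.
Unshelve. all: by end_near. Qed.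

Lemma flow_contract t a x x' : 0 <= t -> x <= x' -> flow t a x' - flow t a x <= x' - x.
Proof.
move=> t0 xx'; apply: (le_trans (flow_sticky a (lexx 0) t0 xx')); rewrite !flow0.
have := @clamp_lipschitz _ (- r) r x' x; rewrite (ger0_norm (_ : 0 <= x' - x)) ?subr_ge0//.
by apply: le_trans; exact: ler_norm.
Qed.

Lemma bm2_flow t : 0 <= t -> bm2 (flow t).
Proof.
move=> t0; apply: (@bmeas_lim _ _ _ (fun n (p : borelR2 R) => approx_flow n t p.1 p.2) _ (r + C * t)).
- by move=> n; exact: bmeas_measurable (bm2_euler mh h0 hfin Rv0 r0 bX0 (tn n) (step n t)).
- move=> n p; exact: approx_norm.
- by move=> p; exact: cvg_flow.
Qed.

Definition flow_along (t a s : R) : R := flow t a (X0 a s).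

Lemma bm2_flow_along t : 0 <= t -> bm2 (flow_along t).
Proof. by move=> t0; exact: (bm2_along bX0 (bm2_flow t0)). Qed.

Let bm2_approx n t : bm2 (approx_flow n t).
Proof. exact: bm2_euler. Qed.

Let cvg_dist t (Y : R -> R -> R) : 0 <= t -> bm2 Y ->
  pint P (fun a s => (approx_flow n t a (X0 a s) - Y a s) ^+ 2) @[n --> \oo] -->
  pint P (fun a s => (flow_along t a s - Y a s) ^+ 2).
Proof.
move=> t0 bY; have [mY [M hM]] := bY.
apply: (@cvg_pint _ P _ _ ((r + C * t + M) ^+ 2)).
- by move=> n; apply: bmeasX; apply: bmeasB => //; exact: (bm2_along bX0 (bm2_approx n t)).
- by apply: bmeasX; apply: bmeasB => //; exact: bm2_flow_along.
- move=> n a s; rewrite normrX lerXn2r ?nnegrE//.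
    by apply: le_trans (normr_ge0 (flow_along t a s - Y a s)) _; apply: (le_trans (ler_normB _ _)); apply: lerD; [exact: flow_norm|exact: (hM (a, s))].
  by apply: (le_trans (ler_normB _ _)); apply: lerD; [exact: approx_norm|exact: (hM (a, s))].
- apply: aeW => p; apply: cvgM; apply: cvgB; (exact: cvg_cst || exact: cvg_flow).
Qed.

Let cvg_energy t : 0 <= t ->
  E (fun a s => approx_flow n t a (X0 a s)) @[n --> \oo] --> E (flow_along t).
Proof.
move=> t0; have tt : 0 <= t <= t by rewrite t0 lexx.
have b1 n : bm2 (fun a s => approx_flow n t a (X0 a s)) := bm2_along bX0 (bm2_approx n t).
have b2 := bm2_flow_along t0.
apply: (@cvg_geo_bound _ (C * (rate t * mass))); first by rewrite !mulr_ge0 ?rate_ge0.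
move=> n.
have bd (Y Z : R -> R -> R) : bm2 Y -> bm2 Z -> (forall a s, `|Y a s - Z a s| <= rate t * (2 ^+ n)^-1) ->
    E Y - E Z <= C * (rate t * mass) * (2 ^+ n)^-1.
  move=> bY bZ hYZ; apply: (le_trans (energy_lip mh h0 hfin Rv0 bZ bY)).
  rewrite -mulrA ler_wpM2l//.
  have bN : bm2 (fun a s => `|Y a s - Z a s|) by apply: bmeas_norm; exact: bmeasB.
  apply: (@le_trans _ _ (pint P (fun a s => rate t * (2 ^+ n)^-1))).
    by apply: le_pint => //; exact: bmeas_cst.
  by rewrite pint_cst -mulrA [_^-1 * _]mulrC mulrA.
rewrite ler_norml; apply/andP; split.
  rewrite lerNl opprB; apply: bd => // a s; rewrite distrC; exact: flow_rate.
by apply: bd => // a s; exact: flow_rate.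
Qed.

(** In the limit of [euler_evi] the term with the additional factor tau vanishes, and step counts
    times tau tend to the elapsed time. *)
Lemma flow_evi t t' (Y : R -> R -> R) : 0 <= t -> t <= t' -> bm2 Y ->
  pint P (fun a s => (flow_along t' a s - Y a s) ^+ 2) <=
  pint P (fun a s => (flow_along t a s - Y a s) ^+ 2) +
  2 * (t' - t) * (E Y - E (flow_along t) + C ^+ 2 * mass * (t' - t)).
Proof.
move=> t0 tt' bY; have t0' := le_trans t0 tt'.
have L1 := cvg_dist t0' bY; have L2 := cvg_dist t0 bY.
have L3 := cvg_energy t0; have L4 := cvg_steps t0 tt'; have L5 := cvg_tn.
set rhs := (X in _ <= X).
have -> : rhs = rhs + C ^+ 2 * mass * 0 * (t' - t) by rewrite mulr0 mul0r addr0.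
rewrite /rhs; apply: (ler_cvg_to L1).
  apply: cvgD.
    apply: cvgD; first exact: L2.
    apply: cvgM; first by apply: cvgMr; exact: L4.
    apply: cvgD; last by apply: cvgMr; exact: L4.
    by apply: cvgB; [exact: cvg_cst|exact: L3].
  by apply: cvgM; [apply: cvgMr; exact: L5|exact: L4].
near=> n; rewrite (approx_shift n t0 tt').
exact: (euler_evi mh h0 hfin Rv0 r0 bX0 (tn_ge0 n) (step n t) (step n t' - step n t) bY).
Unshelve. all: by end_near. Qed.

End limit_flow.

Lemma bm_lt {R : realType} (c : R) : bm (fun z => (z < c)%R%:R).
Proof.
rewrite (_ : (fun z => _) = (fun z => 1 - (c <= z)%R%:R)).
  by apply: bmB; [exact: bm_cst|exact: bm_ge].
by apply/funext => u; case: ltP => _; rewrite ?subr0 ?subrr.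
Qed.

Lemma measurable_cvg_set d (T : measurableType d) (R : realType) (f_ : nat -> T -> R) (f : T -> R) :
  (forall n, measurable_fun setT (f_ n)) -> measurable_fun setT f ->
  measurable [set x | f_ n x @[n --> \oo] --> f x].
Proof.
move=> mf_ mf.
pose S k n : set T := [set x | `|f x - f_ n x| <= k.+1%:R^-1].
have mS k n : measurable (S k n).
  suff H : measurable_fun setT (fun x => `|f x - f_ n x| <= k.+1%:R^-1).
    by rewrite -[X in measurable X]setTI; exact: H.
  apply: measurable_fun_ler; last exact: measurable_cst.
  by apply: measurableT_comp => //; exact: measurable_funB.
have -> : [set x | f_ n x @[n --> \oo] --> f x] =
    \bigcap_(k : nat) \bigcup_(N : nat) \bigcap_(n in [set n | (N <= n)%N]) S k n.
  apply/seteqP; split=> [x /cvgrPdist_le hx k _|x hx].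
    have [|N _ hN] := hx k.+1%:R^-1; first by rewrite invr_gt0.
    by exists N => // n /= Nn; exact: (hN n Nn).
  apply/cvgrPdist_le => e e0; have [k _ hk] := near_infty_natSinv_lt (PosNum e0).
  have [N _ hN] := hx k Logic.I; exists N => // n /= Nn.
  by apply: (le_trans (hN n Nn)); apply: ltW; exact: (hk k (leqnn k)).
apply: bigcap_measurable => // k _; apply: bigcup_measurable => N _.
by apply: bigcap_measurable => //; exists N => /=.
Qed.

(** * Velocity as a function of position *)

Section flow_velocity.
Context {R : realType}.
Variables (mu : {sigma_finite_measure set (borelR R) -> \bar R}) (Rv : R) (h : R -> R).
Hypotheses (mh : measurable_fun setT (h : borelR R -> borelR R)) (h0 : forall a, 0 <= h a).
Hypothesis hfin : (\int[mu]_(a in levels Rv) (h a)%:E < +oo)%E.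
Hypothesis Rv0 : 0 < Rv.
Local Notation P := (level_measure mh h0 hfin).
Local Notation E := (lagrangian_energy mh h0 hfin).
Local Notation C := (speed_bound mh h0 hfin).
Variables (r : R) (X0 : R -> R -> R).
Hypotheses (r0 : 0 <= r) (bX0 : bm2 X0).
Local Notation flow := (flow mh h0 hfin r X0).

Let C0 : 0 <= C. Proof. exact: speed_bound_ge0. Qed.

(* Extended to negative times by the initial value, so as to be Lipschitz on the whole line. *)
Definition eflow (t a x : R) : R := flow (Num.max 0 t) a x.

Let max0 (t : R) : 0 <= Num.max 0 t. Proof. by rewrite le_max lexx. Qed.
Let max_mono (t t' : R) : t <= t' -> Num.max 0 t <= Num.max 0 t'.
Proof. by move=> tt'; rewrite ge_max !le_max lexx tt' orbT. Qed.

Lemma eflow_lipschitz a x : lipschitz_with C (fun t => eflow t a x).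
Proof.
move=> t t'; apply: (le_trans (flow_lipschitz mh h0 hfin Rv0 r0 bX0 a x (max0 t) (max0 t'))).
by rewrite ler_wpM2l//; case: (leP 0 t); case: (leP 0 t'); move=> *; rewrite ler_norml; apply/andP; split;
  case: (ltrgtP t t') => *; lra.
Qed.

Lemma eflow_norm T t a x : 0 <= T -> t <= T -> `|eflow t a x| <= r + C * T.
Proof.
move=> T0 tT; apply: (le_trans (flow_norm mh h0 hfin Rv0 r0 bX0 a x (max0 t))).
by rewrite lerD2l ler_wpM2l// ge_max T0.
Qed.

Lemma eflow_nd t a x x' : x <= x' -> eflow t a x <= eflow t a x'.
Proof. exact: flow_nd. Qed.

Lemma eflow_contract t a x x' : x <= x' -> eflow t a x' - eflow t a x <= x' - x.
Proof. exact: flow_contract. Qed.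

Lemma eflow_sticky t t' a x x' : t <= t' -> eflow t a x = eflow t a x' -> eflow t' a x = eflow t' a x'.
Proof.
wlog xx' : x x' / x <= x'.
  by move=> W tt' e; have [l|/ltW l] := leP x x'; [exact: W|apply/esym; exact: W].
move=> tt' e; apply/eqP; rewrite eq_le eflow_nd//= -subr_le0.
have := flow_sticky mh h0 hfin Rv0 r0 bX0 a (max0 t) (max_mono tt') xx'.
by rewrite -/(eflow t a x) -/(eflow t a x') e subrr.
Qed.

Lemma eflow_clamp t a x : eflow t a (clamp (- r) r x) = eflow t a x.
Proof.
have rr : - r <= r by move: r0; lra.
apply: (@eflow_sticky (Num.min 0 t)); first by rewrite ge_min lexx orbT.
rewrite /eflow (_ : Num.max 0 _ = 0); last by apply/max_idPl; rewrite ge_min lexx.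
by rewrite !flow0// (@clamp_id _ _ _ (clamp _ _ _))// clamp_ge ?clamp_le.
Qed.

Lemma bm2_eflow t : bm2 (eflow t).
Proof. exact: bm2_flow. Qed.

Lemma measurable_eflow : measurable_fun setT
  (fun q : borelR R * borelR2 R => eflow q.1 q.2.1 q.2.2 : borelR R).
Proof.
apply: (@measurable_fun_cvg _ _ R setT
  (fun n (q : borelR R * borelR2 R) => eflow (clamp 0 n.+1%:R q.1) q.2.1 q.2.2)).
  move=> n; apply: bmeas_measurable.
  apply: (@caratheodory_bmeas R _ (borelR2 R) n.+1%:R C (r + C * n.+1%:R) (fun t p => eflow t p.1 p.2)) => //.
  - by move=> t; exact: bm2_eflow.
  - by move=> t t' p _ _; exact: eflow_lipschitz.
  - by move=> t p /andP[_ tn]; exact: eflow_norm.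
move=> -[t [a x]] _ /=.
apply: cvg_near_cst; exists (Num.truncn t) => // n /= nt.
rewrite /eflow /clamp; congr (flow _ a x).
have tn : t <= n.+1%:R by apply/ltW/(lt_le_trans (truncnS_gt _)); rewrite ler_nat.
by rewrite (min_idPl tn) maxA maxxx.
Qed.

Lemma measurable_eflow_comp d (S : measurableType d) (f g k : S -> borelR R) :
  measurable_fun setT f -> measurable_fun setT g -> measurable_fun setT k ->
  measurable_fun setT (fun s => eflow (f s) (g s) (k s) : borelR R).
Proof.
move=> mf mg mk.
have mp : measurable_fun setT (fun s => (f s, (g s, k s)) : borelR R * borelR2 R).
  by apply/measurable_fun_pairP; split => //; apply/measurable_fun_pairP.
exact: (measurableT_comp measurable_eflow mp).
Qed.

(* The last starting point in [-r, r] whose trajectory has not passed [y] at time [t]. *)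
Definition label (t a y : R) : R := ibint (- r) r (fun z => (eflow t a z <= y)%R%:R) - r.

Let mlabel_ind : bmeas (fun p : (borelR2 R * borelR R) * borelR R =>
  (eflow p.1.1.1 p.1.1.2 p.2 <= p.1.2)%R%:R : R).
Proof.
apply: (@bmeas_le _ _ _ _ 1); last by move=> p; rewrite ger0_norm// lern1 leq_b1.
rewrite (_ : (fun p => _) = fun p : (borelR2 R * borelR R) * borelR R =>
  if eflow p.1.1.1 p.1.1.2 p.2 <= p.1.2 then 1 else 0); last by apply/funext => p; case: ifP.
apply: measurable_fun_ifT; [|exact: measurable_cst|exact: measurable_cst].
apply: measurable_fun_ler; last exact: measurableT_comp measurable_snd measurable_fst.
apply: measurable_eflow_comp.
- exact: measurableT_comp measurable_fst (measurableT_comp measurable_fst measurable_fst).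
- exact: measurableT_comp measurable_snd (measurableT_comp measurable_fst measurable_fst).
- exact: measurable_snd.
Qed.

Let bm_label_ind t a y : bm (fun z => (eflow t a z <= y)%R%:R).
Proof. exact: (bmeas_section1 ((t, a), y) mlabel_ind). Qed.

Lemma measurable_label : measurable_fun setT
  (fun q : borelR2 R * borelR R => label q.1.1 q.1.2 q.2 : borelR R).
Proof.
apply: measurable_funB; last exact: measurable_cst.
have := bmeas_bint1 (lebI (- r) r) mlabel_ind => /bmeas_measurable.
by apply: eq_measurable_fun => q _; rewrite ibintE.
Qed.

(** The flow is 1-Lipschitz in the starting point, so that when some trajectory is at y, the last
    one not beyond y is exactly at y. By stickiness the two then have the same future. *)
Lemma eflow_label t t' a x : t <= t' -> eflow t' a (label t a (eflow t a x)) = eflow t' a x.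
Proof.
move=> tt'; rewrite -[RHS]eflow_clamp -[eflow t a x]eflow_clamp; apply: (eflow_sticky tt').
have rr : - r <= r by move: r0; lra.
have [x1 x2] : - r <= clamp (- r) r x /\ clamp (- r) r x <= r by rewrite clamp_ge ?clamp_le.
move: (clamp _ _ _) x1 x2 => {}x x1 x2; set y := eflow t a x; set z := label t a y.
have xz : x <= z.
  rewrite -(lerD2r r) /z /label subrK -(@ibint_lt _ r x) ?x1//.
  apply: le_ibint => //; [exact: bm_lt|move=> u _]; case: ltP => // ux.
  by rewrite (eflow_nd t a (ltW ux)).
apply/eqP; rewrite eq_le; apply/andP; split; last exact: eflow_nd.
rewrite leNgt; apply/negP => zy.
(* If z were beyond y at time t, the 1-Lipschitz bound would put c beyond y as well. Only starting
   points below max(c, x) would then be counted in the label, which forces z <= x, against the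
   assumption. *)
pose c := z - (eflow t a z - y) / 2.
have cz : c < z by rewrite /c; lra.
have zr : z <= r.
  rewrite lerBlDr; apply: le_trans (_ : ibint (- r) r (fun=> 1) <= _).
    by apply: le_ibint => //; [exact: bm_cst|move=> u _; rewrite lern1 leq_b1].
  by rewrite ibint_cst// mul1r opprK.
have yc : y < eflow t a c.
  have := eflow_contract t a (ltW cz); rewrite /c; lra.
have : z <= Num.max c x.
  rewrite -(lerD2r r) {1}/z /label subrK -(@ibint_lt _ r (Num.max c x)); last first.
    by rewrite le_max x1 orbT ge_max x2 (le_trans (ltW cz) zr).
  apply: le_ibint => //; [exact: bm_lt|move=> u _]; case: (leP (eflow t a u) y) => //= uy.
  rewrite lt_max; case: (ltP u c) => //= cu.
  by have := eflow_nd t a cu; rewrite leNgt (le_lt_trans uy yc).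
rewrite le_max leNgt cz/= => zx; have := eflow_nd t a zx; rewrite -/y; lra.
Qed.

(** The forward difference quotient of a trajectory that is at y at time t, located through its
    label. *)
Let quot (n : nat) (t a y : R) : R :=
  clamp (- C) C (n.+1%:R * (eflow (t + n.+1%:R^-1) a (label t a y) - y)).

(** The upper limit is measurable and defined everywhere, also at positions that no trajectory
    visits. The outer truncation gives the bound without an argument on upper limits. *)
Definition velocity (t a y : R) : R := clamp (- C) C (limn_sup (fun n => quot n t a y)).

Let CC : - C <= C. Proof. by move: C0; lra. Qed.

Let quotC n t a y : `|quot n t a y| <= C.
Proof. by rewrite ler_norml clamp_ge ?clamp_le. Qed.

Let mquot n : measurable_fun setT (fun q : borelR2 R * borelR R => quot n q.1.1 q.1.2 q.2 : borelR R).
Proof.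
apply: (bmeas_measurable (bmeas_clamp CC _)).
apply: measurable_funM; first exact: measurable_cst.
apply: measurable_funB; last exact: measurable_snd.
apply: measurable_eflow_comp.
- apply: measurable_funD; last exact: measurable_cst.
  exact: measurableT_comp measurable_fst measurable_fst.
- exact: measurableT_comp measurable_snd measurable_fst.
- exact: measurable_label.
Qed.

Lemma velocity_bound t a y : `|velocity t a y| <= C.
Proof. by rewrite ler_norml clamp_ge ?clamp_le. Qed.

Lemma measurable_velocity_field :
  measurable_fun setT (fun q : borelR2 R * borelR R => velocity q.1.1 q.1.2 q.2 : borelR R).
Proof.
apply: (bmeas_measurable (bmeas_clamp CC _)).
apply: measurable_fun_limn_sup => [q _|q _|n]; last exact: mquot.
  exists C => _ [n _ <-]; exact: le_trans (ler_norm _) (quotC _ _ _ _).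
by exists (- C) => _ [n _ <-]; have := quotC n q.1.1 q.1.2 q.2; rewrite ler_norml => /andP[].
Qed.

Definition trajectory (t a s : R) : R := eflow t a (X0 a s).
Local Notation X := trajectory.

Lemma trajectory_lipschitz a s : lipschitz_with C (fun t => X t a s).
Proof. exact: eflow_lipschitz. Qed.

Lemma bm2_trajectory t : bm2 (X t).
Proof. exact: (bm2_along bX0 (bm2_eflow t)). Qed.

Lemma measurable_trajectory : measurable_fun setT
  (fun q : borelR R * borelR2 R => X q.1 q.2.1 q.2.2 : borelR R).
Proof.
apply: measurable_eflow_comp.
- exact: measurable_fst.
- exact: measurableT_comp measurable_fst measurable_snd.
- exact: measurableT_comp (bmeas_measurable bX0) measurable_snd.
Qed.

Lemma velocity_trajectory t a s l : dqp (fun t => X t a s) t n @[n --> \oo] --> l ->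
  velocity t a (X t a s) = l.
Proof.
move=> dl; have dC n : `|dqp (fun t => X t a s) t n| <= C.
  rewrite /dqp normrM ger0_norm// -ler_pdivlMl// mulrC.
  apply: (le_trans (eflow_lipschitz _ _ _ _)).
  by rewrite addrAC subrr add0r ger0_norm ?invr_ge0.
have q n : quot n t a (X t a s) = dqp (fun t => X t a s) t n.
  by rewrite /quot /X eflow_label ?lerDl// clamp_id// -ler_norml; exact: dC.
rewrite /velocity; under eq_fun do rewrite q; have [_ ->] := cvg_limn_inf_sup dl.
apply: clamp_id; rewrite -ler_norml.
by apply: (ler_cvg_to (cvg_norm dl) (@cvg_cst _ C _ \oo _)); apply: nearW => n; exact: dC.
Qed.

Let along (t a s : R) : R := velocity t a (X t a s).

Lemma measurable_along : measurable_fun setT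
  (fun q : borelR R * borelR2 R => velocity q.1 q.2.1 (X q.1 q.2.1 q.2.2) : borelR R).
Proof.
have mp : measurable_fun setT
    (fun q : borelR R * borelR2 R => ((q.1, q.2.1), X q.1 q.2.1 q.2.2) : borelR2 R * borelR R).
  apply/measurable_fun_pairP; split; last exact: measurable_trajectory.
  apply/measurable_fun_pairP; split; first exact: measurable_fst.
  exact: measurableT_comp measurable_fst measurable_snd.
exact: (measurableT_comp measurable_velocity_field mp).
Qed.

Lemma bm3_along : bm3 along.
Proof. by apply: (@bmeas_le _ _ _ _ C) => [|q]; [exact: measurable_along|exact: velocity_bound]. Qed.

Lemma trajectory_derivative T a s : 0 <= T -> \forall t \ae lebI 0 T,
  dqp (fun t => X t a s) t n @[n --> \oo] --> along t a s.
Proof.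
move=> T0; have [g [_ dg _]] := lipschitz_density T0 (trajectory_lipschitz a s).
by apply: ae_imply dg => t [h1 _]; rewrite /along (velocity_trajectory h1).
Qed.

Lemma ae_trajectory_derivative T : 0 <= T -> \forall t \ae lebI 0 T, \forall p \ae P,
  dqp (fun t => X t p.1 p.2) t n @[n --> \oo] --> along t p.1 p.2.
Proof.
move=> T0.
pose Q := [set q : borelR2 R * borelR R |
  dqp (fun t => X t q.1.1 q.1.2) q.2 n @[n --> \oo] --> along q.2 q.1.1 q.1.2].
apply: (@ae_swap _ _ (borelR2 R) (borelR R) R P (lebI 0 T) Q).
  have msw : measurable_fun setT (fun q : borelR2 R * borelR R => (q.2, q.1)).
    by apply/measurable_fun_pairP; split; [exact: measurable_snd|exact: measurable_fst].
  apply: (@measurable_cvg_set _ (borelR2 R * borelR R)%type R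
    (fun n q => dqp (fun t => X t q.1.1 q.1.2) q.2 n) (fun q => along q.2 q.1.1 q.1.2)).
    move=> n; apply: measurable_funM; first exact: measurable_cst.
    have m2 : measurable_fun setT (fun q : borelR2 R * borelR R => q.1.1 : borelR R).
      exact: measurableT_comp measurable_fst measurable_fst.
    have m3 : measurable_fun setT (fun q : borelR2 R * borelR R => X0 q.1.1 q.1.2 : borelR R).
      exact: measurableT_comp (bmeas_measurable bX0) measurable_fst.
    have mX (f : borelR2 R * borelR R -> borelR R) : measurable_fun setT f ->
        measurable_fun setT (fun q : borelR2 R * borelR R => X (f q) q.1.1 q.1.2 : borelR R).
      by move=> mf; exact: (measurable_eflow_comp mf m2 m3).
    apply: measurable_funB; last by apply: mX; exact: measurable_snd.
    apply: (mX (fun q : borelR2 R * borelR R => (q.2 : R) + n.+1%:R^-1)).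
    by apply: measurable_funD; [exact: measurable_snd|exact: measurable_cst].
  exact: (measurableT_comp measurable_along msw).
by apply: aeW => -[a s]; exact: trajectory_derivative.
Qed.

End flow_velocity.

(** * Conditional expectation and plans *)

Section weighted_pushforward.
Context d (T : measurableType d) d' (S : measurableType d') (R : realType).
Variables (m : {finite_measure set T -> \bar R}) (phi : T -> S) (f : T -> R).
Hypotheses (mphi : measurable_fun setT phi) (bf : bmeas f) (f0 : forall x, 0 <= f x).

(** The image of the measure f m under [phi]. Its density with respect to the image of m is the
    conditional expectation of f given [phi]. *)
Definition weighted_pushforward (U : set S) : \bar R := (\int[m]_(x in phi @^-1` U) (f x)%:E)%E.
Local Notation w := weighted_pushforward.

Let w0 : w set0 = 0%E.
Proof. by rewrite /w preimage_set0 integral_set0. Qed.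

Let w_ge0 U : (0 <= w U)%E.
Proof. by apply: integral_ge0 => x _; rewrite lee_fin. Qed.

Let w_sigma_additive : semi_sigma_additive w.
Proof.
move=> F mF tF mUF; rewrite /w preimage_bigcup.
have mf : measurable_fun setT (fun x => (f x)%:E) by apply/measurable_EFinP; exact: bmeas_measurable bf.
have mpre (U : set S) : measurable U -> measurable (phi @^-1` U).
  by move=> mU; rewrite -[X in measurable X]setTI; exact: mphi.
have := @semi_sigma_additive_nng_induced _ _ R m _ mf _ (fun n => phi @^-1` F n); apply.
- by move=> x; rewrite lee_fin.
- by move=> n; exact: mpre.
- move/trivIsetP : tF => tF; apply/trivIsetP => i j _ _ ij.
  by rewrite -preimage_setI tF// preimage_set0.
- by rewrite -preimage_bigcup; exact: mpre.
Qed.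

HB.instance Definition _ := isMeasure.Build _ _ R w w0 w_ge0 w_sigma_additive.

Let w_finite : fin_num_fun w.
Proof.
move=> U mU; rewrite /w; apply: integrable_fin_num.
  by rewrite -[X in measurable X]setTI; exact: mphi.
apply: (integrableS measurableT) => //; last exact: bmeas_integrable.
by rewrite -[X in measurable X]setTI; exact: mphi.
Qed.

HB.instance Definition _ := Measure_isFinite.Build _ _ R w w_finite.

Definition weighted_pushforward_measure : {finite_measure set S -> \bar R} := w.

End weighted_pushforward.

Section conditional_expectation.
Context d (T : measurableType d) d' (S : measurableType d') (R : realType).
Variables (m : {finite_measure set T -> \bar R}) (phi : T -> S).
Hypothesis mphi : measurable_fun setT phi.

Let law : {finite_measure set S -> \bar R} :=
  weighted_pushforward_measure m mphi (@bmeas_cst _ T R 1) (fun=> ler01).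

Let lawE U : measurable U -> law U = pushforward m phi U.
Proof.
move=> mU; have -> : law U = (\int[m]_(x in phi @^-1` U) cst 1%E x)%E by [].
rewrite integral_cst ?mul1e//.
by rewrite -[X in measurable X]setTI; exact: mphi.
Qed.

Let law_int (k : S -> R) : bmeas k -> \int[law]_y k y = \int[m]_x k (phi x).
Proof.
move=> bk; rewrite /Rintegral (bounded_transfer mphi lawE)//.
  exact: bmeas_measurable bk.
exact: bmeas_comp mphi bk.
Qed.

(** [k] is, up to a constant, an integral of indicators of its superlevel sets, so that an identity
    tested against indicators extends to bounded [k]. *)
Let layer (k : S -> R) (f : T -> R) (K : R) : bmeas k -> bmeas f -> (forall y, `|k y| <= K) ->
  \int[m]_x (k (phi x) * f x) =
  \int[lebI (- K) K]_c \int[m]_x ((c < k (phi x))%R%:R * f x) - K * \int[m]_x f x.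
Proof.
move=> bk bf kK.
have bkp : bmeas (fun x => k (phi x)) by exact: bmeas_comp mphi bk.
have bJ : bmeas (fun q : borelR R * T => (q.1 < k (phi q.2))%R%:R * f q.2 : R).
  apply: bmeasM; last exact: bmeas_comp measurable_snd bf.
  rewrite (_ : (fun q => _) = fun q : borelR R * T => if (q.1 : R) < k (phi q.2) then 1 else 0); last first.
    by apply/funext => q; case: ifP.
  apply: bmeas_if; [|exact: bmeas_cst|exact: bmeas_cst].
  apply: measurable_fun_ltr; first exact: measurable_fst.
  exact: measurableT_comp (bmeas_measurable bkp) measurable_snd.
rewrite (bint_swap (lebI (- K) K) m bJ)/= -bintZl// -bintB; last 2 first.
- exact: (bmeas_bint2 (lebI (- K) K) bJ).
- by apply: bmeasM => //; exact: bmeas_cst.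
apply: eq_Rintegral => x _.
rewrite bintZr; last first.
  exact: (bm_lt (k (phi x))).
by rewrite -ibintE ibint_lt -?ler_norml// mulrDl addrK.
Qed.

Let ge0_case (f : T -> R) (M : R) : 0 <= M -> bmeas f -> (forall x, 0 <= f x <= M) -> exists b : S -> R,
  [/\ bmeas b, forall y, 0 <= b y <= M &
      forall k : S -> R, bmeas k -> \int[m]_x (k (phi x) * f x) = \int[m]_x (k (phi x) * b (phi x))].
Proof.
move=> M0 bf fM; have f0 x : 0 <= f x by case/andP: (fM x).
have mpre (U : set S) : measurable U -> measurable (phi @^-1` U).
  by move=> mU; rewrite -[X in measurable X]setTI; exact: mphi.
pose nu := weighted_pushforward_measure m mphi bf f0.
have nuE U : nu U = (\int[m]_(x in phi @^-1` U) (f x)%:E)%E by [].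
have nu_le U : measurable U -> (nu U <= M%:E * law U)%E.
  move=> mU; rewrite nuE lawE// /pushforward -integral_cst; last exact: mpre.
  apply: ge0_le_integral => //; first exact: mpre.
  - by move=> x _; rewrite lee_fin.
  - apply/measurable_EFinP; apply: measurable_funTS; exact: bmeas_measurable bf.
  - by move=> x _; rewrite /= lee_fin; have /andP[_] := fM x.
have dom : nu `<< law.
  apply/null_content_dominatesP => U mU U0; apply/eqP; rewrite eq_le measure_ge0 andbT.
  by have := nu_le _ mU; rewrite U0 mule0.
have [g [g0 gfin gint gE]] := radon_nikodym_sigma_finite dom.
pose g1 y := fine (g y).
have gE1 : g = EFin \o g1 by apply/funext => y /=; rewrite /g1 fineK.
have mg1 : measurable_fun setT g1.
  by have := measurable_int _ gint; rewrite gE1 => /measurable_EFinP.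
have g10 y : 0 <= g1 y by exact: fine_ge0.
(* The density is at most M almost everywhere, by [nu_le]; cutting it there gives a version that is
   bounded at every point. *)
pose b y := Num.min (g1 y) M.
have mb : measurable_fun setT b.
  by apply: measurable_minr => //; exact: measurable_cst.
have b0M y : 0 <= b y <= M by rewrite /b le_min g10 M0 ge_min lexx orbT.
have bb : bmeas b.
  apply: (@bmeas_le _ _ _ _ M) => // y; case/andP: (b0M y) => b0 bM.
  by rewrite ger0_norm.
pose U : set S := [set y | M < g1 y].
have mU : measurable U.
  suff H : measurable_fun setT (fun y => M < g1 y) by rewrite -[X in measurable X]setTI; exact: H.
  by apply: measurable_fun_ltr => //; exact: measurable_cst.
have gb : \forall y \ae law, g1 y = b y.
  have : ae_eq law U g (cst M%:E).
    apply: (integral_ae_eq mU); [exact: (integrableS measurableT)|exact: measurable_cst|].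
    move=> V VU mV; apply/eqP; rewrite eq_le; apply/andP; split.
      by rewrite integral_cst// -gE//; exact: nu_le.
    apply: ge0_le_integral => //.
      by apply: measurable_funTS; exact: measurable_int gint.
    by move=> y /VU /ltW; rewrite gE1 /= lee_fin.
  apply: filterS => y H; have [l|l] := leP (g1 y) M; first by rewrite /b (min_idPl l).
  by have := H l; rewrite gE1 => -[] e; move: l; rewrite e ltxx.
exists b; split => // k bk.
have [_ [K kK]] := bk.
have bbp : bmeas (fun x => b (phi x)) by exact: bmeas_comp mphi bb.
rewrite (layer bk bf kK) (layer bk bbp kK).
have key (V : set S) : measurable V -> \int[m]_x (\1_V (phi x) * f x) = \int[m]_x (\1_V (phi x) * b (phi x)).
  move=> mV.
  have -> : \int[m]_x (\1_V (phi x) * f x) = fine (nu V).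
    rewrite nuE /Rintegral; congr fine; rewrite [RHS]integral_mkcond; apply: eq_integral => x _.
    by rewrite patchE indicE; have -> : (phi x \in V) = (x \in phi @^-1` V) by []; case: ifP => _; rewrite ?mul1r ?mul0r.
  rewrite -(@law_int (fun y => \1_V y * b y)); last by apply: bmeasM => //; exact: bmeas_indic.
  rewrite gE// /Rintegral; congr fine; rewrite [LHS]integral_mkcond; apply: ae_eq_integral => //.
  - apply/(measurable_restrictT _ mV); apply: measurable_funTS; exact: measurable_int gint.
  - apply/measurable_EFinP; apply: measurable_funM => //; exact: measurable_indic.
  - apply: filterS gb => y gy _; rewrite patchE indicE gE1 /= gy.
    by case: ifP => _; rewrite ?mul1r ?mul0r.
have key2 (c : R) : \int[m]_x ((c < k (phi x))%R%:R * f x) = \int[m]_x ((c < k (phi x))%R%:R * b (phi x)).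
  have mV : measurable [set y | c < k y].
    suff H : measurable_fun setT (fun y => c < k y) by rewrite -[X in measurable X]setTI; exact: H.
    by apply: measurable_fun_ltr; [exact: measurable_cst|exact: bmeas_measurable bk].
  have := key _ mV; under eq_Rintegral do rewrite indicE mem_setE.
  by under [RHS]eq_Rintegral do rewrite indicE mem_setE.
have -> : \int[m]_x f x = \int[m]_x b (phi x).
  have := key setT measurableT; under eq_Rintegral do rewrite indicT mul1r.
  by under [X in _ = X]eq_Rintegral do rewrite indicT mul1r.
by apply: (congr1 (fun z => z - _)); apply: eq_Rintegral => c _; exact: key2.
Qed.

Lemma conditional_expectation (f : T -> R) : bmeas f -> exists b : S -> R,
  bmeas b /\ forall k : S -> R, bmeas k ->
    \int[m]_x (k (phi x) * f x) = \int[m]_x (k (phi x) * b (phi x)).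
Proof.
move=> bf; have [mf [M0 fM0]] := bf.
pose M := `|M0|; have fM x : `|f x| <= M by apply: le_trans (fM0 x) (ler_norm _).
have bM : @bmeas _ T R (fun=> M) by exact: bmeas_cst.
have [b [bb _ hb]] : exists b : S -> R, [/\ bmeas b, forall y, 0 <= b y <= M + M &
      forall k : S -> R, bmeas k -> \int[m]_x (k (phi x) * (f x + M)) = \int[m]_x (k (phi x) * b (phi x))].
  apply: (@ge0_case (fun x => f x + M) (M + M)); [by rewrite /M addr_ge0|exact: bmeasD|move=> x].
  by have := fM x; rewrite ler_norml => /andP[? ?]; apply/andP; split; lra.
exists (fun y => b y - M); split; first by apply: bmeasB => //; exact: bmeas_cst.
move=> k bk; have bkp : bmeas (fun x => k (phi x)) by exact: bmeas_comp mphi bk.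
have bbp : bmeas (fun x => b (phi x)) by exact: bmeas_comp mphi bb.
under [RHS]eq_Rintegral do rewrite mulrBr.
rewrite bintB; [|exact: bmeasM|exact: bmeasM]; rewrite -hb//.
under [X in _ = X - _]eq_Rintegral do rewrite mulrDr.
by rewrite bintD ?addrK//; exact: bmeasM.
Qed.

End conditional_expectation.

(** * Gluing a family of plans into one finite measure *)

Section plan_measure.
Context {R : realType}.
Variables (mu : {sigma_finite_measure set (borelR R) -> \bar R}) (Rv : R) (h : R -> R).
Hypotheses (mh : measurable_fun setT (h : borelR R -> borelR R)) (h0 : forall a, 0 <= h a).
Hypothesis hfin : (\int[mu]_(a in levels Rv) (h a)%:E < +oo)%E.
Let A : set (borelR R) := levels Rv.
Local Notation P := (level_measure mh h0 hfin).
Context d (Y : measurableType d).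
Variables (g : R.-ker (borelR R) ~> Y) (y0 : Y).
Hypothesis gmass : \forall a \ae mu, A a -> g a setT = (h a)%:E.

(** A level of zero mass receives the Dirac mass at [y0]; it has no weight, since the factor [h a]
    that restores the mass is then zero. *)
Let nk : R.-pker (borelR R) ~> Y := knormalize g (dirac y0).

Let nk1 a : nk a setT = 1%E.
Proof. exact: (@probability_setT _ Y R (nk a : probability Y R)). Qed.

Let nkE a (f : Y -> \bar R) : g a setT = (h a)%:E -> measurable_fun setT f -> (forall y, 0 <= f y)%E ->
  ((h a)%:E * \int[nk a]_y f y = \int[g a]_y f y)%E.
Proof.
move=> ga mf f0; have [ha|ha] := eqVneq (h a) 0.
  rewrite ha mul0e -[LHS](integral_measure_zero setT f).
  apply: eq_measure_integral => U mU _; rewrite /mzero; apply/eqP; rewrite eq_le measure_ge0/=.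
  apply: le_trans (_ : g a U <= g a setT)%E _; first by rewrite le_measure// inE.
  by rewrite ga ha.
have hp : 0 < h a by rewrite lt_neqAle eq_sym ha h0.
have hi : 0 <= (h a)^-1 by rewrite invr_ge0.
transitivity ((h a)%:E * \int[mscale (NngNum hi) (g a)]_y f y)%E.
  congr (_ * _)%E; apply: eq_measure_integral => U mU _.
  have -> : nk a U = mnormalize (g a) (dirac y0) U by [].
  rewrite /mnormalize ga /mscale/=.
  by rewrite eqe (negbTE ha) /= muleC.
by rewrite ge0_integral_mscale// muleA -EFinM mulfV// mul1e.
Qed.

Let nk_int a (f : Y -> R) : g a setT = (h a)%:E -> bmeas f ->
  (\int[g a]_y (f y)%:E = (h a * \int[nk a]_y f y)%:E)%E.
Proof.
move=> ga bf; have [mf [M fM]] := bf.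
have gfin : (g a setT < +oo)%E by rewrite ga ltry.
pose m1 : {finite_measure set Y -> \bar R} := mfrestr measurableT gfin.
pose m2 : {finite_measure set Y -> \bar R} := (nk a : probability Y R).
have bM : @bmeas _ Y R (fun=> M) by exact: bmeas_cst.
have bfM : bmeas (fun y => f y + M) by exact: bmeasD.
have m1E k : bmeas k -> (\int[g a]_y (k y)%:E = (\int[m1]_y k y)%:E)%E.
  by move=> bk; rewrite -(bmeas_integralE m1 bk) /m1/= /mfrestr integral_mrestr.
have fM0 y : 0 <= f y + M by have := fM y; rewrite ler_norml => /andP[? _]; lra.
have := nkE ga (f := fun y => (f y + M)%:E).
rewrite (m1E _ bfM) (bmeas_integralE m2 bfM) -EFinM => H.
have {H} : h a * \int[m2]_y (f y + M) = \int[m1]_y (f y + M).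
  have mf' : measurable_fun setT (fun y => (f y + M)%:E).
    by apply/measurable_EFinP; exact: bmeas_measurable bfM.
  by have := H mf' (fun y => (fM0 y : (0 <= (f y + M)%:E)%E)) => -[].
rewrite !bintD// !bint_cst (m1E _ bf) (_ : fine (m1 setT) = h a); last first.
  by rewrite /m1/= /mfrestr /mrestr setIT ga.
rewrite (_ : fine (m2 setT) = 1); last by rewrite /m2/= nk1.
move=> H; congr (_%:E); move: H; rewrite mulr1 mulrDr [h a * M]mulrC => /addIr/esym; exact.
Qed.

Let nk_shift (f : borelR R * Y -> R) M a : bmeas f ->
  (\int[nk a]_y (f (a, y) + M)%:E = (\int[nk a]_y f (a, y) + M)%:E)%E.
Proof.
move=> bf; have bM : @bmeas _ Y R (fun=> M) by exact: bmeas_cst.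
have bfa : bmeas (fun y => f (a, y)) by exact: bmeas_section1.
have bfM : bmeas (fun y => f (a, y) + M) by exact: bmeasD.
pose m2 : {finite_measure set Y -> \bar R} := (nk a : probability Y R).
have P1 : fine (m2 setT) = 1 by rewrite /m2/= nk1.
by rewrite (bmeas_integralE m2 bfM) bintD// bint_cst P1 mulr1.
Qed.

Let bm_nk (f : borelR R * Y -> R) : bmeas f -> bm (fun a => \int[nk a]_y f (a, y)).
Proof.
move=> bf; have [mf [M fM]] := bf.
have bM : @bmeas _ Y R (fun=> M) by exact: bmeas_cst.
have bfa a : bmeas (fun y => f (a, y)) by exact: bmeas_section1.
pose m2 a : {finite_measure set Y -> \bar R} := (nk a : probability Y R).
have mfM : measurable_fun setT (fun z => (f z + M)%:E).
  by apply/measurable_EFinP; apply: measurable_funD => //; exact: measurable_cst.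
have fM0 z : (0 <= (f z + M)%:E)%E.
  by rewrite lee_fin; have := fM z; rewrite ler_norml => /andP[? _]; lra.
apply: (@bmeas_le _ _ _ _ M).
  have := measurable_fun_integral_finite_kernel _ nk fM0 mfM.
  under eq_fun do rewrite nk_shift//.
  move=> /measurable_EFinP m1.
  have := measurable_funB m1 (@measurable_cst _ _ (borelR R) (borelR R) setT M).
  by apply: eq_measurable_fun => a _ /=; rewrite addrK.
move=> a; have := le_norm_bint_bound (m2 a) (bfa a) (fun y => fM (a, y)).
have -> : fine (m2 a setT) = 1 by rewrite /m2/= nk1.
by rewrite mulr1.
Qed.

Let plan_int (f : borelR R * Y -> R) (u : R -> \bar R) : bmeas f ->
  (\forall a \ae mu, A a -> u a = \int[g a]_y (f (a, y))%:E)%E ->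
  (\int[mu]_(a in A) u a = (pint P (fun a _ => \int[nk a]_y f (a, y)))%:E)%E.
Proof.
move=> bf uE; have b2 : bm2 (fun a _ : R => \int[nk a]_y f (a, y)) by apply: bm2_fst; exact: bm_nk.
rewrite -level_integral//; apply: ae_eq_integral_nonmeas.
- exact: measurable_levels.
- exact: level_measurable.
- apply: ae_imply2 gmass uE => a ga ua aA; rewrite (ua aA) (nk_int (ga aA)); last exact: bmeas_section1.
  by rewrite ibint_cst// subr0 mulrC.
Qed.

Let lk : unit -> {measure set (borelR2 R) -> \bar R} := fun=> P.

Let lk_kernel U : measurable U -> measurable_fun setT (lk ^~ U).
Proof. by move=> _; exact: measurable_cst. Qed.

HB.instance Definition _ := isKernel.Build _ _ unit (borelR2 R) R lk lk_kernel.

Let lk_uub : measure_fam_uub lk.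
Proof.
exists (fine (P setT) + 1) => x; rewrite /lk -[ltLHS]fineK ?fin_num_measure//.
by rewrite lte_fin ltrDl.
Qed.

HB.instance Definition _ := Kernel_isFinite.Build _ _ unit (borelR2 R) R lk lk_uub.

Let pair_measurable a : measurable_fun setT (fun y : Y => (a, y) : borelR R * Y).
Proof. exact: measurable_pair1. Qed.

Let sk (q : unit * borelR2 R) : {measure set (borelR R * Y)%type -> \bar R} :=
  measure_function_pushforward__canonical__measure_function_Measure (nk q.2.1) (@pair_measurable q.2.1).

Let sk_kernel U : measurable U -> measurable_fun setT (sk ^~ U).
Proof.
move=> mU; have m1 : measurable_fun setT (fun q : unit * borelR2 R => q.2.1).
  exact: measurableT_comp measurable_fst measurable_snd.
have := @measurable_fun_xsection_finite_kernel _ _ _ _ R nk U.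
rewrite inE => /(_ mU) m2; have := measurableT_comp m2 m1.
apply: eq_measurable_fun => q _ /=; rewrite /sk /pushforward; congr (nk _ _).
by apply/seteqP; split => y /=; rewrite /xsection/= inE.
Qed.

HB.instance Definition _ := isKernel.Build _ _ (unit * borelR2 R)%type (borelR R * Y)%type R sk sk_kernel.

Let sk_uub : measure_fam_uub sk.
Proof.
exists 2 => q; rewrite /sk/= /pushforward preimage_setT nk1.
by rewrite lte_fin ltr1n.
Qed.

HB.instance Definition _ := Kernel_isFinite.Build _ _ (unit * borelR2 R)%type (borelR R * Y)%type R sk sk_uub.

(** Each [g a] is normalised to a probability and composed with P, whose marginal on the levels has
    density [h] with respect to [mu]. This restores the masses and gives a finite measure, to which
    conditional expectation applies, even though [mu] is only sigma-finite. *)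
Lemma plan_measure : exists G : {finite_measure set (borelR R * Y)%type -> \bar R},
  forall (f : borelR R * Y -> R) (u : R -> \bar R), bmeas f ->
    (\forall a \ae mu, A a -> u a = \int[g a]_y (f (a, y))%:E)%E ->
    (\int[mu]_(a in A) u a = (\int[G]_z f z)%:E)%E.
Proof.
pose l : R.-sfker unit ~> borelR2 R := lk.
pose k : R.-sfker (unit * borelR2 R)%type ~> (borelR R * Y)%type := sk.
pose G0 : {measure set (borelR R * Y)%type -> \bar R} := mkcomp l k tt.
have mG0 : (G0 setT = P setT)%E.
  have -> : G0 setT = (\int[P]_y sk (tt, y) setT)%E by [].
  rewrite (eq_integral (cst 1%E)) => [|y _]; first by rewrite integral_cst// mul1e.
  by rewrite /sk/= /pushforward preimage_setT nk1.
have gfin : (G0 setT < +oo)%E by rewrite mG0 -ge0_fin_numE// fin_num_measure.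
pose G : {finite_measure set (borelR R * Y)%type -> \bar R} := mfrestr measurableT gfin.
have G1 : fine (G setT) = fine (P setT) by rewrite /G/= /mfrestr /mrestr setIT mG0.
exists G => f u bf uE; rewrite (plan_int bf uE); have [mf [M fM]] := bf.
have bM : @bmeas _ (borelR R * Y)%type R (fun=> M) by exact: bmeas_cst.
have bfM := bmeasD bf bM.
have b2 : bm2 (fun a _ : R => \int[nk a]_y f (a, y)) by apply: bm2_fst; exact: bm_nk.
have fM0 z : (0 <= (f z + M)%:E)%E.
  by rewrite lee_fin; have := fM z; rewrite ler_norml => /andP[? _]; lra.
have mfM : measurable_fun setT (fun z => (f z + M)%:E) by apply/measurable_EFinP; exact: bmeas_measurable bfM.
have : (\int[G]_z (f z + M)%:E = (pint P (fun a _ => \int[nk a]_y f (a, y)) + M * fine (P setT))%:E)%E.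
  rewrite -pint_cst -pintD//; last exact: bm2_cst.
  rewrite pintE -(bmeas_integralE P (bm2D b2 (bm2_cst M))).
  have -> : (\int[G]_z (f z + M)%:E = \int[G0]_z (f z + M)%:E)%E by exact: integral_mrestr.
  rewrite (integral_kcomp l k tt fM0 mfM); apply: eq_integral => -[a s] _.
  rewrite -nk_shift//.
  have := @ge0_integral_pushforward _ _ _ _ R _ (@pair_measurable a) (nk a) setT (fun z => (f z + M)%:E).
  rewrite preimage_setT; apply => //.
rewrite (bmeas_integralE G bfM) bintD// bint_cst G1 => -[] /addIr ->.
by [].
Qed.

End plan_measure.

(** * From fields to the subdifferential *)

Section lagrangian_subgradient.
Context {R : realType}.
Variables (mu : {sigma_finite_measure set (borelR R) -> \bar R}) (Rv : R) (h : R -> R).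
Hypotheses (mh : measurable_fun setT (h : borelR R -> borelR R)) (h0 : forall a, 0 <= h a).
Hypothesis hfin : (\int[mu]_(a in levels Rv) (h a)%:E < +oo)%E.
Hypothesis Rv0 : 0 < Rv.
Let A : set (borelR R) := levels Rv.
Local Notation P := (level_measure mh h0 hfin).
Local Notation E := (lagrangian_energy mh h0 hfin).
Local Notation represents := (represents mu Rv h).

Let bdist d (T : measurableType d) (f : T -> R) (V : R -> R -> R) : bmeas f -> bm2 V ->
  bmeas (fun q : T * borelR2 R => f q.1 - V q.2.1 q.2.2).
Proof.
move=> bf bV; apply: bmeasB; first exact: (bmeas_comp (h := fst) measurable_fst bf).
exact: (bmeas_comp (h := snd) measurable_snd bV).
Qed.

Let psi (V : R -> R -> R) (y : R) := pint P (fun a s => `|y - V a s|).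
Let sigma (V : R -> R -> R) (y : R) := pint P (fun a s => Num.sg (y - V a s)).

Let bpsi d (T : measurableType d) (f : T -> R) (V : R -> R -> R) : bmeas f -> bm2 V ->
  bmeas (fun x => psi V (f x)).
Proof.
move=> bf bV; have := bmeas_bint1 P (bmeas_norm (bdist bf bV)).
by congr bmeas; apply/funext => x; rewrite /psi pintE.
Qed.

Let bsigma d (T : measurableType d) (f : T -> R) (V : R -> R -> R) : bmeas f -> bm2 V ->
  bmeas (fun x => sigma V (f x)).
Proof.
move=> bf bV; have := bmeas_bint1 P (bmeas_sg (bdist bf bV)).
by congr bmeas; apply/funext => x; rewrite /sigma pintE.
Qed.

Let psi_convex V y y' : bm2 V -> sigma V y * (y' - y) <= psi V y' - psi V y.
Proof.
move=> bV; have bd (c : R) : bm2 (fun a s => c - V a s) by apply: bm2B => //; exact: bm2_cst.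
have bs : bm2 (fun a s => Num.sg (y - V a s)) by exact: (bmeas_sg (bd y)).
have bn c : bm2 (fun a s => `|c - V a s|) by apply: bm2_norm; exact: bd.
rewrite /psi -(pintB _ (bn _) (bn _)) mulrC /sigma -pintZl//; apply: le_pint.
- by apply: bm2M => //; exact: bm2_cst.
- exact: bm2B.
- by move=> a s; rewrite mulrC; exact: sg_subgradient.
Qed.

Lemma in_L1_bounded nu X (w : R -> R -> R) (K : R) : represents nu X ->
  measurable_fun setT (fun p : borelR2 R => w p.1 p.2 : borelR R) ->
  (forall a x, `|w a x| <= K) -> in_L1 mu Rv nu w.
Proof.
move=> HX mw wK; have [bX aeX] := HX.
have bw : bm2 w by apply: (@bmeas_le _ _ _ _ K) => // p; exact: wK.
have bwX : bm2 (fun a s => w a (X a s)) by exact: bm2_along.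
split.
- exact: measurable_funTS.
- rewrite (repr_integral mh h0 hfin (G := fun a x => `|w a x|) (K := fun a s => `|w a (X a s)|) HX) ?ltry//.
    exact: bm2_norm.
  move=> a _; apply: measurableT_comp => //.
  exact: (measurableT_comp mw (@measurable_pair1 _ _ (borelR R) (borelR R) a)).
Qed.

(** The left-hand side and the drift are linear in the target position, with weights that depend on
    (a, x) only, so that the conditional expectation of the target given (a, x) leaves both
    unchanged. Only the interaction changes, and it decreases. *)
Lemma subdiff_of_lagrangian nu X (w : R -> R -> R) (K : R) : represents nu X ->
  measurable_fun setT (fun p : borelR2 R => w p.1 p.2 : borelR R) ->
  (forall a x, `|w a x| <= K) ->
  (forall Y, bm2 Y -> pint P (fun a s => w a (X a s) * (Y a s - X a s)) <= E Y - E X) ->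
  subdiff mu Rv h nu w.
Proof.
move=> HX mw wK sub; have [bX aeX] := HX.
have bw : bm2 w by apply: (@bmeas_le _ _ _ _ K) => // p; exact: wK.
have bwX : bm2 (fun a s => w a (X a s)) by exact: bm2_along.
split; first exact: in_L1_bounded HX mw wK.
move=> rho theta g rho0 thetaX cpl.
have HT := in_XR_repr mh h0 (ltW rho0) thetaX.
set Th := quantile _ _ _ _ in HT; have [bT aeT] := HT.
have Tb a s : `|Th a s| <= rho by exact: quantile_norm (ltW rho0) _ _.
rewrite (energy_repr mh h0 hfin Rv0 HX) (energy_repr mh h0 hfin Rv0 HT) -EFinB.
have [_ [M0 XM0]] := bX; pose M := `|M0|.
have XM a s : `|X a s| <= M by apply: le_trans (XM0 (a, s)) (ler_norm _).
have gmass : \forall a \ae mu, A a -> g a setT = (h a)%:E.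
  by apply: ae_imply2 cpl thetaX.1.1 => a ga ta aA; rewrite -(ta aA) -(ga aA).2// setXTT.
have [G GE] := plan_measure mh h0 hfin ((0, 0) : borelR2 R) gmass.
pose phi (z : borelR R * borelR2 R) : borelR2 R := (z.1, z.2.1).
have mphi : measurable_fun setT phi.
  apply/measurable_fun_pairP; split; first exact: measurable_fst.
  exact: measurableT_comp measurable_fst measurable_snd.
have marg (pr : borelR2 R -> borelR R) (nu' : level_family R) Z (k : R -> R -> R) :
    measurable_fun setT pr -> represents nu' Z -> bm2 k ->
    (\forall a \ae mu, A a -> forall U, measurable U -> g a (pr @^-1` U) = nu' a U) ->
    \int[G]_z k z.1 (pr z.2) = pint P (fun a s => k a (Z a s)).
  move=> mpr HZ bk gnu; have [bZ _] := HZ; apply: EFin_inj.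
  rewrite -(repr_integral mh h0 hfin (G := k) HZ (bm2_along bZ bk)) => [||//]; last first.
    by move=> a _; exact: bmeas_measurable (bm2_row a bk).
  have bkz : bmeas (fun z : borelR R * borelR2 R => k z.1 (pr z.2)).
    apply: (bmeas_comp (h := fun z : borelR R * borelR2 R => (z.1, pr z.2) : borelR2 R) _ bk).
    apply/measurable_fun_pairP; split; first exact: measurable_fst.
    exact: measurableT_comp mpr measurable_snd.
  apply/esym/GE => //; apply: ae_imply2 gnu gmass => a ga gm aA.
  have gfin : (g a setT < +oo)%E by rewrite gm// ltry.
  rewrite (@bounded_transfer _ (borelR2 R) _ (borelR R) R (mfrestr measurableT gfin) pr (nu' a) mpr _ (k a)).
  - rewrite -bmeas_integralE; last exact: (bmeas_section1 a bkz).
    exact: integral_mrestr.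
  - by move=> U mU; rewrite -ga// /pushforward /= /mfrestr /mrestr setIT.
  - exact: bmeas_measurable (bm2_row a bk).
  - exact: (bmeas_section1 a bkz).
have m1 k : bm2 k -> \int[G]_z k (phi z).1 (phi z).2 = pint P (fun a s => k a (X a s)).
  move=> bk; apply: (marg fst nu X k) => //; apply: ae_imply cpl => a ga aA U mU.
  by rewrite -(ga aA).1//; congr (g a _); apply/seteqP; split => p /=; [split|case].
have m2 k : bm2 k -> \int[G]_z k z.1 z.2.2 = pint P (fun a s => k a (Th a s)).
  move=> bk; apply: (marg snd theta Th k) => //; apply: ae_imply cpl => a ga aA U mU.
  by rewrite -(ga aA).2//; congr (g a _); apply/seteqP; split => p /=; [split|case].
have rr : - rho <= rho by lra.
have MM : - M <= M by rewrite /M; have := normr_ge0 M0; lra.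
(* Truncation at [rho] keeps the target position bounded at every point and changes nothing, since
   on a.e. level the plan is carried by targets in [[- rho, rho]]. *)
pose f (z : borelR R * borelR2 R) : R := clamp (- rho) rho z.2.2.
have bf : bmeas f.
  apply: (bmeas_comp (h := fun z : borelR R * borelR2 R => z.2.2 : borelR R) _ (bm_clamp rr)).
  exact: measurableT_comp measurable_snd measurable_snd.
have [b [bb hb]] := conditional_expectation G mphi bf.
pose B a x := b (a, x).
have bB : bm2 B by rewrite /bm2 (_ : (fun p => _) = b)//; apply/funext => -[].
pose Y a s := B a (X a s).
have bY : bm2 Y by exact: (bm2_along bX bB).
have cond k : bm2 k -> \int[G]_z (k z.1 z.2.1 * f z) = pint P (fun a s => k a (X a s) * Y a s).
  move=> bk; rewrite (hb (fun p => k p.1 p.2) bk).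
  exact: (m1 (fun a x => k a x * B a x) (bm2M bk bB)).
have bcl : bm2 (fun _ x => clamp (- M) M x) by apply: bm2_snd; exact: bm_clamp.
have bG1 k : bm2 k -> bmeas (fun z : borelR R * borelR2 R => k z.1 z.2.1).
  by move=> bk; exact: (bmeas_comp (h := phi) mphi bk).
have aeg (pr : borelR2 R -> borelR R) (nu' : level_family R) Z c : measurable_fun setT pr ->
    represents nu' Z -> (forall a s, `|Z a s| <= c) ->
    (\forall a \ae mu, A a -> forall U, measurable U -> g a (pr @^-1` U) = nu' a U) ->
    \forall a \ae mu, A a -> \forall p \ae g a, - c <= pr p <= c.
  move=> mpr [_ aeZ] Zc gnu; apply: ae_imply2 gnu aeZ => a ga na aA.
  have mU : measurable (~` `[- c, c]%classic : set (borelR R)).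
    by apply: measurableC; exact: measurable_borelR_itv.
  exists (pr @^-1` (~` `[- c, c]%classic)); split.
  - by rewrite -[X in measurable X]setTI; exact: mpr.
  - rewrite ga// na// /pushforward (_ : _ @^-1` _ = set0) ?measure0//.
    apply/seteqP; split => // s /=; rewrite in_itv/= => /negP; apply/negP; rewrite negbK.
    by rewrite -ler_norml.
  - by move=> p /=; rewrite in_itv.
have g1 : \forall a \ae mu, A a -> forall U, measurable U -> g a (fst @^-1` U) = nu a U.
  apply: ae_imply cpl => a ga aA U mU; rewrite -(ga aA).1//; congr (g a _).
  by apply/seteqP; split => p /=; [split|case].
have g2 : \forall a \ae mu, A a -> forall U, measurable U -> g a (snd @^-1` U) = theta a U.
  apply: ae_imply cpl => a ga aA U mU; rewrite -(ga aA).2//; congr (g a _).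
  by apply/seteqP; split => p /=; [split|case].
have lhsE : (\int[mu]_(a in levels Rv) \int[g a]_p (w a p.1 * (p.2 - p.1))%:E =
    (pint P (fun a s => w a (X a s) * (Y a s - X a s)))%:E)%E.
  have bI : bmeas (fun z : borelR R * borelR2 R => w z.1 z.2.1 * (f z - clamp (- M) M z.2.1)).
    by apply: bmeasM; [exact: (bG1 w)|apply: bmeasB => //; exact: (bG1 _ bcl)].
  rewrite (GE _ _ bI).
    congr (_%:E); under eq_Rintegral do rewrite mulrBr.
    rewrite bintB; last 2 first.
    - by apply: bmeasM => //; exact: (bG1 w).
    - by apply: bmeasM; [exact: (bG1 w)|exact: (bG1 _ bcl)].
    rewrite (cond w)// (m1 (fun a x => w a x * clamp (- M) M x)); last exact: bm2M.
    rewrite -pintB; last 2 first.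
    - exact: bm2M.
    - by apply: bm2M => //; exact: (bm2_along bX bcl).
    congr pint; apply/funext => a; apply/funext => s.
    by rewrite (clamp_id (x := X a s)) -?ler_norml// mulrBr.
  have e1 := aeg _ _ _ _ measurable_fst HX XM g1; have e2 := aeg _ _ _ _ measurable_snd HT Tb g2.
  apply: ae_imply2 e1 e2 => a a1 a2 aA; apply: ae_eq_integral_nonmeas => //.
    by apply/measurable_EFinP; exact: bmeas_measurable (bmeas_section1 a bI).
  apply: ae_imply2 (a1 aA) (a2 aA) => p p1 p2 _.
  by rewrite /f/= !clamp_id.
rewrite lhsE lee_fin; apply: (le_trans (sub Y bY)); rewrite lerD2r.
have driftE : pint P (fun a s => drift Rv a * Y a s) = pint P (fun a s => drift Rv a * Th a s).
  have bd : bm2 (fun a _ : R => drift Rv a) by apply: bm2_fst; exact: bm_drift.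
  rewrite -(cond (fun a _ => drift Rv a))//.
  have bc : bm2 (fun a y => drift Rv a * clamp (- rho) rho y).
    by apply: bm2M => //; apply: bm2_snd; exact: bm_clamp.
  rewrite (m2 _ bc); congr pint; apply/funext => a; apply/funext => s.
  by rewrite clamp_id// -ler_norml.
(* Jensen for the potential of one fixed field. The interaction is a double integral and requires it
   twice, once in each variable, with the symmetry of |x - y| in between. *)
have jensen V : bm2 V -> pint P (fun a s => psi V (Y a s)) <= pint P (fun a s => psi V (Th a s)).
  move=> bV.
  have bp1 : bm2 (fun a x => psi V (B a x)) by exact: bpsi.
  have bp2 : bm2 (fun _ y => psi V (clamp (- rho) rho y)).
    by apply: bpsi => //; apply: (bm2_snd (bm_clamp rr)).
  have bs1 : bm2 (fun a x => sigma V (B a x)) by exact: bsigma.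
  have bF : bmeas (fun z : borelR R * borelR2 R => psi V (f z)) by exact: bpsi.
  have -> : pint P (fun a s => psi V (Th a s)) = \int[G]_z psi V (f z).
    rewrite (m2 _ bp2); congr pint; apply/funext => a; apply/funext => s.
    by rewrite clamp_id// -ler_norml.
  rewrite -(m1 _ bp1) -subr_ge0 -bintB//; last exact: (bG1 _ bp1).
  have -> : 0 = \int[G]_z (sigma V (B z.1 z.2.1) * (f z - B z.1 z.2.1)).
    under eq_Rintegral do rewrite mulrBr.
    rewrite bintB; last 2 first.
    - by apply: bmeasM => //; exact: (bG1 _ bs1).
    - by apply: bmeasM; [exact: (bG1 _ bs1)|exact: (bG1 _ bB)].
    by rewrite (cond _ bs1) (m1 _ (bm2M bs1 bB)) subrr.
  apply: le_bint.
  - by apply: bmeasM; [exact: (bG1 _ bs1)|apply: bmeasB => //; exact: (bG1 _ bB)].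
  - by apply: bmeasB => //; exact: (bG1 _ bp1).
  - by move=> z; exact: psi_convex.
rewrite /lagrangian_energy driftE lerD2r ler_wpM2l//.
apply: (le_trans (jensen Y bY)).
have -> : pint P (fun a s => psi Y (Th a s)) = pint P (fun a s => psi Th (Y a s)).
  rewrite /psi (@pint_swap _ P (fun a s a' s' => `|Th a s - Y a' s'|)); last first.
    by apply: bmeas_norm; exact: (bdist bT bY).
  congr pint; apply/funext => a; apply/funext => s; congr pint.
  by apply/funext => a'; apply/funext => s'; exact: distrC.
exact: jensen.
Qed.

End lagrangian_subgradient.

(** * The limit flow is a gradient flow *)

Section path_chain_rule.
Context {R : realType}.

Lemma mvt_line (f f' : R -> R) : (forall x, is_derive x (1 : R) f (f' x)) ->
  forall x y, exists c, Num.min x y <= c <= Num.max x y /\ f y - f x = f' c * (y - x).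
Proof.
move=> df; have cf : continuous f by move=> x; have [dfx _] := df x; exact/differentiable_continuous/derivable1_diffP.
have key x y : x <= y -> exists2 c, x <= c <= y & f y - f x = f' c * (y - x).
  move=> xy; have [|c] := @MVT_segment R f f' x y xy (fun z _ => df z).
    exact: continuous_subspaceT.
  by rewrite in_itv/=; exists c.
move=> x y; have [xy|/ltW yx] := leP x y.
  by have [c cxy e] := key x y xy; exists c.
have [c cyx e] := key y x yx; exists c.
by split => //; rewrite -opprB e -mulrN opprB.
Qed.

Lemma between_dist (x y c : R) : Num.min x y <= c <= Num.max x y -> `|c - x| <= `|y - x|.
Proof.
by rewrite ler_norml; case: (lerP x y) => xy /andP[? ?]; apply/andP; split;
  rewrite ?(ger0_norm (_ : 0 <= y - x)) ?(ler0_norm (_ : y - x <= 0)); lra.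
Qed.

Lemma between_mem (lo hi x y c : R) : lo <= x <= hi -> lo <= y <= hi ->
  Num.min x y <= c <= Num.max x y -> lo <= c <= hi.
Proof.
move=> /andP[x1 x2] /andP[y1 y2] /andP[c1 c2]; apply/andP; split.
  by apply: le_trans c1; rewrite le_min x1.
by apply: (le_trans c2); rewrite ge_max x2.
Qed.

Lemma is_derive_fst (phi : R * R -> R) (t x : R) : derivable phi (t, x) (1, 0) ->
  is_derive t (1 : R) (fun z => phi (z, x)) ('D_(1, 0) phi (t, x)).
Proof.
have e : (fun z : R => z^-1 *: ((phi \o shift (t, x)) (z *: ((1 : R), (0 : R))) - phi (t, x))) =
    (fun z : R => z^-1 *: (((fun z => phi (z, x)) \o shift t) (z *: (1 : R)) - phi (t, x))).
  apply/funext => z /=; congr (_ *: (phi _ - _)).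
  by rewrite /shift/= /GRing.add/= /add_pair/= scaler0 add0r.
by rewrite /derivable /derive e => dphi; split => //; rewrite /derive e.
Qed.

Lemma is_derive_snd (phi : R * R -> R) (t x : R) : derivable phi (t, x) (0, 1) ->
  is_derive x (1 : R) (fun z => phi (t, z)) ('D_(0, 1) phi (t, x)).
Proof.
have e : (fun z : R => z^-1 *: ((phi \o shift (t, x)) (z *: ((0 : R), (1 : R))) - phi (t, x))) =
    (fun z : R => z^-1 *: (((fun z => phi (t, z)) \o shift x) (z *: (1 : R)) - phi (t, x))).
  apply/funext => z /=; congr (_ *: (phi _ - _)).
  by rewrite /shift/= /GRing.add/= /add_pair/= scaler0 add0r.
by rewrite /derivable /derive e => dphi; split => //; rewrite /derive e.
Qed.

Lemma cvg_plane (g : R * R -> R) (a_ b_ : nat -> R) (a b : R) : continuous g ->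
  a_ n @[n --> \oo] --> a -> b_ n @[n --> \oo] --> b -> g (a_ n, b_ n) @[n --> \oo] --> g (a, b).
Proof.
move=> cg ca cb.
apply: (@cvg_comp _ _ _ (fun n => (a_ n, b_ n)) g _ (nbhs (a, b)) _ _ (cg (a, b))).
exact: (cvg_pair ca cb).
Qed.

Section test.
Variables (phi D1 D2 : R * R -> R).
Hypotheses (c1 : continuous D1) (c2 : continuous D2).
Hypothesis d1 : forall t x : R, is_derive t (1 : R) (fun z => phi (z, x)) (D1 (t, x)).
Hypothesis d2 : forall t x : R, is_derive x (1 : R) (fun z => phi (t, z)) (D2 (t, x)).

Lemma plane_increment (t t' x x' : R) : exists c e, [/\ Num.min t t' <= c <= Num.max t t',
  Num.min x x' <= e <= Num.max x x' &
  phi (t', x') - phi (t, x) = D1 (c, x') * (t' - t) + D2 (t, e) * (x' - x)].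
Proof.
have [c [ct ec]] := mvt_line (fun z => d1 z x') t t'.
have [e [ex ee]] := mvt_line (fun z => d2 t z) x x'.
by exists c, e; split => //; rewrite -ec -ee; ring.
Qed.

(** The increment is split along the two axes and the mean value theorem is applied to each part;
    continuity of the partial derivatives replaces differentiability in the plane. *)
Lemma path_quotient (X : R -> R) (C t l : R) : lipschitz_with C X ->
  dqp X t n @[n --> \oo] --> l ->
  dqp (fun z => phi (z, X z)) t n @[n --> \oo] --> D1 (t, X t) + l * D2 (t, X t).
Proof.
move=> XC Xl; pose tn n : R := t + n.+1%:R^-1.
have tnE n : tn n - t = n.+1%:R^-1 by rewrite /tn; ring.
have /choice[c /choice[e ce]] : forall n, exists c, exists e, [/\ Num.min t (tn n) <= c <= Num.max t (tn n),
    Num.min (X t) (X (tn n)) <= e <= Num.max (X t) (X (tn n)) &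
    phi (tn n, X (tn n)) - phi (t, X t) = D1 (c, X (tn n)) * (tn n - t) + D2 (t, e) * (X (tn n) - X t)].
  by move=> n; exact: plane_increment.
have XnC n : `|X (tn n) - X t| <= `|C| * n.+1%:R^-1.
  apply: (le_trans (XC _ _)); rewrite tnE ger0_norm ?invr_ge0//.
  by rewrite ler_wpM2r ?invr_ge0// ler_norm.
have cX : X (tn n) @[n --> \oo] --> X t.
  by apply: (@cvg_harmonic_bound _ `|C|) => n; rewrite distrC.
have cc : c n @[n --> \oo] --> t.
  apply: (@cvg_harmonic_bound _ 1) => n; rewrite distrC mul1r.
  by have [/between_dist + _ _] := ce n; rewrite tnE (ger0_norm (_ : 0 <= n.+1%:R^-1)) ?invr_ge0.
have cE : e n @[n --> \oo] --> X t.
  apply: (@cvg_harmonic_bound _ `|C|) => n; rewrite distrC.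
  by have [_ /between_dist + _] := ce n => /le_trans; apply.
have E n : dqp (fun z => phi (z, X z)) t n = D1 (c n, X (tn n)) + dqp X t n * D2 (t, e n).
  rewrite /dqp -/(tn n); have [_ _ ->] := ce n.
  rewrite tnE mulrDr mulrCA mulfV ?mulr1//; congr (_ + _).
  by rewrite -mulrA [_ * D2 _]mulrC.
under eq_fun do rewrite E.
have p1 : D1 (c n, X (tn n)) @[n --> \oo] --> D1 (t, X t).
  exact: cvg_plane.
have p2 : D2 (t, e n) @[n --> \oo] --> D2 (t, X t).
  by apply: cvg_plane => //; exact: cvg_cst.
by apply: cvgD => //; exact: cvgM.
Qed.

Lemma bounded_on_box (g : R * R -> R) (T M : R) : continuous g ->
  exists2 B, 0 <= B & forall t x, 0 <= t <= T -> `|x| <= M -> `|g (t, x)| <= B.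
Proof.
move=> cg; have cK : compact (`[0, T]%classic `*` `[- M, M]%classic : set (R * R)).
  by apply: compact_setX; exact: segment_compact.
have := continuous_compact (continuous_subspaceT cg) cK.
move=> /compact_bounded [B [_ hB]]; exists (`|B| + 1); first by rewrite addr_ge0.
have B1 : B < `|B| + 1 by rewrite (le_lt_trans (ler_norm B))// ltrDl.
move=> t x tT xM; apply: (hB _ B1); exists (t, x) => //; split; rewrite /= in_itv//=.
by rewrite -ler_norml.
Qed.

(** Along a Lipschitz path phi(t, X t) is Lipschitz, hence the integral of its a.e. derivative,
    which [path_quotient] computes. *)
Lemma path_ftc (X : R -> R) (u : R -> R) (T C : R) : 0 < T -> 0 <= C -> lipschitz_with C X -> bm u ->
  (\forall t \ae lebI 0 T, dqp X t n @[n --> \oo] --> u t) ->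
  ibint 0 T (fun t => D1 (t, X t) + u t * D2 (t, X t)) = phi (T, X T) - phi (0, X 0).
Proof.
(* Forward quotients at times up to T look ahead by at most 1, so the composite is left untruncated
   up to T + 1. *)
move=> T0 C0 XC bu Xu; pose S := T + 1.
have S0 : 0 <= S by rewrite /S; lra.
pose M := `|X 0| + C * S.
have XM t : 0 <= t <= S -> `|X t| <= M.
  move=> /andP[t0 tS]; rewrite -[X t](subrK (X 0)); apply: (le_trans (ler_normD _ _)).
  rewrite /M addrC lerD2l; apply: (le_trans (XC _ _)); rewrite subr0 ger0_norm//.
  by rewrite ler_wpM2l.
have [B1 B10 hB1] := bounded_on_box S M c1; have [B2 B20 hB2] := bounded_on_box S M c2.
pose f t := phi (clamp 0 S t, X (clamp 0 S t)).
have ct t : 0 <= clamp 0 S t <= S by rewrite clamp_ge clamp_le.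
have fL : lipschitz_with (B1 + B2 * C) f.
  move=> t t'; rewrite /f; set a := clamp 0 S t; set b := clamp 0 S t'.
  have [c [e [cab eab ->]]] := plane_increment b a (X b) (X a).
  have cS := between_mem (ct t') (ct t) cab.
  have eM : `|e| <= M.
    by rewrite ler_norml; apply: (between_mem _ _ eab); rewrite -ler_norml; apply: XM; exact: ct.
  have ab : `|a - b| <= `|t - t'| by exact: clamp_lipschitz.
  have Xab : `|X a - X b| <= C * `|t - t'| by apply: (le_trans (XC _ _)); rewrite ler_wpM2l.
  apply: (le_trans (ler_normD _ _)); rewrite !normrM mulrDl -mulrA; apply: lerD; apply: ler_pM => //.
    by apply: hB1 => //; apply: XM; exact: ct.
  by apply: hB2 => //; exact: ct.
have [g [bg dg Ig]] := lipschitz_density (ltW T0) fL.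
have fE t : 0 <= t <= S -> f t = phi (t, X t) by move=> tS; rewrite /f clamp_id.
rewrite -!fE; last 2 first.
- by rewrite lexx.
- by rewrite /S; apply/andP; split; lra.
rewrite -(Ig 0 T)// -?ibintE; last exact: ltW.
apply: ae_eq_ibint => //.
have tS (z : R) (n : nat) : 0 <= z -> z <= T -> 0 <= z + n.+1%:R^-1 <= S.
  move=> z0 zT; have : n.+1%:R^-1 <= 1 :> R by rewrite invf_le1 ?ler1n.
  have : 0 <= n.+1%:R^-1 :> R by rewrite invr_ge0.
  by rewrite /S; move: (n.+1%:R^-1) => e ? ?; apply/andP; split; lra.
have zS (z : R) : 0 <= z -> z <= T -> 0 <= z <= S by rewrite /S => ? ?; apply/andP; split; lra.
apply: ae_imply3 dg Xu (ae_lebI_mem 0 T) => t [g1 _] Xt /andP[t0 tT].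
have q1 := path_quotient XC Xt.
have q2 : dqp (fun z => phi (z, X z)) t = dqp f t by apply/funext => n; rewrite /dqp !fE//; [exact: zS|exact: tS].
rewrite q2 in q1.
by rewrite -(cvg_lim _ q1)// -(cvg_lim _ g1).
Qed.

End test.

End path_chain_rule.

(** * Verification of the conditions on a gradient flow *)

Section flow_is_gradient_flow.
Context {R : realType}.
Variables (mu : {sigma_finite_measure set (borelR R) -> \bar R}) (Rv : R) (h : R -> R).
Hypotheses (mh : measurable_fun setT (h : borelR R -> borelR R)) (h0 : forall a, 0 <= h a).
Hypothesis hfin : (\int[mu]_(a in levels Rv) (h a)%:E < +oo)%E.
Hypothesis Rv0 : 0 < Rv.
Let A : set (borelR R) := levels Rv.
Local Notation P := (level_measure mh h0 hfin).
Local Notation E := (lagrangian_energy mh h0 hfin).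
Local Notation C := (speed_bound mh h0 hfin).
Local Notation mass := (fine (P setT)).
Variables (r : R) (X0 : R -> R -> R).
Hypotheses (r0 : 0 <= r) (bX0 : bm2 X0) (X0r : forall a s, `|X0 a s| <= r).
Local Notation X := (trajectory mh h0 hfin r X0).
Local Notation vel := (velocity mh h0 hfin r X0).

Let C0 : 0 <= C. Proof. exact: speed_bound_ge0. Qed.
Let XC a s : lipschitz_with C (fun t => X t a s). Proof. exact: trajectory_lipschitz. Qed.
Let bX t : bm2 (X t). Proof. exact: bm2_trajectory. Qed.
Let bV : bm3 (fun t a s => vel t a (X t a s)). Proof. exact: bm3_along. Qed.

Let X_flow t : 0 <= t -> X t = flow_along mh h0 hfin r X0 t.
Proof.
by move=> t0; apply/funext => a; apply/funext => s; rewrite /trajectory /eflow (max_idPr t0).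
Qed.

Let X_init a s : X 0 a s = X0 a s.
Proof. by rewrite X_flow// /flow_along flow0// clamp_id// -ler_norml. Qed.

Let X_norm T t a s : 0 <= T -> t <= T -> `|X t a s| <= r + C * T.
Proof. by move=> T0 tT; exact: eflow_norm. Qed.

(** The evolution variational inequality from t to t + 1/(n+1), with the square expanded, its
    nonnegative quadratic term dropped, and the rest divided by twice the time step. *)
Lemma velocity_subgradient T : 0 <= T -> \forall t \ae lebI 0 T, forall Y, bm2 Y ->
  pint P (fun a s => - vel t a (X t a s) * (Y a s - X t a s)) <= E Y - E (X t).
Proof.
move=> T0; apply: ae_imply2 (ae_trajectory_derivative mh h0 hfin Rv0 r0 bX0 T0) (ae_lebI_mem 0 T).
move=> t dX /andP[t0 _] Y bY.
pose V a s := vel t a (X t a s); have bVt : bm2 V by exact: (bm3_row t bV).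
pose dq (n : nat) a s := dqp (fun t => X t a s) t n.
have bdq n : bm2 (dq n) by apply: bm2M; [exact: bm2_cst|exact: bm2B].
have dqC n a s : `|dq n a s| <= C.
  rewrite /dq /dqp normrM ger0_norm// -ler_pdivlMl// mulrC.
  apply: (le_trans (XC _ _ _ _)).
  by rewrite addrAC subrr add0r ger0_norm ?invr_ge0.
have bXY : bm2 (fun a s => X t a s - Y a s) by exact: bm2B.
pose rhs (n : nat) := E Y - E (X t) + C ^+ 2 * mass * n.+1%:R^-1.
have key n : pint P (fun a s => dq n a s * (X t a s - Y a s)) <= rhs n.
  have e0 : 0 < n.+1%:R^-1 :> R by rewrite invr_gt0.
  have tt' : t <= t + n.+1%:R^-1 by rewrite lerDl ltW.
  have := flow_evi mh h0 hfin Rv0 r0 bX0 t0 tt' bY.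
  rewrite -!X_flow//; last exact: le_trans tt'.
  rewrite (_ : t + _ - t = n.+1%:R^-1); last by ring.
  rewrite -/(rhs n) => H.
  have b1 : bm2 (fun a s => (X t a s - Y a s) ^+ 2) by exact: bm2X.
  have b2 : bm2 (fun a s => 2 * n.+1%:R^-1 * (dq n a s * (X t a s - Y a s))).
    by apply: bm2M; [exact: bm2_cst|exact: bm2M].
  have : pint P (fun a s => (X t a s - Y a s) ^+ 2 + 2 * n.+1%:R^-1 * (dq n a s * (X t a s - Y a s))) <=
      pint P (fun a s => (X (t + n.+1%:R^-1) a s - Y a s) ^+ 2).
    apply: le_pint; [exact: bm2D|by apply: bm2X; exact: bm2B|move=> a s].
    have -> : X (t + n.+1%:R^-1) a s = X t a s + n.+1%:R^-1 * dq n a s.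
      by rewrite /dq /dqp mulrA mulVf// mul1r; ring.
    have := sqr_ge0 (n.+1%:R^-1 * dq n a s); set d := dq n a s; set i := n.+1%:R^-1; nra.
  rewrite (pintD _ b1 b2) (pintZl P _ (bm2M (bdq n) bXY)) => H2.
  have := le_trans H2 H; rewrite lerD2l ler_pM2l// mulr_gt0//.
have L1 : pint P (fun a s => dq n a s * (X t a s - Y a s)) @[n --> \oo] -->
    pint P (fun a s => V a s * (X t a s - Y a s)).
  have [_ [M hM]] := bXY.
  apply: (@cvg_pint _ P _ _ (C * M)).
  - by move=> n; exact: bm2M.
  - exact: bm2M.
  - by move=> n a s; rewrite normrM; apply: ler_pM => //; exact: (hM (a, s)).
  - by apply: ae_imply dX => p dp; apply: cvgM; [exact: dp|exact: cvg_cst].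
have L2 : rhs n @[n --> \oo] --> E Y - E (X t).
  rewrite -[X in _ --> X]addr0 -(mulr0 (C ^+ 2 * mass)); apply: cvgD; first exact: cvg_cst.
  by apply: cvgMr; exact: cvg_harmonic.
have -> : pint P (fun a s => - vel t a (X t a s) * (Y a s - X t a s)) =
    pint P (fun a s => V a s * (X t a s - Y a s)).
  by congr pint; apply/funext => a; apply/funext => s; rewrite /V; ring.
by apply: (ler_cvg_to L1 L2); apply: nearW.
Qed.

Definition flow_family (t : R) : level_family R :=
  level_kernel mh (Z := fun p : borelR2 R => X t p.1 p.2 : borelR R) (bmeas_measurable (bX t)).

Lemma flow_family_repr t : represents mu Rv h (flow_family t) (X t).
Proof. exact: repr_kernel. Qed.

Let flow_familyE t a U : flow_family t a U = pushforward (lebI 0 (h a)) (X t a) U.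
Proof. by []. Qed.

Lemma measurable_flow_family U : measurable U ->
  measurable_fun setT (fun p : borelR2 R => flow_family p.1 p.2 U).
Proof.
move=> mU.
pose S : set (borelR2 R * borelR R) :=
  [set q | (0 <= (q.2 : R) <= h q.1.2) /\ X q.1.1 q.1.2 q.2 \in (U : set R)].
have mX : measurable_fun setT (fun q : borelR2 R * borelR R => X q.1.1 q.1.2 q.2 : borelR R).
  have mp : measurable_fun setT (fun q : borelR2 R * borelR R => (q.1.1, (q.1.2, q.2)) : borelR R * borelR2 R).
    apply/measurable_fun_pairP; split; first exact: measurableT_comp measurable_fst measurable_fst.
    apply/measurable_fun_pairP; split; last exact: measurable_snd.
    exact: measurableT_comp measurable_snd measurable_fst.
  exact: (measurableT_comp (measurable_trajectory mh h0 hfin Rv0 r0 bX0) mp).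
have mS : measurable S.
  have -> : S = ((fun q : borelR2 R * borelR R => X q.1.1 q.1.2 q.2 : borelR R) @^-1` U) `&`
    ((fun q : borelR2 R * borelR R => ((0 : R) <= q.2) && ((q.2 : R) <= h q.1.2)) @^-1` [set true]).
    apply/seteqP; split => q /= [H1 H2]; first by split => //; exact/set_mem.
    by split => //; exact/mem_set.
  apply: measurableI; rewrite -[Y in measurable Y]setTI; first exact: mX.
  suff H : measurable_fun setT (fun q : borelR2 R * borelR R => ((0 : R) <= q.2) && ((q.2 : R) <= h q.1.2)) by exact: H.
  apply: measurable_and; apply: measurable_fun_ler => //.
  exact: measurableT_comp mh (measurableT_comp measurable_snd measurable_fst).
have := @measurable_fun_xsection _ _ (borelR2 R) (borelR R) R (@lebesgue_measure R) _ mS.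
apply: eq_measurable_fun => p _; rewrite flow_familyE /pushforward /lebI /= /mfrestr /mrestr.
congr (lebesgue_measure _); apply/seteqP; split => s /=.
  by move=> /xsectionP[] /= H1 /set_mem H2; split => //; rewrite in_itv.
by move=> [H1]; rewrite in_itv => H2; apply/xsectionP; split => //; exact/mem_set.
Qed.

Let measurable_vel t a : measurable_fun setT (vel t a : borelR R -> borelR R).
Proof.
exact: (measurableT_comp (measurable_velocity_field mh h0 hfin Rv0 r0 bX0)
  (@measurable_pair1 _ _ (borelR2 R) (borelR R) (t, a))).
Qed.

Let transfer t a (g : R -> R) : measurable_fun setT (g : borelR R -> borelR R) -> bm (fun s => g (X t a s)) ->
  (\int[flow_family t a]_x (g x)%:E = (ibint 0 (h a) (fun s => g (X t a s)))%:E)%E.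
Proof.
move=> mg bg; rewrite ibintE.
exact: (@bounded_transfer _ (borelR R) _ (borelR R) R (lebI 0 (h a)) (X t a) (flow_family t a)
  (bmeas_measurable (bm2_row a (bX t))) (fun U _ => flow_familyE t a U) g mg bg).
Qed.

(** Fubini reduces the identity to single trajectories. Each contributes by [path_ftc] the
    difference of phi between its ends, and phi vanishes at time T. *)
Let weak_form T (m0 : {measure set (borelR R) -> \bar R}) a (phi D1 D2 : R * R -> R) : 0 < T ->
  (forall U : set (borelR R), measurable U -> m0 U = pushforward (lebI 0 (h a)) (X0 a) U) ->
  continuous phi -> continuous D1 -> continuous D2 ->
  (forall t x : R, is_derive t (1 : R) (fun z => phi (z, x)) (D1 (t, x))) ->
  (forall t x : R, is_derive x (1 : R) (fun z => phi (t, z)) (D2 (t, x))) ->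
  (forall x, phi (T, x) = 0) ->
  (\int[lebesgue_measure]_(t in `[0%R, T]) \int[flow_family t a]_x
      (D1 (t, x) + vel t a x * D2 (t, x))%:E + \int[m0]_x (phi (0%R, x))%:E = 0)%E.
Proof.
move=> T0 m0E cphi c1 c2 d1 d2 phiT; have T0' := ltW T0.
have mline (f : R * R -> R) (t : R) : continuous f -> measurable_fun setT (fun x : borelR R => f (t, x) : borelR R).
  move=> cf; exact: measurableT_comp (continuous_plane_measurable cf) (@measurable_pair1 _ _ (borelR R) (borelR R) t).
have bct : bm2 (fun t _ => clamp 0 T t) by apply: bm2_fst; exact: bm_clamp.
have bXc : bm2 (fun t s => X (clamp 0 T t) a s).
  apply: (@caratheodory_bm2 _ T C (r + C * T) (fun t s => X t a s)) => //.
  - by move=> t; exact: (bm2_row a (bX t)).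
  - by move=> t s /andP[_ tT]; exact: X_norm.
have bVa : bm2 (fun t s => vel t a (X t a s)) by exact: (bm3_level a bV).
pose F t s := D1 (clamp 0 T t, X (clamp 0 T t) a s) + vel t a (X t a s) * D2 (clamp 0 T t, X (clamp 0 T t) a s).
have bF : bm2 F.
  apply: bm2D; first exact: (bm2_plane c1 bct bXc).
  by apply: bm2M => //; exact: (bm2_plane c2 bct bXc).
have FE t s : 0 <= t <= T -> F t s = D1 (t, X t a s) + vel t a (X t a s) * D2 (t, X t a s).
  by move=> tT; rewrite /F clamp_id.
have -> : (\int[lebesgue_measure]_(t in `[0%R, T]) \int[flow_family t a]_x
      (D1 (t, x) + vel t a x * D2 (t, x))%:E =
    (ibint 0 T (fun t => ibint 0 (h a) (F t)))%:E)%E.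
  rewrite -lebI_integralE ibintE -(bmeas_integralE (lebI 0 T) (bm_ibint 0 (h a) bF)).
  rewrite !lebI_integralE; apply: eq_integral => t /set_mem/=; rewrite in_itv/= => tT.
  rewrite (@transfer t a (fun x => D1 (t, x) + vel t a x * D2 (t, x))).
  - by congr (_%:E); apply: eq_ibint => s _; rewrite FE.
  - apply: measurable_funD; first exact: mline.
    by apply: measurable_funM; [exact: measurable_vel|exact: mline].
  - by have := bm2_row t bF; congr bm; apply/funext => s; rewrite FE.
have bX0a : bm (X0 a) by exact: (bm2_row a bX0).
have bphi0 : bm (fun s => phi (0, X0 a s)) by exact: (bm2_row a (bm2_plane cphi (bm2_cst 0) bX0)).
have -> : (\int[m0]_x (phi (0, x))%:E = (ibint 0 (h a) (fun s => phi (0, X0 a s)))%:E)%E.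
  rewrite ibintE.
  exact: (@bounded_transfer _ (borelR R) _ (borelR R) R (lebI 0 (h a)) (X0 a) m0
    (bmeas_measurable bX0a) m0E (fun x => phi (0, x)) (mline _ _ cphi) bphi0).
rewrite -EFinD ibint_swap//.
rewrite (_ : ibint 0 (h a) (fun s => ibint 0 T (F^~ s)) = ibint 0 (h a) (fun s => - phi (0, X0 a s))).
  by rewrite ibintN// addNr.
apply: eq_ibint => s _.
rewrite (eq_ibint (g := fun t => D1 (t, X t a s) + vel t a (X t a s) * D2 (t, X t a s))); last first.
  by move=> t tT; rewrite FE.
rewrite (path_ftc c1 c2 d1 d2 T0 C0 (XC a s) (bm3_path a s bV)); last exact: trajectory_derivative.
by rewrite phiT sub0r X_init.
Qed.

Lemma flow_continuity_eq T (m0 : {measure set (borelR R) -> \bar R}) a : 0 < T ->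
  (forall U : set (borelR R), measurable U -> m0 U = pushforward (lebI 0 (h a)) (X0 a) U) ->
  continuity_eq T m0 (fun t => flow_family t a) (fun t => vel t a).
Proof.
move=> T0 m0E; have T0' := ltW T0; split.
- move=> U mU; apply: measurable_funTS.
  exact: (measurableT_comp (measurable_flow_family mU) (@measurable_pair2 _ _ (borelR R) (borelR R) a)).
- apply: (@le_lt_trans _ _ (\int[@lebesgue_measure R]_(t in `[0%R, T]) (C * h a)%:E)%E).
    apply: ge0_le_integral_nonmeas => t _; first by apply: integral_ge0 => x _; rewrite lee_fin.
    have bn : bm (fun s => `|vel t a (X t a s)|) by apply: bmeas_norm; exact: (bm2_row a (bm3_row t bV)).
    have mn : measurable_fun setT (fun x : borelR R => `|vel t a x| : borelR R).
      by apply: measurableT_comp => //; exact: measurable_vel.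
    rewrite (transfer mn bn).
    rewrite lee_fin -[X in _ * X]subr0 -ibint_cst//.
    by apply: le_ibint => //; [exact: bm_cst|move=> s _; exact: velocity_bound].
  rewrite integral_cst; last exact: measurable_borelR_itv.
  by rewrite lte_mul_pinfty ?lee_fin ?mulr_ge0//; exact: lebesgue_itv_lty.
move=> phi tf; have [Ck [K [cK KT K0]]] := tf.
have [cphi dd1 dd2 c1 c2] := Ck 1%N.
apply: (@weak_form T m0 a phi ('D_(1, 0) phi) ('D_(0, 1) phi)) => //.
- by move=> t x; exact: is_derive_fst.
- by move=> t x; exact: is_derive_snd.
- by move=> x; apply: K0 => /KT /=; rewrite ltxx.
Qed.

Lemma flow_gradient_flow nu0 : represents mu Rv h nu0 X0 ->
  gradient_flow mu Rv h nu0 flow_family (fun t a x => vel t a x).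
Proof.
move=> [_ HX0] T T0; have T0' := ltW T0.
have CT0 : 0 <= C * T by rewrite mulr_ge0.
(* The added 1 makes the radius positive even when r and C T are zero. *)
pose rho := r + C * T + 1.
have rho0 : 0 < rho by rewrite /rho; move: r0; lra.
have Xrho t a s : t <= T -> `|X t a s| <= rho.
  by move=> tT; apply: (le_trans (X_norm a s T0' tT)); rewrite lerDl.
have mvel t : measurable_fun setT (fun p : borelR2 R => vel t p.1 p.2 : borelR R).
  have mp : measurable_fun setT (fun p : borelR2 R => ((t, p.1), p.2) : borelR2 R * borelR R).
    apply/measurable_fun_pairP; split; last exact: measurable_snd.
    by apply/measurable_fun_pairP; split; [exact: measurable_cst|exact: measurable_fst].
  exact: (measurableT_comp (measurable_velocity_field mh h0 hfin Rv0 r0 bX0) mp).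
split.
  exists rho => // t; rewrite in_itv/= => /andP[_ tT].
  by apply: (repr_in_XR mh h0 hfin (flow_family_repr t)) => a s; exact: Xrho.
split.
  (* Each trajectory moves by at most C |s - t|; the L^2 norm over P then yields the root of the
     mass. *)
  exists (C * Num.sqrt mass) => s t; rewrite !in_itv/= => /andP[_ sT] /andP[_ tT].
  apply: (le_trans (Xdist_le mh h0 hfin (ltW rho0) (flow_family_repr s) (flow_family_repr t)
    (fun a z => Xrho s a z sT) (fun a z => Xrho t a z tT))).
  have mass0 : 0 <= mass by exact: fine_ge0.
  have -> : C * Num.sqrt mass * `|s - t| = Num.sqrt ((C * `|s - t|) ^+ 2 * mass).
    by rewrite sqrtrM ?sqr_ge0// sqrtr_sqr (ger0_norm (mulr_ge0 C0 (normr_ge0 _))) mulrAC.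
  rewrite lee_fin; apply: ler_wsqrtr; rewrite -pint_cst; apply: le_pint.
  - by apply: bm2X; exact: bm2B.
  - exact: bm2_cst.
  - move=> a z; rewrite -[leLHS]ger0_norm ?sqr_ge0// normrX lerXn2r ?nnegrE ?mulr_ge0//.
    exact: XC.
split; first by move=> U mU; apply: measurable_funTS; exact: measurable_flow_family.
split.
  apply: ae_imply HX0 => a Ha aA U mU; rewrite (Ha aA)// flow_familyE /pushforward.
  by congr (lebI _ _ _); apply/seteqP; split => z /=; rewrite X_init.
split; first exact: measurable_funTS (measurable_velocity_field mh h0 hfin Rv0 r0 bX0).
split.
  move=> t _; apply: (in_L1_bounded mh h0 hfin (flow_family_repr t) (mvel t)) => a x.
  exact: velocity_bound.
split.
  have /ae_lebI := velocity_subgradient T0'; apply: ae_imply => t + tT.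
  rewrite in_itv/= in tT; move=> /(_ tT) sub.
  have mw : measurable_fun setT (fun p : borelR2 R => - vel t p.1 p.2 : borelR R).
    exact: measurable_funN (mvel t).
  have wC a x : `|- vel t a x| <= C by rewrite normrN; exact: velocity_bound.
  exact: (subdiff_of_lagrangian Rv0 (flow_family_repr t) mw wC sub).
by apply: ae_imply HX0 => a Ha aA; apply: flow_continuity_eq => //; exact: Ha.
Qed.

End flow_is_gradient_flow.

Theorem theorem5p1 (R : realType) (Rx Rv : R) (Rx_gt0 : 0 < Rx) (Rv_gt0 : 0 < Rv)
  (f0 : probability (borelR2 R) R)
  (f0_supp : f0 (~` (`[- Rx, Rx]%classic `*` `[- Rv, Rv]%classic)) = 0%E)
  (rho0_atomless : forall x : R, spatial_marginal f0 [set x] = 0%E)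
  (mu : {sigma_finite_measure set (borelR R) -> \bar R})
  (h : R -> R)
  (h_meas : measurable_fun (setT : set (borelR R)) (h : borelR R -> borelR R))
  (h_ge0 : forall a, 0 <= h a)
  (h_density : forall U : set (borelR R), measurable U ->
     eta0_marginal2 f0 U = (\int[mu]_(a in U) (h a)%:E)%E)
  (r : R) (r_gt0 : 0 < r) (nu0 theta0 : level_family R)
  (nu0_XR : in_XR mu Rv h r nu0) (theta0_XR : in_XR mu Rv h r theta0) :
  (forall (nu theta : R -> level_family R) (v w : R -> R -> R -> R),
     gradient_flow mu Rv h nu0 nu v ->
     gradient_flow mu Rv h theta0 theta w ->
     forall t : R, 0 <= t ->
       (Xdist mu Rv (nu t) (theta t) <= Xdist mu Rv nu0 theta0)%E) /\
  (exists nu : R -> level_family R,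
     (exists v : R -> R -> R -> R, gradient_flow mu Rv h nu0 nu v) /\
     forall (theta : R -> level_family R) (w : R -> R -> R -> R),
       gradient_flow mu Rv h nu0 theta w ->
       forall t : R, 0 <= t -> eq_family mu Rv (theta t) (nu t)).
Proof.
(* Push-forwards preserve the total mass, so the integral of [h] over the line is the mass 1 of
   [f0]. *)
have hfin : (\int[mu]_(a in levels Rv) (h a)%:E < +oo)%E.
  apply: le_lt_trans (_ : \int[mu]_(a in setT) (h a)%:E < +oo)%E.
    apply: ge0_subset_integral => //; first exact: measurable_levels.
      by apply/measurable_EFinP.
    by move=> a _; rewrite lee_fin.
  rewrite -h_density//; have -> : eta0_marginal2 f0 setT = f0 setT by [].
  by rewrite probability_setT ltry.
split=> [nu theta v w gnu gtheta t t0|].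
  exact: (flow_contraction h_meas h_ge0 hfin Rv_gt0 gnu gtheta t0).
have r0 := ltW r_gt0.
have HX := in_XR_repr h_meas h_ge0 r0 nu0_XR.
set X0 := quantile _ _ _ _ in HX; have [bX0 _] := HX.
have X0r a s : `|X0 a s| <= r by exact: quantile_norm.
have X0nd a s s' : s <= s' -> X0 a s <= X0 a s' by exact: quantile_nd.
have gnu := flow_gradient_flow h_meas h_ge0 hfin Rv_gt0 r0 bX0 X0r HX.
exists (flow_family h_meas h_ge0 hfin Rv_gt0 r0 bX0); split; first by eexists; exact: gnu.
move=> theta w gtheta t t0.
have T0 : 0 < t + 1 by rewrite ltr_wpDl.
have tT : t \in `[0, t + 1] by rewrite in_itv/= t0 lerDl ler01.
have [[r1 r10 /(_ _ tT) h1] _] := gtheta _ T0.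
have [[r2 r20 /(_ _ tT) h2] _] := gnu _ T0.
have r1m : r1 <= Num.max r1 r2 by rewrite le_max lexx.
have r2m : r2 <= Num.max r1 r2 by rewrite le_max lexx orbT.
apply: (Xdist_eq0 h_meas h_ge0 hfin (le_trans (ltW r10) r1m) (in_XR_le r1m h1) (in_XR_le r2m h2)).
(* Both flows start from [nu0], so that the right-hand side is the distance of [nu0] from itself. *)
apply: (le_trans (flow_contraction h_meas h_ge0 hfin Rv_gt0 gtheta gnu t0)).
rewrite (XdistE h_meas h_ge0 hfin r0 HX HX X0r X0r X0nd X0nd) lee_fin.
rewrite (_ : pint _ _ = 0) ?sqrtr0//; rewrite -[RHS](pint0 (level_measure h_meas h_ge0 hfin)).
by congr pint; apply/funext => a; apply/funext => s; rewrite subrr expr0n.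
Qed.
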